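(* Let $g_\theta$ and $g_\kappa$ both have radius of convergence $R>0$ and be holomorphic in some domain $\Delta_0$. Assume $g_\kappa^{\{1\}}(R)<1$ and that, for some $\theta^*\ge0$ and $\delta>0$, as $z\to R$ with $z\in\Delta_0$, $$g_\theta(z)=-\theta^*\log(1-z/R)+O\big((1-z/R)^\delta\big),\qquad g_\kappa(z)=g_\kappa(R)-g_\kappa^{\{1\}}(R)(1-z/R)+O\big((1-z/R)^{1+\delta}\big).$$ Let $f:\Delta_0\to\mathbb C$ be holomorphic with $f(z)=(1-z/R)^{-\beta}\{1+O((1-z/R)^\delta)\}$ as $z\to R$, $z\in\Delta_0$, for some $\beta\ge0$. Then, provided $v\theta^*+\beta>0$, as $N\to\infty$, $$[z^N]\big[f(z)\exp\{vG_N(z)\}\big]\sim\frac{\exp\{Nv\,g_\kappa(R)\}\cdot\{N(1-vg_\kappa^{\{1\}}(R))\}^{v\theta^*+\beta-1}}{R^N\,\Gamma(v\theta^*+\beta)},$$ uniformly in $v\in[v_1,v_2]$ for any $0<v_1<1<v_2<1/g_\kappa^{\{1\}}(R)$. In particular, for $\theta^*>0$, $$H_N\sim\frac{\exp\{Ng_\kappa(R)\}\cdot\{N(1-g_\kappa^{\{1\}}(R))\}^{\theta^*-1}}{R^N\,\Gamma(\theta^* )},\qquad N\to\infty.$$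
   Context: $(\theta_j)_{j\ge1}$, $(\kappa_j)_{j\ge1}$ are sequences of nonnegative reals; $g_\theta(z)=\sum_{j\ge1}\theta_jz^j/j$, $g_\kappa(z)=\sum_{j\ge1}\kappa_jz^j/j$, $G_N=g_\theta+Ng_\kappa$. $[z^N]F(z)$ is the coefficient of $z^N$ in the power series of $F$ at $0$. $H_N=\frac1{N!}\sum_{\sigma\in S_N}\prod_{j=1}^N(\theta_j+N\kappa_j)^{C_j(\sigma)}$, $C_j(\sigma)$ the number of $j$-cycles of $\sigma$. $g^{\{n\}}(z)=z^ng^{(n)}(z)$, $g_\kappa^{\{n\}}(R):=\lim_{r\uparrow R}g_\kappa^{\{n\}}(r)$. Domain: for $\eta>0$, $\varphi\in(0,\pi/2)$, $\Delta_0=\{z\in\mathbb C:|z|<R|1+\eta e^{i\varphi}|,\ z\ne R,\ |\arg(z-R)|>\varphi\}$ (''some $\Delta_0$'' = for some such $\eta,\varphi$). Logs and non-integer powers of $1-z/R$ use principal branches. Standing assumption: $(\kappa_j)$ is non-arithmetic (no integer $j_0>1$ such that $\kappa_j\ne0$ implies $j_0\mid j$) and $\kappa_j>0$ for some $j\ge2$. Uniform asymptotic equivalence means the ratio tends to $1$ uniformly in $v$. *)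

(* Defs.v *)
From Stdlib Require Import Reals ClassicalEpsilon.
From Coquelicot Require Import Coquelicot.
From mathcomp Require ssreflect ssrbool ssrnat eqtype fintype bigop finset fingroup perm.

Module HNdef.
Import ssreflect ssrbool ssrnat eqtype fintype bigop finset fingroup perm.

Definition ncycles {N : nat} (s : {perm 'I_N}) (j : nat) : nat :=
  #|[set c in porbits s | #|c| == j]|.

Definition HN (theta kappa : nat -> R) (N : nat) : R :=
  Rinv (INR (Factorial.fact N)) *
  \big[Rplus/0%R]_(s : {perm 'I_N})
     \big[Rmult/1%R]_(1 <= j < N.+1)
        pow (theta j + INR N * kappa j)%R (ncycles s j).
End HNdef.
Definition HN := HNdef.HN.

Definition Cexp (z : C) : C :=
  (exp (fst z) * cos (snd z), exp (fst z) * sin (snd z))%R.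

(* principal argument, in (-PI, PI] (for z <> 0) *)
Definition Carg (z : C) : R :=
  if Rle_dec 0 (snd z) then acos (fst z / Cmod z) else (- acos (fst z / Cmod z))%R.

Definition Clog (z : C) : C := (ln (Cmod z), Carg z).

Definition Cpower (w a : C) : C := Cexp (Cmult a (Clog w)).

Definition holomorphic_on (D : C -> Prop) (F : C -> C) : Prop :=
  forall z, D z -> exists l : C, @is_derive C_AbsRing C_NormedModule F z l.

Definition is_taylor0 (F : C -> C) (c : nat -> C) : Prop :=
  exists r : R, (0 < r)%R /\
    forall z : C, (Cmod z < r)%R -> @is_pseries C_AbsRing C_NormedModule c z (F z).

Definition zcoef (F : C -> C) (N : nat) : C :=
  epsilon (inhabits (RtoC 0)) (fun a => exists c, is_taylor0 F c /\ c N = a).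

Definition gcoef (a : nat -> R) (n : nat) : R :=
  match n with O => 0%R | S _ => (a n / INR n)%R end.

Definition Delta0 (R0 eta phi : R) (z : C) : Prop :=
  (Cmod z < R0 * Cmod (Cplus (RtoC 1) (Cmult (RtoC eta) (cos phi, sin phi))))%R /\
  z <> RtoC R0 /\
  (phi < Rabs (Carg (Cminus z (RtoC R0))))%R.

Definition bigO_at (D : C -> Prop) (R0 : R) (F G : C -> C) (d : R) : Prop :=
  exists K eps : R, (0 < eps)%R /\
    forall z, D z -> (Cmod (Cminus z (RtoC R0)) < eps)%R ->
      (Cmod (Cminus (F z) (G z)) <=
         K * Rpower (Cmod (Cminus (RtoC 1) (Cdiv z (RtoC R0)))) d)%R.

Definition Gamma (s : R) : R :=
  RInt_gen (fun t => Rpower t (s - 1) * exp (- t))%R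
           (at_right 0) (Rbar_locally p_infty).

Definition non_arithmetic (k : nat -> R) : Prop :=
  ~ exists j0 : nat, (1 < j0)%nat /\
      forall j : nat, (1 <= j)%nat -> k j <> 0%R -> Nat.divide j0 j.

(* Main.v *)
(** In the coordinate [z = R0 e^w] the coefficient of [z^N] is, up to the factor
    [exp(N v g_kappa(R0)) R0^-N / (2 PI i)], the integral of [A(w) exp(N (B(w) - w))] over a vertical segment of
    length [2 PI], where [A ~ (-w)^-(v theta* + beta)] and [B(w) = v (g_kappa - g_kappa(R0))
    ~ v g_kappa^{1}(R0) w] at [w = 0].  The segment is deformed inside the image of [Delta0]
    into a polygon at distance about [1/N] around the left of 0, two rays of fixed length
    leaving 0 just to the right of the imaginary axis, and two vertical pieces just to the right
    of the axis.  The polygon and the rays give the Hankel-type main term.  On the vertical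
    pieces non-arithmeticity makes [Re B < 0] on the axis, and near [w = 0] the derivative of
    [B] has real part below [v g_kappa^{1}(R0) + epsilon < 1], so that the integrand is
    exponentially small there.  Applying the same estimate to [(1-z)^-a], whose coefficients are
    ratios of Gamma values, identifies the Hankel constant as [1/Gamma(a)] without evaluating
    an integral.  For [H_N], contracting the cycle through a marked point shows that the cycle
    index satisfies the recursion of the coefficients of [exp(g_theta + N g_kappa)]. *)

Require Import Defs.
From Stdlib Require Import Reals Lra Lia ClassicalEpsilon FunctionalExtensionality.
From Coquelicot Require Import Coquelicot.
From HB Require structures.
From mathcomp Require ssreflect ssrfun ssrbool ssrnat eqtype seq choice fintype bigop finset fingroup perm.
Local Open Scope R_scope.

(** In the coordinate [w] the domain is closed under moving left, so Goursat's theorem on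
    axis-parallel rectangles already yields primitives. The deformation of the contour is then a
    telescoping sum of increments of primitives, each bounded by the mean value inequality; no
    winding numbers or general paths occur. Uniformity in [v] comes from proving the estimate for an
    abstract family whose constants precede both the index and [n]. The obstacle is the vertical
    pieces. The model decays along the rays only to the right of the axis, so these pieces have an
    abscissa [x1 > 0], outside the disc of convergence, where positivity of the coefficients says
    nothing directly. Compactness carries the strict inequality from the axis to a strip, but the
    width of the strip depends on how low it reaches, while the pieces begin at a height
    proportional to [x1]: near 0 this is circular. There the derivative of [g_kappa] is controlled
    instead. Only the size of the remainder is assumed, so its derivative is bounded by Cauchy's
    estimate in balls of radius proportional to the height, which fit because the boundary of the
    domain leaves 0 at a positive angle to the axis. *)

Lemma Cmod_minus_sym (a b : C) : Cmod (a - b) = Cmod (b - a).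
Proof. rewrite <- Cmod_opp. f_equal. ring. Qed.

Lemma Cmod_triangle_sub (a b : C) : Cmod a - Cmod b <= Cmod (a - b).
Proof.
  pose proof (Cmod_triangle (a - b) b) as H.
  replace (a - b + b)%C with a in H by ring. lra.
Qed.

Lemma Cmod_minus_le (a b : C) : Cmod (a - b) <= Cmod a + Cmod b.
Proof. unfold Cminus. rewrite <- (Cmod_opp b). apply Cmod_triangle. Qed.

Lemma Cmod_le_parts (a b : R) : Cmod (a, b) <= Rabs a + Rabs b.
Proof.
  replace ((a, b) : C) with (RtoC a + Ci * RtoC b)%C.
  - eapply Rle_trans; [apply Cmod_triangle|].
    rewrite Cmod_mult, Cmod_Ci, !Cmod_R. lra.
  - unfold Cplus, Cmult, Ci, RtoC; simpl. f_equal; ring.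
Qed.

Lemma Im_le_Cmod (z : C) : Rabs (snd z) <= Cmod z.
Proof. eapply Rle_trans; [apply Rmax_r | apply Rmax_Cmod]. Qed.

Lemma Re_le_Cmod (z : C) : Rabs (fst z) <= Cmod z.
Proof. eapply Rle_trans; [apply Rmax_l | apply Rmax_Cmod]. Qed.

Lemma Cmod_neq0 (z : C) : z <> RtoC 0 -> 0 < Cmod z.
Proof. intro H. now apply Cmod_gt_0. Qed.

(** * Derivatives *)

(** Differentiability spelled out with [Cmod], so that bounds can be read off directly. The case
    [w = z] is harmless, both sides being 0. *)
Definition cderiv (F : C -> C) (z l : C) : Prop :=
  forall eps, 0 < eps -> exists d, 0 < d /\ forall w, Cmod (w - z) < d ->
    Cmod (F w - F z - l * (w - z)) <= eps * Cmod (w - z).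

Definition ccont (F : C -> C) (z : C) : Prop :=
  forall eps, 0 < eps -> exists d, 0 < d /\ forall w, Cmod (w - z) < d ->
    Cmod (F w - F z) < eps.

Definition rderiv (u : R -> C) (t : R) (l : C) : Prop :=
  forall eps, 0 < eps -> exists d, 0 < d /\ forall s, Rabs (s - t) < d ->
    Cmod (u s - u t - l * RtoC (s - t)) <= eps * Rabs (s - t).

Lemma is_derive_cderiv (F : C -> C) (z l : C) :
  @is_derive C_AbsRing C_NormedModule F z l -> cderiv F z l.
Proof.
  intros [_ H] eps He.
  specialize (H z (fun P HP => HP) (mkposreal eps He)).
  destruct H as [d Hd]. exists d. split; [apply cond_pos|].
  intros w Hw. specialize (Hd w Hw). simpl in Hd.
  replace (l * (w - z))%C with ((w - z) * l)%C by ring. exact Hd.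
Qed.

Lemma cderiv_ccont (F : C -> C) (z l : C) : cderiv F z l -> ccont F z.
Proof.
  intros H eps He. destruct (H 1 Rlt_0_1) as [d [Hd H1]].
  pose proof (Cmod_ge_0 l).
  assert (Hq : 0 < eps / (2 + Cmod l)) by (apply Rdiv_lt_0_compat; lra).
  exists (Rmin d (eps / (2 + Cmod l))). split; [apply Rmin_glb_lt; assumption|].
  intros w Hw.
  assert (Hw1 : Cmod (w - z) < d) by (eapply Rlt_le_trans; [exact Hw|apply Rmin_l]).
  assert (Hw2 : Cmod (w - z) < eps / (2 + Cmod l))
    by (eapply Rlt_le_trans; [exact Hw|apply Rmin_r]).
  specialize (H1 w Hw1).
  pose proof (Cmod_triangle (F w - F z - l * (w - z)) (l * (w - z))) as H2.
  replace (F w - F z - l * (w - z) + l * (w - z))%C with (F w - F z)%C in H2 by ring.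
  rewrite Cmod_mult in H2.
  pose proof (Cmod_ge_0 (w - z)).
  assert (eps / (2 + Cmod l) * (2 + Cmod l) = eps) by (field; lra).
  nra.
Qed.

Lemma cderiv_ext_loc (F G : C -> C) (z l : C) (r : R) : 0 < r ->
  (forall w, Cmod (w - z) < r -> F w = G w) -> cderiv F z l -> cderiv G z l.
Proof.
  intros Hr E H eps He. destruct (H eps He) as [d [Hd H1]].
  exists (Rmin d r). split; [apply Rmin_glb_lt; assumption|].
  intros w Hw.
  rewrite <- !E.
  - apply H1. eapply Rlt_le_trans; [exact Hw|apply Rmin_l].
  - replace (z - z)%C with (RtoC 0) by ring. now rewrite Cmod_0.
  - eapply Rlt_le_trans; [exact Hw|apply Rmin_r].
Qed.

Lemma cderiv_ext (F G : C -> C) (z l : C) :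
  (forall w, F w = G w) -> cderiv F z l -> cderiv G z l.
Proof. intros E. apply (cderiv_ext_loc F G z l 1 Rlt_0_1). auto. Qed.

Lemma cderiv_const (c z : C) : cderiv (fun _ => c) z 0.
Proof.
  intros eps He. exists 1. split; [lra|]. intros w _.
  replace (c - c - 0 * (w - z))%C with (RtoC 0) by ring. rewrite Cmod_0.
  pose proof (Cmod_ge_0 (w - z)). nra.
Qed.

Lemma cderiv_id (z : C) : cderiv (fun w => w) z 1.
Proof.
  intros eps He. exists 1. split; [lra|]. intros w _.
  replace (w - z - 1 * (w - z))%C with (RtoC 0) by ring. rewrite Cmod_0.
  pose proof (Cmod_ge_0 (w - z)). nra.
Qed.

Lemma cderiv_plus (F G : C -> C) (z l m : C) :
  cderiv F z l -> cderiv G z m -> cderiv (fun w => F w + G w)%C z (l + m)%C.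
Proof.
  intros HF HG eps He.
  destruct (HF (eps / 2)) as [d1 [Hd1 H1]]; [lra|].
  destruct (HG (eps / 2)) as [d2 [Hd2 H2]]; [lra|].
  exists (Rmin d1 d2). split; [apply Rmin_glb_lt; assumption|].
  intros w Hw.
  specialize (H1 w (Rlt_le_trans _ _ _ Hw (Rmin_l _ _))).
  specialize (H2 w (Rlt_le_trans _ _ _ Hw (Rmin_r _ _))).
  replace (F w + G w - (F z + G z) - (l + m) * (w - z))%C
    with ((F w - F z - l * (w - z)) + (G w - G z - m * (w - z)))%C by ring.
  eapply Rle_trans; [apply Cmod_triangle|]. lra.
Qed.

Lemma cderiv_comp (F G : C -> C) (z l m : C) :
  cderiv G z m -> cderiv F (G z) l -> cderiv (fun w => F (G w)) z (l * m)%C.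
Proof.
  intros HG HF eps He.
  pose proof (Cmod_ge_0 l) as Hl. pose proof (Cmod_ge_0 m) as Hm.
  set (e1 := eps / (2 * (Cmod m + 1))).
  assert (He1 : 0 < e1) by (apply Rdiv_lt_0_compat; lra).
  assert (E1 : e1 * (Cmod m + 1) = eps / 2) by (unfold e1; field; lra).
  (* The cap 1 bounds the increment of [G] by [(Cmod m + 1) * Cmod (w - z)], the factor already
     compensated in [e1]. *)
  set (e2 := Rmin 1 (eps / (2 * (Cmod l + 1)))).
  assert (He2 : 0 < e2) by (apply Rmin_glb_lt; [lra|apply Rdiv_lt_0_compat; lra]).
  assert (E2 : e2 * (Cmod l + 1) <= eps / 2).
  { apply Rle_trans with (eps / (2 * (Cmod l + 1)) * (Cmod l + 1)).
    - apply Rmult_le_compat_r; [lra|apply Rmin_r].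
    - right. field. lra. }
  assert (E2' : e2 <= 1) by apply Rmin_l.
  destruct (HF e1 He1) as [d1 [Hd1 H1]].
  destruct (HG e2 He2) as [d2 [Hd2 H2]].
  destruct (cderiv_ccont _ _ _ HG d1 Hd1) as [d3 [Hd3 H3]].
  exists (Rmin d2 d3). split; [apply Rmin_glb_lt; assumption|].
  intros w Hw.
  specialize (H2 w (Rlt_le_trans _ _ _ Hw (Rmin_l _ _))).
  specialize (H3 w (Rlt_le_trans _ _ _ Hw (Rmin_r _ _))).
  specialize (H1 _ H3).
  replace (F (G w) - F (G z) - l * m * (w - z))%C
    with ((F (G w) - F (G z) - l * (G w - G z)) + l * (G w - G z - m * (w - z)))%C by ring.
  eapply Rle_trans; [apply Cmod_triangle|]. rewrite Cmod_mult.
  pose proof (Cmod_triangle (G w - G z - m * (w - z)) (m * (w - z))) as H4.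
  replace (G w - G z - m * (w - z) + m * (w - z))%C with (G w - G z)%C in H4 by ring.
  rewrite Cmod_mult in H4. pose proof (Cmod_ge_0 (w - z)) as Hwz.
  assert (H5 : Cmod (G w - G z) <= (Cmod m + 1) * Cmod (w - z)) by nra.
  assert (H6 : e1 * Cmod (G w - G z) <= eps / 2 * Cmod (w - z)).
  { rewrite <- E1, Rmult_assoc. apply Rmult_le_compat_l; lra. }
  assert (H7 : Cmod l * Cmod (G w - G z - m * (w - z)) <= eps / 2 * Cmod (w - z)).
  { apply Rle_trans with (Cmod l * (e2 * Cmod (w - z))).
    - apply Rmult_le_compat_l; assumption.
    - rewrite <- Rmult_assoc. apply Rmult_le_compat_r; nra. }
  lra.
Qed.

Lemma cderiv_mult (F G : C -> C) (z l m : C) :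
  cderiv F z l -> cderiv G z m ->
  cderiv (fun w => F w * G w)%C z (l * G z + F z * m)%C.
Proof.
  intros HF HG eps He.
  pose proof (Cmod_ge_0 (F z)) as H0. pose proof (Cmod_ge_0 (G z)) as H0'.
  pose proof (Cmod_ge_0 l) as Hl.
  set (e1 := eps / (3 * (Cmod (G z) + 1))).
  assert (He1 : 0 < e1) by (apply Rdiv_lt_0_compat; lra).
  assert (E1 : e1 * (Cmod (G z) + 1) = eps / 3) by (unfold e1; field; lra).
  set (e2 := eps / (3 * (Cmod (F z) + 1))).
  assert (He2 : 0 < e2) by (apply Rdiv_lt_0_compat; lra).
  assert (E2 : e2 * (Cmod (F z) + 1) = eps / 3) by (unfold e2; field; lra).
  set (e3 := eps / (3 * (Cmod l + 1))).
  assert (He3 : 0 < e3) by (apply Rdiv_lt_0_compat; lra).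
  assert (E3 : e3 * (Cmod l + 1) = eps / 3) by (unfold e3; field; lra).
  set (e1' := Rmin e1 1).
  assert (He1' : 0 < e1') by (apply Rmin_glb_lt; lra).
  assert (E1' : e1' <= e1) by apply Rmin_l.
  assert (E1'' : e1' <= 1) by apply Rmin_r.
  destruct (HF e1' He1') as [d1 [Hd1 H1]].
  destruct (HG e2 He2) as [d2 [Hd2 H2]].
  destruct (cderiv_ccont _ _ _ HG e3 He3) as [d3 [Hd3 H3]].
  exists (Rmin d1 (Rmin d2 d3)). split; [repeat apply Rmin_glb_lt; assumption|].
  intros w Hw.
  specialize (H1 w (Rlt_le_trans _ _ _ Hw (Rmin_l _ _))).
  assert (Hw' := Rlt_le_trans _ _ _ Hw (Rmin_r _ _)).
  specialize (H2 w (Rlt_le_trans _ _ _ Hw' (Rmin_l _ _))).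
  specialize (H3 w (Rlt_le_trans _ _ _ Hw' (Rmin_r _ _))).
  (* The two linearisation errors and the product of the two increments get a third of [eps]
     each. *)
  replace (F w * G w - F z * G z - (l * G z + F z * m) * (w - z))%C
    with ((F w - F z - l * (w - z)) * G z + (F z * (G w - G z - m * (w - z))
          + (F w - F z) * (G w - G z)))%C by ring.
  eapply Rle_trans; [apply Cmod_triangle|].
  apply Rle_trans with (eps / 3 * Cmod (w - z) + (eps / 3 * Cmod (w - z) + eps / 3 * Cmod (w - z))); [|lra].
  pose proof (Cmod_ge_0 (w - z)) as Hwz.
  apply Rplus_le_compat.
  - rewrite Cmod_mult. rewrite <- E1.
    apply Rle_trans with (e1' * Cmod (w - z) * Cmod (G z)); [apply Rmult_le_compat_r; lra|].
    apply Rle_trans with (e1 * Cmod (w - z) * Cmod (G z)); [|nra].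
    apply Rmult_le_compat_r; [lra|]. apply Rmult_le_compat_r; lra.
  - eapply Rle_trans; [apply Cmod_triangle|]. rewrite !Cmod_mult.
    apply Rplus_le_compat.
    + rewrite <- E2. apply Rle_trans with (Cmod (F z) * (e2 * Cmod (w - z))); [|nra].
      apply Rmult_le_compat_l; assumption.
    + pose proof (Cmod_triangle (F w - F z - l * (w - z)) (l * (w - z))) as H4.
      replace (F w - F z - l * (w - z) + l * (w - z))%C with (F w - F z)%C in H4 by ring.
      rewrite Cmod_mult in H4.
      assert (H5 : Cmod (F w - F z) <= (Cmod l + 1) * Cmod (w - z)) by nra.
      rewrite <- E3.
      apply Rle_trans with ((Cmod l + 1) * Cmod (w - z) * e3); [|nra].
      apply Rmult_le_compat; try apply Cmod_ge_0; lra.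
Qed.

Lemma cderiv_val (F : C -> C) (z l m : C) : cderiv F z l -> l = m -> cderiv F z m.
Proof. now intros H <-. Qed.

Lemma cderiv_scal (c : C) (F : C -> C) (z l : C) :
  cderiv F z l -> cderiv (fun w => c * F w)%C z (c * l)%C.
Proof.
  intro H. eapply cderiv_val; [apply cderiv_mult; [apply cderiv_const|exact H]|]. cbv beta; ring.
Qed.

Lemma cderiv_opp (F : C -> C) (z l : C) :
  cderiv F z l -> cderiv (fun w => - F w)%C z (- l)%C.
Proof.
  intro H. apply (cderiv_ext (fun w => (- (1)) * F w)%C); [intro; ring|].
  eapply cderiv_val; [apply cderiv_scal, H|]. ring.
Qed.

Lemma cderiv_minus (F G : C -> C) (z l m : C) :
  cderiv F z l -> cderiv G z m -> cderiv (fun w => F w - G w)%C z (l - m)%C.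
Proof. intros HF HG. apply cderiv_plus; [exact HF|apply cderiv_opp, HG]. Qed.

Lemma cderiv_inv (z : C) : z <> 0 -> cderiv Cinv z (- / (z * z))%C.
Proof.
  intros Hz eps He. pose proof (Cmod_neq0 z Hz) as Hm.
  (* The error is [(w - z)^2 / (w z^2)]. The first bound gives [|w| >= |z| / 2]; with it the second
     keeps the quotient below [eps]. *)
  set (d := Rmin (Cmod z / 2) (eps * Cmod z * (Cmod z * Cmod z) / 2)).
  exists d. split.
  { apply Rmin_glb_lt; [lra|]. apply Rdiv_lt_0_compat; [|lra].
    repeat apply Rmult_lt_0_compat; lra. }
  intros w Hw.
  assert (H1 := Rlt_le_trans _ _ _ Hw (Rmin_l _ _)).
  assert (H2 := Rlt_le_trans _ _ _ Hw (Rmin_r _ _)).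
  assert (H3 : Cmod z / 2 <= Cmod w).
  { pose proof (Cmod_triangle_sub z (z - w)) as H.
    replace (z - (z - w))%C with w in H by ring. rewrite (Cmod_minus_sym z w) in H. lra. }
  assert (Hw0 : w <> 0) by (intro E; rewrite E, Cmod_0 in H3; lra).
  replace (/ w - / z - - / (z * z) * (w - z))%C
    with ((w - z) * ((w - z) / (w * (z * z))))%C by (field; auto).
  rewrite Cmod_mult, Rmult_comm. apply Rmult_le_compat_r; [apply Cmod_ge_0|].
  rewrite Cmod_div by (repeat apply Cmult_neq_0; assumption).
  rewrite !Cmod_mult.
  apply Rle_div_l; [repeat apply Rmult_lt_0_compat; lra|].
  apply Rle_trans with (eps * (Cmod z / 2 * (Cmod z * Cmod z))); [lra|].
  apply Rmult_le_compat_l; [lra|]. apply Rmult_le_compat_r; nra.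
Qed.

Lemma rderiv_comp (P : C -> C) (u : R -> C) (t : R) (l m : C) :
  rderiv u t m -> cderiv P (u t) l -> rderiv (fun s => P (u s)) t (l * m)%C.
Proof.
  intros HG HF eps He.
  pose proof (Cmod_ge_0 l) as Hl. pose proof (Cmod_ge_0 m) as Hm.
  set (e1 := eps / (2 * (Cmod m + 1))).
  assert (He1 : 0 < e1) by (apply Rdiv_lt_0_compat; lra).
  assert (E1 : e1 * (Cmod m + 1) = eps / 2) by (unfold e1; field; lra).
  set (e2 := Rmin 1 (eps / (2 * (Cmod l + 1)))).
  assert (He2 : 0 < e2) by (apply Rmin_glb_lt; [lra|apply Rdiv_lt_0_compat; lra]).
  assert (E2 : e2 * (Cmod l + 1) <= eps / 2).
  { apply Rle_trans with (eps / (2 * (Cmod l + 1)) * (Cmod l + 1)).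
    - apply Rmult_le_compat_r; [lra|apply Rmin_r].
    - right. field. lra. }
  assert (E2' : e2 <= 1) by apply Rmin_l.
  destruct (HF e1 He1) as [d1 [Hd1 H1]].
  destruct (HG e2 He2) as [d2 [Hd2 H2]].
  assert (Hd3 : 0 < d1 / (Cmod m + 1)) by (apply Rdiv_lt_0_compat; lra).
  exists (Rmin d2 (d1 / (Cmod m + 1))). split; [apply Rmin_glb_lt; assumption|].
  intros w Hw.
  specialize (H2 w (Rlt_le_trans _ _ _ Hw (Rmin_l _ _))).
  assert (H3 := Rlt_le_trans _ _ _ Hw (Rmin_r _ _)).
  pose proof (Cmod_triangle (u w - u t - m * RtoC (w - t)) (m * RtoC (w - t))) as H4.
  replace (u w - u t - m * RtoC (w - t) + m * RtoC (w - t))%C with (u w - u t)%C in H4 by ring.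
  rewrite Cmod_mult, Cmod_R in H4. pose proof (Rabs_pos (w - t)) as Hwz.
  assert (H5 : Cmod (u w - u t) <= (Cmod m + 1) * Rabs (w - t)) by nra.
  assert (H6 : Cmod (u w - u t) < d1).
  { eapply Rle_lt_trans; [exact H5|].
    replace d1 with ((Cmod m + 1) * (d1 / (Cmod m + 1))) by (field; lra).
    apply Rmult_lt_compat_l; lra. }
  specialize (H1 _ H6).
  replace (P (u w) - P (u t) - l * m * RtoC (w - t))%C
    with ((P (u w) - P (u t) - l * (u w - u t)) + l * (u w - u t - m * RtoC (w - t)))%C by ring.
  eapply Rle_trans; [apply Cmod_triangle|]. rewrite Cmod_mult.
  assert (H7 : e1 * Cmod (u w - u t) <= eps / 2 * Rabs (w - t)).
  { rewrite <- E1, Rmult_assoc. apply Rmult_le_compat_l; lra. }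
  assert (H8 : Cmod l * Cmod (u w - u t - m * RtoC (w - t)) <= eps / 2 * Rabs (w - t)).
  { apply Rle_trans with (Cmod l * (e2 * Rabs (w - t))).
    - apply Rmult_le_compat_l; assumption.
    - rewrite <- Rmult_assoc. apply Rmult_le_compat_r; nra. }
  lra.
Qed.

Lemma rderiv_affine (a b : C) (t : R) : rderiv (fun s => a + RtoC s * b)%C t b.
Proof.
  intros eps He. exists 1. split; [lra|]. intros s _.
  replace (a + RtoC s * b - (a + RtoC t * b) - b * RtoC (s - t))%C with (RtoC 0)
    by (rewrite RtoC_minus; ring).
  rewrite Cmod_0. pose proof (Rabs_pos (s - t)). nra.
Qed.

Lemma rderiv_val (u : R -> C) (t : R) (l m : C) : rderiv u t l -> l = m -> rderiv u t m.
Proof. now intros H <-. Qed.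

Lemma rderiv_plus (u v : R -> C) (t : R) (l m : C) :
  rderiv u t l -> rderiv v t m -> rderiv (fun s => u s + v s)%C t (l + m)%C.
Proof.
  intros HF HG eps He.
  destruct (HF (eps / 2)) as [d1 [Hd1 H1]]; [lra|].
  destruct (HG (eps / 2)) as [d2 [Hd2 H2]]; [lra|].
  exists (Rmin d1 d2). split; [apply Rmin_glb_lt; assumption|].
  intros w Hw.
  specialize (H1 w (Rlt_le_trans _ _ _ Hw (Rmin_l _ _))).
  specialize (H2 w (Rlt_le_trans _ _ _ Hw (Rmin_r _ _))).
  replace (u w + v w - (u t + v t) - (l + m) * RtoC (w - t))%C
    with ((u w - u t - l * RtoC (w - t)) + (v w - v t - m * RtoC (w - t)))%C by ring.
  eapply Rle_trans; [apply Cmod_triangle|]. lra.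
Qed.

Lemma rderiv_scal (c : C) (u : R -> C) (t : R) (l : C) :
  rderiv u t l -> rderiv (fun s => c * u s)%C t (c * l)%C.
Proof.
  intros H. apply (rderiv_comp (fun w => c * w)%C).
  - exact H.
  - eapply cderiv_val; [apply cderiv_scal, cderiv_id|]. ring.
Qed.

Lemma rderiv_Re (u : R -> C) (t : R) (l e : C) :
  rderiv u t l -> derivable_pt_lim (fun s => fst (e * u s)%C) t (fst (e * l)%C).
Proof.
  intros H eps He.
  pose proof (Cmod_ge_0 e) as Hce.
  assert (He1 : 0 < eps / (2 * (Cmod e + 1))) by (apply Rdiv_lt_0_compat; lra).
  destruct (H _ He1) as [d [Hd H1]]. exists (mkposreal d Hd). simpl. intros h Hh0 Hh.
  specialize (H1 (t + h)). replace (t + h - t) with h in H1 by ring. specialize (H1 Hh).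
  assert (E : (fst e * fst (u (t + h)%R) - snd e * snd (u (t + h)%R) -
     (fst e * fst (u t) - snd e * snd (u t))) / h - (fst e * fst l - snd e * snd l)
     = fst (e * (u (t + h)%R - u t - l * RtoC h))%C / h).
  { destruct e, l, (u t), (u (t+h)). unfold Cminus, Copp, Cplus, Cmult, RtoC; simpl. field. exact Hh0. }
  rewrite E. unfold Rdiv. rewrite Rabs_mult, Rabs_inv.
  apply Rle_lt_trans with (Cmod (e * (u (t + h)%R - u t - l * h)) * / Rabs h).
  { apply Rmult_le_compat_r; [left; apply Rinv_0_lt_compat, Rabs_pos_lt, Hh0|apply Re_le_Cmod]. }
  rewrite Cmod_mult.
  assert (Hh' : 0 < Rabs h) by (apply Rabs_pos_lt, Hh0).
  apply Rlt_div_l; [exact Hh'|].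
  apply Rle_lt_trans with (Cmod e * (eps / (2 * (Cmod e + 1)) * Rabs h)).
  { apply Rmult_le_compat_l; lra. }
  rewrite <- Rmult_assoc. apply Rmult_lt_compat_r; [exact Hh'|].
  replace (Cmod e * (eps / (2 * (Cmod e + 1)))) with ((Cmod e / (Cmod e + 1)) * (eps / 2)) by (field; lra).
  assert (Cmod e / (Cmod e + 1) <= 1) by (apply Rle_div_l; lra). nra.
Qed.

(** * Mean value inequality *)

(** The unit factor [e] rotates the increment of [u] onto the real axis, and Lagrange's theorem
    applies to the real function [H - Re (e u)], whose derivative is nonnegative. The majorant [H]
    is left general because on the rays it is an exponential. *)
Lemma mean_value_inequality (u du : R -> C) (H h : R -> R) (a b : R) : a <= b ->
  (forall t, a <= t <= b -> rderiv u t (du t)) ->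
  (forall t, a <= t <= b -> derivable_pt_lim H t (h t)) ->
  (forall t, a <= t <= b -> Cmod (du t) <= h t) ->
  Cmod (u b - u a) <= H b - H a.
Proof.
  intros Hab Du DH Hle.
  assert (Hge : 0 <= H b - H a).
  { destruct (Req_dec a b) as [->|Hne]; [lra|].
    destruct (MVT_cor2 H h a b) as [c [Hc1 Hc2]]; [lra|exact DH|].
    rewrite Hc1. specialize (Hle c ltac:(lra)). pose proof (Cmod_ge_0 (du c)). nra. }
  destruct (Req_dec (Cmod (u b - u a)) 0) as [E|Hne]; [rewrite E; exact Hge|].
  pose proof (Cmod_ge_0 (u b - u a)) as Hp.
  assert (Hpos : 0 < Cmod (u b - u a)) by lra.
  set (r := Cmod (u b - u a)) in *.
  set (e := (Cconj (u b - u a) * RtoC (/ r))%C).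
  assert (He1 : Cmod e = 1).
  { unfold e. rewrite Cmod_mult, Cmod_conj, Cmod_R. fold r.
    rewrite Rabs_pos_eq; [field; lra|left; apply Rinv_0_lt_compat, Hpos]. }
  assert (He2 : fst (e * (u b - u a))%C = r).
  { replace (e * (u b - u a))%C with (RtoC (/ r) * ((u b - u a) * Cconj (u b - u a)))%C by (unfold e; ring).
    rewrite <- Cmod2_conj. fold r.
    rewrite <- RtoC_mult. simpl. field. lra. }
  destruct (Req_dec a b) as [->|Hne'].
  { unfold r in Hpos. replace (u b - u b)%C with (RtoC 0) in Hpos by ring. rewrite Cmod_0 in Hpos. lra. }
  destruct (MVT_cor2 (fun s => H s - fst (e * u s)%C) (fun s => h s - fst (e * du s)%C) a b) as [c [Hc1 Hc2]]; [lra| |].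
  { intros c Hc. apply derivable_pt_lim_minus; [apply DH, Hc|apply rderiv_Re, Du, Hc]. }
  assert (Hc3 : 0 <= h c - fst (e * du c)%C).
  { assert (fst (e * du c)%C <= Cmod (du c)).
    { eapply Rle_trans; [apply Rle_abs|]. eapply Rle_trans; [apply Re_le_Cmod|].
      rewrite Cmod_mult, He1. lra. }
    specialize (Hle c ltac:(lra)). lra. }
  assert (E : fst (e * (u b - u a))%C = fst (e * u b)%C - fst (e * u a)%C)
    by (simpl; ring).
  nra.
Qed.

Lemma mean_value_const (u du : R -> C) (M a b : R) : a <= b ->
  (forall t, a <= t <= b -> rderiv u t (du t)) ->
  (forall t, a <= t <= b -> Cmod (du t) <= M) ->
  Cmod (u b - u a) <= M * (b - a).
Proof.
  intros Hab Du Hle.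
  replace (M * (b - a)) with (M * b - M * a) by ring.
  apply (mean_value_inequality u du (fun t => M * t) (fun _ => M)); auto.
  intros t _. pose proof (derivable_pt_lim_scal id M t 1 (derivable_pt_lim_id t)) as H.
  rewrite Rmult_1_r in H. exact H.
Qed.

Lemma mean_value_segment (P dP : C -> C) (z w : C) (M : R) :
  (forall t, 0 <= t <= 1 -> cderiv P (z + RtoC t * (w - z))%C (dP (z + RtoC t * (w - z))%C)) ->
  (forall t, 0 <= t <= 1 -> Cmod (dP (z + RtoC t * (w - z))%C) <= M) ->
  Cmod (P w - P z) <= M * Cmod (w - z).
Proof.
  intros HP HM.
  pose proof (mean_value_const (fun t => P (z + RtoC t * (w - z))%C)
     (fun t => dP (z + RtoC t * (w - z))%C * (w - z))%C (M * Cmod (w - z)) 0 1 Rle_0_1) as H.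
  cbv beta in H.
  replace (z + RtoC 1 * (w - z))%C with w in H by ring.
  replace (z + RtoC 0 * (w - z))%C with z in H by ring.
  rewrite Rminus_0_r, Rmult_1_r in H. apply H.
  - intros t Ht. apply (rderiv_comp P (fun t => z + RtoC t * (w - z))%C); [apply rderiv_affine|apply HP, Ht].
  - intros t Ht. rewrite Cmod_mult. apply Rmult_le_compat_r; [apply Cmod_ge_0|apply HM, Ht].
Qed.

(** * Goursat's theorem and primitives *)

Definition CInt (f : R -> C) (a b : R) : C := @RInt C_R_CompleteNormedModule f a b.

Definition ex_CInt (f : R -> C) (a b : R) : Prop := @ex_RInt C_R_NormedModule f a b.

Definition rcont (f : R -> C) (t : R) : Prop :=
  forall eps, 0 < eps -> exists d, 0 < d /\ forall s, Rabs (s - t) < d ->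
    Cmod (f s - f t) < eps.

Lemma norm_C_R (x : C) : @norm _ C_R_NormedModule x = Cmod x.
Proof.
  change (sqrt (Rabs (fst x) ^ 2 + Rabs (snd x) ^ 2) = Cmod x).
  unfold Cmod. now rewrite <- !Rsqr_pow2, <- !Rsqr_abs.
Qed.

Lemma scal_C_R (r : R) (x : C) : @scal _ C_R_NormedModule r x = (RtoC r * x)%C.
Proof.
  destruct x as [x y].
  change ((r * x, r * y) = (RtoC r * (x, y))%C).
  unfold RtoC, Cmult; simpl. f_equal; ring.
Qed.

Lemma rcont_continuous (f : R -> C) (t : R) :
  rcont f t -> @continuous _ C_R_NormedModule f t.
Proof.
  intro H. apply filterlim_locally. intros eps.
  destruct (H eps (cond_pos eps)) as [d [Hd H1]].
  exists (mkposreal d Hd). intros s Hs. specialize (H1 s Hs).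
  split.
  - exact (Rle_lt_trans _ _ _ (Re_le_Cmod (f s - f t)) H1).
  - exact (Rle_lt_trans _ _ _ (Im_le_Cmod (f s - f t)) H1).
Qed.

Lemma ex_CInt_rcont (f : R -> C) (a b : R) :
  (forall t, Rmin a b <= t <= Rmax a b -> rcont f t) -> ex_CInt f a b.
Proof.
  intro H. apply (@ex_RInt_continuous C_R_CompleteNormedModule).
  intros t Ht. apply rcont_continuous, H, Ht.
Qed.

Lemma rderiv_rcont (f : R -> C) (t : R) (l : C) : rderiv f t l -> rcont f t.
Proof.
  intros H eps He. destruct (H 1 Rlt_0_1) as [d [Hd H1]].
  pose proof (Cmod_ge_0 l).
  assert (Hq : 0 < eps / (2 + Cmod l)) by (apply Rdiv_lt_0_compat; lra).
  exists (Rmin d (eps / (2 + Cmod l))). split; [apply Rmin_glb_lt; assumption|].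
  intros s Hs.
  specialize (H1 s (Rlt_le_trans _ _ _ Hs (Rmin_l _ _))).
  assert (Hs2 := Rlt_le_trans _ _ _ Hs (Rmin_r _ _)).
  pose proof (Cmod_triangle (f s - f t - l * RtoC (s - t)) (l * RtoC (s - t))) as H2.
  replace (f s - f t - l * RtoC (s - t) + l * RtoC (s - t))%C with (f s - f t)%C in H2 by ring.
  rewrite Cmod_mult, Cmod_R in H2.
  pose proof (Rabs_pos (s - t)).
  assert (eps / (2 + Cmod l) * (2 + Cmod l) = eps) by (field; lra).
  nra.
Qed.

Lemma rcont_comp (F : C -> C) (u : R -> C) (t : R) :
  rcont u t -> ccont F (u t) -> rcont (fun s => F (u s)) t.
Proof.
  intros Hu HF eps He. destruct (HF eps He) as [d [Hd H]].
  destruct (Hu d Hd) as [d' [Hd' H']]. exists d'. split; [exact Hd'|].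
  intros s Hs. apply H, H', Hs.
Qed.

Lemma rderiv_horizontal (y t : R) : rderiv (fun x => (x, y) : C) t 1.
Proof.
  eapply rderiv_val.
  - intros eps He. destruct (rderiv_affine (0, y) 1 t eps He) as [d [Hd H]].
    exists d. split; [exact Hd|]. intros s Hs. specialize (H s Hs).
    replace ((s, y) - (t, y))%C with ((0, y) + s * 1 - ((0, y) + t * 1))%C.
    + exact H.
    + unfold Cminus, Copp, Cplus, Cmult, RtoC; simpl. f_equal; ring.
  - reflexivity.
Qed.

Lemma rderiv_vertical (x t : R) : rderiv (fun y => (x, y) : C) t Ci.
Proof.
  eapply rderiv_val.
  - intros eps He. destruct (rderiv_affine (x, 0) Ci t eps He) as [d [Hd H]].
    exists d. split; [exact Hd|]. intros s Hs. specialize (H s Hs).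
    replace ((x, s) - (x, t))%C with ((x, 0) + s * Ci - ((x, 0) + t * Ci))%C.
    + exact H.
    + unfold Cminus, Copp, Cplus, Cmult, RtoC, Ci; simpl. f_equal; ring.
  - reflexivity.
Qed.

Lemma CInt_Chasles (f : R -> C) (a b c : R) :
  ex_CInt f a b -> ex_CInt f b c -> CInt f a c = (CInt f a b + CInt f b c)%C.
Proof. intros H1 H2. symmetry. exact (@RInt_Chasles C_R_CompleteNormedModule f a b c H1 H2). Qed.

Lemma CInt_swap (f : R -> C) (a b : R) : ex_CInt f a b -> CInt f b a = (- CInt f a b)%C.
Proof. intro H. symmetry. exact (@opp_RInt_swap C_R_CompleteNormedModule f a b H). Qed.

Lemma CInt_plus (f g : R -> C) (a b : R) : ex_CInt f a b -> ex_CInt g a b ->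
  CInt (fun t => f t + g t)%C a b = (CInt f a b + CInt g a b)%C.
Proof. exact (@RInt_plus C_R_CompleteNormedModule f g a b). Qed.

Lemma CInt_minus (f g : R -> C) (a b : R) : ex_CInt f a b -> ex_CInt g a b ->
  CInt (fun t => f t - g t)%C a b = (CInt f a b - CInt g a b)%C.
Proof. exact (@RInt_minus C_R_CompleteNormedModule f g a b). Qed.

Lemma CInt_ext (f g : R -> C) (a b : R) :
  (forall t, Rmin a b < t < Rmax a b -> f t = g t) -> CInt f a b = CInt g a b.
Proof. exact (@RInt_ext C_R_CompleteNormedModule f g a b). Qed.

Lemma CInt_bound (f : R -> C) (a b M : R) : a <= b -> ex_CInt f a b ->
  (forall t, a <= t <= b -> Cmod (f t) <= M) -> Cmod (CInt f a b) <= M * (b - a).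
Proof.
  intros Hab Hex HM. rewrite <- norm_C_R, Rmult_comm.
  apply (@norm_RInt_le_const C_R_NormedModule f a b); [exact Hab| |].
  - intros t Ht. rewrite norm_C_R. apply HM, Ht.
  - apply (@RInt_correct C_R_CompleteNormedModule), Hex.
Qed.

Lemma CInt_bound_abs (f : R -> C) (a b M : R) : ex_CInt f a b ->
  (forall t, Rmin a b <= t <= Rmax a b -> Cmod (f t) <= M) ->
  Cmod (CInt f a b) <= M * Rabs (b - a).
Proof.
  intros Hex HM. destruct (Rle_dec a b) as [H|H].
  - rewrite Rabs_pos_eq by lra. apply CInt_bound; [exact H|exact Hex|].
    intros t Ht. apply HM. rewrite Rmin_left, Rmax_right; lra.
  - rewrite CInt_swap, Cmod_opp, Rabs_left by (lra || apply (@ex_RInt_swap C_R_NormedModule), Hex).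
    replace (- (b - a)) with (a - b) by ring.
    apply CInt_bound; [lra|apply (@ex_RInt_swap C_R_NormedModule), Hex|].
    intros t Ht. apply HM. rewrite Rmin_right, Rmax_left; lra.
Qed.

Lemma is_derive_rderiv (f : R -> C) (t : R) (l : C) :
  rderiv f t l -> @is_derive R_AbsRing C_R_NormedModule f t l.
Proof.
  intros H. split; [apply is_linear_scal_l|].
  intros x Hx. apply (@is_filter_lim_locally_unique R_AbsRing R_NormedModule) in Hx. subst x.
  intros eps. destruct (H eps (cond_pos eps)) as [d [Hd H1]].
  exists (mkposreal d Hd). intros s Hs. specialize (H1 s Hs).
  rewrite norm_C_R, scal_C_R.
  rewrite Cmult_comm. exact H1.
Qed.

Lemma CInt_deriv (f df : R -> C) (a b : R) :
  (forall t, Rmin a b <= t <= Rmax a b -> rderiv f t (df t)) ->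
  (forall t, Rmin a b <= t <= Rmax a b -> rcont df t) ->
  CInt df a b = (f b - f a)%C.
Proof.
  intros H1 H2. apply (@is_RInt_unique C_R_CompleteNormedModule).
  apply (@is_RInt_derive C_R_CompleteNormedModule).
  - intros t Ht. apply is_derive_rderiv, H1, Ht.
  - intros t Ht. apply rcont_continuous, H2, Ht.
Qed.

Lemma rcont_const (c : C) (t : R) : rcont (fun _ => c) t.
Proof.
  intros eps He. exists 1. split; [lra|]. intros s _.
  replace (c - c)%C with (RtoC 0) by ring. now rewrite Cmod_0.
Qed.

Lemma CInt_const (c : C) (a b : R) : CInt (fun _ => c) a b = (RtoC (b - a) * c)%C.
Proof.
  rewrite (CInt_deriv (fun t => 0 + RtoC t * c)%C).
  - rewrite RtoC_minus. ring.
  - intros t _. apply rderiv_affine.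
  - intros t _. apply rcont_const.
Qed.

(** The module structure behind [CInt] has real scalars, so a complex constant is moved out through
    real and imaginary parts. *)
Lemma CInt_scal (c : C) (f : R -> C) (a b : R) : ex_CInt f a b ->
  CInt (fun t => c * f t)%C a b = (c * CInt f a b)%C.
Proof.
  intros H. apply (@is_RInt_unique C_R_CompleteNormedModule).
  pose proof (@RInt_correct C_R_CompleteNormedModule f a b H) as HI. fold (CInt f a b) in HI.
  pose proof (is_RInt_fct_extend_fst _ _ _ _ HI) as Hf.
  pose proof (is_RInt_fct_extend_snd _ _ _ _ HI) as Hs.
  apply is_RInt_fct_extend_pair.
  - apply (is_RInt_ext (fun t => minus (scal (fst c) (fst (f t))) (scal (snd c) (snd (f t))))).
    + intros; reflexivity.
    + apply (is_RInt_minus (V := R_NormedModule)); apply (is_RInt_scal (V := R_NormedModule)); assumption.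
  - apply (is_RInt_ext (fun t => plus (scal (fst c) (snd (f t))) (scal (snd c) (fst (f t))))).
    + intros; reflexivity.
    + apply (is_RInt_plus (V := R_NormedModule)); apply (is_RInt_scal (V := R_NormedModule)); assumption.
Qed.

Lemma ex_CInt_scal (c : C) (f : R -> C) (a b : R) : ex_CInt f a b ->
  ex_CInt (fun t => c * f t)%C a b.
Proof.
  intros H.
  pose proof (@RInt_correct C_R_CompleteNormedModule f a b H) as HI.
  pose proof (is_RInt_fct_extend_fst _ _ _ _ HI) as Hf.
  pose proof (is_RInt_fct_extend_snd _ _ _ _ HI) as Hs.
  exists (c * CInt f a b)%C.
  apply is_RInt_fct_extend_pair.
  - apply (is_RInt_ext (fun t => minus (scal (fst c) (fst (f t))) (scal (snd c) (snd (f t))))).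
    + intros; reflexivity.
    + apply (is_RInt_minus (V := R_NormedModule)); apply (is_RInt_scal (V := R_NormedModule)); assumption.
  - apply (is_RInt_ext (fun t => plus (scal (fst c) (snd (f t))) (scal (snd c) (fst (f t))))).
    + intros; reflexivity.
    + apply (is_RInt_plus (V := R_NormedModule)); apply (is_RInt_scal (V := R_NormedModule)); assumption.
Qed.

Global Opaque CInt.

(** The counterclockwise boundary integral of [F(z) dz]; [Ci] is [dz/dy] on the vertical sides. *)
Definition rect_int (F : C -> C) (a b c d : R) : C :=
  (CInt (fun x => F (x, c)) a b + Ci * CInt (fun y => F (b, y)) c d
   - CInt (fun x => F (x, d)) a b - Ci * CInt (fun y => F (a, y)) c d)%C.

Section Rectangle.
Variables (F : C -> C) (a b c d : R).
Hypothesis Hab : a <= b.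
Hypothesis Hcd : c <= d.
Hypothesis HF : forall x y, a <= x <= b -> c <= y <= d -> ccont F (x, y).

Lemma ex_CInt_horizontal (x x' y : R) :
  a <= x <= b -> a <= x' <= b -> c <= y <= d -> ex_CInt (fun s => F (s, y)) x x'.
Proof.
  intros Hx Hx' Hy. apply ex_CInt_rcont. intros t Ht.
  apply (rcont_comp F (fun s => (s, y))).
  - eapply rderiv_rcont, rderiv_horizontal.
  - apply HF; [|exact Hy]. revert Ht. unfold Rmin, Rmax. destruct (Rle_dec x x'); lra.
Qed.

Lemma ex_CInt_vertical (x y y' : R) :
  a <= x <= b -> c <= y <= d -> c <= y' <= d -> ex_CInt (fun s => F (x, s)) y y'.
Proof.
  intros Hx Hy Hy'. apply ex_CInt_rcont. intros t Ht.
  apply (rcont_comp F (fun s => (x, s))).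
  - eapply rderiv_rcont, rderiv_vertical.
  - apply HF; [exact Hx|]. revert Ht. unfold Rmin, Rmax. destruct (Rle_dec y y'); lra.
Qed.

Lemma rect_int_split (m n : R) : a <= m <= b -> c <= n <= d ->
  rect_int F a b c d = (rect_int F a m c n + rect_int F m b c n
                        + rect_int F a m n d + rect_int F m b n d)%C.
Proof.
  intros Hm Hn. unfold rect_int.
  rewrite (CInt_Chasles (fun x => F (x, c)) a m b) by (apply ex_CInt_horizontal; lra).
  rewrite (CInt_Chasles (fun x => F (x, d)) a m b) by (apply ex_CInt_horizontal; lra).
  rewrite (CInt_Chasles (fun y => F (a, y)) c n d) by (apply ex_CInt_vertical; lra).
  rewrite (CInt_Chasles (fun y => F (b, y)) c n d) by (apply ex_CInt_vertical; lra).
  ring.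
Qed.

Lemma rect_int_bound (M : R) :
  (forall x y, a <= x <= b -> c <= y <= d -> Cmod (F (x, y)) <= M) ->
  Cmod (rect_int F a b c d) <= 2 * M * ((b - a) + (d - c)).
Proof.
  intros HM. unfold rect_int.
  assert (H1 : Cmod (CInt (fun x => F (x, c)) a b) <= M * (b - a)).
  { apply CInt_bound; [exact Hab|apply ex_CInt_horizontal; lra|]. intros; apply HM; lra. }
  assert (H2 : Cmod (CInt (fun x => F (x, d)) a b) <= M * (b - a)).
  { apply CInt_bound; [exact Hab|apply ex_CInt_horizontal; lra|]. intros; apply HM; lra. }
  assert (H3 : Cmod (CInt (fun y => F (b, y)) c d) <= M * (d - c)).
  { apply CInt_bound; [exact Hcd|apply ex_CInt_vertical; lra|]. intros; apply HM; lra. }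
  assert (H4 : Cmod (CInt (fun y => F (a, y)) c d) <= M * (d - c)).
  { apply CInt_bound; [exact Hcd|apply ex_CInt_vertical; lra|]. intros; apply HM; lra. }
  eapply Rle_trans; [apply Cmod_minus_le|].
  rewrite Cmod_mult, Cmod_Ci.
  eapply Rle_trans; [apply Rplus_le_compat_r, Cmod_minus_le|].
  eapply Rle_trans; [apply Rplus_le_compat_r, Rplus_le_compat_r, Cmod_triangle|].
  rewrite Cmod_mult, Cmod_Ci. lra.
Qed.
End Rectangle.

Lemma rect_int_minus (F G : C -> C) (a b c d : R) : a <= b -> c <= d ->
  (forall x y, a <= x <= b -> c <= y <= d -> ccont F (x, y)) ->
  (forall x y, a <= x <= b -> c <= y <= d -> ccont G (x, y)) ->
  rect_int (fun w => F w - G w)%C a b c d = (rect_int F a b c d - rect_int G a b c d)%C.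
Proof.
  intros Hab Hcd HF HG. unfold rect_int.
  assert (Hh : forall y, c <= y <= d -> CInt (fun x => F (x, y) - G (x, y))%C a b
     = (CInt (fun x => F (x, y)) a b - CInt (fun x => G (x, y)) a b)%C).
  { intros y Hy. apply CInt_minus; apply (ex_CInt_horizontal _ a b c d); auto; lra. }
  assert (Hv : forall x, a <= x <= b -> CInt (fun y => F (x, y) - G (x, y))%C c d
     = (CInt (fun y => F (x, y)) c d - CInt (fun y => G (x, y)) c d)%C).
  { intros x Hx. apply CInt_minus; apply (ex_CInt_vertical _ a b c d); auto; lra. }
  rewrite !Hh, !Hv by lra.
  ring.
Qed.

(** An affine function has the explicit primitive [A]. It plays the tangent that is subtracted from
    [F] on small rectangles. *)
Lemma rect_int_affine (p q : C) (a b c d : R) :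
  rect_int (fun w => p + q * w)%C a b c d = 0.
Proof.
  set (A := fun w : C => (p * w + q * (w * w) * / (1 + 1))%C).
  assert (HA : forall w, cderiv A w (p + q * w)%C).
  { intro w. unfold A. eapply cderiv_val.
    - apply cderiv_plus.
      + apply cderiv_scal, cderiv_id.
      + apply (cderiv_mult (fun w => q * (w * w))%C (fun _ => / (1 + 1))%C).
        * apply cderiv_scal, cderiv_mult; apply cderiv_id.
        * apply cderiv_const.
    - cbv beta; field. }
  assert (HC : forall w, ccont (fun w => p + q * w)%C w).
  { intro w. apply (cderiv_ccont _ _ q). eapply cderiv_val.
    - apply cderiv_plus; [apply cderiv_const|apply cderiv_scal, cderiv_id].
    - ring. }
  assert (Hh : forall y, CInt (fun x => p + q * (x, y))%C a b = (A (b, y) - A (a, y))%C).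
  { intro y. apply (CInt_deriv (fun x => A (x, y))).
    - intros t _. eapply rderiv_val.
      + apply (rderiv_comp A (fun x => (x, y))); [apply rderiv_horizontal|apply HA].
      + ring.
    - intros t _. apply (rcont_comp (fun w => p + q * w)%C (fun x => (x, y))).
      + eapply rderiv_rcont, rderiv_horizontal.
      + apply HC. }
  assert (Hv : forall x, (Ci * CInt (fun y => p + q * (x, y))%C c d = A (x, d) - A (x, c))%C).
  { intro x.
    assert (Hx : forall t, rcont (fun y => p + q * (x, y))%C t).
    { intros t. apply (rcont_comp (fun w => p + q * w)%C (fun y => (x, y))).
      + eapply rderiv_rcont, rderiv_vertical.
      + apply HC. }
    rewrite <- CInt_scal by (apply ex_CInt_rcont; intros; apply Hx).
    apply (CInt_deriv (fun y => A (x, y))).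
    - intros t _. eapply rderiv_val.
      + apply (rderiv_comp A (fun y => (x, y))); [apply rderiv_vertical|apply HA].
      + ring.
    - intros t _. apply (rcont_comp (fun w => Ci * w)%C (fun y => p + q * (x, y))%C); [apply Hx|].
      eapply cderiv_ccont, cderiv_scal, cderiv_id. }
  unfold rect_int. rewrite !Hh, !Hv. ring.
Qed.

Section Goursat.
Variables (F : C -> C) (a b c d : R).
Hypothesis Hab : a <= b.
Hypothesis Hcd : c <= d.
Hypothesis HF : forall x y, a <= x <= b -> c <= y <= d -> exists l, cderiv F (x, y) l.

Let W (n : nat) := (b - a) / 2 ^ n.
Let H (n : nat) := (d - c) / 2 ^ n.
Let sub (n : nat) (p : R * R) : C :=
  rect_int F (fst p) (fst p + W n) (snd p) (snd p + H n).
Let inside (n : nat) (p : R * R) : Prop :=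
  a <= fst p /\ fst p + W n <= b /\ c <= snd p /\ snd p + H n <= d.

Let W_ge n : 0 <= W n.
Proof. apply Rdiv_le_0_compat; [lra|apply pow_lt; lra]. Qed.

Let H_ge n : 0 <= H n.
Proof. apply Rdiv_le_0_compat; [lra|apply pow_lt; lra]. Qed.

Let W_S n : W n = 2 * W (S n).
Proof. unfold W. simpl. field. apply pow_nonzero. lra. Qed.

Let H_S n : H n = 2 * H (S n).
Proof. unfold H. simpl. field. apply pow_nonzero. lra. Qed.

(** The integrals over the four quarters add up to the whole, so one of them carries at least a
    quarter of its modulus. *)
Lemma goursat_step (n : nat) (p : R * R) : inside n p ->
  exists q, inside (S n) q /\ fst p <= fst q /\ fst q + W (S n) <= fst p + W n
    /\ snd p <= snd q /\ snd q + H (S n) <= snd p + H n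
    /\ Cmod (sub n p) <= 4 * Cmod (sub (S n) q).
Proof.
  intros [I1 [I2 [I3 I4]]].
  pose proof (W_ge (S n)) as HW. pose proof (H_ge (S n)) as HH.
  pose proof (W_S n) as EW. pose proof (H_S n) as EH.
  destruct p as [x y]. cbn [fst snd] in *.
  set (q1 := (x, y)). set (q2 := (x + W (S n), y)). set (q3 := (x, y + H (S n))).
  set (q4 := (x + W (S n), y + H (S n))).
  assert (E : sub n q1 = (sub (S n) q1 + sub (S n) q2 + sub (S n) q3 + sub (S n) q4)%C).
  { unfold sub, q1, q2, q3, q4. cbn [fst snd].
    rewrite (rect_int_split F x (x + W n) y (y + H n)) with (m := x + W (S n)) (n := y + H (S n)).
    - replace (x + W (S n) + W (S n)) with (x + W n) by lra.
      replace (y + H (S n) + H (S n)) with (y + H n) by lra. reflexivity.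
    - lra.
    - lra.
    - intros s t Hs Ht. destruct (HF s t) as [l Hl]; [lra|lra|]. eapply cderiv_ccont, Hl.
    - lra.
    - lra. }
  assert (Hle : Cmod (sub n q1) <= Cmod (sub (S n) q1) + Cmod (sub (S n) q2)
     + Cmod (sub (S n) q3) + Cmod (sub (S n) q4)).
  { rewrite E. eapply Rle_trans; [apply Cmod_triangle|]. apply Rplus_le_compat_r.
    eapply Rle_trans; [apply Cmod_triangle|]. apply Rplus_le_compat_r.
    apply Cmod_triangle. }
  destruct (Rle_dec (Cmod (sub n q1)) (4 * Cmod (sub (S n) q1))) as [D1|D1];
  [exists q1; unfold inside, q1; cbn [fst snd]; repeat split; try lra; exact D1|].
  destruct (Rle_dec (Cmod (sub n q1)) (4 * Cmod (sub (S n) q2))) as [D2|D2];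
  [exists q2; unfold inside, q2; cbn [fst snd]; repeat split; try lra; exact D2|].
  destruct (Rle_dec (Cmod (sub n q1)) (4 * Cmod (sub (S n) q3))) as [D3|D3];
  [exists q3; unfold inside, q3; cbn [fst snd]; repeat split; try lra; exact D3|].
  exists q4. unfold inside, q4; cbn [fst snd]; repeat split; try lra.
  fold q4. lra.
Qed.

Let next (n : nat) (p : R * R) : R * R := epsilon (inhabits p) (fun q =>
    inside (S n) q /\ fst p <= fst q /\ fst q + W (S n) <= fst p + W n
    /\ snd p <= snd q /\ snd q + H (S n) <= snd p + H n
    /\ Cmod (sub n p) <= 4 * Cmod (sub (S n) q)).

Let corner := fix corner (n : nat) : R * R :=
  match n with O => (a, c) | S n => next n (corner n) end.

Let corner_inside n : inside n (corner n).
Proof.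
  induction n as [|n IH].
  - unfold inside, W, H; simpl. repeat split; lra.
  - exact (proj1 (epsilon_spec _ _ (goursat_step n (corner n) IH))).
Qed.

Let corner_S n := proj2 (epsilon_spec (inhabits (corner n)) _
  (goursat_step n (corner n) (corner_inside n))).

Lemma corner_nested (n k : nat) :
  fst (corner n) <= fst (corner (n + k)) /\
  fst (corner (n + k)) + W (n + k) <= fst (corner n) + W n /\
  snd (corner n) <= snd (corner (n + k)) /\
  snd (corner (n + k)) + H (n + k) <= snd (corner n) + H n.
Proof.
  induction k as [|k IH].
  - rewrite Nat.add_0_r. lra.
  - rewrite Nat.add_succ_r.
    destruct (corner_S (n + k)) as [D1 [D2 [D3 [D4 _]]]].
    fold (next (n + k) (corner (n + k))) in D1, D2, D3, D4.
    change (next (n + k) (corner (n + k))) with (corner (S (n + k))) in D1, D2, D3, D4.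
    lra.
Qed.

Lemma corner_large (n : nat) : Cmod (rect_int F a b c d) <= 4 ^ n * Cmod (sub n (corner n)).
Proof.
  induction n as [|n IH].
  - unfold sub, W, H. simpl.
    replace (a + (b - a) / 1) with b by field. replace (c + (d - c) / 1) with d by field. lra.
  - destruct (corner_S n) as [_ [_ [_ [_ D]]]].
    fold (next n (corner n)) in D. change (next n (corner n)) with (corner (S n)) in D.
    apply Rle_trans with (1 := IH). simpl pow.
    apply Rle_trans with (4 ^ n * (4 * Cmod (sub (S n) (corner (S n))))).
    + apply Rmult_le_compat_l; [apply pow_le; lra|exact D].
    + right. ring.
Qed.

(** Nested intervals: [X] is the supremum of the left ends. Every left end lies below every right
    end because, of two of the intervals, the one with the larger index is inside the other. *)
Lemma corner_le (f : nat -> R) (w : nat -> R) : (forall n, 0 <= w n) ->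
  (forall n k, f n <= f (n + k)%nat /\ f (n + k)%nat + w (n + k)%nat <= f n + w n) ->
  exists X, forall n, f n <= X <= f n + w n.
Proof.
  intros Hw Hf.
  assert (Hle : forall n m, f m <= f n + w n).
  { intros n m. destruct (Nat.le_ge_cases n m) as [L|L].
    - destruct (Hf n (m - n)%nat) as [_ H1]. replace (n + (m - n))%nat with m in H1 by lia.
      specialize (Hw m). lra.
    - destruct (Hf m (n - m)%nat) as [H1 _]. replace (m + (n - m))%nat with n in H1 by lia.
      specialize (Hw n). lra. }
  destruct (completeness (fun x => exists n, x = f n)) as [X [HX1 HX2]].
  - exists (f O + w O). intros x [m ->]. apply Hle.
  - exists (f O). now exists O.
  - exists X. intro n. split.
    + apply HX1. now exists n.
    + apply HX2. intros x [m ->]. apply Hle.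
Qed.

Theorem goursat : rect_int F a b c d = 0.
Proof.
  destruct (corner_le (fun n => fst (corner n)) W W_ge) as [X HX].
  { intros n k. destruct (corner_nested n k) as [? [? _]]. split; assumption. }
  destruct (corner_le (fun n => snd (corner n)) H H_ge) as [Y HY].
  { intros n k. destruct (corner_nested n k) as [_ [_ [? ?]]]. split; assumption. }
  assert (HXY : a <= X <= b /\ c <= Y <= d).
  { specialize (HX O). specialize (HY O). destruct (corner_inside O) as [? [? [? ?]]]. lra. }
  destruct (HF X Y) as [l Hl]; [tauto|tauto|].
  apply Cmod_eq_0. apply Rle_antisym; [|apply Cmod_ge_0].
  apply le_epsilon. intros e He. rewrite Rplus_0_l.
  set (S0 := (b - a) + (d - c)).
  assert (HS0 : 0 <= S0) by (unfold S0; lra).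
  (* The final bound is [2 eps S0^2] with [S0] half the perimeter, as the factor [4^n] cancels the
     squared scale [2^-n]. The [+ 1] covers a degenerate rectangle. *)
  set (eps := e / (2 * (S0 * S0 + 1))).
  assert (HSS : 0 <= S0 * S0) by (apply Rmult_le_pos; assumption).
  assert (Heps : 0 < eps) by (apply Rdiv_lt_0_compat; lra).
  destruct (Hl eps Heps) as [r [Hr Hd]].
  destruct (pow_lt_1_zero (/ 2) ltac:(rewrite Rabs_pos_eq; lra) (r / (S0 + 1))) as [n Hn].
  { apply Rdiv_lt_0_compat; lra. }
  specialize (Hn n (le_n n)).
  rewrite Rabs_pos_eq in Hn by (apply pow_le; lra).
  assert (Hp : 0 < 2 ^ n) by (apply pow_lt; lra).
  assert (Hsmall : W n + H n < r).
  { replace (W n + H n) with (S0 * (/ 2) ^ n) by (unfold W, H, S0; rewrite pow_inv; field; lra).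
    apply Rle_lt_trans with (S0 * (r / (S0 + 1))).
    - apply Rmult_le_compat_l; lra.
    - replace (S0 * (r / (S0 + 1))) with (r * (S0 / (S0 + 1))) by (field; lra).
      rewrite <- (Rmult_1_r r) at 2. apply Rmult_lt_compat_l; [exact Hr|].
      apply Rlt_div_l; lra. }
  specialize (HX n). specialize (HY n).
  destruct (corner_inside n) as [I1 [I2 [I3 I4]]].
  pose proof (W_ge n) as HW. pose proof (H_ge n) as HH.
  pose proof (corner_large n) as HL.
  set (p := corner n) in *.
  (* The tangent at the limit point has zero boundary integral, so only the linearisation error of
     [F] contributes. *)
  set (A := fun w : C => ((F (X, Y) - l * (X, Y)) + l * w)%C).
  assert (HAc : forall w, ccont A w).
  { intro w. apply (cderiv_ccont _ _ l). eapply cderiv_val.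
    - apply cderiv_plus; [apply cderiv_const|apply cderiv_scal, cderiv_id].
    - ring. }
  assert (HFc : forall x y, fst p <= x <= fst p + W n -> snd p <= y <= snd p + H n -> ccont F (x, y)).
  { intros x y Hx Hy. destruct (HF x y) as [m Hm]; [lra|lra|]. eapply cderiv_ccont, Hm. }
  assert (Esub : sub n p = rect_int (fun w => F w - A w)%C (fst p) (fst p + W n) (snd p) (snd p + H n)).
  { rewrite rect_int_minus; [|lra|lra|exact HFc|intros; apply HAc].
    unfold A. rewrite rect_int_affine. unfold sub. ring. }
  assert (Hb : Cmod (sub n p) <= 2 * (eps * (W n + H n)) * (W n + H n)).
  { rewrite Esub.
    replace (W n + H n) with ((fst p + W n - fst p) + (snd p + H n - snd p)) at 2 by ring.
    apply rect_int_bound; [lra|lra| |].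
    - intros x y Hx Hy. destruct (HF x y) as [m Hm]; [lra|lra|].
      apply (cderiv_ccont _ _ (m - l)%C). apply cderiv_minus; [exact Hm|].
      unfold A. eapply cderiv_val.
      + apply cderiv_plus; [apply cderiv_const|apply cderiv_scal, cderiv_id].
      + ring.
    - intros x y Hx Hy.
      assert (Hdist : Cmod ((x, y) - (X, Y)) <= W n + H n).
      { replace ((x, y) - (X, Y))%C with ((x - X, y - Y) : C) by reflexivity.
        eapply Rle_trans; [apply Cmod_le_parts|].
        apply Rplus_le_compat; apply Rabs_le; lra. }
      unfold A.
      replace (F (x, y) - (F (X, Y) - l * (X, Y) + l * (x, y)))%C
        with (F (x, y) - F (X, Y) - l * ((x, y) - (X, Y)))%C by ring.
      eapply Rle_trans; [apply Hd; lra|]. apply Rmult_le_compat_l; lra. }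
  apply Rle_trans with (1 := HL).
  apply Rle_trans with (4 ^ n * (2 * (eps * (W n + H n)) * (W n + H n))).
  { apply Rmult_le_compat_l; [apply pow_le; lra|exact Hb]. }
  replace (4 ^ n) with (2 ^ n * 2 ^ n) by (rewrite <- Rpow_mult_distr; f_equal; lra).
  replace (2 ^ n * 2 ^ n * (2 * (eps * (W n + H n)) * (W n + H n))) with (2 * eps * (S0 * S0))
    by (unfold W, H, S0; field; lra).
  unfold eps. replace (2 * (e / (2 * (S0 * S0 + 1))) * (S0 * S0)) with (e * (S0 * S0 / (S0 * S0 + 1))) by (field; lra).
  rewrite <- (Rmult_1_r e) at 2. apply Rmult_le_compat_l; [lra|].
  apply Rle_div_l; lra.
Qed.
End Goursat.

(** * Primitives on domains closed under moving left *)

Definition copen (D : C -> Prop) : Prop :=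
  forall z, D z -> exists r, 0 < r /\ forall w, Cmod (w - z) < r -> D w.

Definition holo (D : C -> Prop) (F : C -> C) : Prop :=
  forall z, D z -> exists l, cderiv F z l.

(* Typical domain: the preimage of a convex neighbourhood of 0 under the exponential. *)
Definition left_convex (D : C -> Prop) : Prop :=
  forall x y x', D (x, y) -> x' <= x -> D (x', y).

(** Together with [left_convex] it puts the path [(L, 0)], [(L, y)], [(x, y)] inside [D] for every
    point [(x, y)] of [D]; primitives are integrals along this path. *)
Definition contains_line (D : C -> Prop) (L : R) : Prop :=
  forall x y y', D (x, y) -> Rabs y' <= Rabs y -> D (L, y').

(** Goursat's theorem without ordered corners: exchanging two opposite sides only changes signs. *)
Lemma rect_int_zero (D : C -> Prop) (F : C -> C) (a b c d : R) : holo D F ->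
  (forall x y, Rmin a b <= x <= Rmax a b -> Rmin c d <= y <= Rmax c d -> D (x, y)) ->
  rect_int F a b c d = 0.
Proof.
  intros HF HD.
  assert (Hh : forall y, Rmin c d <= y <= Rmax c d -> ex_CInt (fun s => F (s, y)) a b).
  { intros y Hy. apply ex_CInt_rcont. intros t Ht.
    apply (rcont_comp F (fun s => (s, y))).
    - eapply rderiv_rcont, rderiv_horizontal.
    - destruct (HF (t, y)) as [l Hl]; [apply HD; assumption|]. eapply cderiv_ccont, Hl. }
  assert (Hv : forall x, Rmin a b <= x <= Rmax a b -> ex_CInt (fun s => F (x, s)) c d).
  { intros x Hx. apply ex_CInt_rcont. intros t Ht.
    apply (rcont_comp F (fun s => (x, s))).
    - eapply rderiv_rcont, rderiv_vertical.
    - destruct (HF (x, t)) as [l Hl]; [apply HD; assumption|]. eapply cderiv_ccont, Hl. }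
  pose proof (goursat F (Rmin a b) (Rmax a b) (Rmin c d) (Rmax c d)) as G.
  pose proof (Rminmax a b) as Mab. pose proof (Rminmax c d) as Mcd.
  specialize (G Mab Mcd (fun x y Hx Hy => HF _ (HD x y Hx Hy))).
  assert (Ha : Rmin a b <= a <= Rmax a b) by (split; [apply Rmin_l|apply Rmax_l]).
  assert (Hb : Rmin a b <= b <= Rmax a b) by (split; [apply Rmin_r|apply Rmax_r]).
  assert (Hc : Rmin c d <= c <= Rmax c d) by (split; [apply Rmin_l|apply Rmax_l]).
  assert (Hd : Rmin c d <= d <= Rmax c d) by (split; [apply Rmin_r|apply Rmax_r]).
  specialize (Hh c Hc) as Hhc. specialize (Hh d Hd) as Hhd.
  specialize (Hv a Ha) as Hva. specialize (Hv b Hb) as Hvb.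
  revert G. unfold rect_int, Rmin, Rmax.
  destruct (Rle_dec a b), (Rle_dec c d); intro G.
  - exact G.
  - rewrite (CInt_swap (fun y => F (b, y)) c d Hvb), (CInt_swap (fun y => F (a, y)) c d Hva) in G.
    transitivity (- 0)%C; [rewrite <- G|]; ring.
  - rewrite (CInt_swap (fun y => F (y, c)) a b Hhc), (CInt_swap (fun y => F (y, d)) a b Hhd) in G.
    transitivity (- 0)%C; [rewrite <- G|]; ring.
  - rewrite (CInt_swap (fun y => F (b, y)) c d Hvb), (CInt_swap (fun y => F (a, y)) c d Hva) in G.
    rewrite (CInt_swap (fun y => F (y, c)) a b Hhc), (CInt_swap (fun y => F (y, d)) a b Hhd) in G.
    rewrite <- G. ring.
Qed.

(** [P] integrates up the line [Re = L] and then horizontally. For a nearby point, Goursat's theorem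
    on the rectangle between that line and [z] reduces the increment of [P] to two short sides next
    to [z], where [F] is almost constant. *)
Theorem primitive_left_convex (D : C -> Prop) (F : C -> C) (L : R) :
  copen D -> left_convex D -> contains_line D L -> holo D F ->
  exists P : C -> C, forall z, D z -> cderiv P z (F z).
Proof.
  intros HO HC HL HF.
  set (P := fun z : C => (Ci * CInt (fun t => F (L, t)) 0 (snd z)
                       + CInt (fun s => F (s, snd z)) L (fst z))%C).
  assert (Hmax : forall x y s, D (x, y) -> s <= Rmax L x -> D (s, y)).
  { intros x y s Hxy Hs. unfold Rmax in Hs. destruct (Rle_dec L x).
    - apply (HC x); assumption.
    - apply (HC L); [|exact Hs]. apply (HL x y); [exact Hxy|lra]. }
  assert (Hh : forall y x x', (forall s, Rmin x x' <= s <= Rmax x x' -> D (s, y)) ->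
     ex_CInt (fun s => F (s, y)) x x').
  { intros y x x' Hy. apply ex_CInt_rcont. intros t Ht.
    apply (rcont_comp F (fun s => (s, y))).
    - eapply rderiv_rcont, rderiv_horizontal.
    - destruct (HF (t, y)) as [l Hl]; [apply Hy; assumption|]. eapply cderiv_ccont, Hl. }
  assert (Hv : forall x y y', (forall s, Rmin y y' <= s <= Rmax y y' -> D (x, s)) ->
     ex_CInt (fun s => F (x, s)) y y').
  { intros x y y' Hy. apply ex_CInt_rcont. intros t Ht.
    apply (rcont_comp F (fun s => (x, s))).
    - eapply rderiv_rcont, rderiv_vertical.
    - destruct (HF (x, t)) as [l Hl]; [apply Hy; assumption|]. eapply cderiv_ccont, Hl. }
  exists P. intros [x y] Hz eps He.
  destruct (HF _ Hz) as [l Hl].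
  destruct (cderiv_ccont _ _ _ Hl (eps / 2)) as [d1 [Hd1 H1]]; [lra|].
  destruct (HO _ Hz) as [d2 [Hd2 H2]].
  (* Halved because distances in the box are bounded by the sum of two coordinates, each at most the
     distance of the two points. *)
  exists (Rmin d1 d2 / 2). split.
  { pose proof (Rmin_glb_lt _ _ _ Hd1 Hd2). lra. }
  intros [x' y'] Hw.
  assert (Hdx : Rabs (x' - x) <= Cmod ((x', y') - (x, y))) by apply (Re_le_Cmod ((x', y') - (x, y))).
  assert (Hdy : Rabs (y' - y) <= Cmod ((x', y') - (x, y))) by apply (Im_le_Cmod ((x', y') - (x, y))).
  assert (Hbox : forall s t, Rabs (s - x) <= Rabs (x' - x) -> Rabs (t - y) <= Rabs (y' - y) ->
     Cmod ((s, t) - (x, y)) < Rmin d1 d2).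
  { intros s t Hs Ht. replace ((s, t) - (x, y))%C with ((s - x, t - y) : C) by reflexivity.
    eapply Rle_lt_trans; [apply Cmod_le_parts|]. lra. }
  assert (HboxD : forall s t, Rabs (s - x) <= Rabs (x' - x) -> Rabs (t - y) <= Rabs (y' - y) ->
     D (s, t)).
  { intros s t Hs Ht. apply H2. eapply Rlt_le_trans; [apply Hbox; assumption|apply Rmin_r]. }
  assert (Hbet : forall u v s, Rmin u v <= s <= Rmax u v -> Rabs (s - u) <= Rabs (v - u)).
  { intros u v s. unfold Rmin, Rmax. destruct (Rle_dec u v); intro.
    - rewrite !Rabs_pos_eq; lra.
    - rewrite !Rabs_left1; lra. }
  assert (Habs0 : forall v s, Rmin 0 v <= s <= Rmax 0 v -> Rabs s <= Rabs v).
  { intros v s Hs. pose proof (Hbet 0 v s Hs) as Hq. now rewrite !Rminus_0_r in Hq. }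
  assert (H0 : forall u, Rabs (u - u) <= Rabs (x' - x)).
  { intro u. rewrite Rminus_diag, Rabs_R0. apply Rabs_pos. }
  assert (H0' : forall u, Rabs (u - u) <= Rabs (y' - y)).
  { intro u. rewrite Rminus_diag, Rabs_R0. apply Rabs_pos. }
  assert (HLy : forall t, Rmin 0 y <= t <= Rmax 0 y -> D (L, t)).
  { intros t Ht. apply (HL x y); [exact Hz|]. apply Habs0, Ht. }
  assert (Hyy : forall t, Rmin y y' <= t <= Rmax y y' -> D (x, t)).
  { intros t Ht. apply HboxD; [apply H0|apply Hbet, Ht]. }
  assert (HLyy : forall t, Rmin y y' <= t <= Rmax y y' -> D (L, t)).
  { intros t Ht. apply (Hmax x); [apply Hyy, Ht|apply Rmax_l]. }
  assert (Hz' : D (x', y')) by (apply HboxD; lra).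
  pose proof (rect_int_zero D F L x y y' HF) as G. unfold rect_int in G.
  assert (G' : forall s t, Rmin L x <= s <= Rmax L x -> Rmin y y' <= t <= Rmax y y' -> D (s, t)).
  { intros s t Hs Ht. apply (Hmax x); [apply Hyy, Ht|lra]. }
  specialize (G G').
  assert (HEx1 : ex_CInt (fun s => F (s, y')) x x').
  { apply Hh. intros s Hs. apply HboxD; [apply Hbet, Hs|lra]. }
  assert (HEx2 : ex_CInt (fun s => F (x, s)) y y') by (apply Hv; exact Hyy).
  assert (E : (P (x', y') - P (x, y) = CInt (fun s => F (s, y')) x x' + Ci * CInt (fun t => F (x, t)) y y')%C).
  { unfold P. cbn [fst snd].
    rewrite (CInt_Chasles (fun t => F (L, t)) 0 y y') by (apply Hv; assumption).
    rewrite (CInt_Chasles (fun s => F (s, y')) L x x').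
    - apply (f_equal (fun r => (r + CInt (fun s => F (s, y')) L x + CInt (fun s => F (s, y')) x x'
         + Ci * CInt (fun t => F (L, t)) y y' - CInt (fun s => F (s, y)) L x)%C)) in G.
      transitivity (0 + CInt (fun s => F (s, y')) L x + CInt (fun s => F (s, y')) x x'
         + Ci * CInt (fun t => F (L, t)) y y' - CInt (fun s => F (s, y)) L x)%C; [ring|].
      rewrite <- G. ring.
    - apply Hh. intros s Hs. apply (G' s y'); [exact Hs|]. split; [apply Rmin_r|apply Rmax_r].
    - exact HEx1. }
  rewrite E.
  replace (CInt (fun s => F (s, y')) x x' + Ci * CInt (fun t => F (x, t)) y y' - F (x, y) * ((x', y') - (x, y)))%C
    with (CInt (fun s => F (s, y') - F (x, y))%C x x' + Ci * CInt (fun t => F (x, t) - F (x, y))%C y y')%C.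
  2:{ rewrite (CInt_minus (fun s => F (s, y')) (fun _ => F (x, y))) by (try exact HEx1; apply ex_CInt_rcont; intros; apply rcont_const).
      rewrite (CInt_minus (fun t => F (x, t)) (fun _ => F (x, y))) by (try exact HEx2; apply ex_CInt_rcont; intros; apply rcont_const).
      rewrite !CInt_const.
      replace ((x', y') - (x, y))%C with (RtoC (x' - x) + Ci * RtoC (y' - y))%C.
      - ring.
      - unfold Cminus, Copp, Cplus, Cmult, Ci, RtoC; simpl. f_equal; ring. }
  eapply Rle_trans; [apply Cmod_triangle|]. rewrite Cmod_mult, Cmod_Ci, Rmult_1_l.
  assert (B : forall s t, Rabs (s - x) <= Rabs (x' - x) -> Rabs (t - y) <= Rabs (y' - y) ->
     Cmod (F (s, t) - F (x, y)) <= eps / 2).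
  { intros s t Hs Ht. left. apply H1. eapply Rlt_le_trans; [apply Hbox; assumption|apply Rmin_l]. }
  assert (B1 : Cmod (CInt (fun s => F (s, y') - F (x, y))%C x x') <= eps / 2 * Rabs (x' - x)).
  { apply CInt_bound_abs.
    - apply (@ex_RInt_minus C_R_NormedModule (fun s => F (s, y')) (fun _ => F (x, y))); [exact HEx1|].
      apply ex_CInt_rcont; intros; apply rcont_const.
    - intros t Ht. apply B; [apply Hbet, Ht|lra]. }
  assert (B2 : Cmod (CInt (fun t => F (x, t) - F (x, y))%C y y') <= eps / 2 * Rabs (y' - y)).
  { apply CInt_bound_abs.
    - apply (@ex_RInt_minus C_R_NormedModule (fun s => F (x, s)) (fun _ => F (x, y))); [exact HEx2|].
      apply ex_CInt_rcont; intros; apply rcont_const.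
    - intros t Ht. apply B; [apply H0|apply Hbet, Ht]. }
  nra.
Qed.

(** * Exponential and logarithm *)

Lemma Cexp_plus (a b : C) : Cexp (a + b) = (Cexp a * Cexp b)%C.
Proof.
  destruct a as [a1 a2], b as [b1 b2]. unfold Cexp, Cmult, Cplus; simpl.
  rewrite exp_plus, cos_plus, sin_plus. f_equal; ring.
Qed.

Lemma Cexp_R (x : R) : Cexp (RtoC x) = RtoC (exp x).
Proof. unfold Cexp, RtoC; simpl. rewrite cos_0, sin_0. f_equal; ring. Qed.

Lemma Cexp_0 : Cexp 0 = 1.
Proof. rewrite Cexp_R, exp_0. reflexivity. Qed.

Lemma Cmod_Cexp (z : C) : Cmod (Cexp z) = exp (fst z).
Proof.
  unfold Cexp, Cmod; simpl.
  replace (_ + _) with (exp (fst z) * exp (fst z) * ((sin (snd z))² + (cos (snd z))²))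
    by (unfold Rsqr; ring).
  rewrite sin2_cos2, Rmult_1_r. apply sqrt_square. left. apply exp_pos.
Qed.

Lemma Cexp_neq_0 (z : C) : Cexp z <> 0.
Proof. apply Cmod_gt_0. rewrite Cmod_Cexp. apply exp_pos. Qed.

Lemma Cexp_opp (z : C) : Cexp (- z) = (/ Cexp z)%C.
Proof.
  assert (H : (Cexp z * Cexp (- z) = 1)%C).
  { rewrite <- Cexp_plus. replace (z + - z)%C with (RtoC 0) by ring. apply Cexp_0. }
  pose proof (Cexp_neq_0 z). rewrite <- (Cmult_1_l (/ Cexp z)), <- H. field. assumption.
Qed.

Lemma Cexp_minus (a b : C) : Cexp (a - b) = (Cexp a / Cexp b)%C.
Proof. unfold Cminus. now rewrite Cexp_plus, Cexp_opp. Qed.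

Lemma Cexp_periodic (x y : R) : Cexp (x, y + 2 * PI) = Cexp (x, y).
Proof. 
  unfold Cexp; simpl. replace (y + 2 * PI) with (y + 2 * INR 1 * PI) by (simpl; ring).
  now rewrite cos_period, sin_period.
Qed.

Lemma Cexp_INR_mult (n : nat) (w : C) : Cexp (RtoC (INR n) * w) = (Cexp w ^ n)%C.
Proof.
  induction n as [|n IH].
  - simpl. replace (RtoC 0 * w)%C with (RtoC 0) by ring. apply Cexp_0.
  - rewrite S_INR, RtoC_plus, Cpow_S, <- IH, <- Cexp_plus. f_equal. ring.
Qed.

Lemma real_derivative_eps (f : R -> R) (l : R) : derivable_pt_lim f 0 l ->
  forall eps, 0 < eps -> exists d, 0 < d /\ forall x, Rabs x < d ->
    Rabs (f x - f 0 - l * x) <= eps * Rabs x.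
Proof.
  intros H eps He. destruct (H eps He) as [d Hd]. exists d. split; [apply cond_pos|].
  intros x Hx. destruct (Req_dec x 0) as [->|Hn].
  - replace (f 0 - f 0 - l * 0) with 0 by ring. rewrite Rabs_R0. lra.
  - specialize (Hd x Hn Hx). rewrite Rplus_0_l in Hd.
    replace (f x - f 0 - l * x) with (((f x - f 0) / x - l) * x) by (field; exact Hn).
    rewrite Rabs_mult. apply Rmult_le_compat_r; [apply Rabs_pos|lra].
Qed.

Lemma cderiv_Cexp_0 : cderiv Cexp 0 1.
Proof.
  intros eps He.
  (* The two coordinates of the error add up to at most [8 e] times the modulus, hence the divisor
     9. *)
  set (e := Rmin 1 (eps / 9)).
  assert (He0 : 0 < e) by (apply Rmin_glb_lt; lra).
  assert (He1 : e <= 1) by apply Rmin_l.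
  assert (He9 : e <= eps / 9) by apply Rmin_r.
  destruct (real_derivative_eps exp 1 derivable_pt_lim_exp_0 e He0) as [d1 [Hd1 H1]].
  destruct (real_derivative_eps sin 1 derivable_pt_lim_sin_0 e He0) as [d2 [Hd2 H2]].
  destruct (real_derivative_eps cos 0 derivable_pt_lim_cos_0 e He0) as [d3 [Hd3 H3]].
  exists (Rmin (Rmin d1 (e / 2)) (Rmin d2 d3)). split; [repeat apply Rmin_glb_lt; lra|].
  intros [x y]. assert (E0 : ((x, y) - 0)%C = (x, y)).
  { unfold Cminus, Copp, Cplus, RtoC; simpl. f_equal; ring. }
  rewrite E0. intros Hw.
  assert (Hx := Rle_lt_trans _ _ _ (Re_le_Cmod (x, y)) Hw).
  assert (Hy := Rle_lt_trans _ _ _ (Im_le_Cmod (x, y)) Hw).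
  cbn [fst snd] in Hx, Hy.
  assert (Hx1 := Rlt_le_trans _ _ _ Hx (Rmin_l _ _)).
  assert (Hx2 := Rlt_le_trans _ _ _ Hx1 (Rmin_r _ _)).
  assert (Hy1 := Rlt_le_trans _ _ _ Hy (Rmin_r _ _)).
  specialize (H1 x (Rlt_le_trans _ _ _ Hx1 (Rmin_l _ _))).
  specialize (H2 y (Rlt_le_trans _ _ _ Hy1 (Rmin_l _ _))).
  specialize (H3 y (Rlt_le_trans _ _ _ Hy1 (Rmin_r _ _))).
  rewrite exp_0 in H1. rewrite sin_0 in H2. rewrite cos_0 in H3.
  rewrite Cexp_0.
  assert (Ex : Rabs (exp x - 1) <= e).
  { replace (exp x - 1) with ((exp x - 1 - 1 * x) + x) by ring.
    eapply Rle_trans; [apply Rabs_triang|]. pose proof (Rabs_pos x). nra. }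
  assert (Ex3 : Rabs (exp x) <= 3).
  { replace (exp x) with ((exp x - 1) + 1) by ring.
    eapply Rle_trans; [apply Rabs_triang|]. rewrite Rabs_R1. lra. }
  replace (Cexp (x, y) - 1 - 1 * (x, y))%C with
    (((exp x - 1 - 1 * x) + exp x * (cos y - 1 - 0 * y),
     exp x * (sin y - 0 - 1 * y) + (exp x - 1) * y) : C).
  2:{ unfold Cexp, Cminus, Copp, Cplus, Cmult, RtoC; simpl. f_equal; ring. }
  eapply Rle_trans; [apply Cmod_le_parts|].
  pose proof (Re_le_Cmod (x, y)) as Rx. pose proof (Im_le_Cmod (x, y)) as Ry. cbn [fst snd] in Rx, Ry.
  assert (B1 : Rabs (exp x - 1 - 1 * x + exp x * (cos y - 1 - 0 * y)) <= e * Rabs x + 3 * (e * Rabs y)).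
  { eapply Rle_trans; [apply Rabs_triang|]. rewrite Rabs_mult. apply Rplus_le_compat; [exact H1|].
    apply Rmult_le_compat; try apply Rabs_pos; assumption. }
  assert (B2 : Rabs (exp x * (sin y - 0 - 1 * y) + (exp x - 1) * y) <= 3 * (e * Rabs y) + e * Rabs y).
  { eapply Rle_trans; [apply Rabs_triang|]. rewrite !Rabs_mult. apply Rplus_le_compat.
    - apply Rmult_le_compat; try apply Rabs_pos; assumption.
    - apply Rmult_le_compat_r; [apply Rabs_pos|assumption]. }
  pose proof (Cmod_ge_0 (x, y)). pose proof (Rabs_pos y).
  nra.
Qed.

Lemma cderiv_Cexp (z : C) : cderiv Cexp z (Cexp z).
Proof.
  apply (cderiv_ext (fun w => Cexp z * Cexp (w - z))%C).
  { intro w. rewrite <- Cexp_plus. f_equal. ring. }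
  eapply cderiv_val.
  - apply cderiv_scal. apply (cderiv_comp Cexp (fun w => w - z)%C).
    + apply cderiv_minus; [apply cderiv_id|apply cderiv_const].
    + replace (z - z)%C with (RtoC 0) by ring. apply cderiv_Cexp_0.
  - ring.
Qed.

Lemma Cmod_Cexp_le (w : C) : Cmod (Cexp w) <= exp (Cmod w).
Proof.
  rewrite Cmod_Cexp. assert (H : fst w <= Cmod w).
  { eapply Rle_trans; [apply Rle_abs|apply Re_le_Cmod]. }
  destruct H as [H|H]; [left; now apply exp_increasing|right; now rewrite H].
Qed.

Lemma exp_le_compat (x y : R) : x <= y -> exp x <= exp y.
Proof. intros [H|H]; [left; now apply exp_increasing|right; now rewrite H]. Qed.

Lemma Cmod_scaled_le (t : R) (w : C) : 0 <= t <= 1 -> Cmod (0 + RtoC t * (w - 0)) <= Cmod w.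
Proof.
  intros Ht. replace (0 + RtoC t * (w - 0))%C with (RtoC t * w)%C by ring.
  rewrite Cmod_mult, Cmod_R, Rabs_pos_eq by lra.
  pose proof (Cmod_ge_0 w). nra.
Qed.

Lemma Cmod_Cexp_m1 (w : C) : Cmod (Cexp w - 1) <= Cmod w * exp (Cmod w).
Proof.
  rewrite <- Cexp_0. replace w with (w - 0)%C at 2 by ring. rewrite Rmult_comm.
  apply (mean_value_segment Cexp Cexp 0 w).
  - intros t _. apply cderiv_Cexp.
  - intros t Ht. eapply Rle_trans; [apply Cmod_Cexp_le|]. apply exp_le_compat.
    apply Cmod_scaled_le, Ht.
Qed.

Lemma Cmod_Cexp_m1_id (w : C) : Cmod (Cexp w - 1 - w) <= Cmod w ^ 2 * exp (Cmod w).
Proof.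
  pose proof (mean_value_segment (fun w => Cexp w - w)%C (fun w => Cexp w - 1)%C 0 w (Cmod w * exp (Cmod w))) as H.
  cbv beta in H. rewrite Cexp_0 in H.
  replace (Cexp w - w - (1 - 0))%C with (Cexp w - 1 - w)%C in H by ring.
  replace (w - 0)%C with w in H by ring.
  replace (Cmod w ^ 2 * exp (Cmod w)) with (Cmod w * exp (Cmod w) * Cmod w) by ring.
  apply H.
  - intros t _. apply cderiv_minus; [apply cderiv_Cexp|apply cderiv_id].
  - intros t Ht. eapply Rle_trans; [apply Cmod_Cexp_m1|].
    pose proof (Cmod_scaled_le t w Ht) as Hs. replace (w - 0)%C with w in Hs by ring.
    apply Rmult_le_compat; [apply Cmod_ge_0|left; apply exp_pos|exact Hs|].
    apply exp_le_compat, Hs.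
Qed.

Lemma Cmod_sqr (z : C) : Cmod z * Cmod z = fst z * fst z + snd z * snd z.
Proof.
  unfold Cmod. rewrite sqrt_sqrt by nra. ring.
Qed.

(** * Principal argument, logarithm and powers *)

Lemma Carg_spec (z : C) : z <> 0 ->
  (- PI <= Carg z <= PI) /\ cos (Carg z) = fst z / Cmod z /\ sin (Carg z) = snd z / Cmod z.
Proof.
  intros Hz. pose proof (Cmod_neq0 z Hz) as Hp.
  pose proof (Cmod_sqr z) as Hsq.
  assert (Hu : -1 <= fst z / Cmod z <= 1).
  { pose proof (Re_le_Cmod z) as H. apply Rabs_le_between in H. split.
    - apply Rle_div_r; lra.
    - apply Rle_div_l; lra. }
  pose proof (acos_bound (fst z / Cmod z)) as Hb.
  assert (Hs : sin (acos (fst z / Cmod z)) = Rabs (snd z) / Cmod z).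
  { rewrite sin_acos by exact Hu.
    replace (1 - (fst z / Cmod z)²) with ((Rabs (snd z) / Cmod z)²).
    - apply sqrt_Rsqr. apply Rdiv_le_0_compat; [apply Rabs_pos|exact Hp].
    - rewrite !Rsqr_div', <- Rsqr_abs. unfold Rsqr.
      apply Rmult_eq_reg_r with (Cmod z * Cmod z); [|nra]. field_simplify; [|lra|lra]. nra. }
  unfold Carg. destruct (Rle_dec 0 (snd z)) as [H|H].
  - rewrite cos_acos by exact Hu. rewrite Hs, Rabs_pos_eq by exact H. repeat split; lra.
  - rewrite cos_neg, sin_neg, cos_acos, Hs, Rabs_left by lra.
    repeat split; lra.
Qed.

Lemma Cexp_Clog (z : C) : z <> 0 -> Cexp (Clog z) = z.
Proof.
  intros Hz. pose proof (Cmod_neq0 z Hz) as Hp.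
  destruct (Carg_spec z Hz) as [_ [Hc Hs]].
  unfold Cexp, Clog. cbn [fst snd]. rewrite Hc, Hs, exp_ln by exact Hp.
  destruct z as [x y]. cbn [fst snd]. f_equal; field; lra.
Qed.

Lemma Carg_pos (z : C) : 0 < snd z -> 0 < Carg z < PI.
Proof.
  intros H. assert (Hz : z <> 0) by (intros ->; simpl in H; lra).
  pose proof (Cmod_neq0 z Hz) as Hp.
  destruct (Carg_spec z Hz) as [Hb [Hc Hs]].
  assert (Hs' : 0 < sin (Carg z)) by (rewrite Hs; apply Rdiv_lt_0_compat; assumption).
  split.
  - apply Rnot_le_lt. intro Hle.
    assert (sin (Carg z) <= 0).
    { rewrite <- (Ropp_involutive (sin _)), <- sin_neg. pose proof (sin_ge_0 (- Carg z)). lra. }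
    lra.
  - destruct (proj2 Hb) as [Hlt|E]; [exact Hlt|]. rewrite E, sin_PI in Hs'. lra.
Qed.

Lemma Carg_neg (z : C) : snd z < 0 -> - PI < Carg z < 0.
Proof.
  intros H. assert (Hz : z <> 0) by (intros ->; simpl in H; lra).
  pose proof (Cmod_neq0 z Hz) as Hp.
  destruct (Carg_spec z Hz) as [Hb [Hc Hs]].
  assert (Hs' : sin (Carg z) < 0).
  { rewrite Hs. apply Rlt_div_l; [exact Hp|lra]. }
  split.
  - destruct (proj1 Hb) as [Hlt|E]; [exact Hlt|]. rewrite <- E, sin_neg, sin_PI in Hs'. lra.
  - apply Rnot_le_lt. intro Hle. pose proof (sin_ge_0 (Carg z)). lra.
Qed.

Lemma cos_pos_small (t : R) : - PI <= t <= PI -> 0 < cos t -> - (PI / 2) < t < PI / 2.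
Proof.
  intros Hb Hc. pose proof PI_RGT_0. split; apply Rnot_le_lt; intro Hle.
  - rewrite <- cos_neg in Hc. pose proof (cos_le_0 (- t)). lra.
  - pose proof (cos_le_0 t). lra.
Qed.

Lemma Carg_right (z : C) : 0 < fst z -> - (PI / 2) < Carg z < PI / 2.
Proof.
  intros H. assert (Hz : z <> 0) by (intros ->; simpl in H; lra).
  pose proof (Cmod_neq0 z Hz) as Hp.
  destruct (Carg_spec z Hz) as [Hb [Hc Hs]].
  apply cos_pos_small; [exact Hb|]. rewrite Hc. apply Rdiv_lt_0_compat; assumption.
Qed.

(** The Taylor bound [t - t^3/6] is at least [t/3] as long as [t <= 2], and [PI / 2 <= 2]. *)
Lemma sin_ge_third (t : R) : 0 <= t <= PI / 2 -> t / 3 <= sin t.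
Proof.
  intros Ht. pose proof PI_4. pose proof PI_RGT_0.
  destruct (sin_bound t 0) as [H1 _]; [lra|lra|].
  unfold sin_approx, sin_term in H1. simpl in H1.
  assert (t * t <= 4) by nra. nra.
Qed.

Lemma ln_near_1 (r t : R) : t <= 1 / 2 -> Rabs (r - 1) <= t -> Rabs (ln r) <= 2 * t.
Proof.
  intros Ht Hr. apply Rabs_le_between in Hr.
  assert (Hrp : 0 < r) by lra.
  apply Rabs_le. split.
  - assert (H : ln (/ r) <= / r - 1).
    { pose proof (exp_ineq1_le (ln (/ r))) as H. rewrite exp_ln in H by (apply Rinv_0_lt_compat, Hrp). lra. }
    rewrite ln_Rinv in H by exact Hrp.
    assert (/ r - 1 <= 2 * t).
    { replace (/ r - 1) with ((1 - r) / r) by (field; lra). apply Rle_div_l; [exact Hrp|]. nra. }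
    lra.
  - pose proof (exp_ineq1_le (ln r)) as H. rewrite exp_ln in H by exact Hrp. lra.
Qed.

(** The difference is a logarithm of [w / z], and the hypothesis on the arguments makes it the one
    near 0: its imaginary part has positive cosine, so it is controlled by its sine. The 8 is 2 for
    the real part and [3 * 2] for the imaginary part. *)
Lemma Clog_diff (z w : C) : z <> 0 -> w <> 0 -> Rabs (Carg w - Carg z) < PI ->
  Cmod (w / z - 1) <= 1 / 2 -> Cmod (Clog w - Clog z) <= 8 * Cmod (w / z - 1).
Proof.
  intros Hz Hw Harg Ht. set (t := Cmod (w / z - 1)) in *.
  set (u := (w / z)%C) in *.
  assert (Hexp : Cexp (Clog w - Clog z) = u).
  { rewrite Cexp_minus, !Cexp_Clog by assumption. reflexivity. }
  assert (Hut : Rabs (Cmod u - 1) <= t).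
  { apply Rabs_le. split.
    - pose proof (Cmod_triangle_sub 1 (1 - u)) as H. replace (1 - (1 - u))%C with u in H by ring.
      rewrite Cmod_1, (Cmod_minus_sym 1 u) in H. fold t in H. lra.
    - pose proof (Cmod_triangle_sub u 1) as H. rewrite Cmod_1 in H. fold t in H. lra. }
  assert (Hu2 : 1 / 2 <= Cmod u) by (apply Rabs_le_between in Hut; lra).
  destruct (Clog w - Clog z)%C as [a b] eqn:E.
  assert (Ea : exp a = Cmod u) by (rewrite <- Hexp, Cmod_Cexp; reflexivity).
  assert (Eb : b = Carg w - Carg z).
  { apply (f_equal snd) in E. cbn in E. rewrite <- E. ring. }
  rewrite <- Eb in Harg.
  eapply Rle_trans; [apply Cmod_le_parts|].
  assert (Ba : Rabs a <= 2 * t).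
  { rewrite <- (ln_exp a), Ea. apply ln_near_1; [lra|exact Hut]. }
  assert (Hre : fst u = Cmod u * cos b) by (rewrite <- Ea, <- Hexp; reflexivity).
  assert (Him : snd u = Cmod u * sin b) by (rewrite <- Ea, <- Hexp; reflexivity).
  assert (Hre' : Rabs (fst u - 1) <= t).
  { pose proof (Re_le_Cmod (u - 1)) as H. exact H. }
  assert (Him' : Rabs (snd u) <= t).
  { pose proof (Im_le_Cmod (u - 1)) as H. fold t in H.
    replace (snd (u - 1)%C) with (snd u) in H by (change (snd u = snd u + - 0); ring). exact H. }
  apply Rabs_le_between in Hre'.
  assert (Hcos : 0 < cos b) by nra.
  apply Rabs_lt_between in Harg.
  destruct (cos_pos_small b) as [Hb1 Hb2]; [lra|exact Hcos|].
  assert (Hsin : Rabs (sin b) <= 2 * t).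
  { rewrite Him, Rabs_mult, (Rabs_pos_eq (Cmod u)) in Him' by lra.
    pose proof (Rabs_pos (sin b)). nra. }
  assert (Bb : Rabs b <= 3 * Rabs (sin b)).
  { destruct (Rle_dec 0 b) as [H0|H0].
    - pose proof (sin_ge_third b ltac:(lra)). rewrite !Rabs_pos_eq by lra. lra.
    - pose proof (sin_ge_third (- b) ltac:(lra)) as H. rewrite sin_neg in H.
      rewrite !Rabs_left1 by lra. lra. }
  lra.
Qed.

(** The plane without the branch cut of [Clog]. *)
Definition slit (z : C) : Prop := 0 < fst z \/ snd z <> 0.

Lemma slit_neq_0 (z : C) : slit z -> z <> 0.
Proof. intros [H|H] ->; simpl in H; lra. Qed.

(** No jump of the argument: in the right half-plane it stays within [PI / 2] of 0, elsewhere nearby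
    points have an imaginary part of the same sign, which confines the argument to one half of its
    range. *)
Lemma Carg_close (z : C) : slit z -> exists r, 0 < r /\ forall w, Cmod (w - z) < r ->
  w <> 0 /\ Rabs (Carg w - Carg z) < PI.
Proof.
  intros Hz. pose proof PI_RGT_0.
  assert (Hpart : forall w r, Cmod (w - z) < r -> Rabs (fst w - fst z) < r /\ Rabs (snd w - snd z) < r).
  { intros w r Hw. split.
    - exact (Rle_lt_trans _ _ _ (Re_le_Cmod (w - z)) Hw).
    - exact (Rle_lt_trans _ _ _ (Im_le_Cmod (w - z)) Hw). }
  destruct (Rlt_dec 0 (fst z)) as [H1|H1].
  - exists (fst z). split; [exact H1|]. intros w Hw. apply Hpart in Hw. destruct Hw as [Hw _].
    apply Rabs_lt_between in Hw.
    assert (Hw' : 0 < fst w) by lra. split; [apply slit_neq_0; now left|].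
    pose proof (Carg_right _ H1). pose proof (Carg_right _ Hw'). apply Rabs_lt_between. lra.
  - destruct Hz as [Hz|Hz]; [lra|]. exists (Rabs (snd z)). split; [now apply Rabs_pos_lt|].
    intros w Hw. apply Hpart in Hw. destruct Hw as [_ Hw]. apply Rabs_lt_between in Hw.
    destruct (Rlt_dec 0 (snd z)) as [H2|H2].
    + rewrite Rabs_pos_eq in Hw by lra. assert (H3 : 0 < snd w) by lra.
      split; [apply slit_neq_0; right; lra|].
      pose proof (Carg_pos _ H2). pose proof (Carg_pos _ H3). apply Rabs_lt_between. lra.
    + rewrite Rabs_left in Hw by lra. assert (H3 : snd w < 0) by lra. assert (H4 : snd z < 0) by lra.
      split; [apply slit_neq_0; right; lra|].
      pose proof (Carg_neg _ H4). pose proof (Carg_neg _ H3). apply Rabs_lt_between. lra.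
Qed.

Lemma exp_1_le_3 : exp 1 <= 3.
Proof. exact exp_le_3. Qed.

Lemma Cexp_quadratic (w : C) : Cmod w <= 1 -> Cmod (Cexp w - 1 - w) <= 3 * Cmod w ^ 2.
Proof.
  intros H. eapply Rle_trans; [apply Cmod_Cexp_m1_id|]. rewrite Rmult_comm.
  apply Rmult_le_compat_r; [apply pow2_ge_0|].
  eapply Rle_trans; [apply exp_le_compat, H|apply exp_1_le_3].
Qed.

(** For the increment [D] of the logarithm, [Cexp D - 1 = (w - z) / z] exactly, so the error of
    [Clog] is minus the quadratic error of [Cexp] at [D]. The constant 192 is [3 * 8^2], from the
    bounds on that error and on [D]. *)
Lemma cderiv_Clog (z : C) : slit z -> cderiv Clog z (/ z)%C.
Proof.
  intros Hz eps He. pose proof (slit_neq_0 z Hz) as Hz0. pose proof (Cmod_neq0 z Hz0) as Hm.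
  destruct (Carg_close z Hz) as [r [Hr Hclose]].
  set (d := Rmin r (Rmin (Cmod z / 8) (eps * (Cmod z * Cmod z) / 192))).
  assert (Hd : 0 < d).
  { repeat apply Rmin_glb_lt; try lra. apply Rdiv_lt_0_compat; [|lra].
    repeat apply Rmult_lt_0_compat; lra. }
  exists d. split; [exact Hd|]. intros w Hw.
  assert (Hw1 := Rlt_le_trans _ _ _ Hw (Rmin_l _ _)).
  assert (Hw2 := Rlt_le_trans _ _ _ Hw (Rmin_r _ _)).
  assert (Hw3 := Rlt_le_trans _ _ _ Hw2 (Rmin_l _ _)).
  assert (Hw4 := Rlt_le_trans _ _ _ Hw2 (Rmin_r _ _)).
  destruct (Hclose w Hw1) as [Hw0 Harg].
  assert (Eu : (w / z - 1)%C = ((w - z) / z)%C) by (field; exact Hz0).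
  assert (Et : Cmod (w / z - 1) = Cmod (w - z) / Cmod z) by (rewrite Eu; now apply Cmod_div).
  assert (Ht : Cmod (w / z - 1) <= 1 / 8).
  { rewrite Et. apply Rle_div_l; lra. }
  pose proof (Clog_diff z w Hz0 Hw0 Harg ltac:(lra)) as HD.
  set (D := (Clog w - Clog z)%C) in *.
  assert (HexpD : Cexp D = (w / z)%C).
  { unfold D. rewrite Cexp_minus, !Cexp_Clog by assumption. reflexivity. }
  assert (Hq := Cexp_quadratic D ltac:(lra)).
  replace (D - / z * (w - z))%C with (- (Cexp D - 1 - D))%C.
  2:{ rewrite HexpD. field. exact Hz0. }
  rewrite Cmod_opp. apply Rle_trans with (1 := Hq).
  pose proof (Cmod_ge_0 D). pose proof (Cmod_ge_0 (w - z)) as Hwz.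
  apply Rle_trans with (3 * (8 * Cmod (w / z - 1)) ^ 2).
  { apply Rmult_le_compat_l; [lra|]. apply pow_incr. split; assumption. }
  rewrite Et.
  replace (3 * (8 * (Cmod (w - z) / Cmod z)) ^ 2)
    with (192 / (Cmod z * Cmod z) * Cmod (w - z) * Cmod (w - z)) by (field; lra).
  apply Rmult_le_compat_r; [exact Hwz|].
  apply Rle_trans with (192 / (Cmod z * Cmod z) * (eps * (Cmod z * Cmod z) / 192)).
  - apply Rmult_le_compat_l; [left; apply Rdiv_lt_0_compat; nra|lra].
  - right. field. lra.
Qed.

Lemma Clog_scale (r : R) (z : C) : 0 < r -> z <> 0 -> Clog (RtoC r * z) = (RtoC (ln r) + Clog z)%C.
Proof.
  intros Hr Hz. pose proof (Cmod_neq0 z Hz) as Hm.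
  unfold Clog, Carg. rewrite Cmod_mult, Cmod_R, (Rabs_pos_eq r) by lra.
  rewrite ln_mult by assumption.
  destruct z as [x y]. unfold Cmult, Cplus, RtoC; cbn [fst snd].
  replace (r * x - 0 * y) with (r * x) by ring. replace (r * y + 0 * x) with (r * y) by ring.
  replace (r * x / (r * Cmod (x, y))) with (x / Cmod (x, y)) by (field; lra).
  f_equal. rewrite Rplus_0_l.
  destruct (Rle_dec 0 (r * y)) as [H1|H1], (Rle_dec 0 y) as [H2|H2]; try reflexivity; exfalso; nra.
Qed.

Lemma Cmod_Cpower (z : C) (a : R) : Cmod (Cpower z (RtoC a)) = Rpower (Cmod z) a.
Proof.
  unfold Cpower, Rpower. rewrite Cmod_Cexp. f_equal.
  unfold Clog, Cmult, RtoC; cbn [fst snd]. ring.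
Qed.

Lemma Cpower_neq_0 (z a : C) : Cpower z a <> 0.
Proof. apply Cexp_neq_0. Qed.

Lemma cderiv_Cpower (a z : C) : slit z ->
  cderiv (fun w => Cpower w a) z (a * Cpower z a / z)%C.
Proof.
  intros Hz. unfold Cpower. pose proof (slit_neq_0 z Hz). eapply cderiv_val.
  - apply (cderiv_comp Cexp (fun w => a * Clog w)%C).
    + apply cderiv_scal, cderiv_Clog, Hz.
    + apply cderiv_Cexp.
  - field. assumption.
Qed.

(** * Cauchy's formula and Taylor series *)

Lemma Cmod_sub_eq_0 (x y : C) : Cmod (x - y) = 0 -> x = y.
Proof.
  intros H. apply Cmod_eq_0 in H.
  replace x with ((x - y) + y)%C by ring. rewrite H. ring.
Qed.

(** The integrand takes the same values at the two heights, so the difference of the primitive has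
    zero derivative in the abscissa. This is how a full period of a contour is shifted sideways. *)
Lemma primitive_vertical_diff (D : C -> Prop) (P Phi : C -> C) (a b b' : R) :
  left_convex D -> (forall z, D z -> cderiv P z (Phi z)) -> D (a, b) -> D (a, b') ->
  (forall x, x <= a -> Phi (x, b') = Phi (x, b)) ->
  forall x, x <= a -> (P (x, b') - P (x, b) = P (a, b') - P (a, b))%C.
Proof.
  intros HC HP Hb Hb' Hper x Hx.
  pose proof (mean_value_const (fun t => P (t, b') + (- (1)) * P (t, b))%C
     (fun t => Phi (t, b') * 1 + (- (1)) * (Phi (t, b) * 1))%C 0 x a Hx) as H.
  cbv beta in H. rewrite Rmult_0_l in H.
  assert (E : (P (a, b') + (- (1)) * P (a, b) - (P (x, b') + (- (1)) * P (x, b)))%C = 0).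
  { apply Cmod_eq_0. apply Rle_antisym; [|apply Cmod_ge_0]. apply H.
    - intros t Ht. apply rderiv_plus; [|apply rderiv_scal].
      + apply (rderiv_comp P (fun t => (t, b'))); [apply rderiv_horizontal|].
        apply HP. apply (HC a); [exact Hb'|lra].
      + apply (rderiv_comp P (fun t => (t, b))); [apply rderiv_horizontal|].
        apply HP. apply (HC a); [exact Hb|lra].
    - intros t Ht. rewrite Hper by lra.
      replace (Phi (t, b) * 1 + (- (1)) * (Phi (t, b) * 1))%C with (RtoC 0) by ring.
      rewrite Cmod_0. lra. }
  transitivity (P (a, b') + (- (1)) * P (a, b) -
     (P (a, b') + (- (1)) * P (a, b) - (P (x, b') + (- (1)) * P (x, b))))%C; [ring|].
  rewrite E. ring.
Qed.

(** A residue theorem in the coordinate [z = e^w], where [Phi] already contains the factor [z] from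
    [dz = z dw] and [l] is the residue. The increment over a period does not depend on the abscissa
    and is evaluated far to the left, where [Phi] is close to [l]. *)
Lemma primitive_period (D : C -> Prop) (P Phi : C -> C) (a b : R) (l : C) :
  left_convex D -> (forall z, D z -> cderiv P z (Phi z)) -> D (a, b) -> D (a, b + 2 * PI) ->
  (forall x, x <= a -> Phi (x, b + 2 * PI) = Phi (x, b)) ->
  (forall eps, 0 < eps -> exists A, forall x y, x <= A -> D (x, y) /\ Cmod (Phi (x, y) - l) <= eps) ->
  (P (a, b + 2 * PI)%R - P (a, b) = RtoC (2 * PI) * Ci * l)%C.
Proof.
  intros HC HP Hb Hb' Hper Hlim. pose proof PI_RGT_0 as Hpi.
  assert (E : Cmod (P (a, b + 2 * PI)%R - P (a, b) - RtoC (2 * PI) * Ci * l) = 0).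
  { apply Rle_antisym; [|apply Cmod_ge_0]. apply le_epsilon. intros eps He. rewrite Rplus_0_l.
    destruct (Hlim (eps / (2 * PI))) as [A HA]; [apply Rdiv_lt_0_compat; lra|].
    set (x := Rmin A a).
    assert (HxA : x <= A) by apply Rmin_l. assert (Hxa : x <= a) by apply Rmin_r.
    rewrite <- (primitive_vertical_diff D P Phi a b (b + 2 * PI) HC HP Hb Hb' Hper x Hxa).
    pose proof (mean_value_const (fun t => P (x, t) + (- l) * (x, t))%C
      (fun t => Phi (x, t) * Ci + (- l) * Ci)%C (eps / (2 * PI)) b (b + 2 * PI) ltac:(lra)) as H.
    cbv beta in H.
    replace (eps / (2 * PI) * (b + 2 * PI - b)) with eps in H by (field; lra).
    replace (P (x, b + 2 * PI)%R - P (x, b) - RtoC (2 * PI) * Ci * l)%C with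
      (P (x, b + 2 * PI)%R + (- l) * (x, b + 2 * PI)%R - (P (x, b) + (- l) * (x, b)))%C.
    - apply H.
      + intros t _. apply rderiv_plus; [|apply rderiv_scal, rderiv_vertical].
        apply (rderiv_comp P (fun t => (x, t))); [apply rderiv_vertical|]. apply HP, HA, HxA.
      + intros t _. replace (Phi (x, t) * Ci + (- l) * Ci)%C with ((Phi (x, t) - l) * Ci)%C by ring.
        rewrite Cmod_mult, Cmod_Ci, Rmult_1_r. apply HA, HxA.
    - replace ((x, b + 2 * PI)%R : C) with ((x, b) + RtoC (2 * PI) * Ci)%C; [ring|].
      unfold Cplus, Cmult, RtoC, Ci; simpl. f_equal; ring. }
  now apply Cmod_sub_eq_0.
Qed.

(** The disc about 0, punctured at [z], in the logarithmic coordinate centred at [z]. *)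
Definition Cexp_disc (z : C) (rho : R) (w : C) : Prop := Cmod (z + Cexp w) < rho.

Lemma Cexp_disc_open (z : C) (rho : R) : copen (Cexp_disc z rho).
Proof.
  intros w Hw. unfold Cexp_disc in *.
  destruct (cderiv_ccont _ _ _ (cderiv_Cexp w) (rho - Cmod (z + Cexp w))) as [d [Hd H]]; [lra|].
  exists d. split; [exact Hd|]. intros w' Hw'. specialize (H w' Hw').
  replace (z + Cexp w')%C with ((z + Cexp w) + (Cexp w' - Cexp w))%C by ring.
  eapply Rle_lt_trans; [apply Cmod_triangle|]. lra.
Qed.

Lemma Cexp_split (x y : R) : Cexp (x, y) = (RtoC (exp x) * Cexp (0%R, y))%C.
Proof.
  rewrite <- Cexp_R, <- Cexp_plus. f_equal. unfold Cplus, RtoC; simpl. f_equal; ring.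
Qed.

(** Moving left moves [z + Cexp w] along a segment towards [z], and the disc is convex. *)
Lemma Cexp_disc_left_convex (z : C) (rho : R) : Cmod z < rho -> left_convex (Cexp_disc z rho).
Proof.
  intros Hz x y x' H Hx. unfold Cexp_disc in *.
  set (t := exp (x' - x)).
  assert (Ht : 0 < t <= 1).
  { split; [apply exp_pos|]. rewrite <- exp_0. apply exp_le_compat. lra. }
  replace (z + Cexp (x', y))%C with (RtoC (1 - t) * z + RtoC t * (z + Cexp (x, y)))%C.
  2:{ rewrite (Cexp_split x'), (Cexp_split x).
      replace (exp x') with (t * exp x) by (unfold t; rewrite <- exp_plus; f_equal; ring).
      rewrite RtoC_minus, RtoC_mult. ring. }
  eapply Rle_lt_trans; [apply Cmod_triangle|].
  rewrite !Cmod_mult, !Cmod_R, !Rabs_pos_eq by lra. nra.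
Qed.

Lemma Cexp_disc_low (z : C) (rho r : R) (x y : R) : 0 < r -> Cmod z + r <= rho ->
  x < ln r -> Cexp_disc z rho (x, y) /\ Cmod (Cexp (x, y)) < r.
Proof.
  intros Hr Hz Hx. unfold Cexp_disc.
  assert (H : Cmod (Cexp (x, y)) < r).
  { rewrite Cmod_Cexp. cbn [fst]. rewrite <- (exp_ln r Hr). now apply exp_increasing. }
  split; [|exact H]. eapply Rle_lt_trans; [apply Cmod_triangle|]. lra.
Qed.

Lemma Cexp_disc_line (z : C) (rho : R) : Cmod z < rho ->
  contains_line (Cexp_disc z rho) (ln (rho - Cmod z) - 1).
Proof.
  intros Hz x y y' _ _. apply (Cexp_disc_low z rho (rho - Cmod z)); lra.
Qed.

Lemma holo_Cexp_comp (F : C -> C) (z : C) (rho : R) :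
  (forall w, Cmod w < rho -> exists l, cderiv F w l) ->
  holo (Cexp_disc z rho) (fun w => F (z + Cexp w)%C).
Proof.
  intros HF w Hw. destruct (HF _ Hw) as [l Hl]. exists (l * Cexp w)%C.
  apply (cderiv_comp F (fun w => z + Cexp w)%C); [|exact Hl].
  eapply cderiv_val; [apply cderiv_plus; [apply cderiv_const|apply cderiv_Cexp]|]. ring.
Qed.

Lemma rcont_mult (f g : R -> C) (t : R) : rcont f t -> rcont g t -> rcont (fun s => f s * g s)%C t.
Proof.
  intros Hf Hg eps He.
  pose proof (Cmod_ge_0 (f t)) as Hf0. pose proof (Cmod_ge_0 (g t)) as Hg0.
  set (e := Rmin 1 (eps / (3 + Cmod (f t) + Cmod (g t)))).
  assert (He0 : 0 < e) by (apply Rmin_glb_lt; [lra|apply Rdiv_lt_0_compat; lra]).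
  assert (He1 : e <= 1) by apply Rmin_l.
  assert (He2 : e * (3 + Cmod (f t) + Cmod (g t)) <= eps).
  { apply Rle_trans with (eps / (3 + Cmod (f t) + Cmod (g t)) * (3 + Cmod (f t) + Cmod (g t))).
    - apply Rmult_le_compat_r; [lra|apply Rmin_r].
    - right. field. lra. }
  destruct (Hf e He0) as [d1 [Hd1 H1]]. destruct (Hg e He0) as [d2 [Hd2 H2]].
  exists (Rmin d1 d2). split; [apply Rmin_glb_lt; assumption|]. intros s Hs.
  specialize (H1 s (Rlt_le_trans _ _ _ Hs (Rmin_l _ _))).
  specialize (H2 s (Rlt_le_trans _ _ _ Hs (Rmin_r _ _))).
  replace (f s * g s - f t * g t)%C with
    ((f s - f t) * (g s - g t) + ((f s - f t) * g t + f t * (g s - g t)))%C by ring.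
  eapply Rle_lt_trans; [apply Cmod_triangle|].
  eapply Rle_lt_trans; [apply Rplus_le_compat_l, Cmod_triangle|].
  rewrite !Cmod_mult.
  pose proof (Cmod_ge_0 (f s - f t)). pose proof (Cmod_ge_0 (g s - g t)).
  assert (Cmod (f s - f t) * Cmod (g s - g t) <= e * 1) by (apply Rmult_le_compat; lra).
  nra.
Qed.

Lemma rcont_plus (f g : R -> C) (t : R) : rcont f t -> rcont g t -> rcont (fun s => f s + g s)%C t.
Proof.
  intros Hf Hg eps He.
  destruct (Hf (eps / 2)) as [d1 [Hd1 H1]]; [lra|]. destruct (Hg (eps / 2)) as [d2 [Hd2 H2]]; [lra|].
  exists (Rmin d1 d2). split; [apply Rmin_glb_lt; assumption|]. intros s Hs.
  specialize (H1 s (Rlt_le_trans _ _ _ Hs (Rmin_l _ _))).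
  specialize (H2 s (Rlt_le_trans _ _ _ Hs (Rmin_r _ _))).
  replace (f s + g s - (f t + g t))%C with ((f s - f t) + (g s - g t))%C by ring.
  eapply Rle_lt_trans; [apply Cmod_triangle|]. lra.
Qed.

Lemma rcont_Cmod (f : R -> C) (t : R) : rcont f t -> continuity_pt (fun s => Cmod (f s)) t.
Proof.
  intros H eps He. destruct (H eps He) as [d [Hd H1]]. exists d. split; [exact Hd|].
  intros s [_ Hs]. simpl. unfold Rdist in *.
  eapply Rle_lt_trans; [|apply (H1 s Hs)].
  apply Rabs_le. pose proof (Cmod_triangle_sub (f s) (f t)).
  pose proof (Cmod_triangle_sub (f t) (f s)). rewrite (Cmod_minus_sym (f t)) in *. lra.
Qed.

Lemma rcont_bounded (f : R -> C) (a b : R) : a <= b ->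
  (forall t, a <= t <= b -> rcont f t) -> exists M, 0 <= M /\ forall t, a <= t <= b -> Cmod (f t) <= M.
Proof.
  intros Hab Hf.
  destruct (continuity_ab_maj (fun s => Cmod (f s)) a b Hab) as [m [Hm _]].
  - intros t Ht. apply rcont_Cmod, Hf, Ht.
  - exists (Cmod (f m)). split; [apply Cmod_ge_0|exact Hm].
Qed.

Lemma rcont_Cexp_vertical (x t : R) : rcont (fun y => Cexp (x, y)) t.
Proof.
  apply (rcont_comp Cexp (fun y => (x, y))).
  - eapply rderiv_rcont, rderiv_vertical.
  - eapply cderiv_ccont, cderiv_Cexp.
Qed.

(** The path is a smooth logarithm of [Cexp (x, y) - z]: factoring out [Cexp (x, y)] leaves
    [1 - z Cexp (- (x, y))], which stays in the right half-plane. *)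
Lemma cauchy_kernel_deriv (x : R) (z : C) (t : R) : Cmod z < exp x ->
  rderiv (fun y => (x, y) + Clog (1 - z * Cexp (- (x, y))))%C t
    (Ci / (1 - z * Cexp (- (x, t))))%C.
Proof.
  intros Hz.
  set (q := (z * Cexp (- (x, t)))%C).
  assert (Hq : Cmod q < 1).
  { unfold q. rewrite Cmod_mult, Cmod_Cexp. cbn [fst Copp].
    rewrite exp_Ropp. pose proof (exp_pos x). apply Rlt_div_l; lra. }
  assert (Hsl : slit (1 - q)).
  { left. pose proof (Re_le_Cmod q) as H. apply Rabs_le_between in H.
    change (0 < 1 + - fst q). lra. }
  pose proof (slit_neq_0 _ Hsl) as Hn.
  eapply rderiv_val.
  - apply (rderiv_comp (fun w => w + Clog (1 - z * Cexp (- w)))%C (fun y => (x, y))); [apply rderiv_vertical|].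
    apply cderiv_plus; [apply cderiv_id|].
    apply (cderiv_comp Clog (fun w => 1 - z * Cexp (- w))%C).
    + apply cderiv_minus; [apply cderiv_const|]. apply cderiv_scal.
      apply (cderiv_comp Cexp Copp); [apply cderiv_opp, cderiv_id|apply cderiv_Cexp].
    + apply cderiv_Clog. exact Hsl.
  - fold q. replace (z * (Cexp (- (x, t)) * - (1)))%C with (- q)%C by (unfold q; ring).
    field. exact Hn.
Qed.

(** The circle about 0 is lifted by [om] to the logarithmic coordinate centred at [z]. The
    logarithmic correction is periodic, so the lift rises by exactly [2 PI] and [primitive_period]
    evaluates the increment. *)
Theorem cauchy_formula (F : C -> C) (rho x : R) (z : C) :
  (forall w, Cmod w < rho -> exists l, cderiv F w l) -> Cmod z < exp x < rho ->
  (CInt (fun y => F (Cexp (x, y)) * / (1 - z * Cexp (- (x, y))))%C (- PI) PI = RtoC (2 * PI) * F z)%C.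
Proof.
  intros HF [Hz Hx]. pose proof PI_RGT_0 as Hpi.
  assert (Hzr : Cmod z < rho) by lra.
  pose proof (Cexp_disc_left_convex z rho Hzr) as HC.
  destruct (primitive_left_convex (Cexp_disc z rho) (fun w => F (z + Cexp w)%C) _
    (Cexp_disc_open z rho) HC (Cexp_disc_line z rho Hzr) (holo_Cexp_comp F z rho HF)) as [P HP].
  set (om := fun y : R => ((x, y) + Clog (1 - z * Cexp (- (x, y))))%C).
  assert (Hne : forall y, (1 - z * Cexp (- (x, y)))%C <> 0).
  { intros y E. assert (H1 : Cmod (z * Cexp (- (x, y))) = 1).
    { replace (z * Cexp (- (x, y)))%C with (1 - (1 - z * Cexp (- (x, y))))%C by ring.
      rewrite E. replace (1 - 0)%C with (RtoC 1) by ring. apply Cmod_1. }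
    rewrite Cmod_mult, Cmod_Cexp in H1. cbn [fst Copp] in H1. rewrite exp_Ropp in H1.
    pose proof (exp_pos x). apply (f_equal (fun r => r * exp x)) in H1.
    rewrite Rmult_assoc, Rinv_l in H1; lra. }
  assert (Hexp : forall y, (z + Cexp (om y))%C = Cexp (x, y)).
  { intro y. unfold om. rewrite Cexp_plus, Cexp_Clog by apply Hne.
    rewrite Cexp_opp. field. apply Cexp_neq_0. }
  assert (HD : forall y, Cexp_disc z rho (om y)).
  { intro y. unfold Cexp_disc. rewrite Hexp, Cmod_Cexp. exact Hx. }
  assert (Hom : om PI = (fst (om (- PI)%R), snd (om (- PI)%R) + 2 * PI)).
  { unfold om. replace (Cexp (- (x, PI))) with (Cexp (- (x, (- PI)%R))).
    - generalize (Clog (1 - z * Cexp (- (x, (- PI)%R)))). intro c.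
      unfold Cplus; cbn [fst snd]. f_equal; ring.
    - rewrite !Cexp_opp. f_equal. replace PI with (- PI + 2 * PI) at 2 by ring.
      symmetry. apply Cexp_periodic. }
  assert (Hend : (P (om PI) - P (om (- PI)%R) = RtoC (2 * PI) * Ci * F z)%C).
  { rewrite Hom. replace (om (- PI)%R) with ((fst (om (- PI)%R), snd (om (- PI)%R)) : C) at 3
      by (symmetry; apply surjective_pairing).
    apply (primitive_period (Cexp_disc z rho) P (fun w => F (z + Cexp w)%C)); [exact HC|exact HP| | | |].
    - rewrite <- surjective_pairing. apply HD.
    - rewrite <- Hom. apply HD.
    - intros u _. now rewrite Cexp_periodic.
    - intros eps He. destruct (HF z Hzr) as [l Hl].
      destruct (cderiv_ccont _ _ _ Hl eps He) as [d [Hd H]].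
      assert (Hr : 0 < Rmin d (rho - Cmod z)) by (apply Rmin_glb_lt; lra).
      exists (ln (Rmin d (rho - Cmod z)) - 1). intros u v Hu.
      destruct (Cexp_disc_low z rho (Rmin d (rho - Cmod z)) u v Hr) as [H1 H2].
      + pose proof (Rmin_r d (rho - Cmod z)). lra.
      + lra.
      + split; [exact H1|]. left. apply H.
        replace (z + Cexp (u, v) - z)%C with (Cexp (u, v)) by ring.
        eapply Rlt_le_trans; [exact H2|apply Rmin_l]. }
  rewrite <- (CInt_deriv (fun y => P (om y)) (fun y => Ci * (F (Cexp (x, y)) * / (1 - z * Cexp (- (x, y)))))%C) in Hend.
  - rewrite CInt_scal in Hend.
    + assert (HCi : Ci <> 0) by (intro E; apply (f_equal snd) in E; simpl in E; lra).
      transitivity (/ Ci * (Ci * CInt (fun y => F (Cexp (x, y)) * / (1 - z * Cexp (- (x, y))))%C (- PI) PI))%C.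
      * field. exact HCi.
      * rewrite Hend. field. exact HCi.
    + apply ex_CInt_rcont. intros t _. apply rcont_mult.
      * apply (rcont_comp F (fun y => Cexp (x, y))); [apply rcont_Cexp_vertical|].
        destruct (HF (Cexp (x, t))) as [l Hl]; [rewrite Cmod_Cexp; exact Hx|]. eapply cderiv_ccont, Hl.
      * apply (rcont_comp (fun w => / (1 - z * Cexp (- w)))%C (fun y => (x, y))).
        -- eapply rderiv_rcont, rderiv_vertical.
        -- eapply cderiv_ccont. apply (cderiv_comp Cinv (fun w => 1 - z * Cexp (- w))%C).
           ++ apply cderiv_minus; [apply cderiv_const|]. apply cderiv_scal.
              apply (cderiv_comp Cexp Copp); [apply cderiv_opp, cderiv_id|apply cderiv_Cexp].
           ++ apply cderiv_inv, Hne.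
  - intros t _. eapply rderiv_val.
    + apply (rderiv_comp P om); [apply cauchy_kernel_deriv, Hz|apply HP, HD].
    + cbv beta. rewrite Hexp. field. apply Hne.
  - intros t _. apply rcont_mult; [apply rcont_const|]. apply rcont_mult.
      * apply (rcont_comp F (fun y => Cexp (x, y))); [apply rcont_Cexp_vertical|].
        destruct (HF (Cexp (x, t))) as [l Hl]; [rewrite Cmod_Cexp; exact Hx|]. eapply cderiv_ccont, Hl.
      * apply (rcont_comp (fun w => / (1 - z * Cexp (- w)))%C (fun y => (x, y))).
        -- eapply rderiv_rcont, rderiv_vertical.
        -- eapply cderiv_ccont. apply (cderiv_comp Cinv (fun w => 1 - z * Cexp (- w))%C).
           ++ apply cderiv_minus; [apply cderiv_const|]. apply cderiv_scal.
              apply (cderiv_comp Cexp Copp); [apply cderiv_opp, cderiv_id|apply cderiv_Cexp].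
           ++ apply cderiv_inv, Hne.
Qed.

(** * Complex power series *)

Fixpoint csum (f : nat -> C) (n : nat) : C :=
  match n with O => 0 | S n => (csum f n + f n)%C end.

Lemma csum_ext (f g : nat -> C) (n : nat) :
  (forall k, (k < n)%nat -> f k = g k) -> csum f n = csum g n.
Proof.
  induction n as [|n IH]; intro H; simpl; [reflexivity|].
  rewrite IH by (intros; apply H; lia). rewrite H by lia. reflexivity.
Qed.

Lemma csum_scal (c : C) (f : nat -> C) (n : nat) :
  csum (fun k => c * f k)%C n = (c * csum f n)%C.
Proof. induction n as [|n IH]; simpl; [ring|]. rewrite IH. ring. Qed.

Lemma sum_n_csum (f : nat -> C) (n : nat) :
  @sum_n C_NormedModule f n = csum f (S n).
Proof.
  induction n as [|n IH].
  - rewrite sum_O. simpl. symmetry. apply Cplus_0_l.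
  - rewrite sum_Sn, IH. reflexivity.
Qed.

Lemma pow_n_Cpow (z : C) (n : nat) : @pow_n C_AbsRing z n = (z ^ n)%C.
Proof. induction n as [|n IH]; [reflexivity|]. simpl. now rewrite IH. Qed.

Definition cseries_eps (c : nat -> C) (z l : C) : Prop :=
  forall eps, 0 < eps -> exists n0, forall n, (n0 <= n)%nat ->
    Cmod (csum (fun k => c k * z ^ k)%C n - l) < eps.

Lemma pseries_term (c : nat -> C) (z : C) (n : nat) :
  @sum_n C_NormedModule (fun k => scal (pow_n z k) (c k)) n = csum (fun k => c k * z ^ k)%C (S n).
Proof.
  rewrite sum_n_csum. apply csum_ext. intros k _.
  change (@scal C_AbsRing C_NormedModule (pow_n z k) (c k)) with (@pow_n C_AbsRing z k * c k)%C.
  rewrite pow_n_Cpow. apply Cmult_comm.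
Qed.

Lemma is_pseries_cseries (c : nat -> C) (z l : C) :
  @is_pseries C_AbsRing C_NormedModule c z l -> cseries_eps c z l.
Proof.
  intros H eps He.
  (* Balls of [C] are those of the product structure; [sqrt 2] is the factor between them and
     [Cmod]. *)
  assert (Hs : 0 < sqrt 2) by (apply sqrt_lt_R0; lra).
  assert (He' : 0 < eps / sqrt 2) by (apply Rdiv_lt_0_compat; lra).
  unfold is_pseries, is_series in H.
  destruct (proj1 (filterlim_locally _ _) H (mkposreal _ He')) as [n0 Hn].
  exists (S n0). intros n Hn0. destruct n as [|n]; [lia|].
  specialize (Hn n ltac:(lia)). apply C_NormedModule_mixin_compat2 in Hn.
  rewrite pseries_term in Hn. simpl pos in Hn.
  replace (sqrt 2 * (eps / sqrt 2)) with eps in Hn by (field; lra). exact Hn.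
Qed.

Lemma cseries_is_pseries (c : nat -> C) (z l : C) :
  cseries_eps c z l -> @is_pseries C_AbsRing C_NormedModule c z l.
Proof.
  intros H. unfold is_pseries, is_series. apply filterlim_locally. intros eps.
  destruct (H eps (cond_pos eps)) as [n0 Hn]. exists n0. intros n Hn0.
  apply C_NormedModule_mixin_compat1. rewrite pseries_term. apply Hn. lia.
Qed.

(** Convergence at [r / 2] bounds the terms there: late ones are differences of two partial sums
    within 1 of the limit. Inside radius [r / 4] this gives a geometric majorant of ratio at most
    1/2, whence the factor 2. *)
Lemma cseries_remainder (c : nat -> C) (F : C -> C) (r : R) (n : nat) : 0 < r ->
  (forall z, Cmod z < r -> cseries_eps c z (F z)) ->
  exists K r1, 0 < r1 <= r /\ 0 <= K /\ forall z, Cmod z < r1 ->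
    Cmod (F z - csum (fun k => c k * z ^ k)%C n) <= K * Cmod z ^ n.
Proof.
  intros Hr HF.
  assert (Hz0 : Cmod (RtoC (r / 2)) < r) by (rewrite Cmod_R, Rabs_pos_eq; lra).
  destruct (HF _ Hz0 1 Rlt_0_1) as [n0 Hn0].
  assert (HM : exists M, 0 <= M /\ forall k, Cmod (c k * RtoC (r / 2) ^ k) <= M).
  { assert (Hfin : forall m, exists M, 0 <= M /\ forall k, (k < m)%nat -> Cmod (c k * RtoC (r / 2) ^ k) <= M).
    { induction m as [|m [M [HM1 HM2]]].
      - exists 0. split; [lra|]. intros; lia.
      - exists (Rmax M (Cmod (c m * RtoC (r / 2) ^ m))). split.
        + eapply Rle_trans; [exact HM1|apply Rmax_l].
        + intros k Hk. destruct (Nat.eq_dec k m) as [->|Hne]; [apply Rmax_r|].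
          eapply Rle_trans; [apply HM2; lia|apply Rmax_l]. }
    destruct (Hfin n0) as [M [HM1 HM2]]. exists (M + 2). split; [lra|].
    intros k. destruct (Nat.lt_ge_cases k n0) as [L|L].
    - specialize (HM2 k L). lra.
    - pose proof (Hn0 k L) as A1. pose proof (Hn0 (S k) ltac:(lia)) as A2.
      set (s := csum (fun k => c k * RtoC (r / 2) ^ k)%C) in *.
      assert (Es : s (S k) = (s k + c k * RtoC (r / 2) ^ k)%C) by reflexivity.
      replace (c k * RtoC (r / 2) ^ k)%C with ((s (S k) - F (RtoC (r / 2))) - (s k - F (RtoC (r / 2))))%C
        by (rewrite Es; ring).
      eapply Rle_trans; [apply Cmod_minus_le|]. lra. }
  destruct HM as [M [HM1 HM2]].
  exists (2 * M * (/ (r / 2)) ^ n), (r / 4). split; [lra|]. split.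
  { apply Rmult_le_pos; [lra|]. apply pow_le. left. apply Rinv_0_lt_compat. lra. }
  intros z Hz. set (q := Cmod z * / (r / 2)).
  assert (Hq : 0 <= q <= / 2).
  { unfold q. split.
    - apply Rmult_le_pos; [apply Cmod_ge_0|left; apply Rinv_0_lt_compat; lra].
    - apply Rmult_le_reg_r with (r / 2); [lra|]. rewrite Rmult_assoc, Rinv_l by lra. lra. }
  assert (Hterm : forall k, Cmod (c k * z ^ k) <= M * q ^ k).
  { intro k. rewrite Cmod_mult, Cmod_pow. unfold q. rewrite Rpow_mult_distr.
    replace (M * (Cmod z ^ k * (/ (r / 2)) ^ k)) with (M * (/ (r / 2)) ^ k * Cmod z ^ k) by ring.
    apply Rmult_le_compat_r; [apply pow_le, Cmod_ge_0|].
    specialize (HM2 k). rewrite Cmod_mult, Cmod_pow, Cmod_R, Rabs_pos_eq in HM2 by lra.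
    assert (Hp : 0 < (r / 2) ^ k) by (apply pow_lt; lra).
    rewrite pow_inv. apply Rle_div_r; [exact Hp|exact HM2]. }
  set (s := csum (fun k => c k * z ^ k)%C) in *.
  assert (Hpart : forall j, Cmod (s (n + j)%nat - s n) <= M * q ^ n * (2 * (1 - (/ 2) ^ j))).
  { induction j as [|j IH].
    - rewrite Nat.add_0_r. replace (s n - s n)%C with (RtoC 0) by ring. rewrite Cmod_0. simpl. lra.
    - rewrite Nat.add_succ_r.
      assert (Es : s (S (n + j)) = (s (n + j)%nat + c (n + j)%nat * z ^ (n + j))%C) by reflexivity.
      rewrite Es.
      replace (s (n + j)%nat + c (n + j)%nat * z ^ (n + j) - s n)%C
        with ((s (n + j)%nat - s n) + c (n + j)%nat * z ^ (n + j))%C by ring.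
      eapply Rle_trans; [apply Cmod_triangle|].
      eapply Rle_trans; [apply Rplus_le_compat; [exact IH|apply Hterm]|].
      assert (Hqj : q ^ j <= (/ 2) ^ j) by (apply pow_incr; exact Hq).
      assert (Hqn : 0 <= M * q ^ n) by (apply Rmult_le_pos; [exact HM1|apply pow_le; lra]).
      rewrite pow_add. simpl pow. nra. }
  replace (2 * M * (/ (r / 2)) ^ n * Cmod z ^ n) with (2 * (M * q ^ n))
    by (unfold q; rewrite Rpow_mult_distr; ring).
  assert (Hqn : 0 <= M * q ^ n) by (apply Rmult_le_pos; [exact HM1|apply pow_le; lra]).
  apply le_epsilon. intros eps He.
  destruct (HF z ltac:(lra) eps He) as [n1 Hn1].
  specialize (Hn1 (n + n1)%nat ltac:(lia)). fold s in Hn1. specialize (Hpart n1).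
  replace (F z - s n)%C with ((s (n + n1)%nat - s n) - (s (n + n1)%nat - F z))%C by ring.
  eapply Rle_trans; [apply Cmod_minus_le|].
  assert (0 <= (/ 2) ^ n1) by (apply pow_le; lra). nra.
Qed.

(** * Coefficients as integrals over circles *)

Definition mcoef_int (F : C -> C) (n : nat) (w : C) : C := (F (Cexp w) * Cexp (- (RtoC (INR n) * w)))%C.

(* Cauchy's integral for [[z^n] F(z)] over the circle of radius [e^x], in the coordinate [z = e^w]. *)
Definition mcoef (F : C -> C) (n : nat) (x : R) : C :=
  (/ RtoC (2 * PI) * CInt (fun y => mcoef_int F n (x, y)) (- PI) PI)%C.

Definition half_plane (rho : R) (w : C) : Prop := exp (fst w) < rho.

Definition holo_disc (F : C -> C) (rho : R) : Prop :=
  forall w, Cmod w < rho -> exists l, cderiv F w l.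

Lemma RtoC_2PI_neq_0 : RtoC (2 * PI) <> 0.
Proof. intro E. apply RtoC_inj in E. pose proof PI_RGT_0. lra. Qed.

Lemma Ci_neq_0 : Ci <> 0.
Proof. intro E. apply (f_equal snd) in E. simpl in E. lra. Qed.

Lemma cderiv_Cexp_lin (a : C) (w : C) : cderiv (fun w => Cexp (- (a * w))) w (- a * Cexp (- (a * w)))%C.
Proof.
  eapply cderiv_val.
  - apply (cderiv_comp Cexp (fun w => - (a * w))%C).
    + apply cderiv_opp, cderiv_scal, cderiv_id.
    + apply cderiv_Cexp.
  - ring.
Qed.

Lemma cderiv_mcoef_int (F : C -> C) (n : nat) (w l : C) : cderiv F (Cexp w) l ->
  exists m, cderiv (mcoef_int F n) w m.
Proof.
  intro H. eexists. apply cderiv_mult.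
  - apply (cderiv_comp F Cexp); [apply cderiv_Cexp|exact H].
  - apply cderiv_Cexp_lin.
Qed.

Lemma mcoef_int_period (F : C -> C) (n : nat) (x y : R) :
  mcoef_int F n (x, y + 2 * PI) = mcoef_int F n (x, y).
Proof.
  unfold mcoef_int. rewrite Cexp_periodic. f_equal.
  rewrite !Cexp_opp, !Cexp_INR_mult. now rewrite Cexp_periodic.
Qed.

Lemma mcoef_int_cont (F : C -> C) (n : nat) (x : R) (rho : R) : holo_disc F rho -> exp x < rho ->
  forall t, rcont (fun y => mcoef_int F n (x, y)) t.
Proof.
  intros HF Hx t. apply (rcont_comp (mcoef_int F n) (fun y => (x, y))).
  - eapply rderiv_rcont, rderiv_vertical.
  - destruct (HF (Cexp (x, t))) as [l Hl]; [rewrite Cmod_Cexp; exact Hx|].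
    destruct (cderiv_mcoef_int F n (x, t) l Hl) as [m Hm]. eapply cderiv_ccont, Hm.
Qed.

Lemma mcoef_primitive (F P : C -> C) (n : nat) (x rho : R) : holo_disc F rho -> exp x < rho ->
  (forall y, - PI <= y <= PI -> cderiv P (x, y) (mcoef_int F n (x, y))) ->
  (P (x, PI) - P (x, (- PI)%R) = RtoC (2 * PI) * Ci * mcoef F n x)%C.
Proof.
  intros HF Hx HP. pose proof PI_RGT_0.
  pose proof RtoC_2PI_neq_0 as H2.
  rewrite <- (CInt_deriv (fun y => P (x, y)) (fun y => Ci * mcoef_int F n (x, y))%C).
  - rewrite CInt_scal.
    + unfold mcoef. field. exact H2.
    + apply ex_CInt_rcont. intros; eapply mcoef_int_cont; eassumption.
  - intros t Ht. rewrite Rmin_left, Rmax_right in Ht by lra. eapply rderiv_val.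
    + apply (rderiv_comp P (fun y => (x, y))); [apply rderiv_vertical|apply HP, Ht].
    + ring.
  - intros t _. apply rcont_mult; [apply rcont_const|eapply mcoef_int_cont; eassumption].
Qed.

Lemma half_plane_primitive (rho : R) (Phi : C -> C) : 0 < rho -> holo (half_plane rho) Phi ->
  exists P, forall w, half_plane rho w -> cderiv P w (Phi w).
Proof.
  intros Hr HF. apply (primitive_left_convex (half_plane rho) Phi (ln rho - 1)).
  - intros w Hw. unfold half_plane in *. exists (ln rho - fst w). split.
    + rewrite <- (exp_ln rho Hr) in Hw. apply exp_lt_inv in Hw. lra.
    + intros w' Hw'. rewrite <- (exp_ln rho Hr). apply exp_increasing.
      pose proof (Re_le_Cmod (w' - w)) as H. change (fst (w' - w)%C) with (fst w' - fst w) in H.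
      apply Rabs_le_between in H. lra.
  - intros x y x' H Hx. unfold half_plane in *. cbn [fst] in *.
    eapply Rle_lt_trans; [apply exp_le_compat, Hx|exact H].
  - intros x y y' _ _. unfold half_plane; cbn [fst]. rewrite <- (exp_ln rho Hr) at 2.
    apply exp_increasing. lra.
  - exact HF.
Qed.

Lemma half_plane_left_convex (rho : R) : left_convex (half_plane rho).
Proof.
  intros x y x' H Hx. unfold half_plane in *. cbn [fst] in *.
  eapply Rle_lt_trans; [apply exp_le_compat, Hx|exact H].
Qed.

Lemma holo_mcoef_int (F : C -> C) (n : nat) (rho : R) : holo_disc F rho ->
  holo (half_plane rho) (mcoef_int F n).
Proof.
  intros HF w Hw. destruct (HF (Cexp w)) as [l Hl]; [rewrite Cmod_Cexp; exact Hw|].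
  eapply cderiv_mcoef_int, Hl.
Qed.

Lemma mcoef_indep (F : C -> C) (n : nat) (rho x x' : R) : holo_disc F rho ->
  exp x < rho -> exp x' < rho -> mcoef F n x = mcoef F n x'.
Proof.
  intros HF.
  assert (W : forall x x', x <= x' -> exp x' < rho -> mcoef F n x = mcoef F n x').
  { clear x x'. intros x x' Hle Hx'.
    assert (Hx : exp x < rho) by (eapply Rle_lt_trans; [apply exp_le_compat, Hle|exact Hx']).
    assert (Hr : 0 < rho) by (pose proof (exp_pos x); lra).
    destruct (half_plane_primitive rho _ Hr (holo_mcoef_int F n rho HF)) as [P HP].
    assert (E1 := mcoef_primitive F P n x rho HF Hx (fun y _ => HP (x, y) Hx)).
    assert (E2 := mcoef_primitive F P n x' rho HF Hx' (fun y _ => HP (x', y) Hx')).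
    rewrite (primitive_vertical_diff (half_plane rho) P (mcoef_int F n) x' (- PI) PI) in E1.
    - rewrite E2 in E1. pose proof RtoC_2PI_neq_0 as N1. pose proof Ci_neq_0 as N2.
      assert (N3 : (RtoC (2 * PI) * Ci)%C <> 0) by (now apply Cmult_neq_0).
      transitivity (/ (RtoC (2 * PI) * Ci) * (RtoC (2 * PI) * Ci * mcoef F n x))%C; [field; split; assumption|].
      rewrite <- E1. field. split; assumption.
    - apply half_plane_left_convex.
    - exact HP.
    - exact Hx'.
    - exact Hx'.
    - intros t _. replace PI with (- PI + 2 * PI) at 1 by ring. apply mcoef_int_period.
    - exact Hle. }
  intros Hx Hx'. destruct (Rle_dec x x') as [H|H]; [now apply W|symmetry; apply W; [lra|exact Hx]].
Qed.

(** Expanding the Cauchy kernel geometrically leaves, after [n] terms, exactly the integral of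
    [g n]; there the kernel carries [k^n] with [|k| = q < 1]. *)
Theorem taylor_series (F : C -> C) (rho x : R) (z : C) : holo_disc F rho ->
  Cmod z < exp x < rho -> cseries_eps (fun n => mcoef F n x) z (F z).
Proof.
  intros HF [Hz Hx] eps He. pose proof PI_RGT_0 as Hpi. pose proof (exp_pos x) as Hep.
  set (q := Cmod z / exp x).
  assert (Hq : 0 <= q < 1).
  { unfold q. split; [apply Rdiv_le_0_compat; [apply Cmod_ge_0|exact Hep]|apply Rlt_div_l; lra]. }
  destruct (rcont_bounded (fun y => F (Cexp (x, y))) (- PI) PI) as [M [HM0 HM]]; [lra| |].
  { intros t _. apply (rcont_comp F (fun y => Cexp (x, y))); [apply rcont_Cexp_vertical|].
    destruct (HF (Cexp (x, t))) as [l Hl]; [rewrite Cmod_Cexp; exact Hx|]. eapply cderiv_ccont, Hl. }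
  set (k := fun y : R => (z * Cexp (- (x, y)))%C).
  assert (Hk : forall y, Cmod (k y) = q).
  { intro y. unfold k. rewrite Cmod_mult, Cmod_Cexp. cbn [fst Copp]. rewrite exp_Ropp. reflexivity. }
  assert (Hk1 : forall y, 1 - q <= Cmod (1 - k y)).
  { intro y. pose proof (Cmod_triangle_sub 1 (k y)) as H. rewrite Cmod_1, Hk in H. exact H. }
  assert (Hne : forall y, (1 - k y)%C <> 0).
  { intros y E. specialize (Hk1 y). rewrite E, Cmod_0 in Hk1. lra. }
  assert (HFc : forall t, rcont (fun y => F (Cexp (x, y))) t).
  { intros t. apply (rcont_comp F (fun y => Cexp (x, y))); [apply rcont_Cexp_vertical|].
    destruct (HF (Cexp (x, t))) as [l Hl]; [rewrite Cmod_Cexp; exact Hx|]. eapply cderiv_ccont, Hl. }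
  assert (Hkd : forall w, cderiv (fun w => z * Cexp (- w))%C w (- (z * Cexp (- w)))%C).
  { intro w. eapply cderiv_val.
    - apply cderiv_scal. apply (cderiv_comp Cexp Copp); [apply cderiv_opp, cderiv_id|apply cderiv_Cexp].
    - ring. }
  assert (Hkc : forall t, rcont k t).
  { intros t. apply (rcont_comp (fun w => z * Cexp (- w))%C (fun y => (x, y))).
    - eapply rderiv_rcont, rderiv_vertical.
    - eapply cderiv_ccont, Hkd. }
  assert (Hic : forall t, rcont (fun y => / (1 - k y))%C t).
  { intro t. apply (rcont_comp (fun u => / (1 - u))%C k); [apply Hkc|].
    eapply cderiv_ccont. apply (cderiv_comp Cinv (fun u => 1 - u)%C).
    - apply cderiv_minus; [apply cderiv_const|apply cderiv_id].
    - apply cderiv_inv, Hne. }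
  assert (Hpc : forall n t, rcont (fun y => k y ^ n)%C t).
  { induction n as [|n IH]; intro t; [apply (rcont_const 1)|].
    apply (rcont_mult k (fun y => k y ^ n)%C); [apply Hkc|apply IH]. }
  set (g := fun (n : nat) (y : R) => (F (Cexp (x, y)) * (k y ^ n * / (1 - k y)))%C).
  assert (Hgc : forall n t, rcont (g n) t).
  { intros n t. apply rcont_mult; [apply HFc|]. apply rcont_mult; [apply Hpc|apply Hic]. }
  assert (Hrec : forall n, (RtoC (2 * PI) * csum (fun j => mcoef F j x * z ^ j)%C n
      = RtoC (2 * PI) * F z - CInt (g n) (- PI) PI)%C).
  { induction n as [|n IH].
    - simpl csum. rewrite <- (cauchy_formula F rho x z HF (conj Hz Hx)).
      rewrite (CInt_ext (g O) (fun y => F (Cexp (x, y)) * / (1 - z * Cexp (- (x, y))))%C).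
      + ring.
      + intros y _. unfold g, k. simpl. ring.
    - simpl csum. rewrite Cmult_plus_distr_l, IH.
      assert (E : CInt (g n) (- PI) PI = (CInt (g (S n)) (- PI) PI
         + z ^ n * CInt (fun y => mcoef_int F n (x, y)) (- PI) PI)%C).
      { assert (X1 : ex_CInt (fun y => mcoef_int F n (x, y)) (- PI) PI).
        { apply ex_CInt_rcont; intros; eapply mcoef_int_cont; eassumption. }
        rewrite <- (CInt_scal (z ^ n)%C) by exact X1.
        rewrite <- CInt_plus.
        - apply CInt_ext. intros y _. unfold g, mcoef_int.
          replace (Cexp (- (RtoC (INR n) * (x, y)))) with (Cexp (- (x, y)) ^ n)%C.
          + replace (k y ^ n)%C with (z ^ n * Cexp (- (x, y)) ^ n)%C
              by (unfold k; rewrite Cpow_mult_l; reflexivity).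
            rewrite Cpow_S.
            replace (k y ^ n)%C with (z ^ n * Cexp (- (x, y)) ^ n)%C
              by (unfold k; rewrite Cpow_mult_l; reflexivity).
            specialize (Hne y). field. exact Hne.
          + rewrite <- Cexp_INR_mult. f_equal. ring.
        - apply ex_CInt_rcont; intros; apply Hgc.
        - apply ex_CInt_scal, X1. }
      rewrite E. unfold mcoef. field. exact RtoC_2PI_neq_0. }
  assert (Hb : forall n, Cmod (csum (fun j => mcoef F j x * z ^ j)%C n - F z) <= M / (1 - q) * q ^ n).
  { intro n.
    replace (csum (fun j => mcoef F j x * z ^ j)%C n - F z)%C
      with (- (/ RtoC (2 * PI) * CInt (g n) (- PI) PI))%C.
    - rewrite Cmod_opp, Cmod_mult, Cmod_inv, Cmod_R, Rabs_pos_eq by (lra || exact RtoC_2PI_neq_0).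
      assert (HB : Cmod (CInt (g n) (- PI) PI) <= M / (1 - q) * q ^ n * (PI - - PI)).
      { apply CInt_bound; [lra|apply ex_CInt_rcont; intros; apply Hgc|].
        intros t Ht. unfold g. rewrite !Cmod_mult, Cmod_pow, Hk, Cmod_inv by apply Hne.
        replace (M / (1 - q) * q ^ n) with (M * (q ^ n * / (1 - q))) by (field; lra).
        apply Rmult_le_compat; [apply Cmod_ge_0| |apply HM, Ht|].
        - apply Rmult_le_pos; [apply pow_le; lra|]. left. apply Rinv_0_lt_compat. specialize (Hk1 t). lra.
        - apply Rmult_le_compat_l; [apply pow_le; lra|]. apply Rinv_le_contravar; [lra|apply Hk1]. }
      apply Rmult_le_reg_l with (2 * PI); [lra|]. rewrite <- Rmult_assoc, Rinv_r by lra. lra.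
    - pose proof RtoC_2PI_neq_0 as N.
      replace (csum (fun j => mcoef F j x * z ^ j)%C n)
        with (/ RtoC (2 * PI) * (RtoC (2 * PI) * csum (fun j => mcoef F j x * z ^ j)%C n))%C by (field; exact N).
      rewrite Hrec. field. exact N. }
  assert (Hq0 : 0 < 1 - q) by lra.
  destruct (pow_lt_1_zero q ltac:(rewrite Rabs_pos_eq; lra) (eps / (M / (1 - q) + 1))) as [n0 Hn0].
  { apply Rdiv_lt_0_compat; [exact He|]. pose proof (Rdiv_le_0_compat M (1 - q) HM0 Hq0). lra. }
  exists n0. intros n Hn. specialize (Hn0 n Hn). rewrite Rabs_pos_eq in Hn0 by (apply pow_le; lra).
  eapply Rle_lt_trans; [apply Hb|].
  pose proof (Rdiv_le_0_compat M (1 - q) HM0 Hq0) as HMq.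
  assert (Hp : 0 <= q ^ n) by (apply pow_le; lra).
  replace eps with ((M / (1 - q) + 1) * (eps / (M / (1 - q) + 1))) by (field; lra).
  apply Rle_lt_trans with ((M / (1 - q) + 1) * q ^ n); [nra|].
  apply Rmult_lt_compat_l; lra.
Qed.

Lemma csum_deriv (f df : nat -> C -> C) (n : nat) (w : C) :
  (forall k, (k < n)%nat -> cderiv (f k) w (df k w)) ->
  cderiv (fun w => csum (fun k => f k w) n) w (csum (fun k => df k w) n).
Proof.
  induction n as [|n IH]; intro H; simpl.
  - apply cderiv_const.
  - apply cderiv_plus; [apply IH; intros; apply H; lia|apply H; lia].
Qed.

(** Only the order of the remainder at 0 enters, so no sum is interchanged with an integral. The
    terms below [n] have the periodic primitive [Q] and drop out; term [n] is the residue, and the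
    remainder vanishes at the left end. *)
Theorem mcoef_extract (F : C -> C) (c : nat -> C) (n : nat) (rho r K x : R) :
  holo_disc F rho -> exp x < rho -> 0 < r ->
  (forall z, Cmod z < r -> Cmod (F z - csum (fun k => c k * z ^ k)%C (S n)) <= K * Cmod z ^ S n) ->
  mcoef F n x = c n.
Proof.
  intros HF Hx Hr HK. pose proof PI_RGT_0 as Hpi. pose proof (exp_pos x) as Hep.
  assert (Hrho : 0 < rho) by lra.
  destruct (half_plane_primitive rho _ Hrho (holo_mcoef_int F n rho HF)) as [P HP].
  set (m := fun k : nat => RtoC (INR (n - k))).
  assert (Hm : forall k, (k < n)%nat -> m k <> 0).
  { intros k Hk E. unfold m in E. apply RtoC_inj in E. rewrite minus_INR in E by lia.
    apply lt_INR in Hk. lra. }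
  set (Q := fun w => csum (fun k => - (c k / m k) * Cexp (- (m k * w)))%C n).
  set (q := fun w => csum (fun k => c k * Cexp (- (m k * w)))%C n).
  assert (HQ : forall w, cderiv Q w (q w)).
  { intro w. unfold Q. apply (csum_deriv (fun k w => - (c k / m k) * Cexp (- (m k * w)))%C
       (fun k w => c k * Cexp (- (m k * w)))%C).
    intros k Hk. eapply cderiv_val; [apply cderiv_scal, cderiv_Cexp_lin|].
    field. apply Hm, Hk. }
  assert (Hper : forall k u v, Cexp (- (m k * (u, (v + 2 * PI)%R))) = Cexp (- (m k * (u, v)))).
  { intros k u v. unfold m. rewrite !Cexp_opp, !Cexp_INR_mult. now rewrite Cexp_periodic. }
  assert (HQper : forall u v, Q (u, (v + 2 * PI)%R) = Q (u, v)).
  { intros u v. unfold Q. apply csum_ext. intros k _. now rewrite Hper. }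
  assert (Hpow : forall w, (csum (fun k => c k * Cexp w ^ k) (S n) * Cexp (- (RtoC (INR n) * w)) = q w + c n)%C).
  { intro w. rewrite Cmult_comm, <- csum_scal. simpl csum. f_equal.
    - unfold q. apply csum_ext. intros k Hk. rewrite <- Cexp_INR_mult.
      transitivity (c k * (Cexp (- (RtoC (INR n) * w)) * Cexp (RtoC (INR k) * w)))%C; [ring|].
      rewrite <- Cexp_plus. f_equal. f_equal. unfold m. rewrite minus_INR by lia. rewrite RtoC_minus. ring.
    - rewrite <- Cexp_INR_mult.
      transitivity (c n * (Cexp (- (RtoC (INR n) * w)) * Cexp (RtoC (INR n) * w)))%C; [ring|].
      rewrite <- Cexp_plus. replace (- (INR n * w) + INR n * w)%C with (RtoC 0) by ring.
      rewrite Cexp_0. ring. }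
  assert (HP' : (P (x, PI) - P (x, (- PI)%R) = RtoC (2 * PI) * Ci * c n)%C).
  { transitivity ((fun w => P w - Q w)%C (x, (- PI + 2 * PI)%R) - (fun w => P w - Q w)%C (x, (- PI)%R))%C.
    { cbv beta. rewrite HQper. replace (- PI + 2 * PI) with PI by ring. ring. }
    apply (primitive_period (half_plane rho) (fun w => P w - Q w)%C (fun w => mcoef_int F n w - q w)%C
      x (- PI) (c n)).
    - apply half_plane_left_convex.
    - intros w Hw. apply cderiv_minus; [apply HP, Hw|apply HQ].
    - exact Hx.
    - exact Hx.
    - intros u _. rewrite mcoef_int_period. apply (f_equal (Cminus _)). unfold q.
      apply csum_ext. intros k _. now rewrite Hper.
    - intros eps He.
      set (d := Rmin (Rmin rho r) (eps / (Rabs K + 1))).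
      pose proof (Rabs_pos K) as HK0.
      assert (Hd : 0 < d) by (repeat apply Rmin_glb_lt; try assumption; apply Rdiv_lt_0_compat; lra).
      exists (ln d - 1). intros u v Hu.
      assert (Hmod : Cmod (Cexp (u, v)) < d).
      { rewrite Cmod_Cexp. cbn [fst]. rewrite <- (exp_ln d Hd). apply exp_increasing. lra. }
      assert (Hd1 : d <= rho) by (eapply Rle_trans; apply Rmin_l).
      assert (Hd2 : d <= r) by (eapply Rle_trans; [apply Rmin_l|apply Rmin_r]).
      assert (Hd3 : d <= eps / (Rabs K + 1)) by apply Rmin_r.
      split.
      { unfold half_plane. rewrite Cmod_Cexp in Hmod. lra. }
      set (w := (u, v) : C) in *.
      replace (mcoef_int F n w - q w - c n)%C with
        ((F (Cexp w) - csum (fun k => c k * Cexp w ^ k)%C (S n)) * Cexp (- (RtoC (INR n) * w)))%C.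
      2:{ unfold mcoef_int. specialize (Hpow w).
          transitivity (F (Cexp w) * Cexp (- (RtoC (INR n) * w)) -
            csum (fun k => c k * Cexp w ^ k)%C (S n) * Cexp (- (RtoC (INR n) * w)))%C; [ring|].
          rewrite Hpow. ring. }
      rewrite Cmod_mult, Cexp_opp, Cexp_INR_mult.
      rewrite Cmod_inv by (apply Cpow_nz, Cexp_neq_0). rewrite Cmod_pow.
      specialize (HK (Cexp w) ltac:(lra)).
      set (t := Cmod (Cexp w)) in *.
      assert (Ht : 0 < t) by (apply Cmod_neq0, Cexp_neq_0).
      assert (Htn : 0 < t ^ n) by (apply pow_lt, Ht).
      apply Rle_trans with (Rabs K * t ^ S n * / t ^ n).
      { apply Rmult_le_compat_r; [left; apply Rinv_0_lt_compat, Htn|].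
        eapply Rle_trans; [exact HK|]. apply Rmult_le_compat_r; [apply pow_le; lra|apply Rle_abs]. }
      replace (Rabs K * t ^ S n * / t ^ n) with (Rabs K * t) by (simpl; field; lra).
      apply Rle_trans with ((Rabs K + 1) * (eps / (Rabs K + 1))); [|right; field; lra].
      apply Rmult_le_compat; lra. }
  rewrite (mcoef_primitive F P n x rho HF Hx (fun y _ => HP (x, y) Hx)) in HP'.
  pose proof RtoC_2PI_neq_0 as N1. pose proof Ci_neq_0 as N2.
  transitivity (/ (RtoC (2 * PI) * Ci) * (RtoC (2 * PI) * Ci * mcoef F n x))%C; [field; split; assumption|].
  rewrite HP'. field. split; assumption.
Qed.

(** [zcoef] picks some Taylor series: [taylor_series] provides one, and [mcoef_extract] shows that
    any choice has the same coefficient. *)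
Theorem zcoef_mcoef (F : C -> C) (n : nat) (rho x : R) : holo_disc F rho -> exp x < rho ->
  zcoef F n = mcoef F n x.
Proof.
  intros HF Hx. unfold zcoef. pose proof (exp_pos x) as Hep.
  destruct (epsilon_spec (inhabits (RtoC 0)) (fun a => exists c, is_taylor0 F c /\ c n = a)) as [c [[r [Hr Hc]] E]].
  - exists (mcoef F n x), (fun n => mcoef F n x). split; [|reflexivity].
    exists (exp x). split; [exact Hep|]. intros z Hz. apply cseries_is_pseries.
    apply (taylor_series F rho); [exact HF|split; assumption].
  - rewrite <- E. symmetry.
    destruct (cseries_remainder c F r (S n) Hr) as [K [r1 [Hr1 [_ HK]]]].
    + intros z Hz. apply is_pseries_cseries, Hc, Hz.
    + apply (mcoef_extract F c n rho r1 K x HF Hx (proj1 Hr1) HK).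
Qed.

(** The difference quotient tends to [l] at the centre, so its mean over the circle of radius
    [rho / 2] is [l]; on that circle it is at most [2 M / (rho / 2)]. *)
Theorem cauchy_estimate (F : C -> C) (w l : C) (rho M : R) : 0 < rho ->
  (forall z, Cmod (z - w) < rho -> exists m, cderiv F z m) ->
  (forall z, Cmod (z - w) < rho -> Cmod (F z) <= M) ->
  cderiv F w l -> Cmod l <= 4 * M / rho.
Proof.
  intros Hr HF HM Hl. pose proof PI_RGT_0 as Hpi.
  set (Phi := fun u => ((F (w + Cexp u) - F w) * Cexp (- u))%C).
  assert (Hsub : forall u, (w + Cexp u - w)%C = Cexp u) by (intro; ring).
  assert (HPhi : holo (half_plane rho) Phi).
  { intros u Hu. destruct (HF (w + Cexp u)%C) as [m Hm].
    - rewrite Hsub, Cmod_Cexp. exact Hu.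
    - eexists. apply cderiv_mult.
      + apply cderiv_minus; [|apply cderiv_const].
        apply (cderiv_comp F (fun u => w + Cexp u)%C); [|exact Hm].
        apply cderiv_plus; [apply cderiv_const|apply cderiv_Cexp].
      + apply (cderiv_comp Cexp Copp); [apply cderiv_opp, cderiv_id|apply cderiv_Cexp]. }
  destruct (half_plane_primitive rho Phi Hr HPhi) as [P HP].
  set (x := ln (rho / 2)).
  assert (Ex : exp x = rho / 2) by (apply exp_ln; lra).
  assert (Hx : forall y, half_plane rho (x, y)) by (intro y; unfold half_plane; cbn [fst]; lra).
  assert (E : (P (x, - PI + 2 * PI)%R - P (x, (- PI)%R) = RtoC (2 * PI) * Ci * l)%C).
  { apply (primitive_period (half_plane rho) P Phi).
    - apply half_plane_left_convex.
    - exact HP.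
    - apply Hx.
    - apply Hx.
    - intros u _. unfold Phi. rewrite !Cexp_opp. now rewrite Cexp_periodic.
    - intros eps He. destruct (Hl eps He) as [d [Hd H]].
      assert (Hd' : 0 < Rmin d rho) by (now apply Rmin_glb_lt).
      exists (ln (Rmin d rho) - 1). intros u v Hu.
      assert (Hmod : Cmod (Cexp (u, v)) < Rmin d rho).
      { rewrite Cmod_Cexp. cbn [fst]. rewrite <- (exp_ln _ Hd'). apply exp_increasing. lra. }
      split.
      + unfold half_plane. rewrite Cmod_Cexp in Hmod. eapply Rlt_le_trans; [exact Hmod|apply Rmin_r].
      + unfold Phi. specialize (H (w + Cexp (u, v))%C). rewrite Hsub in H.
        specialize (H (Rlt_le_trans _ _ _ Hmod (Rmin_l _ _))).
        pose proof (Cexp_neq_0 (u, v)) as Hn.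
        rewrite Cexp_opp.
        replace ((F (w + Cexp (u, v)) - F w) * / Cexp (u, v) - l)%C
          with ((F (w + Cexp (u, v)) - F w - l * Cexp (u, v)) / Cexp (u, v))%C by (field; exact Hn).
        rewrite Cmod_div by exact Hn. apply Rle_div_l; [now apply Cmod_neq0|exact H]. }
  pose proof (mean_value_const (fun t => P (x, t)) (fun t => Phi (x, t) * Ci)%C (4 * M / rho)
     (- PI) (- PI + 2 * PI) ltac:(lra)) as HB.
  cbv beta in HB. rewrite E in HB.
  rewrite !Cmod_mult, Cmod_Ci, Cmod_R, Rabs_pos_eq in HB by lra.
  apply Rmult_le_reg_l with (2 * PI); [lra|].
  replace (2 * PI * (4 * M / rho)) with (4 * M / rho * (- PI + 2 * PI - - PI)) by (field; lra).
  replace (2 * PI * Cmod l) with (2 * PI * 1 * Cmod l) by ring.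
  apply HB.
  - intros t _. apply (rderiv_comp P (fun t => (x, t))); [apply rderiv_vertical|apply HP, Hx].
  - intros t _. rewrite Cmod_mult, Cmod_Ci, Rmult_1_r. unfold Phi.
    rewrite Cmod_mult, Cmod_Cexp. cbn [fst Copp]. rewrite exp_Ropp, Ex.
    replace (4 * M / rho) with (2 * M * / (rho / 2)) by (field; lra).
    apply Rmult_le_compat_r; [left; apply Rinv_0_lt_compat; lra|].
    eapply Rle_trans; [apply Cmod_minus_le|].
    assert (H1 : Cmod (F (w + Cexp (x, t))%C) <= M).
    { apply HM. rewrite Hsub, Cmod_Cexp. exact (Hx t). }
    assert (H2 : Cmod (F w) <= M).
    { apply HM. replace (w - w)%C with (RtoC 0) by ring. now rewrite Cmod_0. }
    lra.
Qed.

(** * The contour estimate *)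

Lemma Rpower_pos (x y : R) : 0 < Rpower x y.
Proof. apply exp_pos. Qed.

Lemma Rpower_le_base (x y a : R) : 0 < x -> x <= y -> 0 <= a -> Rpower x a <= Rpower y a.
Proof. intros. apply Rle_Rpower_l; lra. Qed.

Lemma Rpower_le_base_neg (x y a : R) : 0 < x -> x <= y -> 0 <= a -> Rpower y (- a) <= Rpower x (- a).
Proof.
  intros. rewrite !Rpower_Ropp. apply Rinv_le_contravar; [apply Rpower_pos|].
  now apply Rpower_le_base.
Qed.

Lemma Rpower_le_1 (x a : R) : 0 < x <= 1 -> 0 <= a -> Rpower x a <= 1.
Proof.
  intros [H1 H2] Ha. replace 1 with (Rpower 1 a).
  - now apply Rpower_le_base.
  - unfold Rpower. rewrite ln_1, Rmult_0_r. apply exp_0.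
Qed.

Lemma Rpower_ge_1 (x a : R) : 1 <= x -> 0 <= a -> 1 <= Rpower x a.
Proof.
  intros H Ha. replace 1 with (Rpower 1 a) at 1.
  - apply Rpower_le_base; lra.
  - unfold Rpower. rewrite ln_1, Rmult_0_r. apply exp_0.
Qed.

Lemma Cpower_opp_inv (z : C) (a : R) : Cpower z (RtoC (- a)) = (/ Cpower z (RtoC a))%C.
Proof. unfold Cpower. rewrite <- Cexp_opp. f_equal. rewrite RtoC_opp. ring. Qed.

(** The integrand is the model times [x e^u], with [x] the normalised prefactor and [u] the error of
    the exponent multiplied by [n]. The dependence on [n] and [|w|] stays explicit because the bound
    serves both at distance [1/n] and along rays of fixed length. *)
Lemma local_error (A B w : C) (a c K d : R) (n : nat) :
  0 <= K -> 0 < d -> 0 < Cmod w <= 1 ->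
  Cmod (A * Cpower (- w) (RtoC a) - 1) <= K * Rpower (Cmod w) d ->
  Cmod (B - RtoC (1 - c) * w) <= K * (Cmod w * Rpower (Cmod w) d) ->
  Cmod (A * Cexp (RtoC (INR n) * (B - w))
        - Cpower (- w) (RtoC (- a)) * Cexp (- (RtoC (INR n * c) * w)))
  <= Rpower (Cmod w) (- a) * exp (- (INR n * c * fst w))
     * ((K + (1 + K) * K) * Rpower (Cmod w) d * (1 + INR n * Cmod w)
        * exp (K * (INR n * Cmod w * Rpower (Cmod w) d))).
Proof.
  intros HK Hd Hw HA HB.
  set (t := Cmod w) in *. set (r := Rpower t d) in *.
  assert (Hr : 0 < r) by apply Rpower_pos.
  assert (Hr1 : r <= 1) by (apply Rpower_le_1; lra).
  pose proof (pos_INR n) as Hn.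
  pose proof (Cpower_neq_0 (- w) (RtoC a)) as Hp.
  set (x := (A * Cpower (- w) (RtoC a))%C) in *.
  set (u := (RtoC (INR n) * (B - RtoC (1 - c) * w))%C).
  replace (A * Cexp (RtoC (INR n) * (B - w)) - Cpower (- w) (RtoC (- a)) * Cexp (- (RtoC (INR n * c) * w)))%C
    with (Cpower (- w) (RtoC (- a)) * Cexp (- (RtoC (INR n * c) * w)) * (x * (Cexp u - 1) + (x - 1)))%C.
  2:{ replace (RtoC (INR n) * (B - w))%C with (- (RtoC (INR n * c) * w) + u)%C
        by (unfold u; rewrite RtoC_mult, RtoC_minus; ring).
      rewrite Cexp_plus, Cpower_opp_inv. unfold x. field. exact Hp. }
  rewrite !Cmod_mult, Cmod_Cpower, Cmod_opp, Cmod_Cexp.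
  replace (fst (- (RtoC (INR n * c) * w))%C) with (- (INR n * c * fst w))
    by (unfold Copp, Cmult, RtoC; cbn [fst snd]; ring).
  apply Rmult_le_compat_l.
  { apply Rmult_le_pos; left; [apply Rpower_pos|apply exp_pos]. }
  set (ex := exp (K * (INR n * t * r))).
  assert (Hex : 1 <= ex).
  { unfold ex. rewrite <- exp_0 at 1. apply exp_le_compat.
    apply Rmult_le_pos; [exact HK|]. apply Rmult_le_pos; [apply Rmult_le_pos|]; lra. }
  assert (Hu : Cmod u <= K * (INR n * t * r)).
  { unfold u. rewrite Cmod_mult, Cmod_R, Rabs_pos_eq by exact Hn.
    replace (K * (INR n * t * r)) with (INR n * (K * (t * r))) by ring.
    apply Rmult_le_compat_l; assumption. }
  assert (Heu : Cmod (Cexp u - 1) <= K * (INR n * t * r) * ex).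
  { eapply Rle_trans; [apply Cmod_Cexp_m1|]. apply Rmult_le_compat; [apply Cmod_ge_0|left; apply exp_pos|exact Hu|].
    apply exp_le_compat, Hu. }
  assert (Hx : Cmod x <= 1 + K).
  { replace x with ((x - 1) + 1)%C by ring. eapply Rle_trans; [apply Cmod_triangle|].
    rewrite Cmod_1. nra. }
  assert (Hxu : Cmod x * Cmod (Cexp u - 1) <= (1 + K) * (K * (INR n * t * r) * ex)).
  { apply Rmult_le_compat; try apply Cmod_ge_0; assumption. }
  eapply Rle_trans; [apply Cmod_triangle|]. rewrite Cmod_mult.
  assert (H0 : 0 <= INR n * t) by (apply Rmult_le_pos; lra).
  apply Rle_trans with ((1 + K) * (K * (INR n * t * r) * ex) + K * r * (1 + INR n * t) * ex).
  - apply Rplus_le_compat; [exact Hxu|].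
    assert (K * r * 1 <= K * r * ((1 + INR n * t) * ex)).
    { apply Rmult_le_compat_l; [apply Rmult_le_pos; lra|]. nra. }
    lra.
  - assert (0 <= (1 + K) * K * r * ex) by (repeat apply Rmult_le_pos; lra). nra.
Qed.

(** If [PI] were 4 then [cos 2 = 0], but Taylor's bound gives [cos 2 <= -1/3]. Strictness puts the
    heights [PI] and [-PI] in the interior of [wedge]. *)
Lemma PI_lt_4 : PI < 4.
Proof.
  pose proof PI_4 as H. destruct H as [H|H]; [exact H|exfalso].
  destruct (cos_bound (PI / 2) 0) as [_ Hc]; [lra|lra|].
  rewrite cos_PI2, H in Hc. unfold cos_approx, cos_term in Hc. simpl in Hc. lra.
Qed.

(** The complement of a closed sector around the positive real axis. *)
Definition cone (m : R) (w : C) : Prop := fst w < m * Rabs (snd w).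

(* The slit disc [Delta0] in the coordinate [z = R0 e^w]; [4] stands for any bound above [PI]. *)
Definition wedge (s m : R) (w : C) : Prop := Rabs (snd w) < 4 /\ fst w < s /\ cone m w.

Lemma cone_slit (m : R) (w : C) : 0 < m -> cone m w -> slit (- w).
Proof.
  intros Hm H. unfold cone in H. destruct (Req_dec (snd w) 0) as [E|E].
  - left. rewrite E, Rabs_R0 in H. change (0 < - fst w). lra.
  - right. change (- snd w <> 0). lra.
Qed.

Lemma cone_scale (m r : R) (w : C) : 0 < r -> cone m w -> cone m (RtoC r * w).
Proof.
  intros Hr H. unfold cone in *.
  replace (fst (RtoC r * w)%C) with (r * fst w) by (unfold Cmult, RtoC; cbn [fst snd]; ring).
  replace (snd (RtoC r * w)%C) with (r * snd w) by (unfold Cmult, RtoC; cbn [fst snd]; ring).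
  rewrite Rabs_mult, (Rabs_pos_eq r) by lra. nra.
Qed.

Lemma cone_open (m : R) : 0 < m -> copen (cone m).
Proof.
  intros Hm w Hw. unfold cone in *. exists ((m * Rabs (snd w) - fst w) / (1 + m)). split.
  { apply Rdiv_lt_0_compat; lra. }
  intros w' H.
  apply Rlt_div_r in H; [|lra].
  pose proof (Re_le_Cmod (w' - w)) as H1. pose proof (Im_le_Cmod (w' - w)) as H2.
  change (fst (w' - w)%C) with (fst w' - fst w) in H1. change (snd (w' - w)%C) with (snd w' - snd w) in H2.
  apply Rabs_le_between in H1.
  pose proof (Rabs_triang_inv (snd w) (snd w')) as H3. rewrite Rabs_minus_sym in H3.
  assert (H4 : Rabs (snd w) - Cmod (w' - w) <= Rabs (snd w')) by lra.
  assert (m * (Rabs (snd w) - Cmod (w' - w)) <= m * Rabs (snd w')) by (apply Rmult_le_compat_l; lra).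
  lra.
Qed.

Lemma cone_left_convex (m : R) : left_convex (cone m).
Proof. intros x y x' H Hx. unfold cone in *; cbn [fst snd] in *. lra. Qed.

Lemma wedge_open (s m : R) : 0 < m -> copen (wedge s m).
Proof.
  intros Hm w [H1 [H2 H3]]. destruct (cone_open m Hm w H3) as [r [Hr H]].
  exists (Rmin r (Rmin (4 - Rabs (snd w)) (s - fst w))). split.
  { repeat apply Rmin_glb_lt; lra. }
  intros w' Hw'.
  assert (A1 := Rlt_le_trans _ _ _ Hw' (Rmin_l _ _)).
  assert (A2 := Rlt_le_trans _ _ _ Hw' (Rmin_r _ _)).
  assert (A3 := Rlt_le_trans _ _ _ A2 (Rmin_l _ _)).
  assert (A4 := Rlt_le_trans _ _ _ A2 (Rmin_r _ _)).
  pose proof (Re_le_Cmod (w' - w)) as B1. pose proof (Im_le_Cmod (w' - w)) as B2.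
  change (fst (w' - w)%C) with (fst w' - fst w) in B1. change (snd (w' - w)%C) with (snd w' - snd w) in B2.
  apply Rabs_le_between in B1. pose proof (Rabs_triang_inv (snd w') (snd w)).
  split; [lra|]. split; [lra|]. apply H, A1.
Qed.

Lemma wedge_left_convex (s m : R) : left_convex (wedge s m).
Proof.
  intros x y x' [H1 [H2 H3]] Hx. split; [exact H1|]. split; [cbn [fst] in *; lra|].
  eapply cone_left_convex; eassumption.
Qed.

Lemma wedge_primitive (s m : R) (F : C -> C) : 0 < s -> 0 < m -> holo (wedge s m) F ->
  exists P, forall w, wedge s m w -> cderiv P w (F w).
Proof.
  intros Hs Hm. apply (primitive_left_convex _ _ (-1)).
  - now apply wedge_open.
  - apply wedge_left_convex.
  - intros x y y' [H1 [H2 H3]] Hy. unfold wedge, cone in *; cbn [fst snd] in *.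
    pose proof (Rabs_pos y'). assert (0 <= m * Rabs y') by (apply Rmult_le_pos; lra). lra.
Qed.

Lemma cone_primitive (m : R) (F : C -> C) : 0 < m -> holo (cone m) F ->
  exists P, forall w, cone m w -> cderiv P w (F w).
Proof.
  intros Hm. apply (primitive_left_convex _ _ (-1)).
  - now apply cone_open.
  - apply cone_left_convex.
  - intros x y y' _ _. unfold cone; cbn [fst snd].
    pose proof (Rabs_pos y'). assert (0 <= m * Rabs y') by (apply Rmult_le_pos; lra). lra.
Qed.

(** Homogeneity: replacing [w] by [r w] in [(-w)^-a e^-w] brings out [r^-a], and [dw] brings out
    [r]. One primitive [Q] thus serves every scale. *)
Lemma scaled_primitive (m a r : R) (Q : C -> C) (w : C) : 0 < m -> 0 < r ->
  (forall w, cone m w -> cderiv Q w (Cpower (- w) (RtoC (- a)) * Cexp (- w))%C) -> cone m w ->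
  cderiv (fun w => RtoC (Rpower r (a - 1)) * Q (RtoC r * w))%C w
    (Cpower (- w) (RtoC (- a)) * Cexp (- (RtoC r * w)))%C.
Proof.
  intros Hm Hr HQ Hw.
  pose proof (slit_neq_0 _ (cone_slit m w Hm Hw)) as Hw0.
  eapply cderiv_val.
  - apply cderiv_scal. apply (cderiv_comp Q (fun w => RtoC r * w)%C).
    + apply cderiv_scal, cderiv_id.
    + apply HQ, cone_scale; assumption.
  - replace (- (RtoC r * w))%C with (RtoC r * (- w))%C by ring.
    unfold Cpower at 1. rewrite Clog_scale by assumption.
    replace (RtoC (- a) * (RtoC (ln r) + Clog (- w)))%C with (RtoC (- a * ln r) + RtoC (- a) * Clog (- w))%C
      by (rewrite RtoC_mult; ring).
    rewrite Cexp_plus, Cexp_R. fold (Cpower (- w) (RtoC (- a))).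
    transitivity (RtoC (Rpower r (a - 1) * exp (- a * ln r) * r) * (Cpower (- w) (RtoC (- a)) * Cexp (RtoC r * - w)))%C.
    + rewrite !RtoC_mult. ring.
    + replace (Rpower r (a - 1) * exp (- a * ln r) * r) with 1; [ring|].
      transitivity (exp ((a - 1) * ln r + - a * ln r + ln r)).
      * rewrite <- exp_0 at 1. f_equal. ring.
      * rewrite !exp_plus, exp_ln by exact Hr. reflexivity.
Qed.

(* [A i] and [B i] are the prefactor and the normalised exponent; [I] carries the
   parameter in which all the constants must be uniform. *)
Section Transfer.
Variables (I : Type) (A B : I -> C -> C) (al c : I -> R) (m s d K e0 a2 c0 c1 p q : R).
Hypothesis (Hm : 0 < m) (Hs : 0 < s) (Hd : 0 < d) (HK : 0 <= K) (He0 : 0 < e0).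
Hypothesis (Hc0 : 0 < c0) (Hp : 0 < p) (Hq : 0 < q) (Hpq : p * p + q * q = 1) (Hslope : p < m * q).
Hypothesis (Hal : forall i, d <= al i <= a2) (Hc : forall i, c0 <= c i <= c1).
Hypothesis HA : forall i w, wedge s m w -> Cmod w < e0 ->
  Cmod (A i w * Cpower (- w) (RtoC (al i)) - 1) <= K * Rpower (Cmod w) d.
Hypothesis HB : forall i w, wedge s m w -> Cmod w < e0 ->
  Cmod (B i w - RtoC (1 - c i) * w) <= K * (Cmod w * Rpower (Cmod w) d).
Hypothesis Hgap : forall r, 0 < r -> exists x1, 0 < x1 < r /\ exists c' M, 0 < c' /\ 0 <= M /\
  forall i y, x1 <= p / q * Rabs y -> Rabs y <= PI ->
    fst (B i (x1, y)) - x1 <= - c' /\ Cmod (A i (x1, y)) <= M.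

Let K2 := K + (1 + K) * K.
(** Along a ray the model decays at rate at least [c0 p] in [n rho]. Half of that rate is spent on
    the error of the exponent, the other half remains. *)
Let kap := c0 * p / 2.

Let model (i : I) (n : nat) (w : C) : C :=
  (Cpower (- w) (RtoC (- al i)) * Cexp (- (RtoC (INR n * c i) * w)))%C.
Let full (i : I) (n : nat) (w : C) : C := (A i w * Cexp (RtoC (INR n) * (B i w - w)))%C.

Let p_le_1 : p <= 1.
Proof. nra. Qed.

Let q_le_1 : q <= 1.
Proof. nra. Qed.

Let K2_ge : 0 <= K2.
Proof. unfold K2. nra. Qed.

(** Here [q / n <= |w| <= 2 / n], so the exponentials are bounded and the relative error is of order
    [n^-d]. The disjunction describes three sides in units of [1/n]: two horizontal ones at heights
    [q] and [-q], and the vertical one at abscissa [-1]. *)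
Lemma polygon_error (i : I) (n : nat) (X Y : R) : 0 < INR n -> 2 / INR n < e0 -> 2 / INR n <= 1 ->
  p / INR n < s ->
  -1 <= X <= p -> Rabs Y <= q -> (Rabs Y = q \/ X = -1) ->
  wedge s m (X / INR n, Y / INR n) /\
  Cmod (full i n (X / INR n, Y / INR n) - model i n (X / INR n, Y / INR n))
    <= Rpower q (- a2) * exp c1 * (K2 * 3 * exp (2 * K)) * Rpower (INR n) (al i - d).
Proof.
  intros Hn Hn1 Hn2 Hns HX HY Hor.
  destruct (Hal i) as [Ha1 Ha2]. destruct (Hc i) as [Hci1 Hci2].
  pose proof (Rinv_0_lt_compat _ Hn) as Hni.
  assert (EY : Rabs (Y / INR n) = Rabs Y / INR n).
  { unfold Rdiv. now rewrite Rabs_mult, (Rabs_pos_eq (/ INR n)) by lra. }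
  assert (HW : wedge s m (X / INR n, Y / INR n)).
  { unfold wedge, cone; cbn [fst snd]. rewrite EY. split; [|split].
    - apply Rle_lt_trans with (1 / INR n); [apply Rmult_le_compat_r; lra|]. unfold Rdiv in *. lra.
    - apply Rle_lt_trans with (p / INR n); [apply Rmult_le_compat_r; lra|exact Hns].
    - replace (m * (Rabs Y / INR n)) with (m * Rabs Y / INR n) by (field; lra).
      apply Rmult_lt_compat_r; [exact Hni|]. destruct Hor as [E|E]; [rewrite E; lra|].
      rewrite E. pose proof (Rabs_pos Y). nra. }
  split; [exact HW|].
  set (w := (X / INR n, Y / INR n) : C) in *.
  assert (Hup : Cmod w <= 2 / INR n).
  { eapply Rle_trans; [apply Cmod_le_parts|]. rewrite EY.
    assert (Rabs (X / INR n) <= 1 / INR n).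
    { unfold Rdiv. rewrite Rabs_mult, (Rabs_pos_eq (/ INR n)) by lra.
      apply Rmult_le_compat_r; [lra|]. apply Rabs_le; lra. }
    assert (Rabs Y / INR n <= 1 / INR n) by (apply Rmult_le_compat_r; lra).
    unfold Rdiv in *; lra. }
  assert (Hlow : q / INR n <= Cmod w).
  { destruct Hor as [E|E].
    - rewrite <- E, <- EY. apply (Im_le_Cmod w).
    - apply Rle_trans with (Rabs (X / INR n)); [|apply (Re_le_Cmod w)].
      unfold Rdiv. rewrite Rabs_mult, (Rabs_pos_eq (/ INR n)) by lra.
      apply Rmult_le_compat_r; [lra|]. rewrite E, Rabs_left; lra. }
  assert (Hqn : 0 < q / INR n) by (now apply Rdiv_lt_0_compat).
  assert (Hw01 : 0 < Cmod w <= 1) by lra.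
  eapply Rle_trans; [apply (local_error (A i w) (B i w) w (al i) (c i) K d n HK Hd Hw01)|].
  - apply HA; [exact HW|lra].
  - apply HB; [exact HW|lra].
  - fold K2.
    assert (Hr1 : Rpower (Cmod w) d <= 1) by (apply Rpower_le_1; lra).
    pose proof (Rpower_pos (Cmod w) d) as Hr0.
    assert (E1 : Rpower (Cmod w) (- al i) * Rpower (Cmod w) d <= Rpower q (- a2) * Rpower (INR n) (al i - d)).
    { rewrite <- Rpower_plus. replace (- al i + d) with (- (al i - d)) by ring.
      apply Rle_trans with (Rpower (q / INR n) (- (al i - d))); [apply Rpower_le_base_neg; lra|].
      unfold Rdiv.
      rewrite <- Rpower_mult_distr by lra.
      replace (Rpower (/ INR n) (- (al i - d))) with (Rpower (INR n) (al i - d)).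
      2:{ unfold Rpower. rewrite ln_Rinv by exact Hn. f_equal. ring. }
      apply Rmult_le_compat_r; [left; apply Rpower_pos|].
      unfold Rpower. apply exp_le_compat.
      assert (ln q <= 0) by (rewrite <- ln_1; destruct q_le_1 as [L|L]; [left; now apply ln_increasing|right; now rewrite L]).
      nra. }
    assert (E2 : exp (- (INR n * c i * fst w)) <= exp c1).
    { apply exp_le_compat. unfold w; cbn [fst].
      replace (- (INR n * c i * (X / INR n))) with (- c i * X) by (field; lra). nra. }
    assert (E3 : INR n * Cmod w <= 2).
    { replace 2 with (INR n * (2 / INR n)) by (field; lra). apply Rmult_le_compat_l; lra. }
    assert (E30 : 0 <= INR n * Cmod w) by (apply Rmult_le_pos; lra).
    assert (E4 : exp (K * (INR n * Cmod w * Rpower (Cmod w) d)) <= exp (2 * K)).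
    { apply exp_le_compat. assert (INR n * Cmod w * Rpower (Cmod w) d <= 2 * 1) by (apply Rmult_le_compat; lra).
      nra. }
    pose proof (exp_pos (- (INR n * c i * fst w))) as P2. pose proof (exp_pos (K * (INR n * Cmod w * Rpower (Cmod w) d))) as P4.
    pose proof (Rpower_pos (Cmod w) (- al i)) as P1.
    pose proof (Rpower_pos q (- a2)) as P5. pose proof (Rpower_pos (INR n) (al i - d)) as P6.
    apply Rle_trans with ((Rpower (Cmod w) (- al i) * Rpower (Cmod w) d) * exp (- (INR n * c i * fst w))
      * (K2 * (1 + INR n * Cmod w) * exp (K * (INR n * Cmod w * Rpower (Cmod w) d)))).
    { right. ring. }
    apply Rle_trans with ((Rpower q (- a2) * Rpower (INR n) (al i - d)) * exp c1 * (K2 * 3 * exp (2 * K))); [|right; ring].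
    apply Rmult_le_compat.
    + apply Rmult_le_pos; [|lra]. apply Rmult_le_pos; lra.
    + apply Rmult_le_pos; [|lra]. apply Rmult_le_pos; lra.
    + apply Rmult_le_compat; try lra. apply Rmult_le_pos; lra.
    + apply Rmult_le_compat; try lra; [apply Rmult_le_pos; lra|]. apply Rmult_le_compat_l; lra.
Qed.

(** As [d <= al i], the power of [rho] is largest at the inner end [rho = 1/n]. Half of the decay
    rate [kap] absorbs the factor [1 + n rho], by [u <= (2 / kap) e^(kap u / 2)]; the rest makes the
    bound integrable along the ray. *)
Lemma ray_error (i : I) (n : nat) (rho sg : R) : 0 < INR n -> / INR n <= rho -> rho < e0 -> rho <= 1 ->
  rho * p < s -> K * Rpower rho d <= kap -> (sg = 1 \/ sg = -1) ->
  wedge s m (rho * p, sg * (rho * q)) /\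
  Cmod (full i n (rho * p, sg * (rho * q)) - model i n (rho * p, sg * (rho * q)))
    <= K2 * (1 + 2 / kap) * Rpower (INR n) (al i - d) * exp (- (kap * INR n / 2 * rho)).
Proof.
  intros Hn Hrn Hre Hr1 Hrs HKr Hsg.
  destruct (Hal i) as [Ha1 Ha2]. destruct (Hc i) as [Hci1 Hci2].
  pose proof (Rinv_0_lt_compat _ Hn) as Hni.
  assert (Hr : 0 < rho) by lra.
  assert (Hkap : 0 < kap) by (unfold kap; nra).
  assert (Eabs : Rabs (sg * (rho * q)) = rho * q).
  { rewrite Rabs_mult, (Rabs_pos_eq (rho * q)) by nra.
    destruct Hsg as [-> | ->]; [rewrite Rabs_R1|rewrite Rabs_left by lra]; ring. }
  assert (HW : wedge s m (rho * p, sg * (rho * q))).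
  { unfold wedge, cone; cbn [fst snd]. rewrite Eabs. repeat split; nra. }
  split; [exact HW|].
  set (w := (rho * p, sg * (rho * q)) : C) in *.
  assert (Ew : Cmod w = rho).
  { unfold w, Cmod; cbn [fst snd].
    replace ((rho * p) ^ 2 + (sg * (rho * q)) ^ 2) with (rho * rho).
    - apply sqrt_square. lra.
    - assert (sg * sg = 1) by (destruct Hsg as [-> | ->]; ring).
      replace ((rho * p) ^ 2 + (sg * (rho * q)) ^ 2) with (rho * rho * (p * p + (sg * sg) * (q * q))) by ring.
      rewrite H, Rmult_1_l, Hpq. ring. }
  eapply Rle_trans; [apply (local_error (A i w) (B i w) w (al i) (c i) K d n HK Hd)|].
  - rewrite Ew. lra.
  - apply HA; [exact HW|lra].
  - apply HB; [exact HW|lra].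
  - fold K2. rewrite Ew. unfold w; cbn [fst].
    assert (E1 : Rpower rho (- al i) * Rpower rho d <= Rpower (INR n) (al i - d)).
    { rewrite <- Rpower_plus. replace (- al i + d) with (- (al i - d)) by ring.
      apply Rle_trans with (Rpower (/ INR n) (- (al i - d))); [apply Rpower_le_base_neg; lra|].
      unfold Rpower. rewrite ln_Rinv by exact Hn. right. f_equal. ring. }
    set (u := INR n * rho).
    assert (Hu : 0 <= u) by (unfold u; nra).
    assert (E2 : exp (- (INR n * c i * (rho * p))) * exp (K * (u * Rpower rho d)) <= exp (- (kap * u))).
    { rewrite <- exp_plus. apply exp_le_compat.
      assert (c0 * p * u <= c i * p * u) by (apply Rmult_le_compat_r; [exact Hu|apply Rmult_le_compat_r; lra]).
      assert (K * Rpower rho d * u <= kap * u) by (apply Rmult_le_compat_r; assumption).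
      replace (INR n * c i * (rho * p)) with (c i * p * u) by (unfold u; ring).
      unfold kap in *. lra. }
    assert (E3 : (1 + u) * exp (- (kap * u)) <= (1 + 2 / kap) * exp (- (kap * INR n / 2 * rho))).
    { replace (- (kap * u)) with (- (kap * INR n / 2 * rho) + - (kap * u / 2)) by (unfold u; field).
      rewrite exp_plus.
      assert (X : (1 + u) * exp (- (kap * u / 2)) <= 1 + 2 / kap).
      { rewrite exp_Ropp. pose proof (exp_ineq1_le (kap * u / 2)) as L.
        pose proof (exp_pos (kap * u / 2)) as Ep.
        apply Rle_div_l; [exact Ep|].
        assert (0 <= kap * u / 2) by nra.
        assert (u <= 2 / kap * exp (kap * u / 2)).
        { replace u with (2 / kap * (kap * u / 2)) at 1 by (field; lra).
          apply Rmult_le_compat_l; [left; apply Rdiv_lt_0_compat; lra|lra]. }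
        lra. }
      pose proof (exp_pos (- (kap * INR n / 2 * rho))).
      replace ((1 + u) * (exp (- (kap * INR n / 2 * rho)) * exp (- (kap * u / 2))))
        with (((1 + u) * exp (- (kap * u / 2))) * exp (- (kap * INR n / 2 * rho))) by ring.
      apply Rmult_le_compat_r; lra. }
    apply Rle_trans with (K2 * (Rpower rho (- al i) * Rpower rho d) * ((1 + u) *
      (exp (- (INR n * c i * (rho * p))) * exp (K * (u * Rpower rho d))))).
    { right. unfold u. ring. }
    apply Rle_trans with (K2 * Rpower (INR n) (al i - d) * ((1 + 2 / kap) * exp (- (kap * INR n / 2 * rho)))); [|right; ring].
    pose proof (Rpower_pos rho (- al i)). pose proof (Rpower_pos rho d).
    apply Rmult_le_compat.
    + repeat apply Rmult_le_pos; lra.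
    + apply Rmult_le_pos; [lra|]. apply Rmult_le_pos; left; apply exp_pos.
    + apply Rmult_le_compat_l; lra.
    + eapply Rle_trans; [apply Rmult_le_compat_l; [lra|exact E2]|exact E3].
Qed.

(* Integrals are differences of primitives: of [P] over the vertical segment at [x1], of [Q]
   over a truncated Hankel contour. *)
Theorem contour_transfer : exists rho0 Cst N0, 0 < rho0 /\ 0 <= Cst /\ exists x1, forall i n P Q, (N0 <= n)%nat ->
  (forall w, wedge s m w -> cderiv P w (full i n w)) ->
  (forall w, cone m w -> cderiv Q w (Cpower (- w) (RtoC (- al i)) * Cexp (- w))%C) ->
  wedge s m (x1, PI) /\ wedge s m (x1, (- PI)%R) /\
  Cmod (P (x1, PI) - P (x1, (- PI)%R) - RtoC (Rpower (INR n * c i) (al i - 1)) *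
     (Q ((INR n * c i * rho0) * p, (INR n * c i * rho0) * q)%R
      - Q ((INR n * c i * rho0) * p, - ((INR n * c i * rho0) * q))%R))
  <= Cst * Rpower (INR n) (al i - 1 - d).
Proof.
  assert (Hkap : 0 < kap) by (unfold kap; nra).
  (* [r2^d = kap / (K + 1)], so up to radius [r2] the relative error [K r^d] of the exponent is at
     most [kap]. *)
  set (r2 := Rpower (kap / (K + 1)) (/ d)).
  assert (Hr2 : forall r, 0 < r -> r <= r2 -> K * Rpower r d <= kap).
  { intros r Hr Hrr. assert (Hq2 : 0 < kap / (K + 1)) by (apply Rdiv_lt_0_compat; lra).
    assert (E : Rpower r d <= kap / (K + 1)).
    { apply Rle_trans with (Rpower r2 d); [apply Rpower_le_base; lra|].
      unfold r2. rewrite Rpower_mult, Rinv_l by lra. rewrite Rpower_1 by exact Hq2. lra. }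
    apply Rle_trans with (K * (kap / (K + 1))); [apply Rmult_le_compat_l; lra|].
    replace (K * (kap / (K + 1))) with (kap * (K / (K + 1))) by (field; lra).
    rewrite <- (Rmult_1_r kap) at 2. apply Rmult_le_compat_l; [lra|]. apply Rle_div_l; lra. }
  set (rs := Rmin (Rmin (e0 / 2) 1) (Rmin r2 s)).
  assert (Hrs : 0 < rs) by (repeat apply Rmin_glb_lt; try lra; apply Rpower_pos).
  assert (Hrs1 : rs <= e0 / 2) by (eapply Rle_trans; apply Rmin_l).
  assert (Hrs2 : rs <= 1) by (eapply Rle_trans; [apply Rmin_l|apply Rmin_r]).
  assert (Hrs3 : rs <= r2) by (eapply Rle_trans; [apply Rmin_r|apply Rmin_l]).
  assert (Hrs4 : rs <= s) by (eapply Rle_trans; apply Rmin_r).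
  destruct (Hgap (rs * p)) as [x1 [[Hx1 Hx1'] [c' [M [Hc' [HM Hg]]]]]]; [nra|].
  (* The rays in directions [(p, q)] and [(p, -q)] meet the vertical line through [x1] at distance
     [rho0] and height [y1]. From there up to [PI] the line is covered by [Hgap]. *)
  set (rho0 := x1 / p).
  assert (Hrho : 0 < rho0) by (now apply Rdiv_lt_0_compat).
  assert (Hrho' : rho0 < rs) by (apply Rlt_div_l; lra).
  assert (Ex1 : rho0 * p = x1) by (unfold rho0; field; lra).
  set (y1 := rho0 * q).
  assert (Hy1 : 0 < y1) by (unfold y1; nra).
  assert (Ey1 : p / q * y1 = x1) by (rewrite <- Ex1; unfold y1; field; lra).
  assert (Hpi : 3 < PI < 4).
  { split; [|exact PI_lt_4]. pose proof PI2_3_2. unfold PI2 in *. lra. }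
  assert (Hy1pi : y1 < PI) by (unfold y1; nra).
  set (CV := 2 * PI * M / c').
  set (CR := K2 * (1 + 2 / kap) * (2 / kap)).
  set (CP := Rpower q (- a2) * exp c1 * (K2 * 3 * exp (2 * K))).
  assert (HCV : 0 <= CV).
  { unfold CV. apply Rdiv_le_0_compat; [|exact Hc']. nra. }
  assert (Hk2 : 0 < 2 / kap) by (apply Rdiv_lt_0_compat; lra).
  assert (HCR : 0 <= CR).
  { unfold CR. repeat apply Rmult_le_pos; lra. }
  assert (HCP : 0 <= CP).
  { unfold CP. pose proof (Rpower_pos q (- a2)). pose proof (exp_pos c1). pose proof (exp_pos (2 * K)).
    repeat apply Rmult_le_pos; lra. }
  destruct (INR_unbounded (2 / rho0)) as [N1 HN1].
  exists rho0, (CV + 2 * CR + 6 * CP), (S N1). split; [exact Hrho|]. split; [lra|]. exists x1.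
  intros i n P Q HnN HP HQ.
  assert (HnR : 2 / rho0 < INR n).
  { eapply Rlt_le_trans; [exact HN1|]. apply le_INR. lia. }
  assert (Hn0 : 0 < INR n) by (pose proof (Rdiv_lt_0_compat 2 rho0); lra).
  assert (Hn1 : 1 <= INR n).
  { change 1 with (INR 1). apply le_INR. lia. }
  pose proof (Rinv_0_lt_compat _ Hn0) as Hni.
  assert (Hnr : 2 / INR n < rho0).
  { apply Rlt_div_l; [exact Hn0|]. apply Rlt_div_l in HnR; lra. }
  assert (Hni2 : / INR n < rho0) by (unfold Rdiv in Hnr; lra).
  destruct (Hal i) as [Ha1 Ha2]. destruct (Hc i) as [Hci1 Hci2].
  assert (Hx1s : x1 < s) by nra.
  assert (Hx1m : x1 < m * PI).
  { assert (x1 < m * y1) by (rewrite <- Ex1; unfold y1; nra). nra. }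
  split; [|split].
  1, 2: unfold wedge, cone; cbn [fst snd];
    ((rewrite Rabs_pos_eq by lra) || (rewrite Rabs_Ropp, Rabs_pos_eq by lra)); repeat split; lra.
  assert (Hnc : 0 < INR n * c i) by nra.
  set (S := fun w => (RtoC (Rpower (INR n * c i) (al i - 1)) * Q (RtoC (INR n * c i) * w))%C).
  assert (HS : forall w, cone m w -> cderiv S w (model i n w)).
  { intros w Hw. unfold S, model. apply (scaled_primitive m); assumption. }
  (* Polygon and rays are traversed with the primitive of the difference to the model; on the
     vertical pieces [P] alone is already small. *)
  set (PE := fun w => (P w - S w)%C).
  assert (HPE : forall w, wedge s m w -> cderiv PE w (full i n w - model i n w)%C).
  { intros w Hw. apply cderiv_minus; [apply HP, Hw|apply HS, Hw]. }
  assert (HSb : forall sg, S (rho0 * p, sg * (rho0 * q)) =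
     (RtoC (Rpower (INR n * c i) (al i - 1)) * Q ((INR n * c i * rho0) * p, sg * ((INR n * c i * rho0) * q))%R)%C).
  { intros sg. unfold S. do 2 f_equal. unfold Cmult, RtoC; cbn [fst snd]. f_equal; ring. }
  set (NN := Rpower (INR n) (al i - 1 - d)).
  assert (HNN : 0 < NN) by apply Rpower_pos.
  assert (ENN : Rpower (INR n) (al i - d) = INR n * NN).
  { unfold NN. rewrite <- (Rpower_1 (INR n) Hn0) at 2. rewrite <- Rpower_plus. f_equal. ring. }
  assert (HV : forall y y', y <= y' -> (forall t, y <= t <= y' -> y1 <= Rabs t <= PI) -> y' - y <= PI ->
     Cmod (P (x1, y') - P (x1, y)) <= CV / 2 * NN).
  { intros y y' Hyy Ht Hlen.
    apply Rle_trans with (M * exp (- (INR n * c')) * (y' - y)).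
    - apply (mean_value_const (fun t => P (x1, t)) (fun t => full i n (x1, t) * Ci)%C _ y y' Hyy).
      + intros t Htt. apply (rderiv_comp P (fun t => (x1, t))); [apply rderiv_vertical|].
        apply HP. specialize (Ht t Htt). unfold wedge, cone; cbn [fst snd].
        split; [|split; [exact Hx1s|]].
        * lra.
        * assert (x1 < m * y1) by (rewrite <- Ex1; unfold y1; nra). nra.
      + intros t Htt. specialize (Ht t Htt).
        destruct (Hg i t) as [G1 G2]; [|apply Ht|].
        * rewrite <- Ey1. apply Rmult_le_compat_l; [left; now apply Rdiv_lt_0_compat|apply Ht].
        * unfold full. rewrite !Cmod_mult, Cmod_Ci, Rmult_1_r, Cmod_Cexp.
          apply Rmult_le_compat; [apply Cmod_ge_0|left; apply exp_pos|exact G2|].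
          apply exp_le_compat. unfold Cminus, Copp, Cplus, Cmult, RtoC; cbn [fst snd]. nra.
    (* The exponent [al i - 1 - d] is at least [-1] because [d <= al i], so decay like [1/n]
       suffices. *)
    - assert (He : exp (- (INR n * c')) <= NN / c').
      { apply Rle_trans with (/ INR n / c').
        - rewrite exp_Ropp. unfold Rdiv. rewrite <- Rinv_mult.
          apply Rinv_le_contravar; [nra|]. pose proof (exp_ineq1_le (INR n * c')). lra.
        - apply Rmult_le_compat_r; [left; now apply Rinv_0_lt_compat|].
          rewrite <- (Rpower_1 (INR n) Hn0) at 1. rewrite <- Rpower_Ropp. unfold NN.
          apply Rle_Rpower; lra. }
      apply Rle_trans with (M * (NN / c') * PI).
      + apply Rmult_le_compat; [|lra| |exact Hlen].
        * apply Rmult_le_pos; [exact HM|left; apply exp_pos].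
        * apply Rmult_le_compat_l; assumption.
      + right. unfold CV. field. lra. }
  assert (HR : forall sg, sg = 1 \/ sg = -1 ->
     Cmod (PE (rho0 * p, sg * (rho0 * q)) - PE (/ INR n * p, sg * (/ INR n * q))) <= CR * NN).
  { intros sg Hsg.
    set (G := K2 * (1 + 2 / kap) * Rpower (INR n) (al i - d)).
    assert (HG : 0 <= G).
    { unfold G. pose proof (Rpower_pos (INR n) (al i - d)). repeat apply Rmult_le_pos; lra. }
    set (k2 := kap * INR n / 2).
    assert (Hk : 0 < k2) by (unfold k2; nra).
    assert (Hb : Cmod (p, sg * q) = 1).
    { unfold Cmod; cbn [fst snd]. replace (p ^ 2 + (sg * q) ^ 2) with 1; [apply sqrt_1|].
      assert (sg * sg = 1) by (destruct Hsg as [-> | ->]; ring).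
      replace (p ^ 2 + (sg * q) ^ 2) with (p * p + (sg * sg) * (q * q)) by ring. rewrite H. lra. }
    assert (HMV := mean_value_inequality (fun t => PE (t * p, sg * (t * q)))
      (fun t => (full i n (t * p, sg * (t * q))%R - model i n (t * p, sg * (t * q))%R) * (p, (sg * q)%R))%C
      (fun t => - (G / k2) * exp (- (k2 * t))) (fun t => G * exp (- (k2 * t))) (/ INR n) rho0).
    eapply Rle_trans; [apply HMV|].
    - lra.
    - intros t Ht. destruct (ray_error i n t sg) as [W _]; try assumption; try lra; try nra.
      { apply Hr2; lra. }
      apply (rderiv_comp PE (fun t => (t * p, sg * (t * q)))).
      + intros eps He. destruct (rderiv_affine 0 (p, sg * q) t eps He) as [dd [Hdd HH]].
        exists dd. split; [exact Hdd|]. intros u Hu. specialize (HH u Hu).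
        replace ((u * p, sg * (u * q)) : C) with (0 + RtoC u * (p, (sg * q)%R))%C
          by (unfold Cplus, Cmult, RtoC; cbn [fst snd]; f_equal; ring).
        replace ((t * p, sg * (t * q)) : C) with (0 + RtoC t * (p, (sg * q)%R))%C
          by (unfold Cplus, Cmult, RtoC; cbn [fst snd]; f_equal; ring).
        exact HH.
      + apply HPE, W.
    - intros t _.
      apply is_derive_Reals. auto_derive; [trivial|]. field. lra.
    - intros t Ht. destruct (ray_error i n t sg) as [_ W]; try assumption; try lra; try nra.
      { apply Hr2; lra. }
      rewrite Cmod_mult, Hb, Rmult_1_r. exact W.
    - assert (HE : exp (- (k2 * / INR n)) <= 1) by (rewrite <- exp_0; apply exp_le_compat; assert (0 <= k2 * / INR n) by nra; lra).
      pose proof (exp_pos (- (k2 * rho0))).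
      assert (HGk : 0 <= G / k2) by (apply Rdiv_le_0_compat; lra).
      apply Rle_trans with (G / k2).
      + nra.
      + right. unfold G, k2, CR. rewrite ENN. field. lra. }
  assert (HNs : p / INR n < s).
  { apply Rle_lt_trans with (rho0 * p); [|lra]. unfold Rdiv. nra. }
  assert (HPoly : forall X Y, -1 <= X <= p -> Rabs Y <= q -> (Rabs Y = q \/ X = -1) ->
     wedge s m (X / INR n, Y / INR n) /\
     Cmod (full i n (X / INR n, Y / INR n) - model i n (X / INR n, Y / INR n)) <= CP * (INR n * NN)).
  { intros X Y H1 H2 H3. unfold CP. rewrite <- ENN. apply polygon_error; try assumption; lra. }
  assert (HH : forall Y, Rabs Y = q ->
     Cmod (PE (p / INR n, Y / INR n) - PE (-1 / INR n, Y / INR n)) <= 2 * CP * NN).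
  { intros Y HY.
    apply Rle_trans with (CP * (INR n * NN) * (p / INR n - -1 / INR n)).
    - apply (mean_value_const (fun t => PE (t, Y / INR n)) (fun t => (full i n (t, Y / INR n)%R - model i n (t, Y / INR n)%R) * 1)%C).
      + unfold Rdiv. nra.
      + intros t Ht. apply (rderiv_comp PE (fun t => (t, Y / INR n))); [apply rderiv_horizontal|].
        apply HPE. replace t with (t * INR n / INR n) by (field; lra).
        apply HPoly; [|lra|now left]. unfold Rdiv in Ht. split; apply Rmult_le_reg_r with (/ INR n); try lra;
        rewrite Rmult_assoc, Rinv_r by lra; lra.
      + intros t Ht. rewrite Cmult_1_r. replace t with (t * INR n / INR n) by (field; lra).
        apply HPoly; [|lra|now left]. unfold Rdiv in Ht. split; apply Rmult_le_reg_r with (/ INR n); try lra;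
        rewrite Rmult_assoc, Rinv_r by lra; lra.
    - replace (CP * (INR n * NN) * (p / INR n - -1 / INR n)) with (CP * NN * (p + 1)) by (field; lra).
      assert (0 <= CP * NN) by (apply Rmult_le_pos; lra). nra. }
  assert (HL : Cmod (PE (-1 / INR n, q / INR n) - PE (-1 / INR n, - q / INR n)) <= 2 * CP * NN).
  { apply Rle_trans with (CP * (INR n * NN) * (q / INR n - - q / INR n)).
    - apply (mean_value_const (fun t => PE (-1 / INR n, t)) (fun t => (full i n (-1 / INR n, t)%R - model i n (-1 / INR n, t)%R) * Ci)%C).
      + unfold Rdiv. nra.
      + intros t Ht. apply (rderiv_comp PE (fun t => (-1 / INR n, t))); [apply rderiv_vertical|].
        apply HPE. replace t with (t * INR n / INR n) by (field; lra).
        apply HPoly; [lra| |now right]. apply Rabs_le. unfold Rdiv in Ht. split; apply Rmult_le_reg_r with (/ INR n); try lra;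
        rewrite Rmult_assoc, Rinv_r by lra; lra.
      + intros t Ht. rewrite Cmod_mult, Cmod_Ci, Rmult_1_r. replace t with (t * INR n / INR n) by (field; lra).
        apply HPoly; [lra| |now right]. apply Rabs_le. unfold Rdiv in Ht. split; apply Rmult_le_reg_r with (/ INR n); try lra;
        rewrite Rmult_assoc, Rinv_r by lra; lra.
    - replace (CP * (INR n * NN) * (q / INR n - - q / INR n)) with (CP * NN * (2 * q)) by (field; lra).
      assert (0 <= CP * NN) by (apply Rmult_le_pos; lra). nra. }
  assert (HV1 : Cmod (P (x1, PI) - P (x1, y1)) <= CV / 2 * NN).
  { apply HV; [lra| |lra]. intros t Ht. rewrite Rabs_pos_eq; lra. }
  assert (HV2 : Cmod (P (x1, (- y1)%R) - P (x1, (- PI)%R)) <= CV / 2 * NN).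
  { apply HV; [lra| |lra]. intros t Ht. rewrite Rabs_left; lra. }
  pose proof (HR 1 (or_introl eq_refl)) as HR1. pose proof (HR (-1) (or_intror eq_refl)) as HR2.
  assert (HHp := HH q (Rabs_pos_eq q (Rlt_le _ _ Hq))).
  assert (HHm := HH (- q) (eq_trans (Rabs_Ropp q) (Rabs_pos_eq q (Rlt_le _ _ Hq)))).
  pose proof (HSb 1) as HS1. pose proof (HSb (-1)) as HS2.
  assert (R1 : forall r, 1 * r = r) by (intro; ring). assert (R2 : forall r, -1 * r = - r) by (intro; ring).
  rewrite R1 in HR1, HS1. rewrite R2 in HR2, HS2. rewrite R1 in HR1, HS1. rewrite R2 in HR2, HS2.
  fold y1 in HR1, HR2, HS1, HS2. rewrite Ex1 in HR1, HR2, HS1, HS2.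
  replace (/ INR n * p) with (p / INR n) in HR1, HR2 by (field; lra).
  replace (/ INR n * q) with (q / INR n) in HR1, HR2 by (field; lra).
  replace (- (q / INR n)) with (- q / INR n) in HR2 by (field; lra).
  rewrite Cmod_minus_sym in HHm. rewrite Cmod_minus_sym in HR2.
  set (Q1 := Q (INR n * c i * rho0 * p, INR n * c i * rho0 * q)) in *.
  set (Q2 := Q (INR n * c i * rho0 * p, - (INR n * c i * rho0 * q))) in *.
  (* The two vertical pieces, then ray, polygon and ray from top to bottom. With [PE = P - S] the
     sum telescopes, and the values of [S] at the two outer corners give [Q1] and [Q2]. *)
  replace (P (x1, PI) - P (x1, (- PI)%R) - RtoC (Rpower (INR n * c i) (al i - 1)) * (Q1 - Q2))%C with
    ((P (x1, PI) - P (x1, y1)) + ((P (x1, (- y1)%R) - P (x1, (- PI)%R))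
     + ((PE (x1, y1) - PE (p / INR n, q / INR n)%R) + ((PE (p / INR n, q / INR n)%R - PE (-1 / INR n, q / INR n)%R)
     + ((PE (-1 / INR n, q / INR n)%R - PE (-1 / INR n, - q / INR n)%R)
     + ((PE (-1 / INR n, - q / INR n)%R - PE (p / INR n, - q / INR n)%R)
     + (PE (p / INR n, - q / INR n)%R - PE (x1, (- y1)%R))))))))%C.
  2:{ transitivity (P (x1, PI) - P (x1, (- PI)%R) - (RtoC (Rpower (INR n * c i) (al i - 1)) * Q1
        - RtoC (Rpower (INR n * c i) (al i - 1)) * Q2))%C; [|ring].
      rewrite <- HS1, <- HS2. unfold PE. ring. }
  replace ((CV + 2 * CR + 6 * CP) * NN) with (CV / 2 * NN + (CV / 2 * NN + (CR * NN + (2 * CP * NN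
    + (2 * CP * NN + (2 * CP * NN + CR * NN)))))) by field.
  do 5 (eapply Rle_trans; [apply Cmod_triangle|]; apply Rplus_le_compat; [assumption|]).
  eapply Rle_trans; [apply Cmod_triangle|]; apply Rplus_le_compat; assumption.
Qed.
End Transfer.

(** * The Gamma function *)

Definition gint (s t : R) : R := Rpower t (s - 1) * exp (- t).

(** The improper integral at both ends at once, in the form in which identities and inequalities
    over finite intervals pass to the limit. *)
Definition gamma_lim (s l : R) : Prop :=
  forall eps, 0 < eps -> exists d T, 0 < d /\ forall a b, 0 < a < d -> T < b -> a < b ->
    Rabs (RInt (gint s) a b - l) <= eps.

Lemma gint_pos (s t : R) : 0 < gint s t.
Proof. apply Rmult_lt_0_compat; apply exp_pos. Qed.

Lemma is_derive_Rpower_base (a t : R) : 0 < t -> is_derive (fun t => Rpower t a) t (a * Rpower t (a - 1)).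
Proof.
  intro Ht. apply is_derive_Reals. apply derivable_pt_lim_power, Ht.
Qed.

Lemma continuous_gint (s t : R) : 0 < t -> continuous (gint s) t.
Proof.
  intro Ht. apply (continuous_mult (K := R_AbsRing) (fun t => Rpower t (s - 1)) (fun t => exp (- t))).
  - apply (ex_derive_continuous (fun t => Rpower t (s - 1))).
    eexists. apply is_derive_Rpower_base, Ht.
  - apply (ex_derive_continuous (fun t => exp (- t))). auto_derive. trivial.
Qed.

Lemma ex_RInt_gint (s a b : R) : 0 < a -> 0 < b -> ex_RInt (gint s) a b.
Proof.
  intros Ha Hb. apply (ex_RInt_continuous (V := R_CompleteNormedModule)).
  intros t Ht. apply continuous_gint.
  pose proof (Rmin_glb_lt _ _ _ Ha Hb). lra.
Qed.

Lemma RInt_gint_pos (s a b : R) : 0 < a -> a <= b -> 0 <= RInt (gint s) a b.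
Proof.
  intros Ha Hab. apply RInt_ge_0; [exact Hab|apply ex_RInt_gint; lra|].
  intros t _. left. apply gint_pos.
Qed.

Lemma RInt_gint_mono (s a b a' b' : R) : 0 < a' -> a' <= a -> a <= b -> b <= b' ->
  RInt (gint s) a b <= RInt (gint s) a' b'.
Proof.
  intros H1 H2 H3 H4.
  rewrite <- (RInt_Chasles (gint s) a' a b') by (apply ex_RInt_gint; lra).
  rewrite <- (RInt_Chasles (gint s) a b b') by (apply ex_RInt_gint; lra).
  pose proof (RInt_gint_pos s a' a H1 H2). pose proof (RInt_gint_pos s b b' ltac:(lra) H4).
  unfold plus; simpl. lra.
Qed.

Lemma ln_le_sub (x : R) : 0 < x -> ln x <= x - 1.
Proof. intro H. pose proof (exp_ineq1_le (ln x)) as L. rewrite exp_ln in L by exact H. lra. Qed.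

(** The maximum is at [t = r], by [ln x <= x - 1] at [x = t / r]; the factor [e^-r] of its value is
    dropped. *)
Lemma exp_decay (r t : R) : 0 < r -> 0 < t -> Rpower t r * exp (- t) <= Rpower r r.
Proof.
  intros Hr Ht. unfold Rpower. rewrite <- exp_plus. apply exp_le_compat.
  assert (Htr : 0 < t / r) by (now apply Rdiv_lt_0_compat).
  pose proof (ln_le_sub (t / r) Htr) as L.
  unfold Rdiv in L at 1. rewrite ln_mult, ln_Rinv in L by (assumption || now apply Rinv_0_lt_compat).
  assert (r * (ln t + - ln r) <= r * (t / r - 1)) by (apply Rmult_le_compat_l; lra).
  replace (r * (t / r - 1)) with (t - r) in H by (field; lra). nra.
Qed.

(* The majorant [t^(s-1) (1+t)^(-s-1)] has the bounded primitive [(t/(1+t))^s / s]. *)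
Lemma gamma_bounded (s : R) : 0 < s -> exists M, forall a b, 0 < a -> a <= b -> RInt (gint s) a b <= M.
Proof.
  intros Hs. set (C0 := exp 1 * Rpower (s + 1) (s + 1)).
  assert (HC0 : 0 < C0) by (apply Rmult_lt_0_compat; apply exp_pos).
  set (H := fun t => C0 / s * Rpower (t / (1 + t)) s).
  set (h := fun t => C0 * (Rpower (t / (1 + t)) (s - 1) * / ((1 + t) * (1 + t)))).
  exists (C0 / s). intros a b Ha Hab.
  assert (HH : forall t, 0 < t -> is_derive H t (h t)).
  { intros t Ht. assert (Hq : 0 < t / (1 + t)) by (apply Rdiv_lt_0_compat; lra).
    replace (h t) with (C0 / s * (/ ((1 + t) * (1 + t)) * (s * Rpower (t / (1 + t)) (s - 1))))
      by (unfold h; field; split; lra).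
    apply (is_derive_scal (fun t => Rpower (t / (1 + t)) s)).
    apply (is_derive_comp (fun u => Rpower u s) (fun t => t / (1 + t))).
    - now apply is_derive_Rpower_base.
    - auto_derive; [lra|]. field. lra. }
  assert (Hhc : forall t, 0 < t -> continuous h t).
  { intros t Ht. assert (Hq : 0 < t / (1 + t)) by (apply Rdiv_lt_0_compat; lra).
    apply (continuous_scal_r C0 (fun t => Rpower (t / (1 + t)) (s - 1) * / ((1 + t) * (1 + t)))).
    apply (continuous_mult (K := R_AbsRing) (fun t => Rpower (t / (1 + t)) (s - 1)) (fun t => / ((1 + t) * (1 + t)))).
    - apply (continuous_comp (fun t => t / (1 + t)) (fun u => Rpower u (s - 1))).
      + apply (ex_derive_continuous (fun t => t / (1 + t))). auto_derive. lra.
      + apply (ex_derive_continuous (fun u => Rpower u (s - 1))). eexists. apply is_derive_Rpower_base, Hq.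
    - apply (ex_derive_continuous (fun t => / ((1 + t) * (1 + t)))). auto_derive. nra. }
  assert (HI : is_RInt h a b (minus (H b) (H a))).
  { apply (is_RInt_derive (V := R_CompleteNormedModule) H h).
    - intros t Ht. apply HH. rewrite Rmin_left in Ht; lra.
    - intros t Ht. apply Hhc. rewrite Rmin_left in Ht; lra. }
  apply Rle_trans with (RInt h a b).
  - apply RInt_le; [exact Hab|apply ex_RInt_gint; lra|eexists; exact HI|].
    intros t [Ht _]. unfold gint, h.
    assert (Ht0 : 0 < t) by lra.
    assert (E : Rpower (t / (1 + t)) (s - 1) * / ((1 + t) * (1 + t)) = Rpower t (s - 1) * Rpower (1 + t) (- (s + 1))).
    { unfold Rdiv. rewrite <- Rpower_mult_distr by (lra || (apply Rinv_0_lt_compat; lra)).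
      rewrite Rmult_assoc. f_equal.
      replace (/ ((1 + t) * (1 + t))) with (Rpower (1 + t) (- (2))).
      - unfold Rpower. rewrite ln_Rinv by lra. rewrite <- exp_plus. f_equal. ring.
      - rewrite Rpower_Ropp. replace 2 with (1 + 1) by ring. rewrite Rpower_plus, Rpower_1 by lra. reflexivity. }
    rewrite E.
    replace (C0 * (Rpower t (s - 1) * Rpower (1 + t) (- (s + 1)))) with (Rpower t (s - 1) * (C0 * Rpower (1 + t) (- (s + 1)))) by ring.
    apply Rmult_le_compat_l; [left; apply Rpower_pos|].
    rewrite Rpower_Ropp. apply Rle_div_r; [apply Rpower_pos|].
    pose proof (exp_decay (s + 1) (1 + t) ltac:(lra) ltac:(lra)) as D.
    unfold C0. replace (exp (- t)) with (exp 1 * exp (- (1 + t))) by (rewrite <- exp_plus; f_equal; ring).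
    pose proof (exp_pos 1). nra.
  - rewrite (is_RInt_unique _ _ _ _ HI). unfold minus, plus, opp; simpl. unfold H.
    assert (Hq : Rpower (b / (1 + b)) s <= 1).
    { apply Rpower_le_1; [|lra]. split; [apply Rdiv_lt_0_compat; lra|apply Rle_div_l; lra]. }
    pose proof (Rpower_pos (a / (1 + a)) s).
    assert (Hcs : 0 < C0 / s) by (now apply Rdiv_lt_0_compat). nra.
Qed.

(** The integrand is positive, so the integrals over [[a, b]] grow to their supremum, finite by
    [gamma_bounded]; uniqueness of limits identifies it with [Gamma]. *)
Lemma Gamma_lim (s : R) : 0 < s -> gamma_lim s (Gamma s).
Proof.
  intros Hs. destruct (gamma_bounded s Hs) as [M HM].
  destruct (completeness (fun x => exists a b, 0 < a /\ a <= b /\ x = RInt (gint s) a b)) as [l [Hl1 Hl2]].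
  - exists M. intros x [a [b [Ha [Hab ->]]]]. now apply HM.
  - exists (RInt (gint s) 1 1), 1, 1. repeat split; lra.
  - assert (Hlim : forall eps, 0 < eps -> exists d T, 0 < d /\ forall a b, 0 < a < d -> T < b -> a < b ->
      l - eps < RInt (gint s) a b <= l).
    { intros eps He.
      assert (Hex : exists a b, 0 < a /\ a <= b /\ l - eps < RInt (gint s) a b).
      { apply Classical_Prop.NNPP. intro Hn.
        assert (l <= l - eps); [|lra]. apply Hl2. intros x [a [b [Ha [Hab ->]]]].
        apply Rnot_lt_le. intro Hlt. apply Hn. now exists a, b. }
      destruct Hex as [a0 [b0 [Ha0 [Hab0 H0]]]].
      exists a0, b0. split; [exact Ha0|]. intros a b Ha Hb Hab. split.
      - eapply Rlt_le_trans; [exact H0|]. apply RInt_gint_mono; lra.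
      - apply Hl1. exists a, b. repeat split; lra. }
    assert (E : Gamma s = l).
    { unfold Gamma. apply is_RInt_gen_unique.
      apply filterlimi_locally. intros eps.
      destruct (Hlim eps (cond_pos eps)) as [d [T [Hd H]]].
      assert (HT : 0 < Rmax T d) by (eapply Rlt_le_trans; [exact Hd|apply Rmax_r]).
      apply (Filter_prod _ _ _ (fun a => 0 < a < d) (fun b => Rmax T d < b)).
      - exists (mkposreal d Hd). intros y Hy Hy0. split; [exact Hy0|].
        change (Rabs (y - 0) < d) in Hy. rewrite Rminus_0_r, Rabs_pos_eq in Hy; lra.
      - now exists (Rmax T d).
      - intros a b Ha Hb. exists (RInt (gint s) a b). cbn [fst snd].
        pose proof (Rmax_l T d). pose proof (Rmax_r T d). split.
        + apply (RInt_correct (V := R_CompleteNormedModule)). apply ex_RInt_gint; lra.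
        + specialize (H a b Ha ltac:(lra) ltac:(lra)).
          change (Rabs (RInt (gint s) a b - l) < eps). apply Rabs_lt_between. lra. }
    rewrite E. intros eps He. destruct (Hlim eps He) as [d [T [Hd H]]].
    exists d, T. split; [exact Hd|]. intros a b Ha Hb Hab. specialize (H a b Ha Hb Hab).
    apply Rabs_le. lra.
Qed.

Lemma gamma_lim_le (s1 s2 s3 l1 l2 l3 c2 c3 : R) : 0 <= c2 -> 0 <= c3 ->
  gamma_lim s1 l1 -> gamma_lim s2 l2 -> gamma_lim s3 l3 ->
  (forall t, 0 < t -> gint s1 t <= c2 * gint s2 t + c3 * gint s3 t) -> l1 <= c2 * l2 + c3 * l3.
Proof.
  intros Hc2 Hc3 H1 H2 H3 Hle. apply le_epsilon. intros eps He.
  set (e := eps / (1 + c2 + c3)).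
  assert (He' : 0 < e) by (apply Rdiv_lt_0_compat; lra).
  destruct (H1 e He') as [d1 [T1 [Hd1 G1]]]. destruct (H2 e He') as [d2 [T2 [Hd2 G2]]].
  destruct (H3 e He') as [d3 [T3 [Hd3 G3]]].
  set (a := Rmin d1 (Rmin d2 d3) / 2). set (b := Rmax a (Rmax T1 (Rmax T2 T3)) + 1).
  assert (Hm : 0 < Rmin d1 (Rmin d2 d3)) by (repeat apply Rmin_glb_lt; assumption).
  pose proof (Rmin_l d1 (Rmin d2 d3)). pose proof (Rmin_r d1 (Rmin d2 d3)).
  pose proof (Rmin_l d2 d3). pose proof (Rmin_r d2 d3).
  pose proof (Rmax_l a (Rmax T1 (Rmax T2 T3))). pose proof (Rmax_r a (Rmax T1 (Rmax T2 T3))).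
  pose proof (Rmax_l T1 (Rmax T2 T3)). pose proof (Rmax_r T1 (Rmax T2 T3)).
  pose proof (Rmax_l T2 T3). pose proof (Rmax_r T2 T3).
  assert (Ha : 0 < a) by (unfold a; lra).
  specialize (G1 a b ltac:(unfold a in *; lra) ltac:(unfold b; lra) ltac:(unfold b; lra)).
  specialize (G2 a b ltac:(unfold a in *; lra) ltac:(unfold b; lra) ltac:(unfold b; lra)).
  specialize (G3 a b ltac:(unfold a in *; lra) ltac:(unfold b; lra) ltac:(unfold b; lra)).
  assert (Hab : a <= b) by (unfold b; lra).
  assert (Hb : 0 < b) by lra.
  assert (I : RInt (gint s1) a b <= c2 * RInt (gint s2) a b + c3 * RInt (gint s3) a b).
  { assert (E : is_RInt (fun t => plus (scal c2 (gint s2 t)) (scal c3 (gint s3 t))) a b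
       (plus (scal c2 (RInt (gint s2) a b)) (scal c3 (RInt (gint s3) a b)))).
    { apply (is_RInt_plus (V := R_NormedModule)); apply (is_RInt_scal (V := R_NormedModule));
      apply (RInt_correct (V := R_CompleteNormedModule)), ex_RInt_gint; assumption. }
    change (RInt (gint s1) a b <= plus (scal c2 (RInt (gint s2) a b)) (scal c3 (RInt (gint s3) a b))).
    rewrite <- (is_RInt_unique _ _ _ _ E).
    apply RInt_le; [exact Hab|now apply ex_RInt_gint|eexists; exact E|].
    intros t Ht. apply Hle. lra. }
  apply Rabs_le_between in G1. apply Rabs_le_between in G2. apply Rabs_le_between in G3.
  assert (e * (1 + c2 + c3) = eps) by (unfold e; field; lra).
  nra.
Qed.

Lemma Gamma_pos (s : R) : 0 < s -> 0 < Gamma s.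
Proof.
  intros Hs.
  assert (H12 : 0 < RInt (gint s) 1 2).
  { apply RInt_gt_0; [lra| |].
    - intros; apply gint_pos.
    - intros t Ht. apply continuous_gint. lra. }
  apply Rlt_le_trans with (1 := H12). apply le_epsilon. intros eps He.
  destruct (Gamma_lim s Hs eps He) as [d [T [Hd H]]].
  set (a := Rmin d 1 / 2). set (b := Rmax T 2 + 1).
  assert (Hm : 0 < Rmin d 1) by (apply Rmin_glb_lt; lra).
  pose proof (Rmin_l d 1). pose proof (Rmin_r d 1). pose proof (Rmax_l T 2). pose proof (Rmax_r T 2).
  specialize (H a b ltac:(unfold a; lra) ltac:(unfold b; lra) ltac:(unfold a, b; lra)).
  pose proof (RInt_gint_mono s 1 2 a b ltac:(unfold a; lra) ltac:(unfold a; lra) ltac:(lra) ltac:(unfold b; lra)).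
  apply Rabs_le_between in H. lra.
Qed.

Lemma Gamma_1 : Gamma 1 = 1.
Proof.
  apply cond_eq. intros eps He.
  destruct (Gamma_lim 1 Rlt_0_1 (eps / 4) ltac:(lra)) as [d [T [Hd H]]].
  set (a := Rmin d (Rmin 1 (eps / 4)) / 2). set (b := Rmax 1 (Rmax T (4 / eps)) + 1).
  assert (Hm : 0 < Rmin d (Rmin 1 (eps / 4))) by (repeat apply Rmin_glb_lt; lra).
  pose proof (Rmin_l d (Rmin 1 (eps / 4))). pose proof (Rmin_r d (Rmin 1 (eps / 4))).
  pose proof (Rmin_l 1 (eps / 4)). pose proof (Rmin_r 1 (eps / 4)).
  pose proof (Rmax_l 1 (Rmax T (4 / eps))). pose proof (Rmax_r 1 (Rmax T (4 / eps))).
  pose proof (Rmax_l T (4 / eps)). pose proof (Rmax_r T (4 / eps)).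
  specialize (H a b ltac:(unfold a; lra) ltac:(unfold b; lra) ltac:(unfold a, b; lra)).
  assert (Hab : a <= b) by (unfold a, b; lra). assert (Ha : 0 < a) by (unfold a; lra).
  assert (E : RInt (gint 1) a b = exp (- a) - exp (- b)).
  { transitivity (minus (- exp (- b)) (- exp (- a))); [|unfold minus, plus, opp; simpl; ring].
    apply is_RInt_unique.
    apply (is_RInt_ext (fun t => exp (- t))).
    { intros t Ht. rewrite Rmin_left in Ht by lra. unfold gint.
      replace (1 - 1) with 0 by ring. rewrite Rpower_O by lra. symmetry. apply Rmult_1_l. }
    apply (is_RInt_derive (V := R_CompleteNormedModule) (fun t => - exp (- t)) (fun t => exp (- t))).
    - intros t _. auto_derive; [trivial|ring].
    - intros t _. apply (ex_derive_continuous (fun t => exp (- t))). auto_derive. trivial. }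
  rewrite E in H. apply Rabs_le_between in H.
  assert (E1 : 1 - a <= exp (- a)) by (pose proof (exp_ineq1_le (- a)); lra).
  assert (E2 : exp (- a) <= 1) by (rewrite <- exp_0; apply exp_le_compat; lra).
  assert (E3 : exp (- b) <= eps / 4).
  { assert (Hb : 4 / eps < b) by (unfold b; lra).
    rewrite exp_Ropp. apply Rle_trans with (/ (4 / eps)).
    - apply Rinv_le_contravar; [apply Rdiv_lt_0_compat; lra|]. pose proof (exp_ineq1_le b). lra.
    - right. field. lra. }
  pose proof (exp_pos (- b)). apply Rabs_lt_between. unfold a in *. lra.
Qed.

Lemma Gamma_succ (s : R) : 0 < s -> Gamma (s + 1) = s * Gamma s.
Proof.
  intros Hs. apply cond_eq. intros eps He.
  set (e := eps / (4 * (1 + s))).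
  assert (He' : 0 < e) by (apply Rdiv_lt_0_compat; lra).
  destruct (Gamma_lim s Hs e He') as [d1 [T1 [Hd1 H1]]].
  destruct (Gamma_lim (s + 1) ltac:(lra) e He') as [d2 [T2 [Hd2 H2]]].
  set (C0 := Rpower (s + 1) (s + 1)).
  assert (HC0 : 0 < C0) by apply Rpower_pos.
  set (d3 := Rpower e (/ s)).
  assert (Hd3 : 0 < d3) by apply Rpower_pos.
  (* These ends make the boundary terms of the integration by parts small: [a^s <= e] below [d3],
     and [b^s e^-b <= C0 / b <= e] beyond [C0 / e]. *)
  set (a := Rmin d1 (Rmin d2 d3) / 2). set (b := Rmax a (Rmax T1 (Rmax T2 (C0 / e))) + 1).
  assert (Hm : 0 < Rmin d1 (Rmin d2 d3)) by (repeat apply Rmin_glb_lt; assumption).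
  pose proof (Rmin_l d1 (Rmin d2 d3)). pose proof (Rmin_r d1 (Rmin d2 d3)).
  pose proof (Rmin_l d2 d3). pose proof (Rmin_r d2 d3).
  set (T3 := C0 / e) in *.
  pose proof (Rmax_l a (Rmax T1 (Rmax T2 T3))). pose proof (Rmax_r a (Rmax T1 (Rmax T2 T3))).
  pose proof (Rmax_l T1 (Rmax T2 T3)). pose proof (Rmax_r T1 (Rmax T2 T3)).
  pose proof (Rmax_l T2 T3). pose proof (Rmax_r T2 T3).
  assert (Ha : 0 < a) by (unfold a; lra).
  specialize (H1 a b ltac:(unfold a in *; lra) ltac:(unfold b; lra) ltac:(unfold b; lra)).
  specialize (H2 a b ltac:(unfold a in *; lra) ltac:(unfold b; lra) ltac:(unfold b; lra)).
  assert (Hab : a <= b) by (unfold b; lra).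
  assert (Hb : 0 < b) by lra.
  assert (I : s * RInt (gint s) a b - RInt (gint (s + 1)) a b = Rpower b s * exp (- b) - Rpower a s * exp (- a)).
  { assert (E : is_RInt (fun t => minus (scal s (gint s t)) (gint (s + 1) t)) a b
       (minus (scal s (RInt (gint s) a b)) (RInt (gint (s + 1)) a b))).
    { apply (is_RInt_minus (V := R_NormedModule)); [apply (is_RInt_scal (V := R_NormedModule))|];
      apply (RInt_correct (V := R_CompleteNormedModule)), ex_RInt_gint; assumption. }
    change (minus (scal s (RInt (gint s) a b)) (RInt (gint (s + 1)) a b) = minus (Rpower b s * exp (- b)) (Rpower a s * exp (- a))).
    rewrite <- (is_RInt_unique _ _ _ _ E). apply is_RInt_unique.
    apply (is_RInt_derive (V := R_CompleteNormedModule) (fun t => Rpower t s * exp (- t))).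
    - intros t Ht. rewrite Rmin_left in Ht by lra.
      replace (minus (scal s (gint s t)) (gint (s + 1) t))
        with (plus (mult (s * Rpower t (s - 1)) (exp (- t))) (mult (Rpower t s) (- exp (- t)))).
      + apply (is_derive_mult (K := R_AbsRing) (fun t => Rpower t s) (fun t => exp (- t))).
        * apply is_derive_Rpower_base. lra.
        * auto_derive; [trivial|ring].
        * intros; apply Rmult_comm.
      + unfold minus, plus, opp, scal, mult; simpl. unfold mult; simpl. unfold gint.
        replace (s + 1 - 1) with s by ring. ring.
    - intros t Ht. rewrite Rmin_left in Ht by lra.
      apply (continuous_minus (V := R_NormedModule)); [apply (continuous_scal_r (V := R_NormedModule) s (gint s))|];
      apply continuous_gint; lra. }
  assert (B1 : Rpower a s * exp (- a) <= e).
  { assert (Rpower a s <= e).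
    { replace e with (Rpower d3 s) by (unfold d3; rewrite Rpower_mult, Rinv_l, Rpower_1; lra).
      apply Rpower_le_base; unfold a in *; lra. }
    assert (exp (- a) <= 1) by (rewrite <- exp_0; apply exp_le_compat; lra).
    pose proof (exp_pos (- a)). pose proof (Rpower_pos a s). nra. }
  assert (B2 : Rpower b s * exp (- b) <= e).
  { pose proof (exp_decay (s + 1) b ltac:(lra) Hb) as D. fold C0 in D.
    rewrite Rpower_plus, Rpower_1 in D by exact Hb.
    assert (Hb3 : T3 < b) by (unfold b; lra). unfold T3 in Hb3. apply Rlt_div_l in Hb3; [|lra].
    apply Rmult_le_reg_l with b; [exact Hb|]. nra. }
  assert (B3 : 0 < Rpower a s * exp (- a)) by (apply Rmult_lt_0_compat; apply exp_pos).
  assert (B4 : 0 < Rpower b s * exp (- b)) by (apply Rmult_lt_0_compat; apply exp_pos).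
  apply Rabs_le_between in H1. apply Rabs_le_between in H2.
  assert (Ee : e * (4 * (1 + s)) = eps) by (unfold e; field; lra).
  apply Rabs_lt_between. nra.
Qed.

(** The weighted inequality of arithmetic and geometric means for 1 and [u]. It is [e^t >= 1 + t] at
    two exponents whose weighted sum is 0. *)
Lemma Rpower_weighted (u x : R) : 0 < u -> 0 <= x <= 1 -> Rpower u x <= (1 - x) + x * u.
Proof.
  intros Hu Hx. unfold Rpower. set (y := ln u).
  assert (Ey : u = exp y) by (unfold y; now rewrite exp_ln).
  pose proof (exp_ineq1_le (- (x * y))) as E1. pose proof (exp_ineq1_le (y - x * y)) as E2.
  pose proof (exp_pos (x * y)) as Ep.
  assert (F1 : 1 = exp (x * y) * exp (- (x * y))) by (rewrite <- exp_plus, Rplus_opp_r, exp_0; reflexivity).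
  assert (F2 : u = exp (x * y) * exp (y - x * y)) by (rewrite <- exp_plus, Ey; f_equal; ring).
  assert (G1 : exp (x * y) * (1 + - (x * y)) <= 1) by (rewrite F1 at 2; apply Rmult_le_compat_l; lra).
  assert (G2 : exp (x * y) * (1 + (y - x * y)) <= u) by (rewrite F2; apply Rmult_le_compat_l; lra).
  assert (G3 : (1 - x) * (exp (x * y) * (1 + - (x * y))) <= (1 - x) * 1) by (apply Rmult_le_compat_l; lra).
  assert (G4 : x * (exp (x * y) * (1 + (y - x * y))) <= x * u) by (apply Rmult_le_compat_l; lra).
  replace (exp (x * y)) with ((1 - x) * (exp (x * y) * (1 + - (x * y))) + x * (exp (x * y) * (1 + (y - x * y)))) by ring.
  lra.
Qed.

(** Wendel's inequality: the weighted mean inequality for [t / s] is applied under the integral, and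
    the functional equation removes [Gamma (s + 1)]. *)
Lemma Gamma_wendel (s x : R) : 0 < s -> 0 <= x <= 1 -> Gamma (s + x) <= Rpower s x * Gamma s.
Proof.
  intros Hs Hx. pose proof (Rpower_pos s x) as Hp.
  assert (H : Gamma (s + x) <= (Rpower s x * (1 - x)) * Gamma s + (Rpower s x * (x / s)) * Gamma (s + 1)).
  { assert (0 <= x / s) by (apply Rdiv_le_0_compat; lra).
    apply (gamma_lim_le (s + x) s (s + 1)); try (apply Gamma_lim; lra).
    - apply Rmult_le_pos; lra.
    - apply Rmult_le_pos; lra.
    - intros t Ht. unfold gint.
      assert (Hts : 0 < t / s) by (now apply Rdiv_lt_0_compat).
      pose proof (Rpower_weighted (t / s) x Hts Hx) as W.
      replace (Rpower t (s + x - 1)) with (Rpower t (s - 1) * (Rpower s x * Rpower (t / s) x)).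
      2:{ rewrite Rpower_mult_distr by assumption. replace (s * (t / s)) with t by (field; lra).
          rewrite <- Rpower_plus. f_equal. ring. }
      replace (Rpower t (s + 1 - 1)) with (Rpower t (s - 1) * t).
      2:{ rewrite <- (Rpower_1 t Ht) at 2. rewrite <- Rpower_plus. f_equal. ring. }
      pose proof (Rpower_pos t (s - 1)). pose proof (exp_pos (- t)).
      apply Rle_trans with (Rpower t (s - 1) * (Rpower s x * ((1 - x) + x * (t / s))) * exp (- t)).
      + apply Rmult_le_compat_r; [lra|]. apply Rmult_le_compat_l; [lra|]. apply Rmult_le_compat_l; lra.
      + right. field. lra. }
  rewrite Gamma_succ in H by exact Hs. eapply Rle_trans; [exact H|]. right. field. lra.
Qed.

(** For each [t] the power [t^(a - 1)] is at most its value at one of the ends. This bounds [Gamma]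
    uniformly in [v]. *)
Lemma Gamma_le_ends (a a1 a2 : R) : 0 < a1 -> a1 <= a <= a2 -> Gamma a <= Gamma a1 + Gamma a2.
Proof.
  intros Ha1 Ha. replace (Gamma a1 + Gamma a2) with (1 * Gamma a1 + 1 * Gamma a2) by ring.
  apply (gamma_lim_le a a1 a2); try (apply Gamma_lim; lra); try lra.
  intros t Ht. unfold gint. pose proof (exp_pos (- t)).
  replace (1 * (Rpower t (a1 - 1) * exp (- t)) + 1 * (Rpower t (a2 - 1) * exp (- t)))
    with ((Rpower t (a1 - 1) + Rpower t (a2 - 1)) * exp (- t)) by ring.
  apply Rmult_le_compat_r; [lra|].
  pose proof (Rpower_pos t (a1 - 1)). pose proof (Rpower_pos t (a2 - 1)).
  destruct (Rle_dec 1 t) as [Ht1|Ht1].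
  - assert (Rpower t (a - 1) <= Rpower t (a2 - 1)) by (apply Rle_Rpower; lra). lra.
  - assert (Rpower t (a - 1) <= Rpower t (a1 - 1)); [|lra].
    unfold Rpower. apply exp_le_compat.
    assert (ln t <= 0) by (rewrite <- ln_1; left; apply ln_increasing; lra). nra.
Qed.

(** * Binomial coefficients and ratios of Gamma values *)

(** The coefficient of [z^n] in [(1 - z)^-a], built from the ratio of consecutive coefficients. *)
Fixpoint binc (a : R) (n : nat) : R :=
  match n with O => 1 | S n => binc a n * (INR n + a) / (INR n + 1) end.

Lemma binc_Gamma (a : R) (n : nat) : 0 < a -> binc a n * Gamma (INR n + 1) * Gamma a = Gamma (INR n + a).
Proof.
  intros Ha. induction n as [|n IH].
  - simpl. rewrite !Rplus_0_l, Gamma_1. ring.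
  - pose proof (pos_INR n). rewrite S_INR. simpl binc.
    rewrite (Gamma_succ (INR n + 1)) by lra.
    replace (INR n + 1 + a) with (INR n + a + 1) by ring. rewrite (Gamma_succ (INR n + a)) by lra.
    rewrite <- IH. field. lra.
Qed.

Lemma lim_inv_INR (c : R) : is_lim_seq (fun n => / (INR n + c)) 0.
Proof.
  change (Finite 0) with (Rbar_inv p_infty). apply is_lim_seq_inv; [|discriminate].
  apply (is_lim_seq_plus _ _ p_infty c p_infty); [apply is_lim_seq_INR|apply is_lim_seq_const|reflexivity].
Qed.

(** For [a] in [[0, 1]] Wendel's inequality squeezes the ratio: used at [N] it gives the upper
    bound, at [N + a] with increment [1 - a] the lower one. Raising [a] by 1 multiplies by a factor
    that tends to 1. *)
Lemma Gamma_ratio (k : nat) : forall a, INR k <= a <= INR k + 1 ->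
  is_lim_seq (fun n => Gamma (INR (S n) + a) / (Rpower (INR (S n)) a * Gamma (INR (S n)))) 1.
Proof.
  induction k as [|k IH]; intros a Ha.
  - simpl in Ha.
    apply (is_lim_seq_le_le (fun n => 1 - / (INR n + 2)) _ (fun _ => 1)).
    + intro n. rewrite S_INR. pose proof (pos_INR n) as Hn. set (N := INR n + 1).
      assert (HN : 1 <= N) by (unfold N; lra).
      pose proof (Gamma_pos N ltac:(lra)) as G0. pose proof (Rpower_pos N a) as P0.
      pose proof (Gamma_pos (N + a) ltac:(lra)) as G1.
      assert (HD : 0 < Rpower N a * Gamma N) by (apply Rmult_lt_0_compat; assumption).
      split.
      * apply Rle_div_r; [exact HD|].
        pose proof (Gamma_wendel (N + a) (1 - a) ltac:(lra) ltac:(lra)) as W.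
        replace (N + a + (1 - a)) with (N + 1) in W by ring. rewrite Gamma_succ in W by lra.
        assert (P1 : Rpower (N + a) (1 - a) <= Rpower (N + 1) (1 - a)) by (apply Rpower_le_base; lra).
        assert (W' : N * Gamma N <= Rpower (N + 1) (1 - a) * Gamma (N + a)) by nra.
        assert (P2 : Rpower (N + 1) (1 - a) * Rpower N a <= N + 1).
        { apply Rle_trans with (Rpower (N + 1) (1 - a) * Rpower (N + 1) a).
          - apply Rmult_le_compat_l; [left; apply Rpower_pos|apply Rpower_le_base; lra].
          - rewrite <- Rpower_plus. replace (1 - a + a) with 1 by ring. rewrite Rpower_1; lra. }
        assert (X : N * Gamma N * Rpower N a <= (N + 1) * Gamma (N + a)) by nra.
        replace (INR n + 2) with (N + 1) by (unfold N; ring).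
        apply Rmult_le_reg_l with (N + 1); [lra|].
        replace ((N + 1) * ((1 - / (N + 1)) * (Rpower N a * Gamma N))) with (N * Gamma N * Rpower N a) by (field; lra).
        exact X.
      * apply Rle_div_l; [exact HD|]. rewrite Rmult_1_l. apply Gamma_wendel; lra.
    + replace (Finite 1) with (Finite (1 - 0)) by (f_equal; ring).
      apply is_lim_seq_minus'; [apply is_lim_seq_const|apply lim_inv_INR].
    + apply is_lim_seq_const.
  - rewrite S_INR in Ha. pose proof (pos_INR k) as Hk.
    specialize (IH (a - 1) ltac:(lra)).
    apply (is_lim_seq_ext (fun n => (Gamma (INR (S n) + (a - 1)) / (Rpower (INR (S n)) (a - 1) * Gamma (INR (S n))))
      * (1 + (a - 1) * / INR (S n)))).
    + intro n. pose proof (pos_INR n). assert (HN : 0 < INR (S n)) by (rewrite S_INR; lra).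
      replace (INR (S n) + a) with (INR (S n) + (a - 1) + 1) by ring. rewrite Gamma_succ by lra.
      assert (E : Rpower (INR (S n)) a = Rpower (INR (S n)) (a - 1) * INR (S n)).
      { rewrite <- (Rpower_1 (INR (S n)) HN) at 3. rewrite <- Rpower_plus. f_equal. ring. }
      rewrite E. pose proof (Rpower_pos (INR (S n)) (a - 1)). pose proof (Gamma_pos (INR (S n)) HN).
      field. repeat split; lra.
    + replace (Finite 1) with (Finite (1 * (1 + (a - 1) * 0))) by (f_equal; ring).
      apply is_lim_seq_mult'; [exact IH|].
      apply is_lim_seq_plus'; [apply is_lim_seq_const|].
      apply is_lim_seq_mult'; [apply is_lim_seq_const|].
      apply (is_lim_seq_ext (fun n => / (INR n + 1))); [intro n; now rewrite S_INR|apply lim_inv_INR].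
Qed.

Lemma binc_lim (a : R) : 0 < a ->
  is_lim_seq (fun n => binc a (S n) * Rpower (INR (S n)) (1 - a)) (/ Gamma a).
Proof.
  intros Ha. assert (Hk : exists k, INR k <= a <= INR k + 1).
  { destruct (nfloor_ex a ltac:(lra)) as [k Hk]. exists k. lra. }
  destruct Hk as [k Hk]. pose proof (Gamma_pos a Ha) as Hg.
  apply (is_lim_seq_ext (fun n => Gamma (INR (S n) + a) / (Rpower (INR (S n)) a * Gamma (INR (S n))) * / Gamma a)).
  - intro n. assert (HN : 0 < INR (S n)) by (apply lt_0_INR; lia).
    rewrite <- (binc_Gamma a (S n) Ha), Gamma_succ by exact HN.
    replace (Rpower (INR (S n)) (1 - a)) with (INR (S n) * / Rpower (INR (S n)) a).
    + pose proof (Rpower_pos (INR (S n)) a). pose proof (Gamma_pos (INR (S n)) HN).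
      field. repeat split; lra.
    + rewrite <- Rpower_Ropp. rewrite <- (Rpower_1 (INR (S n)) HN) at 1. rewrite <- Rpower_plus. reflexivity.
  - replace (Finite (/ Gamma a)) with (Finite (1 * / Gamma a)) by (f_equal; ring).
    apply is_lim_seq_mult'; [apply (Gamma_ratio k a Hk)|apply is_lim_seq_const].
Qed.

(** * The constant [1/Gamma] *)

Lemma fst_1_minus_Cexp (w : C) : fst (1 - Cexp w)%C = 1 - exp (fst w) * cos (snd w).
Proof. unfold Cexp, Cminus, Copp, Cplus, RtoC; cbn [fst snd]. ring. Qed.

Lemma snd_1_minus_Cexp (w : C) : snd (1 - Cexp w)%C = - (exp (fst w) * sin (snd w)).
Proof. unfold Cexp, Cminus, Copp, Cplus, RtoC; cbn [fst snd]. ring. Qed.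

(** [1 - e^w] and [-w] have imaginary parts of the same sign or, at height 0, both have positive
    real part, so the two principal logarithms do not differ by a period. Their quotient is within
    [3 |w|] of 1, and [24 = 8 * 3]. *)
Lemma Clog_one_minus_exp (m : R) (w : C) : 0 < m -> cone m w -> Cmod w <= 1 / 6 ->
  Cmod (Clog (1 - Cexp w) - Clog (- w)) <= 24 * Cmod w.
Proof.
  intros Hm Hw Hsm. pose proof PI2_3_2 as HPI. unfold PI2 in HPI.
  pose proof (slit_neq_0 _ (cone_slit m w Hm Hw)) as Hw0.
  assert (Hw0' : w <> 0) by (intro E; apply Hw0; rewrite E; ring).
  pose proof (Cmod_neq0 _ Hw0') as Hp.
  pose proof (Im_le_Cmod w) as Hy. apply Rabs_le_between in Hy.
  assert (Eu : ((1 - Cexp w) / - w - 1)%C = ((Cexp w - 1 - w) / w)%C) by (field; exact Hw0').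
  assert (Hu : Cmod ((1 - Cexp w) / - w - 1) <= 3 * Cmod w).
  { rewrite Eu, Cmod_div by exact Hw0'. apply Rle_div_l; [exact Hp|].
    replace (3 * Cmod w * Cmod w) with (3 * Cmod w ^ 2) by ring. apply Cexp_quadratic. lra. }
  assert (Hne : (1 - Cexp w)%C <> 0).
  { intro E. rewrite E in Hu. replace (0 / - w - 1)%C with (- (1))%C in Hu by (field; exact Hw0').
    rewrite Cmod_opp, Cmod_1 in Hu. lra. }
  apply Rle_trans with (8 * Cmod ((1 - Cexp w) / - w - 1)); [|lra].
  apply Clog_diff; [exact Hw0|exact Hne| |lra].
  pose proof (snd_1_minus_Cexp w) as Hs. pose proof (fst_1_minus_Cexp w) as Hf.
  pose proof (exp_pos (fst w)) as Hex.
  destruct (Rtotal_order (snd w) 0) as [H|[H|H]].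
  - assert (A1 : 0 < snd (- w)%C) by (change (0 < - snd w); lra).
    assert (A2 : 0 < snd (1 - Cexp w)%C).
    { rewrite Hs. pose proof (sin_gt_0 (- snd w) ltac:(lra) ltac:(lra)) as S0. rewrite sin_neg in S0. nra. }
    pose proof (Carg_pos _ A1). pose proof (Carg_pos _ A2). apply Rabs_lt_between. lra.
  - unfold cone in Hw. rewrite H, Rabs_R0 in Hw.
    assert (A1 : 0 < fst (- w)%C) by (change (0 < - fst w); lra).
    assert (A2 : 0 < fst (1 - Cexp w)%C).
    { rewrite Hf, H, cos_0. assert (exp (fst w) < 1) by (rewrite <- exp_0; apply exp_increasing; lra). lra. }
    pose proof (Carg_right _ A1). pose proof (Carg_right _ A2). apply Rabs_lt_between. lra.
  - assert (A1 : snd (- w)%C < 0) by (change (- snd w < 0); lra).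
    assert (A2 : snd (1 - Cexp w)%C < 0).
    { rewrite Hs. pose proof (sin_gt_0 (snd w) ltac:(lra) ltac:(lra)). nra. }
    pose proof (Carg_neg _ A1). pose proof (Carg_neg _ A2). apply Rabs_lt_between. lra.
Qed.

Lemma Clog_1 : Clog 1 = 0.
Proof.
  unfold Clog, Carg. rewrite Cmod_1, ln_1. cbn [fst snd RtoC].
  destruct (Rle_dec 0 0) as [_|H]; [|lra]. unfold Rdiv. rewrite Rinv_1, Rmult_1_r, acos_1. reflexivity.
Qed.

Lemma cderiv_one_minus_power (a : R) (z : C) : slit (1 - z) ->
  cderiv (fun z => Cpower (1 - z) (RtoC (- a))) z (RtoC a * Cpower (1 - z) (RtoC (- a)) / (1 - z))%C.
Proof.
  intros H. pose proof (slit_neq_0 _ H). eapply cderiv_val.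
  - apply (cderiv_comp (fun u => Cpower u (RtoC (- a))) (fun z => 1 - z)%C).
    + apply cderiv_minus; [apply cderiv_const|apply cderiv_id].
    + apply cderiv_Cpower, H.
  - rewrite RtoC_opp. field. assumption.
Qed.

Lemma slit_one_minus (z : C) : Cmod z < 1 -> slit (1 - z).
Proof.
  intros H. left. pose proof (Re_le_Cmod z) as H1. apply Rabs_le_between in H1.
  change (0 < 1 + - fst z). lra.
Qed.

Lemma holo_disc_power (a : R) : holo_disc (fun z => Cpower (1 - z) (RtoC (- a))) 1.
Proof. intros z Hz. eexists. apply cderiv_one_minus_power, slit_one_minus, Hz. Qed.

(** The function satisfies [(1 - z) F' = a F]. In the coordinate [w] this says that the derivative
    of the periodic function [Th] is a combination of two coefficient integrands; its integral is 0,
    which is the recursion of [binc]. *)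
Lemma mcoef_power (a x : R) (n : nat) : x < 0 ->
  mcoef (fun z => Cpower (1 - z) (RtoC (- a))) n x = RtoC (binc a n).
Proof.
  intros Hx. set (F := fun z => Cpower (1 - z) (RtoC (- a))).
  assert (Hx1 : exp x < 1) by (rewrite <- exp_0; apply exp_increasing, Hx).
  pose proof PI_RGT_0 as Hpi.
  assert (HF : holo_disc F 1) by apply holo_disc_power.
  induction n as [|n IH].
  - simpl binc.
    assert (HF0 : F 0 = 1).
    { unfold F, Cpower. replace (1 - 0)%C with (RtoC 1) by ring. rewrite Clog_1.
      replace (RtoC (- a) * 0)%C with (RtoC 0) by ring. apply Cexp_0. }
    destruct (HF 0) as [l Hl]; [rewrite Cmod_0; lra|].
    destruct (Hl 1 Rlt_0_1) as [r [Hr H]].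
    apply (mcoef_extract F (fun _ => 1) O 1 r (1 + Cmod l) x HF Hx1 Hr).
    intros z Hz. specialize (H z). replace (z - 0)%C with z in H by ring. specialize (H Hz).
    rewrite HF0 in H. simpl csum. replace (F z - (0 + 1 * 1))%C with ((F z - 1 - l * z) + l * z)%C by ring.
    eapply Rle_trans; [apply Cmod_triangle|]. rewrite Cmod_mult. simpl pow. lra.
  - set (Th := fun w => (F (Cexp w) * (1 - Cexp w) * Cexp (- (RtoC (INR (S n)) * w)))%C).
    assert (HTh : forall w, fst w < 0 ->
      cderiv Th w (RtoC (a + INR n) * mcoef_int F n w - RtoC (INR (S n)) * mcoef_int F (S n) w)%C).
    { intros w Hw.
      assert (Hm : Cmod (Cexp w) < 1).
      { rewrite Cmod_Cexp, <- exp_0. apply exp_increasing, Hw. }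
      pose proof (slit_one_minus _ Hm) as Hsl. pose proof (slit_neq_0 _ Hsl) as Hne.
      eapply cderiv_val.
      - apply cderiv_mult; [apply cderiv_mult|].
        + apply (cderiv_comp F Cexp); [apply cderiv_Cexp|]. apply cderiv_one_minus_power, Hsl.
        + apply cderiv_minus; [apply cderiv_const|apply cderiv_Cexp].
        + apply cderiv_Cexp_lin.
      - cbv beta. unfold mcoef_int. fold (F (Cexp w)).
        replace (Cexp (- (RtoC (INR n) * w))) with (Cexp w * Cexp (- (RtoC (INR (S n)) * w)))%C.
        + rewrite S_INR, !RtoC_plus. field. exact Hne.
        + rewrite <- Cexp_plus. f_equal. rewrite S_INR, RtoC_plus. ring. }
    assert (X : forall k, ex_CInt (fun y => mcoef_int F k (x, y)) (- PI) PI).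
    { intro k. apply ex_CInt_rcont. intros; eapply mcoef_int_cont; eassumption. }
    assert (HC : forall k t, rcont (fun y => mcoef_int F k (x, y)) t).
    { intros; eapply mcoef_int_cont; eassumption. }
    assert (XS : forall k (c : C), ex_CInt (fun y => c * mcoef_int F k (x, y))%C (- PI) PI).
    { intros k c. apply ex_CInt_scal, X. }
    assert (E : CInt (fun y => Ci * (RtoC (a + INR n) * mcoef_int F n (x, y)
       - RtoC (INR (S n)) * mcoef_int F (S n) (x, y)))%C (- PI) PI = (Th (x, PI) - Th (x, (- PI)%R))%C).
    { apply (CInt_deriv (fun y => Th (x, y))).
      - intros t _. eapply rderiv_val; [apply (rderiv_comp Th (fun y => (x, y))); [apply rderiv_vertical|apply HTh, Hx]|]. ring.
      - intros t _. apply rcont_mult; [apply rcont_const|].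
        apply (rcont_plus (fun y => RtoC (a + INR n) * mcoef_int F n (x, y))%C
          (fun y => - (RtoC (INR (S n)) * mcoef_int F (S n) (x, y)))%C).
        + apply rcont_mult; [apply rcont_const|apply HC].
        + apply (rcont_comp Copp); [apply rcont_mult; [apply rcont_const|apply HC]|].
          eapply cderiv_ccont, cderiv_opp, cderiv_id. }
    rewrite CInt_scal in E.
    2:{ apply (@ex_RInt_minus C_R_NormedModule (fun y => RtoC (a + INR n) * mcoef_int F n (x, y))%C
           (fun y => RtoC (INR (S n)) * mcoef_int F (S n) (x, y))%C); apply XS. }
    rewrite (CInt_minus (fun y => RtoC (a + INR n) * mcoef_int F n (x, y))%C
           (fun y => RtoC (INR (S n)) * mcoef_int F (S n) (x, y))%C) in E by apply XS.
    rewrite !CInt_scal in E by apply X.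
    assert (E0 : (Th (x, PI) - Th (x, (- PI)%R))%C = 0).
    { replace (Th (x, PI)) with (Th (x, (- PI)%R)); [ring|].
      unfold Th. rewrite !Cexp_opp, !Cexp_INR_mult.
      replace (Cexp (x, PI)) with (Cexp (x, (- PI)%R)); [reflexivity|].
      rewrite <- Cexp_periodic. do 2 f_equal. ring. }
    rewrite E0 in E.
    assert (E1 : (RtoC (a + INR n) * CInt (fun y => mcoef_int F n (x, y)) (- PI) PI =
        RtoC (INR (S n)) * CInt (fun y => mcoef_int F (S n) (x, y)) (- PI) PI)%C).
    { set (u := (RtoC (a + INR n) * CInt (fun y => mcoef_int F n (x, y)) (- PI) PI)%C) in *.
      set (v := (RtoC (INR (S n)) * CInt (fun y => mcoef_int F (S n) (x, y)) (- PI) PI)%C) in *.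
      pose proof Ci_neq_0. transitivity (/ Ci * (Ci * (u - v)) + v)%C; [field; assumption|].
      rewrite E. ring. }
    unfold mcoef in IH |- *. pose proof RtoC_2PI_neq_0 as N2.
    assert (NS : RtoC (INR (S n)) <> 0).
    { intro Z. apply RtoC_inj in Z. rewrite S_INR in Z. pose proof (pos_INR n). lra. }
    transitivity (/ RtoC (INR (S n)) * (/ RtoC (2 * PI) * (RtoC (INR (S n)) * CInt (fun y => mcoef_int F (S n) (x, y)) (- PI) PI)))%C.
    { field. split; assumption. }
    rewrite <- E1.
    transitivity (/ RtoC (INR (S n)) * RtoC (a + INR n) * (/ RtoC (2 * PI) * CInt (fun y => mcoef_int F n (x, y)) (- PI) PI))%C.
    { field. split; assumption. }
    rewrite IH, <- RtoC_inv by (apply not_0_INR; lia). rewrite <- !RtoC_mult. f_equal. simpl binc. rewrite S_INR in *.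
    pose proof (pos_INR n). field. lra.
Qed.

Section Hankel.
Variables (m p q a : R).
Hypothesis (Hm : 0 < m) (Hp : 0 < p) (Hq : 0 < q) (Hpq : p * p + q * q = 1) (Hslope : p < m * q).
Hypothesis Ha : 0 < a.
Variable Q : C -> C.
Hypothesis HQ : forall w, cone m w -> cderiv Q w (Cpower (- w) (RtoC (- a)) * Cexp (- w))%C.

(** The integral of [(-w)^-a e^-w] over a Hankel contour whose arms are cut at distance [T]. *)
Let Del (T : R) : C := (Q ((T * p)%R, (T * q)%R) - Q ((T * p)%R, (- (T * q))%R))%C.

Lemma hankel_ray (T T' sg : R) : 1 <= T -> T <= T' -> sg = 1 \/ sg = -1 ->
  Cmod (Q (T' * p, sg * (T' * q)) - Q (T * p, sg * (T * q))) <= / p * exp (- (p * T)).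
Proof.
  intros HT HTT Hsg.
  assert (Hb : forall t, 0 <= t -> Cmod (t * p, sg * (t * q)) = t).
  { intros t Ht. unfold Cmod; cbn [fst snd].
    replace ((t * p) ^ 2 + (sg * (t * q)) ^ 2) with (t * t); [apply sqrt_square, Ht|].
    assert (sg * sg = 1) by (destruct Hsg as [-> | ->]; ring).
    replace ((t * p) ^ 2 + (sg * (t * q)) ^ 2) with (t * t * (p * p + (sg * sg) * (q * q))) by ring.
    rewrite H, Rmult_1_l, Hpq. ring. }
  assert (Hcone : forall t, 0 < t -> cone m (t * p, sg * (t * q))).
  { intros t Ht. unfold cone; cbn [fst snd].
    assert (E : Rabs (sg * (t * q)) = t * q).
    { rewrite Rabs_mult, (Rabs_pos_eq (t * q)) by nra.
      destruct Hsg as [-> | ->]; [rewrite Rabs_R1|rewrite Rabs_left by lra]; ring. }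
    rewrite E. nra. }
  eapply Rle_trans.
  - apply (mean_value_inequality (fun t => Q (t * p, sg * (t * q)))
      (fun t => (Cpower (- (t * p, sg * (t * q))%R) (RtoC (- a)) * Cexp (- (t * p, sg * (t * q))%R)) * (p, (sg * q)%R))%C
      (fun t => - / p * exp (- (p * t))) (fun t => exp (- (p * t))) T T' HTT).
    + intros t Ht. apply (rderiv_comp Q (fun t => (t * p, sg * (t * q)))).
      * intros eps He. destruct (rderiv_affine 0 (p, sg * q) t eps He) as [dd [Hdd HH]].
        exists dd. split; [exact Hdd|]. intros u Hu. specialize (HH u Hu).
        replace ((u * p, sg * (u * q)) : C) with (0 + RtoC u * (p, (sg * q)%R))%C
          by (unfold Cplus, Cmult, RtoC; cbn [fst snd]; f_equal; ring).
        replace ((t * p, sg * (t * q)) : C) with (0 + RtoC t * (p, (sg * q)%R))%C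
          by (unfold Cplus, Cmult, RtoC; cbn [fst snd]; f_equal; ring).
        exact HH.
      * apply HQ, Hcone. lra.
    + intros t _. apply is_derive_Reals. auto_derive; [trivial|]. field. lra.
    + intros t Ht. rewrite !Cmod_mult, Cmod_Cpower, Cmod_opp, Cmod_Cexp, Hb by lra.
      replace (Cmod (p, (sg * q)%R)) with 1.
      2:{ rewrite <- (Hb 1) by lra. f_equal. f_equal; ring. }
      replace (fst (- ((t * p)%R, (sg * (t * q))%R))%C) with (- (p * t)) by (cbn [fst Copp]; ring).
      assert (Rpower t (- a) <= 1).
      { rewrite Rpower_Ropp. rewrite <- Rinv_1. apply Rinv_le_contravar; [lra|]. apply Rpower_ge_1; lra. }
      pose proof (exp_pos (- (p * t))). pose proof (Rpower_pos t (- a)). nra.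
  - pose proof (exp_pos (- (p * T'))). pose proof (Rinv_0_lt_compat _ Hp). nra.
Qed.

Lemma hankel_cauchy (T T' : R) : 1 <= T -> T <= T' -> Cmod (Del T' - Del T) <= 2 / p * exp (- (p * T)).
Proof.
  intros HT HTT. pose proof (hankel_ray T T' 1 HT HTT (or_introl eq_refl)) as H1.
  pose proof (hankel_ray T T' (-1) HT HTT (or_intror eq_refl)) as H2.
  assert (R2 : forall r, -1 * r = - r) by (intro; ring).
  rewrite !Rmult_1_l in H1. rewrite !R2 in H2.
  unfold Del.
  replace (Q ((T' * p)%R, (T' * q)%R) - Q ((T' * p)%R, (- (T' * q))%R) - (Q ((T * p)%R, (T * q)%R) - Q ((T * p)%R, (- (T * q))%R)))%C
    with ((Q ((T' * p)%R, (T' * q)%R) - Q ((T * p)%R, (T * q)%R)) - (Q ((T' * p)%R, (- (T' * q))%R) - Q ((T * p)%R, (- (T * q))%R)))%C by ring.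
  eapply Rle_trans; [apply Cmod_minus_le|]. unfold Rdiv. lra.
Qed.

(** If the sine vanishes, the height is either 0, where the cone forces a negative abscissa, or at
    least [PI] in modulus and below 4, where the cosine is not positive. *)
Lemma wedge_slit (s : R) (w : C) : wedge s m w -> slit (1 - Cexp w).
Proof.
  intros [H1 [_ H3]]. unfold slit. rewrite fst_1_minus_Cexp, snd_1_minus_Cexp.
  pose proof (exp_pos (fst w)) as He. pose proof PI2_3_2 as HPI. unfold PI2 in HPI.
  apply Rabs_lt_between in H1.
  destruct (Req_dec (sin (snd w)) 0) as [Es|Es].
  - left. destruct (Req_dec (snd w) 0) as [E0|E0].
    + unfold cone in H3. rewrite E0, Rabs_R0 in H3. rewrite E0, cos_0.
      assert (exp (fst w) < 1) by (rewrite <- exp_0; apply exp_increasing; lra). lra.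
    + assert (Hcos : cos (snd w) <= 0); [|nra].
      destruct (Rle_dec 0 (snd w)).
      * apply cos_le_0; [|lra]. apply Rnot_lt_le. intro. pose proof (sin_gt_0 (snd w)). lra.
      * rewrite <- cos_neg. apply cos_le_0; [|lra]. apply Rnot_lt_le. intro.
        pose proof (sin_gt_0 (- snd w)) as S0. rewrite sin_neg in S0. lra.
  - right. intro E. apply Es. nra.
Qed.

Lemma Cmod_one_minus_exp_ge (w : C) : exp (fst w) - 1 <= Cmod (1 - Cexp w).
Proof.
  pose proof (Cmod_triangle_sub (Cexp w) 1) as H. rewrite Cmod_Cexp, Cmod_1 in H.
  rewrite (Cmod_minus_sym 1). exact H.
Qed.

Lemma Rpower_ge_self (x d : R) : 0 < x <= 1 -> d <= 1 -> x <= Rpower x d.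
Proof.
  intros [H1 H2] Hd. rewrite <- (Rpower_1 x H1) at 1. unfold Rpower. apply exp_le_compat.
  assert (ln x <= 0).
  { rewrite <- ln_1. destruct H2 as [H2|H2]; [left; now apply ln_increasing|right; now rewrite H2]. }
  nra.
Qed.

(** At abscissa [x1] the circle leaves the disc in which [F] is known to be holomorphic; only the
    two endpoints are used there. Both are shifted left, by periodicity without changing the
    increment, to a circle inside the disc. *)
Lemma wedge_coefficient (F P : C -> C) (k : C) (n : nat) (s x x1 : R) : k <> 0 ->
  holo_disc F 1 -> x < 0 -> wedge s m (x1, PI) -> wedge s m (x1, (- PI)%R) ->
  (forall w, wedge s m w -> cderiv P w (k * mcoef_int F n w)%C) ->
  (P (x1, PI) - P (x1, (- PI)%R) = k * (RtoC (2 * PI) * Ci * mcoef F n x))%C.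
Proof.
  intros Hk HF Hx Hw1 Hw2 HP.
  assert (Hlow : forall y, y < 0 -> exp y < 1) by (intros y Hy; rewrite <- exp_0; now apply exp_increasing).
  (* At a negative abscissa the cone condition holds at every height, so the whole segment lies in
     the wedge. *)
  set (x' := Rmin (x1) (Rmin (s - 1) (-1))).
  assert (H1 : x' <= x1) by apply Rmin_l.
  assert (H2 : x' <= s - 1) by (eapply Rle_trans; [apply Rmin_r|apply Rmin_l]).
  assert (H3 : x' <= -1) by (eapply Rle_trans; apply Rmin_r).
  rewrite (mcoef_indep F n 1 x x' HF) by (apply Hlow; lra).
  assert (Hlt := PI_lt_4). pose proof PI_RGT_0 as Hpi.
  rewrite <- (mcoef_primitive F (fun w => / k * P w)%C n x' 1 HF).
  - rewrite <- (primitive_vertical_diff (wedge s m) P (fun w => k * mcoef_int F n w)%C x1 (- PI) PI) with (x := x').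
    + field. exact Hk.
    + apply wedge_left_convex.
    + exact HP.
    + exact Hw2.
    + exact Hw1.
    + intros u _. apply (f_equal (Cmult k)). replace PI with (- PI + 2 * PI) at 1 by ring.
      apply mcoef_int_period.
    + exact H1.
  - apply Hlow. lra.
  - intros y Hy. eapply cderiv_val.
    + apply cderiv_scal, HP. unfold wedge, cone; cbn [fst snd].
      pose proof (Rabs_pos y). assert (Rabs y <= PI) by (apply Rabs_le; lra).
      assert (0 <= m * Rabs y) by (apply Rmult_le_pos; lra). lra.
    + field. exact Hk.
Qed.

(** The exponent is bounded by [24 b |w|], and [4 b] is its value at [|w| = 1/6]. *)
Lemma power_ratio_bound (w : C) (b : R) : 0 <= b -> cone m w -> Cmod w <= 1 / 6 ->
  Cmod (Cpower (1 - Cexp w) (RtoC (- b)) * Cpower (- w) (RtoC b) - 1) <= 24 * b * exp (4 * b) * Cmod w.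
Proof.
  intros Hb Hc Hs. unfold Cpower. rewrite <- Cexp_plus.
  replace (RtoC (- b) * Clog (1 - Cexp w) + RtoC b * Clog (- w))%C
    with (- (RtoC b * (Clog (1 - Cexp w) - Clog (- w))))%C by (rewrite RtoC_opp; ring).
  pose proof (Clog_one_minus_exp m w Hm Hc Hs) as HL.
  set (L := (Clog (1 - Cexp w) - Clog (- w))%C) in *.
  assert (HbL : Cmod (- (RtoC b * L)) <= 24 * b * Cmod w).
  { rewrite Cmod_opp, Cmod_mult, Cmod_R, Rabs_pos_eq by exact Hb.
    replace (24 * b * Cmod w) with (b * (24 * Cmod w)) by ring. apply Rmult_le_compat_l; assumption. }
  eapply Rle_trans; [apply Cmod_Cexp_m1|].
  replace (24 * b * exp (4 * b) * Cmod w) with (24 * b * Cmod w * exp (4 * b)) by ring.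
  apply Rmult_le_compat; [apply Cmod_ge_0|left; apply exp_pos|exact HbL|].
  apply exp_le_compat. eapply Rle_trans; [exact HbL|]. nra.
Qed.
(* The coefficients of [(1-z)^-a] are known in closed form; comparing them with the
   contour estimate for this function identifies the constant. *)
Lemma hankel_subsequence (eps T0 : R) : 0 < eps ->
  exists T, T0 <= T /\ Cmod (Del T - RtoC (2 * PI) * Ci * RtoC (/ Gamma a)) <= eps.
Proof.
  intros He.
  (* The relative error of the prefactor is of first order, which allows 1; the contour estimate
     needs [d <= al], here [a]. *)
  set (d := Rmin 1 a).
  assert (Hd0 : 0 < d) by (apply Rmin_glb_lt; lra).
  assert (Hd1 : d <= 1) by apply Rmin_l. assert (Hda : d <= a) by apply Rmin_r.
  pose proof (exp_pos (4 * a)) as Hex.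
  destruct (contour_transfer unit (fun _ w => Cpower (1 - Cexp w) (RtoC (- a))) (fun _ _ => RtoC 0)
     (fun _ => a) (fun _ => 1) m 1 d (24 * a * exp (4 * a)) (1 / 6) a 1 1 p q)
     as [rho0 [Cst [N0 [Hrho [HCst [x1 HT]]]]]]; try assumption; try lra;
     try (intros _; lra).
  - apply Rmult_le_pos; lra.
  - intros _ w [_ [_ Hw]] Hw6.
    pose proof (slit_neq_0 _ (cone_slit m w Hm Hw)) as Hw0.
    assert (Hwp : 0 < Cmod w) by (rewrite <- Cmod_opp; apply Cmod_neq0, Hw0).
    eapply Rle_trans; [apply power_ratio_bound; [lra|exact Hw|lra]|].
    apply Rmult_le_compat_l; [apply Rmult_le_pos; lra|]. apply Rpower_ge_self; lra.
  - intros _ w _ _. replace (0 - RtoC (1 - 1) * w)%C with (RtoC 0) by (rewrite RtoC_minus; ring).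
    rewrite Cmod_0. pose proof (Cmod_ge_0 w). pose proof (Rpower_pos (Cmod w) d).
    apply Rmult_le_pos; [apply Rmult_le_pos; lra|apply Rmult_le_pos; lra].
  (* With [B = 0] the exponent is [-w], so every vertical line right of the axis gives decay by its
     abscissa. *)
  - intros r Hr. exists (r / 2). split; [lra|]. exists (r / 2), (Rpower (r / 2) (- a)).
    split; [lra|]. split; [left; apply Rpower_pos|]. intros _ y _ _. cbn [fst RtoC]. split; [lra|].
    rewrite Cmod_Cpower. apply Rpower_le_base_neg; [lra| |lra].
    eapply Rle_trans; [|apply Cmod_one_minus_exp_ge]. cbn [fst]. pose proof (exp_ineq1_le (r / 2)). lra.
  - set (F := fun z => Cpower (1 - z) (RtoC (- a))) in *.
    pose proof (binc_lim a Ha) as HL. apply is_lim_seq_spec in HL.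
    assert (Hpi := PI_RGT_0).
    destruct (HL (mkposreal (eps / (4 * PI)) ltac:(apply Rdiv_lt_0_compat; lra))) as [N1 HN1]. cbn [pos] in HN1.
    destruct (INR_unbounded (Rmax (T0 / rho0) (Rpower (2 * Cst / eps + 1) (/ d)))) as [N2 HN2].
    set (n := (S (N0 + N1 + N2))).
    assert (HnN : INR N2 <= INR n) by (apply le_INR; unfold n; lia).
    pose proof (Rmax_l (T0 / rho0) (Rpower (2 * Cst / eps + 1) (/ d))) as M1.
    pose proof (Rmax_r (T0 / rho0) (Rpower (2 * Cst / eps + 1) (/ d))) as M2.
    assert (Hn0 : 0 < INR n) by (apply lt_0_INR; unfold n; lia).
    exists (INR n * rho0). split.
    { assert (HT0 : T0 / rho0 <= INR n) by lra. apply Rle_div_l in HT0; lra. }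
    destruct (wedge_primitive 1 m (mcoef_int F n) Rlt_0_1 Hm) as [P HP].
    { intros w Hw. apply (cderiv_mcoef_int F n w (RtoC a * F (Cexp w) / (1 - Cexp w))%C).
      apply cderiv_one_minus_power, (wedge_slit _ _ Hw). }
    destruct (HT tt n P Q) as [W1 [W2 HB]]; [unfold n; lia| |exact HQ|].
    { intros w Hw. eapply cderiv_val; [apply HP, Hw|]. unfold mcoef_int, F. do 2 f_equal. ring. }
    rewrite (wedge_coefficient F P 1 n 1 (-1) x1) in HB; try assumption; try lra.
    + cbv beta in HB. rewrite !Rmult_1_r in HB. fold (Del (INR n * rho0)) in HB.
      unfold F in HB. rewrite mcoef_power in HB by lra. fold F in HB.
      set (D := Del (INR n * rho0)) in *. set (N := INR n) in *.
      set (r := Rpower N (a - 1)) in *. pose proof (Rpower_pos N (a - 1)) as Hr. fold r in Hr.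
      assert (HNd : Rpower N (a - 1 - d) = r * Rpower N (- d)).
      { unfold r. rewrite <- Rpower_plus. f_equal. }
      rewrite HNd in HB.
      assert (B1 : Cmod (D - RtoC (2 * PI) * Ci * RtoC (binc a n * Rpower N (1 - a))) <= Cst * Rpower N (- d)).
      { apply Rmult_le_reg_l with r; [exact Hr|].
        replace (r * (Cst * Rpower N (- d))) with (Cst * (r * Rpower N (- d))) by ring.
        eapply Rle_trans; [|exact HB]. right.
        assert (E : (RtoC (Rpower N (1 - a)) * RtoC r = 1)%C).
        { rewrite <- RtoC_mult. f_equal. unfold r. rewrite <- Rpower_plus.
          replace (1 - a + (a - 1)) with 0 by ring. apply Rpower_O, Hn0. }
        replace (1 * (RtoC (2 * PI) * Ci * RtoC (binc a n)) - RtoC r * D)%C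
          with (- (RtoC r * (D - RtoC (2 * PI) * Ci * RtoC (binc a n * Rpower N (1 - a)))))%C.
        - rewrite Cmod_opp, Cmod_mult, Cmod_R, (Rabs_pos_eq r) by lra. reflexivity.
        - rewrite (RtoC_mult (binc a n)).
          transitivity (RtoC (2 * PI) * Ci * RtoC (binc a n) * (RtoC (Rpower N (1 - a)) * RtoC r) - RtoC r * D)%C; [ring|].
          rewrite E. ring. }
      assert (B2 : Rabs (binc a n * Rpower N (1 - a) - / Gamma a) < eps / (4 * PI)).
      { apply (HN1 (N0 + N1 + N2)%nat). lia. }
      assert (B3 : Cst * Rpower N (- d) <= eps / 2).
      { rewrite Rpower_Ropp. apply Rle_div_l; [apply Rpower_pos|].
        assert (HRN : 2 * Cst / eps + 1 <= Rpower N d).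
        { assert (Hpos : 0 < 2 * Cst / eps + 1).
          { assert (0 <= 2 * Cst / eps) by (apply Rdiv_le_0_compat; lra). lra. }
          replace (2 * Cst / eps + 1) with (Rpower (Rpower (2 * Cst / eps + 1) (/ d)) d)
            by (rewrite Rpower_mult, Rinv_l, Rpower_1; lra).
          apply Rpower_le_base; [apply Rpower_pos|lra|lra]. }
        assert (eps / 2 * (2 * Cst / eps + 1) = Cst + eps / 2) by (field; lra). nra. }
      replace (D - RtoC (2 * PI) * Ci * RtoC (/ Gamma a))%C with
        ((D - RtoC (2 * PI) * Ci * RtoC (binc a n * Rpower N (1 - a)))
         + RtoC (2 * PI) * Ci * RtoC (binc a n * Rpower N (1 - a) - / Gamma a))%C by (rewrite RtoC_minus; ring).
      eapply Rle_trans; [apply Cmod_triangle|]. rewrite !Cmod_mult, Cmod_Ci, !Cmod_R, (Rabs_pos_eq (2 * PI)) by lra.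
      assert (2 * PI * (eps / (4 * PI)) = eps / 2) by (field; lra). nra.
    + intro E. apply RtoC_inj in E. lra.
    + apply holo_disc_power.
    + intros w Hw. eapply cderiv_val; [apply HP, Hw|]. ring.
Qed.

(** [Del] is a Cauchy family with an exponential rate, so its approach to the constant along some
    arbitrarily large [T] fixes the limit and the rate. The bound does not involve [a], hence it is
    uniform in [v]. *)
Theorem hankel_constant (T : R) : 1 <= T ->
  Cmod (Del T - RtoC (2 * PI) * Ci * RtoC (/ Gamma a)) <= 2 / p * exp (- (p * T)).
Proof.
  intros HT. apply le_epsilon. intros eps He.
  destruct (hankel_subsequence eps T He) as [T' [HT' H]].
  pose proof (hankel_cauchy T T' HT HT') as H1.
  replace (Del T - RtoC (2 * PI) * Ci * RtoC (/ Gamma a))%C with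
    ((Del T' - RtoC (2 * PI) * Ci * RtoC (/ Gamma a)) - (Del T' - Del T))%C by ring.
  eapply Rle_trans; [apply Cmod_minus_le|]. lra.
Qed.
End Hankel.

(** * The domain [Delta0] in logarithmic coordinates *)

Lemma Carg_gt (phi : R) (z : C) : 0 < phi < PI / 2 -> z <> 0 -> fst z < cos phi * Cmod z ->
  phi < Rabs (Carg z).
Proof.
  intros Hphi Hz H. pose proof (Cmod_neq0 z Hz) as Hp. destruct (Carg_spec z Hz) as [Hb [Hc _]].
  apply Rnot_le_lt. intro Hle.
  assert (Hcos : cos phi <= cos (Carg z)).
  { replace (cos (Carg z)) with (cos (Rabs (Carg z))).
    - apply cos_decr_1; pose proof (Rabs_pos (Carg z)); lra.
    - unfold Rabs. destruct (Rcase_abs (Carg z)); [apply cos_neg|reflexivity]. }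
  rewrite Hc in Hcos. apply Rle_div_r in Hcos; lra.
Qed.

Section Domain.
Variables (R0 eta phi : R).
Hypothesis (HR : 0 < R0) (Heta : 0 < eta) (Hphi : 0 < phi < PI / 2).

Let rad := Cmod (1 + RtoC eta * (cos phi, sin phi)).

Definition dom_s : R := ln rad.
(* A third of the slope [cot phi] of the boundary of [Delta0] at [R0], which leaves room
   for the curvature of the exponential. *)
Definition dom_m : R := cos phi / (3 * sin phi).

Lemma cos_phi_pos : 0 < cos phi.
Proof. apply cos_gt_0; lra. Qed.

Lemma sin_phi_pos : 0 < sin phi.
Proof. apply sin_gt_0; lra. Qed.

Lemma rad_gt_1 : 1 < rad.
Proof.
  pose proof cos_phi_pos. eapply Rlt_le_trans; [|apply (Rle_trans _ _ _ (Rle_abs _) (Re_le_Cmod _))].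
  unfold Cplus, Cmult, RtoC; cbn [fst snd]. nra.
Qed.

Lemma dom_s_pos : 0 < dom_s.
Proof. unfold dom_s. rewrite <- ln_1. apply ln_increasing; [lra|apply rad_gt_1]. Qed.

Lemma dom_m_pos : 0 < dom_m.
Proof. unfold dom_m. pose proof cos_phi_pos. pose proof sin_phi_pos. apply Rdiv_lt_0_compat; lra. Qed.

Lemma cos_pos_lt_PI2 (y : R) : Rabs y < 4 -> 0 < cos y -> Rabs y <= PI / 2.
Proof.
  intros Hy Hc. pose proof PI2_3_2 as HPI. unfold PI2 in HPI.
  apply Rnot_lt_le. intro Hlt.
  assert (H : cos (Rabs y) <= 0) by (apply cos_le_0; lra).
  revert H. unfold Rabs. destruct (Rcase_abs y); [rewrite cos_neg|]; lra.
Qed.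

(** Put [ze = e^w - 1] and [w = x + i y]. When [Re ze > 0], then [Re ze <= x e^x] and
    [|Im ze| >= e^x |y| / 3]; the common factor [e^x] cancels, and what remains is the cone of slope
    [cot phi / 3]. Otherwise the condition on the argument is immediate. *)
Lemma Delta0_wedge (w : C) : wedge dom_s dom_m w -> Delta0 R0 eta phi (RtoC R0 * Cexp w).
Proof.
  intros Hw. pose proof (wedge_slit dom_m dom_s w Hw) as Hsl.
  pose proof (slit_neq_0 _ Hsl) as Hne.
  destruct Hw as [H1 [H2 H3]]. unfold cone in H3.
  pose proof cos_phi_pos as Hc. pose proof sin_phi_pos as Hs. pose proof rad_gt_1 as Hr.
  assert (HR0 : RtoC R0 <> 0) by (intro E; apply RtoC_inj in E; lra).
  assert (Ez : (RtoC R0 * Cexp w - RtoC R0)%C = (RtoC R0 * (Cexp w - 1))%C) by ring.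
  assert (Hz : (Cexp w - 1)%C <> 0).
  { intro E. apply Hne. replace (1 - Cexp w)%C with (- (Cexp w - 1))%C by ring. rewrite E. ring. }
  unfold Delta0. split; [|split].
  - rewrite Cmod_mult, Cmod_R, Rabs_pos_eq by lra. apply Rmult_lt_compat_l; [exact HR|].
    rewrite Cmod_Cexp. fold rad. rewrite <- (exp_ln rad) by lra. apply exp_increasing. exact H2.
  - intro E. apply Hz. transitivity (/ RtoC R0 * (RtoC R0 * Cexp w - RtoC R0))%C; [field; exact HR0|].
    rewrite E. ring.
  - rewrite Ez. apply Carg_gt; [exact Hphi|now apply Cmult_neq_0|].
    rewrite Cmod_mult, Cmod_R, Rabs_pos_eq by lra.
    set (ze := (Cexp w - 1)%C) in *.
    replace (fst (RtoC R0 * ze)%C) with (R0 * fst ze) by (unfold Cmult, RtoC; cbn [fst snd]; ring).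
    assert (Hgoal : fst ze < cos phi * Cmod ze); [|nra].
    pose proof (Cmod_neq0 ze Hz) as Hzp.
    destruct (Rle_dec (fst ze) 0) as [Hle|Hgt]; [nra|].
    assert (Hgt' : 0 < fst ze) by lra.
    assert (Ef : fst ze = exp (fst w) * cos (snd w) - 1).
    { unfold ze, Cexp, Cminus, Copp, Cplus, RtoC; cbn [fst snd]. ring. }
    assert (Es : snd ze = exp (fst w) * sin (snd w)).
    { unfold ze, Cexp, Cminus, Copp, Cplus, RtoC; cbn [fst snd]. ring. }
    pose proof (exp_pos (fst w)) as He.
    assert (Hcos : 0 < cos (snd w)) by nra.
    pose proof (COS_bound (snd w)) as Hcb.
    assert (He1 : 1 < exp (fst w)) by nra.
    assert (Hx : 0 < fst w).
    { apply exp_lt_inv. rewrite exp_0. exact He1. }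
    pose proof (cos_pos_lt_PI2 _ H1 Hcos) as Hy.
    assert (Hsin : Rabs (snd w) / 3 <= Rabs (sin (snd w))).
    { pose proof (sin_ge_third (Rabs (snd w)) (conj (Rabs_pos _) Hy)) as Hq.
      eapply Rle_trans; [exact Hq|]. unfold Rabs at 1. destruct (Rcase_abs (snd w)); [rewrite sin_neg|].
      - rewrite <- Rabs_Ropp. apply Rle_abs.
      - apply Rle_abs. }
    assert (Hf1 : fst ze <= fst w * exp (fst w)).
    { assert (exp (fst w) - 1 <= fst w * exp (fst w)).
      { pose proof (exp_ineq1_le (- fst w)) as L. rewrite exp_Ropp in L.
        apply Rmult_le_compat_l with (r := exp (fst w)) in L; [|lra]. rewrite Rinv_r in L by lra. lra. }
      nra. }
    assert (Hm3 : fst w * sin phi < cos phi * (Rabs (snd w) / 3)).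
    { apply Rmult_lt_compat_r with (r := sin phi) in H3; [|exact Hs].
      replace (dom_m * Rabs (snd w) * sin phi) with (cos phi * (Rabs (snd w) / 3)) in H3; [exact H3|].
      unfold dom_m. field. lra. }
    assert (Him : fst ze * sin phi < cos phi * Rabs (snd ze)).
    { rewrite Es, Rabs_mult, (Rabs_pos_eq (exp (fst w))) by lra.
      apply Rle_lt_trans with (exp (fst w) * (fst w * sin phi)).
      { replace (exp (fst w) * (fst w * sin phi)) with (fst w * exp (fst w) * sin phi) by ring.
        apply Rmult_le_compat_r; lra. }
      replace (cos phi * (exp (fst w) * Rabs (sin (snd w)))) with (exp (fst w) * (cos phi * Rabs (sin (snd w)))) by ring.
      apply Rmult_lt_compat_l; [exact He|]. apply Rlt_le_trans with (1 := Hm3). apply Rmult_le_compat_l; lra. }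
    pose proof (Cmod_sqr ze) as Hsq.
    assert (Hsc : sin phi * sin phi + cos phi * cos phi = 1) by (exact (sin2_cos2 phi)).
    assert (Hsn : Rabs (snd ze) * Rabs (snd ze) = snd ze * snd ze).
    { rewrite <- Rabs_mult. apply Rabs_pos_eq. nra. }
    apply Rnot_le_lt. intro Hcontra.
    assert (A1 : (cos phi * Cmod ze) * (cos phi * Cmod ze) <= fst ze * fst ze).
    { apply Rmult_le_compat; try assumption; apply Rmult_le_pos; lra. }
    assert (A2 : (fst ze * sin phi) * (fst ze * sin phi) < (cos phi * Rabs (snd ze)) * (cos phi * Rabs (snd ze))).
    { assert (0 < fst ze * sin phi) by nra. nra. }
    nra.
Qed.

Lemma Delta0_disc (z : C) : Cmod z < R0 -> Delta0 R0 eta phi z.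
Proof.
  intros Hz. pose proof cos_phi_pos as Hc. pose proof rad_gt_1 as Hr.
  assert (Hf : fst (z - RtoC R0)%C < 0).
  { pose proof (Re_le_Cmod z) as H. apply Rabs_le_between in H. change (fst z + - R0 < 0). lra. }
  assert (Hne : (z - RtoC R0)%C <> 0) by (intro E; rewrite E in Hf; simpl in Hf; lra).
  unfold Delta0. split; [|split].
  - fold rad. nra.
  - intros ->. apply Hne. ring.
  - apply Carg_gt; [exact Hphi|exact Hne|]. pose proof (Cmod_neq0 _ Hne). nra.
Qed.

Lemma bigO_wedge (F G : C -> C) (d0 : R) : 0 <= d0 -> bigO_at (Delta0 R0 eta phi) R0 F G d0 ->
  exists K e0, 0 <= K /\ 0 < e0 <= 1 / 6 /\ forall w, wedge dom_s dom_m w -> Cmod w < e0 ->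
    Cmod (F (RtoC R0 * Cexp w)%C - G (RtoC R0 * Cexp w)%C) <= K * Rpower (Cmod w) d0.
Proof.
  intros Hd [K [eps [Heps H]]].
  (* The 3 bounds [|e^w - 1| / |w|] for small [w]; 1/6 is the range of [Clog_one_minus_exp]. *)
  exists (Rabs K * Rpower 3 d0), (Rmin (1 / 6) (eps / (3 * R0))).
  pose proof (Rabs_pos K) as HK. pose proof (Rpower_pos 3 d0) as H3.
  assert (Hq : 0 < eps / (3 * R0)) by (apply Rdiv_lt_0_compat; lra).
  split; [apply Rmult_le_pos; lra|]. split; [split; [apply Rmin_glb_lt; lra|apply Rmin_l]|].
  intros w Hw Hsm.
  assert (Hs1 := Rlt_le_trans _ _ _ Hsm (Rmin_l _ _)). assert (Hs2 := Rlt_le_trans _ _ _ Hsm (Rmin_r _ _)).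
  assert (HR0 : RtoC R0 <> 0) by (intro E; apply RtoC_inj in E; lra).
  pose proof (slit_neq_0 _ (wedge_slit _ _ _ Hw)) as Hne. pose proof (Cmod_neq0 _ Hne) as Hnp.
  pose proof (slit_neq_0 _ (cone_slit _ _ dom_m_pos (proj2 (proj2 Hw)))) as Hw0.
  assert (Hwp : 0 < Cmod w) by (rewrite <- Cmod_opp; apply Cmod_neq0, Hw0).
  assert (E1 : Cmod (Cexp w - 1) <= 3 * Cmod w).
  { eapply Rle_trans; [apply Cmod_Cexp_m1|]. rewrite Rmult_comm. apply Rmult_le_compat_r; [lra|].
    eapply Rle_trans; [apply exp_le_compat|apply exp_1_le_3]. lra. }
  specialize (H (RtoC R0 * Cexp w)%C (Delta0_wedge w Hw)).
  replace (RtoC R0 * Cexp w - RtoC R0)%C with (RtoC R0 * (Cexp w - 1))%C in H by ring.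
  replace (1 - RtoC R0 * Cexp w / RtoC R0)%C with (1 - Cexp w)%C in H by (field; exact HR0).
  rewrite Cmod_mult, Cmod_R, Rabs_pos_eq in H by lra.
  assert (Hlt : R0 * Cmod (Cexp w - 1) < eps).
  { apply Rle_lt_trans with (R0 * (3 * Cmod w)); [apply Rmult_le_compat_l; lra|].
    replace eps with (R0 * (3 * (eps / (3 * R0)))) by (field; lra). nra. }
  eapply Rle_trans; [exact (H Hlt)|].
  apply Rle_trans with (Rabs K * Rpower (Cmod (1 - Cexp w)) d0).
  - apply Rmult_le_compat_r; [left; apply Rpower_pos|apply Rle_abs].
  - rewrite Rmult_assoc, Rpower_mult_distr by lra. apply Rmult_le_compat_l; [exact HK|].
    apply Rpower_le_base; [exact Hnp| |exact Hd]. rewrite Cmod_minus_sym. exact E1.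
Qed.

Lemma Rpower_le_exponent_small (x a b : R) : 0 < x <= 1 -> a <= b -> Rpower x b <= Rpower x a.
Proof.
  intros [H1 H2] Hab. unfold Rpower. apply exp_le_compat.
  assert (ln x <= 0).
  { rewrite <- ln_1. destruct H2 as [H2|H2]; [left; now apply ln_increasing|right; now rewrite H2]. }
  nra.
Qed.

Lemma expansion_kappa (G : C -> C) (g0 g1 delta d : R) : 0 < d <= 1 -> d <= delta ->
  bigO_at (Delta0 R0 eta phi) R0 G
     (fun z => Cminus (RtoC g0) (Cmult (RtoC g1) (Cminus (RtoC 1) (Cdiv z (RtoC R0))))) (1 + delta) ->
  exists K e0, 0 <= K /\ 0 < e0 <= 1 / 6 /\ forall w, wedge dom_s dom_m w -> Cmod w < e0 ->
    Cmod (G (RtoC R0 * Cexp w)%C - RtoC g0 - RtoC g1 * w) <= K * (Cmod w * Rpower (Cmod w) d).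
Proof.
  intros Hd Hdd HG. destruct (bigO_wedge _ _ (1 + delta) ltac:(lra) HG) as [K [e0 [HK [He0 H]]]].
  exists (K + Rabs g1 * 3), e0. pose proof (Rabs_pos g1) as Hg1.
  split; [lra|]. split; [exact He0|]. intros w Hw Hsm. specialize (H w Hw Hsm).
  assert (HR0 : RtoC R0 <> 0) by (intro E; apply RtoC_inj in E; lra).
  pose proof (slit_neq_0 _ (cone_slit _ _ dom_m_pos (proj2 (proj2 Hw)))) as Hw0.
  assert (Hwp : 0 < Cmod w) by (rewrite <- Cmod_opp; apply Cmod_neq0, Hw0).
  replace (1 - RtoC R0 * Cexp w / RtoC R0)%C with (1 - Cexp w)%C in H by (field; exact HR0).
  replace (G (RtoC R0 * Cexp w) - RtoC g0 - RtoC g1 * w)%C with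
    ((G (RtoC R0 * Cexp w) - (RtoC g0 - RtoC g1 * (1 - Cexp w))) + RtoC g1 * (Cexp w - 1 - w))%C by ring.
  eapply Rle_trans; [apply Cmod_triangle|]. rewrite Cmod_mult, Cmod_R, Rmult_plus_distr_r.
  apply Rplus_le_compat.
  - eapply Rle_trans; [exact H|]. apply Rmult_le_compat_l; [exact HK|].
    rewrite Rpower_plus, Rpower_1 by exact Hwp. apply Rmult_le_compat_l; [lra|].
    apply Rpower_le_exponent_small; lra.
  - rewrite Rmult_assoc. apply Rmult_le_compat_l; [exact Hg1|].
    eapply Rle_trans; [apply Cexp_quadratic; lra|]. apply Rmult_le_compat_l; [lra|].
    simpl pow. rewrite Rmult_1_r. apply Rmult_le_compat_l; [lra|]. apply Rpower_ge_self; lra.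
Qed.

(** Every power is [Cexp] of a multiple of [Clog], so all factors but [e] merge into one exponential
    [Cexp t] without branch questions. In [K3] the part [v2 * K2] is the remainder of [g_theta], the
    part with 24 is the change from [Clog (1 - e^w)] to [Clog (- w)]. *)
Lemma expansion_f_theta (f G : C -> C) (beta ts delta d v2 : R) : 0 < d <= 1 -> d <= delta ->
  0 <= beta -> 0 <= ts -> 0 <= v2 ->
  bigO_at (Delta0 R0 eta phi) R0
       (fun z => Cdiv (f z) (Cpower (Cminus (RtoC 1) (Cdiv z (RtoC R0))) (RtoC (- beta))))
       (fun _ => RtoC 1) delta ->
  bigO_at (Delta0 R0 eta phi) R0 G
     (fun z => Copp (Cmult (RtoC ts) (Clog (Cminus (RtoC 1) (Cdiv z (RtoC R0)))))) delta ->
  exists K e0, 0 <= K /\ 0 < e0 <= 1 / 6 /\ forall v w, 0 <= v <= v2 ->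
    wedge dom_s dom_m w -> Cmod w < e0 ->
    Cmod (f (RtoC R0 * Cexp w)%C * Cexp (RtoC v * G (RtoC R0 * Cexp w)%C) * Cpower (- w) (RtoC (v * ts + beta)) - 1)
      <= K * Rpower (Cmod w) d.
Proof.
  intros Hd Hdd Hbeta Hts Hv2 Hf HG.
  destruct (bigO_wedge _ _ delta ltac:(lra) Hf) as [K1 [e1 [HK1 [He1 H1]]]].
  destruct (bigO_wedge _ _ delta ltac:(lra) HG) as [K2 [e2 [HK2 [He2 H2]]]].
  set (K3 := v2 * K2 + (v2 * ts + beta) * 24).
  assert (Hvt : 0 <= v2 * ts) by (now apply Rmult_le_pos).
  assert (HK3 : 0 <= K3).
  { unfold K3. assert (0 <= v2 * K2) by (now apply Rmult_le_pos). nra. }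
  pose proof (exp_pos K3) as HeK.
  exists ((K1 + K3) * exp K3), (Rmin e1 e2).
  split; [apply Rmult_le_pos; lra|].
  split; [split; [apply Rmin_glb_lt; lra|eapply Rle_trans; [apply Rmin_l|lra]]|].
  intros v w Hv Hw Hsm.
  specialize (H1 w Hw (Rlt_le_trans _ _ _ Hsm (Rmin_l _ _))).
  specialize (H2 w Hw (Rlt_le_trans _ _ _ Hsm (Rmin_r _ _))).
  assert (Hw6 : Cmod w <= 1 / 6) by (pose proof (Rlt_le_trans _ _ _ Hsm (Rmin_l _ _)); lra).
  assert (HR0 : RtoC R0 <> 0) by (intro E; apply RtoC_inj in E; lra).
  pose proof (slit_neq_0 _ (cone_slit _ _ dom_m_pos (proj2 (proj2 Hw)))) as Hw0.
  assert (Hwp : 0 < Cmod w) by (rewrite <- Cmod_opp; apply Cmod_neq0, Hw0).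
  replace (1 - RtoC R0 * Cexp w / RtoC R0)%C with (1 - Cexp w)%C in H1, H2 by (field; exact HR0).
  set (z := (RtoC R0 * Cexp w)%C) in *.
  set (pw := Cpower (1 - Cexp w) (RtoC (- beta))) in *.
  assert (Hpw : pw <> 0) by apply Cpower_neq_0.
  set (e := (f z / pw)%C) in *.
  set (t := (RtoC v * (G z - - (RtoC ts * Clog (1 - Cexp w))) - RtoC (v * ts + beta) * (Clog (1 - Cexp w) - Clog (- w)))%C).
  assert (Ef : (f z * Cexp (RtoC v * G z) * Cpower (- w) (RtoC (v * ts + beta)))%C = (e * Cexp t)%C).
  { replace (f z) with (e * pw)%C by (unfold e; field; exact Hpw).
    rewrite <- !Cmult_assoc. f_equal. unfold pw, Cpower. rewrite <- !Cexp_plus. f_equal.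
    unfold t. rewrite RtoC_opp, RtoC_plus, (RtoC_mult v ts). ring. }
  rewrite Ef.
  assert (Hr : Rpower (Cmod w) delta <= Rpower (Cmod w) d) by (apply Rpower_le_exponent_small; lra).
  assert (Hr1 : Rpower (Cmod w) d <= 1) by (apply Rpower_le_1; lra).
  pose proof (Rpower_pos (Cmod w) d) as Hr0.
  assert (Hself : Cmod w <= Rpower (Cmod w) d) by (apply Rpower_ge_self; lra).
  pose proof (Clog_one_minus_exp dom_m w dom_m_pos (proj2 (proj2 Hw)) Hw6) as HL.
  assert (Ht : Cmod t <= K3 * Rpower (Cmod w) d).
  { unfold t. eapply Rle_trans; [apply Cmod_minus_le|]. rewrite !Cmod_mult, !Cmod_R.
    rewrite (Rabs_pos_eq v) by lra. rewrite (Rabs_pos_eq (v * ts + beta)) by nra.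
    unfold K3. rewrite (Rmult_plus_distr_r (v2 * K2)). apply Rplus_le_compat.
    - rewrite Rmult_assoc. apply Rmult_le_compat; [lra|apply Cmod_ge_0|lra|].
      eapply Rle_trans; [exact H2|]. apply Rmult_le_compat_l; lra.
    - rewrite Rmult_assoc. apply Rmult_le_compat; [nra|apply Cmod_ge_0|nra|].
      eapply Rle_trans; [exact HL|]. lra. }
  assert (Ht3 : Cmod t <= K3) by nra.
  assert (Hexp : Cmod (Cexp t) <= exp K3).
  { eapply Rle_trans; [apply Cmod_Cexp_le|]. now apply exp_le_compat. }
  replace (e * Cexp t - 1)%C with ((e - 1) * Cexp t + (Cexp t - 1))%C by ring.
  eapply Rle_trans; [apply Cmod_triangle|]. rewrite Cmod_mult.
  replace ((K1 + K3) * exp K3 * Rpower (Cmod w) d) with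
    (K1 * Rpower (Cmod w) d * exp K3 + K3 * Rpower (Cmod w) d * exp K3) by ring.
  apply Rplus_le_compat.
  - apply Rmult_le_compat; try apply Cmod_ge_0; [|exact Hexp].
    eapply Rle_trans; [exact H1|]. apply Rmult_le_compat_l; lra.
  - eapply Rle_trans; [apply Cmod_Cexp_m1|].
    apply Rmult_le_compat; [apply Cmod_ge_0|left; apply exp_pos|exact Ht|now apply exp_le_compat].
Qed.
End Domain.

(** * Strict decay away from the singularity *)

Lemma cos_eq_1_sub (a b : R) : cos a = 1 -> cos b = 1 -> cos (a - b) = 1.
Proof.
  intros Ha Hb. rewrite cos_minus.
  pose proof (sin2_cos2 a) as H1. unfold Rsqr in H1. rewrite Ha in H1.
  assert (sin a = 0) by nra. rewrite Ha, Hb, H. ring.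
Qed.

Lemma cos_eq_1_mult (y : R) (k : nat) : cos y = 1 -> cos (INR k * y) = 1.
Proof.
  intros H. induction k as [|k IH].
  - simpl. rewrite Rmult_0_l. apply cos_0.
  - replace (INR (S k) * y) with (INR k * y - - y) by (rewrite S_INR; ring).
    apply cos_eq_1_sub; [exact IH|]. now rewrite cos_neg.
Qed.

Lemma cos_lt_1 (y : R) : 0 < Rabs y < 4 -> cos y < 1.
Proof.
  intros Hy. pose proof PI2_3_2 as HPI. unfold PI2 in HPI.
  replace (cos y) with (cos (Rabs y)) by (unfold Rabs; destruct (Rcase_abs y); [apply cos_neg|reflexivity]).
  replace (Rabs y) with (2 * (Rabs y / 2)) by field. rewrite cos_2a_sin.
  assert (0 < sin (Rabs y / 2)) by (apply sin_gt_0; lra). nra.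
Qed.

(** The [j] with [cos (j y) = 1] are closed under remainders. If they contained the support of
    [kappa], the least positive one would divide the support, and it is not 1 because [cos y < 1].
    If there is no positive one, the support is empty and 2 divides it vacuously. *)
Lemma non_arithmetic_cos (kappa : nat -> R) (y : R) : non_arithmetic kappa -> 0 < Rabs y < 4 ->
  exists j, (1 <= j)%nat /\ kappa j <> 0 /\ cos (INR j * y) < 1.
Proof.
  intros Hna Hy. apply Classical_Prop.NNPP. intro Hn.
  assert (Hall : forall j, (1 <= j)%nat -> kappa j <> 0 -> cos (INR j * y) = 1).
  { intros j Hj Hk. apply Rle_antisym; [apply COS_bound|]. apply Rnot_lt_le. intro. apply Hn. now exists j. }
  destruct (Classical_Prop.classic (exists j, (1 <= j)%nat /\ cos (INR j * y) = 1)) as [Hex|Hno].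
  - assert (Hmin : exists q, ((1 <= q)%nat /\ cos (INR q * y) = 1) /\
       forall n, (n < q)%nat -> ~ ((1 <= n)%nat /\ cos (INR n * y) = 1)).
    { destruct Hex as [j Hj]. revert Hj. induction j as [j IH] using (well_founded_induction Wf_nat.lt_wf). intros Hj.
      destruct (Classical_Prop.classic (exists n, (n < j)%nat /\ (1 <= n)%nat /\ cos (INR n * y) = 1)) as [[n [H1 H2]]|H].
      - exact (IH n H1 H2).
      - exists j. split; [exact Hj|]. intros n Hnj Hc. apply H. now exists n. }
    destruct Hmin as [q [[Hq1 Hq2] Hq3]].
    apply Hna. exists q. split.
    + destruct (Nat.eq_dec q 1) as [->|]; [|lia]. simpl in Hq2. rewrite Rmult_1_l in Hq2.
      pose proof (cos_lt_1 y Hy). lra.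
    + intros j Hj Hk. specialize (Hall j Hj Hk).
      assert (Hmod : cos (INR (j mod q) * y) = 1).
      { pose proof (Nat.div_mod j q ltac:(lia)) as Hd. apply (f_equal INR) in Hd. rewrite plus_INR, mult_INR in Hd.
        replace (INR (j mod q) * y) with (INR j * y - INR (j / q) * (INR q * y)) by (rewrite Hd; ring).
        apply cos_eq_1_sub; [exact Hall|]. now apply cos_eq_1_mult. }
      apply Nat.Lcm0.mod_divide. apply Classical_Prop.NNPP. intro Hne.
      apply (Hq3 (j mod q)); [apply Nat.mod_upper_bound; lia|]. split; [lia|exact Hmod].
  - apply Hna. exists 2%nat. split; [lia|]. intros j Hj Hk. exfalso. apply Hno. exists j. split; [exact Hj|]. now apply Hall.
Qed.

(** Finitely many neighbourhoods turn the pointwise strict inequality on the axis into a uniform one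
    on a strip to its right. At each point one number serves as radius and as gain, and so does the
    resulting [c]. *)
Lemma compact_strict (F : C -> C) (g a b : R) : a <= b ->
  (forall y, a <= y <= b -> ccont F (0, y)) -> (forall y, a <= y <= b -> fst (F (0, y)) < g) ->
  exists c, 0 < c /\ forall x y, 0 <= x <= c -> a <= y <= b -> fst (F (x, y)) <= g - c.
Proof.
  intros Hab HF Hg.
  assert (Hd : forall t, exists e : posreal, a <= t <= b -> forall w, Cmod (w - (0, t)) < 2 * e -> fst (F w) <= g - e).
  { intro t. destruct (Classical_Prop.classic (a <= t <= b)) as [Ht|Ht].
    - specialize (Hg t Ht). destruct (HF t Ht ((g - fst (F (0, t))) / 2)) as [d [Hd H]]; [lra|].
      assert (He : 0 < Rmin (d / 2) ((g - fst (F (0, t))) / 2)) by (apply Rmin_glb_lt; lra).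
      exists (mkposreal _ He). cbn [pos]. intros _ w Hw.
      pose proof (Rmin_l (d / 2) ((g - fst (F (0, t))) / 2)). pose proof (Rmin_r (d / 2) ((g - fst (F (0, t))) / 2)).
      specialize (H w ltac:(lra)). pose proof (Re_le_Cmod (F w - F (0, t))) as H3.
      change (fst (F w - F (0%R, t))%C) with (fst (F w) - fst (F (0, t))) in H3.
      apply Rabs_le_between in H3. lra.
    - exists (mkposreal 1 Rlt_0_1). intro; contradiction. }
  set (delta := fun t => proj1_sig (constructive_indefinite_description _ (Hd t))).
  assert (Hdel : forall t, a <= t <= b -> forall w, Cmod (w - (0, t)) < 2 * delta t -> fst (F w) <= g - delta t).
  { intros t. exact (proj2_sig (constructive_indefinite_description _ (Hd t))). }
  destruct (compactness_value_1d a b delta) as [d H].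
  exists d. split; [apply cond_pos|]. intros x y Hx Hy.
  apply Classical_Prop.NNPP. intro Hn. apply (H y Hy). intros [t [Ht [Hyt Hdt]]]. apply Hn.
  apply Rle_trans with (g - delta t); [|lra]. apply Hdel; [exact Ht|].
  replace ((x, y) - (0%R, t))%C with ((x - 0, y - t) : C) by reflexivity.
  eapply Rle_lt_trans; [apply Cmod_le_parts|]. rewrite Rminus_0_r, (Rabs_pos_eq x) by lra. lra.
Qed.

Lemma csum_R (a : nat -> R) (r : R) (n : nat) :
  csum (fun k => RtoC (a k) * RtoC r ^ k)%C (S n) = RtoC (sum_n (fun k => scal (pow_n r k) (a k)) n).
Proof.
  induction n as [|n IH].
  - rewrite sum_O. simpl. unfold scal, mult, one; simpl. unfold mult, one; simpl. rewrite Rmult_1_l. ring.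
  - rewrite sum_Sn. set (S0 := sum_n (fun k => scal (pow_n r k) (a k)) n) in *.
    change (csum (fun k => RtoC (a k) * RtoC r ^ k)%C (S n) + RtoC (a (S n)) * RtoC r ^ S n
      = RtoC (S0 + pow_n r (S n) * a (S n)))%C.
    rewrite IH, pow_n_pow, <- RtoC_pow, <- RtoC_mult, <- RtoC_plus. f_equal. ring.
Qed.

Lemma PSeries_csum (a : nat -> R) (r : R) (l : C) :
  cseries_eps (fun n => RtoC (a n)) (RtoC r) l -> PSeries a r = fst l.
Proof.
  intros H. apply is_pseries_unique. unfold is_pseries, is_series. apply filterlim_locally. intros eps.
  destruct (H eps (cond_pos eps)) as [n0 Hn]. exists n0. intros n Hnn.
  specialize (Hn (S n) ltac:(lia)). rewrite csum_R in Hn.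
  exact (Rle_lt_trans _ _ _ (Re_le_Cmod (RtoC _ - l)) Hn).
Qed.

(** Termwise this is [cos <= 1]; the defect of the single term [j] is kept. *)
Lemma csum_cos_le (a : nat -> R) (r y : R) (j n : nat) : (forall k, 0 <= a k) -> 0 <= r ->
  fst (csum (fun k => RtoC (a k) * (RtoC r * Cexp (0%R, y)) ^ k)%C n)
    + (if Compare_dec.lt_dec j n then a j * r ^ j * (1 - cos (INR j * y)) else 0)
  <= fst (csum (fun k => RtoC (a k) * RtoC r ^ k)%C n).
Proof.
  intros Ha Hr.
  assert (Hterm : forall k, fst (RtoC (a k) * (RtoC r * Cexp (0%R, y)) ^ k)%C = a k * r ^ k * cos (INR k * y)).
  { intro k. rewrite Cpow_mult_l, <- Cexp_INR_mult, <- RtoC_pow.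
    unfold Cexp, Cmult, RtoC; cbn [fst snd].
    replace (INR k * 0 - 0 * y) with 0 by ring. rewrite exp_0.
    replace (INR k * y + 0 * 0) with (INR k * y) by ring. ring. }
  assert (Hterm' : forall k, fst (RtoC (a k) * RtoC r ^ k)%C = a k * r ^ k).
  { intro k. rewrite <- RtoC_pow. unfold Cmult, RtoC; cbn [fst snd]. ring. }
  assert (Hpos : forall k, 0 <= a k * r ^ k) by (intro k; apply Rmult_le_pos; [apply Ha|apply pow_le, Hr]).
  induction n as [|n IH].
  - simpl. destruct (Compare_dec.lt_dec j 0); [lia|lra].
  - simpl csum. cbn [fst Cplus]. rewrite Hterm, Hterm'.
    pose proof (COS_bound (INR n * y)) as Hc. specialize (Hpos n) as Hn.
    destruct (Compare_dec.lt_dec j n), (Compare_dec.lt_dec j (S n)); try lia.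
    + nra.
    + assert (j = n) by lia. subst j. nra.
    + nra.
Qed.

(** * The real part of [g_kappa] on and to the right of the axis *)

Section Kappa.
Variables (kappa : nat -> R) (R0 eta phi g0 g1 : R) (G : C -> C).
Hypothesis (Hkn : forall j, 0 <= kappa j) (Hna : non_arithmetic kappa).
Hypothesis (HR : 0 < R0) (Heta : 0 < eta) (Hphi : 0 < phi < PI / 2).
Hypothesis Hext : forall z, Cmod z < R0 ->
     @is_pseries C_AbsRing C_NormedModule (fun n => RtoC (gcoef kappa n)) z (G z).
Hypothesis Hhol : holo (Delta0 R0 eta phi) G.
Hypothesis Hlim : filterlim (PSeries (gcoef kappa)) (at_left R0) (locally g0).

Let s := dom_s eta phi.
Let m := dom_m phi.
Let gt (w : C) : C := G (RtoC R0 * Cexp w).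

Lemma gcoef_nonneg (n : nat) : 0 <= gcoef kappa n.
Proof.
  destruct n as [|n]; simpl; [lra|]. apply Rdiv_le_0_compat; [apply Hkn|].
  apply (lt_0_INR (S n)). lia.
Qed.

Lemma holo_log : holo (wedge s m) gt.
Proof.
  intros w Hw. destruct (Hhol _ (Delta0_wedge R0 eta phi HR Heta Hphi w Hw)) as [l Hl].
  eexists. apply (cderiv_comp G (fun w => RtoC R0 * Cexp w)%C); [apply cderiv_scal, cderiv_Cexp|exact Hl].
Qed.

Lemma wedge_axis (y : R) : 0 < Rabs y < 4 -> wedge s m (0, y).
Proof.
  intros Hy. pose proof (dom_s_pos eta phi Heta Hphi). pose proof (dom_m_pos phi Hphi).
  unfold wedge, cone; cbn [fst snd]. repeat split; try lra; try apply H; apply Rmult_lt_0_compat; [exact H0|lra].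
Qed.

(** The series is only used inside the disc: there the term [j] alone costs a defect at least [D],
    the same for all radii above [R0 / 2], and this survives the passage to the circle. *)
Lemma axis_decay (y : R) : 0 < Rabs y < 4 -> fst (gt (0, y)) < g0.
Proof.
  intros Hy. destruct (non_arithmetic_cos kappa y Hna Hy) as [j [Hj1 [Hj2 Hj3]]].
  set (D := gcoef kappa j * (R0 / 2) ^ j * (1 - cos (INR j * y))).
  assert (HD : 0 < D).
  { unfold D. apply Rmult_lt_0_compat; [|lra]. apply Rmult_lt_0_compat; [|apply pow_lt; lra].
    destruct j as [|j]; [lia|]. simpl gcoef. apply Rdiv_lt_0_compat; [|apply (lt_0_INR (S j)); lia].
    specialize (Hkn (S j)). lra. }
  assert (Hin : forall r, R0 / 2 <= r < R0 -> fst (G (RtoC r * Cexp (0%R, y))%C) <= PSeries (gcoef kappa) r - D).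
  { intros r Hr.
    assert (H1 : Cmod (RtoC r * Cexp (0%R, y)) < R0).
    { rewrite Cmod_mult, Cmod_R, Cmod_Cexp, Rabs_pos_eq by lra. cbn [fst]. rewrite exp_0. lra. }
    assert (H2 : Cmod (RtoC r) < R0) by (rewrite Cmod_R, Rabs_pos_eq; lra).
    pose proof (is_pseries_cseries _ _ _ (Hext _ H1)) as S1.
    pose proof (is_pseries_cseries _ _ _ (Hext _ H2)) as S2.
    rewrite (PSeries_csum _ _ _ S2).
    apply le_epsilon. intros eps He.
    destruct (S1 (eps / 2) ltac:(lra)) as [n1 Hn1]. destruct (S2 (eps / 2) ltac:(lra)) as [n2 Hn2].
    set (n := (n1 + n2 + S j)%nat). specialize (Hn1 n ltac:(unfold n; lia)). specialize (Hn2 n ltac:(unfold n; lia)).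
    pose proof (csum_cos_le (gcoef kappa) r y j n gcoef_nonneg ltac:(lra)) as L.
    destruct (Compare_dec.lt_dec j n) as [_|Hno]; [|unfold n in Hno; lia].
    pose proof (Rle_lt_trans _ _ _ (Re_le_Cmod _) Hn1) as L1. pose proof (Rle_lt_trans _ _ _ (Re_le_Cmod _) Hn2) as L2.
    cbn [fst Cminus Cplus Copp] in L1, L2.
    apply Rabs_lt_between in L1. apply Rabs_lt_between in L2.
    assert (LD : D <= gcoef kappa j * r ^ j * (1 - cos (INR j * y))).
    { unfold D. apply Rmult_le_compat_r; [lra|]. apply Rmult_le_compat_l; [apply gcoef_nonneg|].
      apply pow_incr. lra. }
    lra. }
  apply Rnot_le_lt. intro Hge.
  destruct (holo_log _ (wedge_axis y Hy)) as [l Hl].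
  destruct (cderiv_ccont _ _ _ Hl (D / 2) ltac:(lra)) as [d [Hd Hc]].
  destruct (proj1 (filterlim_locally _ _) Hlim (mkposreal (D / 2) ltac:(lra))) as [e He]. cbn [pos] in He.
  assert (HeR : 0 < Rmin (R0 / 2) (e / 2)).
  { pose proof (cond_pos e). apply Rmin_glb_lt; lra. }
  (* A negative abscissa so close to 0 that both the continuity of [gt] at [(0, y)] and the radial
     limit [g0] are within [D / 2]. *)
  set (x := Rmax (- d / 2) (ln ((R0 - Rmin (R0 / 2) (e / 2)) / R0))).
  pose proof (Rmin_l (R0 / 2) (e / 2)) as Hm1. pose proof (Rmin_r (R0 / 2) (e / 2)) as Hm2.
  set (u := (R0 - Rmin (R0 / 2) (e / 2)) / R0) in *.
  assert (Hu : 0 < u < 1).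
  { unfold u. split; [apply Rdiv_lt_0_compat; lra|apply Rlt_div_l; lra]. }
  assert (Hlnu : ln u < 0) by (rewrite <- ln_1; apply ln_increasing; lra).
  assert (Hx0 : - d < x < 0).
  { unfold x. pose proof (Rmax_l (- d / 2) (ln u)). split; [lra|]. apply Rmax_lub_lt; lra. }
  assert (Hxu : u <= exp x).
  { rewrite <- (exp_ln u) by lra. apply exp_le_compat. apply Rmax_r. }
  assert (Hx1 : exp x < 1) by (rewrite <- exp_0; apply exp_increasing; lra).
  assert (HuR : R0 * u = R0 - Rmin (R0 / 2) (e / 2)) by (unfold u; field; lra).
  set (r := R0 * exp x).
  assert (Hr : R0 / 2 <= r < R0) by (unfold r; split; nra).
  assert (Hre : R0 - e < r) by (unfold r; pose proof (cond_pos e); nra).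
  specialize (He r). assert (HB : Rabs (PSeries (gcoef kappa) r - g0) < D / 2).
  { apply He; [|lra]. change (Rabs (r - R0) < e). rewrite Rabs_left; lra. }
  specialize (Hin r Hr). specialize (Hc (x, y)).
  assert (Hcc : Cmod (gt (x, y) - gt (0, y)) < D / 2).
  { apply Hc. replace ((x, y) - (0%R, y))%C with (RtoC x).
    - rewrite Cmod_R, Rabs_left; lra.
    - unfold Cminus, Cplus, Copp, RtoC; cbn [fst snd]. f_equal; ring. }
  assert (Eg : gt (x, y) = G (RtoC r * Cexp (0%R, y))%C).
  { unfold gt. rewrite (Cexp_split x y). unfold r. rewrite RtoC_mult. f_equal. ring. }
  rewrite <- Eg in Hin.
  pose proof (Rle_lt_trans _ _ _ (Re_le_Cmod _) Hcc) as L1. cbn [fst Cminus Cplus Copp] in L1.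
  apply Rabs_lt_between in L1. apply Rabs_lt_between in HB. lra.
Qed.

Section Gap.
Variables (K e0 d v1 v2 : R).
Hypothesis (HK : 0 <= K) (He0 : 0 < e0 <= 1 / 6) (Hd : 0 < d <= 1).
Hypothesis HE : forall w, wedge s m w -> Cmod w < e0 ->
    Cmod (gt w - RtoC g0 - RtoC g1 * w) <= K * (Cmod w * Rpower (Cmod w) d).
Hypothesis (Hv1 : 0 < v1) (Hv12 : v1 <= v2) (Hvg : v2 * g1 < 1).

(** The radius [rho] solves [rho (1 + m) = (m / 2) Y], the balance at which a point on the line of
    slope [m / 2], moved right and towards the axis by [rho], just reaches the boundary of slope
    [m]. *)
Lemma ball_wedge (w w' : C) : 0 <= fst w <= m / 2 * Rabs (snd w) -> 0 < Rabs (snd w) <= 1 ->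
  fst w < s / 2 -> m / (2 * (1 + m)) * Rabs (snd w) <= s / 2 ->
  Cmod (w' - w) < m / (2 * (1 + m)) * Rabs (snd w) -> wedge s m w' /\ Cmod w' <= 2 * (1 + m) * Rabs (snd w).
Proof.
  intros Hf Hs Hfs Hms Hw.
  pose proof (dom_m_pos phi Hphi) as Hm. fold m in Hm.
  set (Y := Rabs (snd w)) in *.
  assert (Hrho : m / (2 * (1 + m)) * Y * (1 + m) = m / 2 * Y) by (field; lra).
  assert (Hrho2 : m / (2 * (1 + m)) * Y <= Y / 2).
  { apply Rmult_le_reg_r with (1 + m); [lra|]. rewrite Hrho. nra. }
  set (rho := m / (2 * (1 + m)) * Y) in *.
  pose proof (Rle_lt_trans _ _ _ (Re_le_Cmod (w' - w)) Hw) as H1.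
  pose proof (Rle_lt_trans _ _ _ (Im_le_Cmod (w' - w)) Hw) as H2.
  change (fst (w' - w)%C) with (fst w' - fst w) in H1. change (snd (w' - w)%C) with (snd w' - snd w) in H2.
  apply Rabs_lt_between in H1.
  assert (HY1 : Y - rho < Rabs (snd w')).
  { pose proof (Rabs_triang_inv (snd w) (snd w')) as T. rewrite Rabs_minus_sym in T. fold Y in T. lra. }
  assert (HY2 : Rabs (snd w') < Y + rho).
  { pose proof (Rabs_triang_inv (snd w') (snd w)) as T. fold Y in T. lra. }
  split.
  - unfold wedge, cone. split; [lra|]. split; [lra|]. nra.
  - replace w' with (w + (w' - w))%C by ring. eapply Rle_trans; [apply Cmod_triangle|].
    assert (Cmod w <= (m / 2 + 1) * Y).
    { destruct w as [x y]. eapply Rle_trans; [apply Cmod_le_parts|]. cbn [fst snd] in *. rewrite (Rabs_pos_eq x) by lra.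
      fold Y. lra. }
    nra.
Qed.

(** Cauchy's estimate for the remainder of [gt] on the ball of [ball_wedge]: the radius is of order
    [Y] and the remainder of order [Y^(1 + d)], so the derivative is off by order [Y^d]. *)
Lemma near_axis_derivative (e : R) : 0 < e -> exists y2, 0 < y2 <= 1 /\ forall w l,
  0 <= fst w <= m / 2 * Rabs (snd w) -> 0 < Rabs (snd w) <= y2 ->
  cderiv gt w l -> Cmod (l - RtoC g1) <= e.
Proof.
  intros He. pose proof (dom_m_pos phi Hphi) as Hm. fold m in Hm.
  pose proof (dom_s_pos eta phi Heta Hphi) as Hs. fold s in Hs.
  set (C1 := 2 * (1 + m)). set (C2 := m / C1).
  assert (HC1 : 2 < C1) by (unfold C1; lra).
  assert (HC2 : 0 < C2) by (unfold C2; apply Rdiv_lt_0_compat; lra).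
  set (C3 := 4 * K * C1 / C2 + 1).
  assert (HC3 : 0 < C3).
  { unfold C3. assert (0 <= 4 * K * C1 / C2) by (apply Rdiv_le_0_compat; [repeat apply Rmult_le_pos; lra|lra]). lra. }
  (* After the cap 1, the bounds keep in turn the ball within [e0], the abscissa below [s / 2], the
     radius below [s / 2], and the resulting error below [e]. *)
  set (y2 := Rmin (Rmin 1 (e0 / (2 * C1))) (Rmin (Rmin (s / (4 * m)) (s / (2 * C2))) (Rpower (e / C3) (/ d) / C1))).
  assert (Hpos : 0 < y2).
  { unfold y2. repeat apply Rmin_glb_lt; try lra; apply Rdiv_lt_0_compat; try lra. apply Rpower_pos. }
  assert (H1 : y2 <= 1) by (eapply Rle_trans; apply Rmin_l).
  assert (H2 : y2 <= e0 / (2 * C1)) by (eapply Rle_trans; [apply Rmin_l|apply Rmin_r]).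
  assert (H3 : y2 <= s / (4 * m)) by (eapply Rle_trans; [apply Rmin_r|eapply Rle_trans; apply Rmin_l]).
  assert (H4 : y2 <= s / (2 * C2)) by (eapply Rle_trans; [apply Rmin_r|eapply Rle_trans; [apply Rmin_l|apply Rmin_r]]).
  assert (H5 : y2 <= Rpower (e / C3) (/ d) / C1) by (eapply Rle_trans; apply Rmin_r).
  exists y2. split; [lra|]. intros w l Hf Hy Hl.
  set (Y := Rabs (snd w)) in *.
  assert (HfS : fst w < s / 2).
  { apply Rle_lt_trans with (m / 2 * (s / (4 * m))).
    - eapply Rle_trans; [apply Hf|]. apply Rmult_le_compat_l; lra.
    - replace (m / 2 * (s / (4 * m))) with (s / 8) by (field; lra). lra. }
  assert (HC2Y : C2 * Y <= s / 2).
  { replace (s / 2) with (C2 * (s / (2 * C2))) by (field; lra). apply Rmult_le_compat_l; lra. }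
  assert (HB : forall w', Cmod (w' - w) < C2 * Y -> wedge s m w' /\ Cmod w' <= C1 * Y).
  { intros w' Hw'. apply ball_wedge; try assumption. fold Y. lra. }
  assert (HY0 : C1 * Y < e0).
  { apply Rle_lt_trans with (C1 * (e0 / (2 * C1))); [apply Rmult_le_compat_l; lra|].
    replace (C1 * (e0 / (2 * C1))) with (e0 / 2) by (field; lra). lra. }
  set (M := K * (C1 * Y * Rpower (C1 * Y) d)).
  assert (HCY : 0 < C1 * Y) by nra.
  apply Rle_trans with (4 * M / (C2 * Y)).
  - apply (cauchy_estimate (fun w => gt w - RtoC g0 - RtoC g1 * w)%C w); [nra| | |].
    + intros w' Hw'. destruct (HB w' Hw') as [W _]. destruct (holo_log w' W) as [l' Hl'].
      eexists. apply cderiv_minus; [apply cderiv_minus; [exact Hl'|apply cderiv_const]|apply cderiv_scal, cderiv_id].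
    + intros w' Hw'. destruct (HB w' Hw') as [W W']. eapply Rle_trans; [apply HE; [exact W|lra]|].
      unfold M. apply Rmult_le_compat_l; [exact HK|].
      pose proof (slit_neq_0 _ (cone_slit _ _ Hm (proj2 (proj2 W)))) as Hw0.
      assert (Hwp : 0 < Cmod w') by (rewrite <- Cmod_opp; apply Cmod_neq0, Hw0).
      apply Rmult_le_compat; [lra|left; apply Rpower_pos|exact W'|]. apply Rpower_le_base; lra.
    + eapply cderiv_val.
      * apply cderiv_minus; [apply cderiv_minus; [exact Hl|apply cderiv_const]|apply cderiv_scal, cderiv_id].
      * ring.
  - assert (HP : Rpower (C1 * Y) d <= e / C3).
    { apply Rle_trans with (Rpower (Rpower (e / C3) (/ d)) d).
      - apply Rpower_le_base; [exact HCY| |lra].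
        replace (Rpower (e / C3) (/ d)) with (C1 * (Rpower (e / C3) (/ d) / C1)) by (field; lra).
        apply Rmult_le_compat_l; lra.
      - rewrite Rpower_mult, Rinv_l by lra. rewrite Rpower_1; [lra|apply Rdiv_lt_0_compat; lra]. }
    replace (4 * M / (C2 * Y)) with (4 * K * C1 / C2 * Rpower (C1 * Y) d) by (unfold M; field; split; lra).
    apply Rle_trans with (C3 * (e / C3)); [|right; field; lra].
    apply Rmult_le_compat; [|left; apply Rpower_pos|unfold C3; lra|exact HP].
    apply Rdiv_le_0_compat; [repeat apply Rmult_le_pos; lra|lra].
Qed.

(** Above the height [y2], compactness on the axis gives a gain that does not depend on [x1]. Below
    it the value on the axis is already less than [g0], and moving right to [x1] adds at most
    [(g + e) x1]; times [v] this stays below [x1]. Since [y2] is fixed before [x1], there is no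
    circularity. *)
Theorem gap (r : R) : 0 < r -> exists x1, 0 < x1 < r /\ x1 < s /\ exists c', 0 < c' /\
  forall v y, v1 <= v <= v2 -> x1 <= m / 2 * Rabs y -> Rabs y <= PI ->
    v * (fst (gt (x1, y)) - g0) - x1 <= - c'.
Proof.
  intros Hr. pose proof (dom_m_pos phi Hphi) as Hm. fold m in Hm.
  pose proof (dom_s_pos eta phi Heta Hphi) as Hs. fold s in Hs.
  pose proof PI_lt_4 as Hpi4. pose proof PI2_3_2 as HPI. unfold PI2 in HPI.
  (* Nonnegative, so that [v (g + e)] is largest at [v2] whatever the sign of [g1]. *)
  set (g := Rmax g1 0).
  assert (Hg0 : 0 <= g) by apply Rmax_r. assert (Hg1 : g1 <= g) by apply Rmax_l.
  assert (Hgv : v2 * g < 1).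
  { unfold g, Rmax. destruct (Rle_dec g1 0); [lra|exact Hvg]. }
  (* Puts [v2 (g + e)] halfway between [v2 g] and 1; the remaining half is [sg]. *)
  set (e := (1 - v2 * g) / (2 * v2)).
  assert (He : 0 < e) by (apply Rdiv_lt_0_compat; lra).
  assert (Hve : v2 * (g + e) = (1 + v2 * g) / 2) by (unfold e; field; lra).
  set (sg := (1 - v2 * g) / 2). assert (Hsg : 0 < sg) by (unfold sg; lra).
  destruct (near_axis_derivative e He) as [y2 [Hy2 Hder]].
  destruct (compact_strict gt g0 y2 PI) as [ca [Hca Ha]]; [lra| | |].
  { intros y Hy. destruct (holo_log (0, y)) as [l Hl]; [apply wedge_axis; rewrite Rabs_pos_eq; lra|]. eapply cderiv_ccont, Hl. }
  { intros y Hy. apply axis_decay. rewrite Rabs_pos_eq; lra. }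
  destruct (compact_strict gt g0 (- PI) (- y2)) as [cb [Hcb Hb]]; [lra| | |].
  { intros y Hy. destruct (holo_log (0, y)) as [l Hl]; [apply wedge_axis; rewrite Rabs_left; lra|]. eapply cderiv_ccont, Hl. }
  { intros y Hy. apply axis_decay. rewrite Rabs_left; lra. }
  set (x1 := Rmin (Rmin r s) (Rmin ca cb) / 2).
  assert (Hx : 0 < Rmin (Rmin r s) (Rmin ca cb)) by (repeat apply Rmin_glb_lt; assumption).
  assert (B1 : Rmin (Rmin r s) (Rmin ca cb) <= r) by (eapply Rle_trans; apply Rmin_l).
  assert (B2 : Rmin (Rmin r s) (Rmin ca cb) <= s) by (eapply Rle_trans; [apply Rmin_l|apply Rmin_r]).
  assert (B3 : Rmin (Rmin r s) (Rmin ca cb) <= ca) by (eapply Rle_trans; [apply Rmin_r|apply Rmin_l]).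
  assert (B4 : Rmin (Rmin r s) (Rmin ca cb) <= cb) by (eapply Rle_trans; apply Rmin_r).
  assert (Hx1 : 0 < x1) by (unfold x1; lra).
  exists x1. split; [unfold x1 in *; lra|]. split; [unfold x1 in *; lra|].
  exists (Rmin (sg * x1) (Rmin (v1 * ca) (v1 * cb))). split.
  { repeat apply Rmin_glb_lt; apply Rmult_lt_0_compat; assumption. }
  intros v y Hv Hxy Hy.
  pose proof (Rmin_l (sg * x1) (Rmin (v1 * ca) (v1 * cb))) as M1.
  pose proof (Rmin_r (sg * x1) (Rmin (v1 * ca) (v1 * cb))) as M2.
  pose proof (Rmin_l (v1 * ca) (v1 * cb)) as M3. pose proof (Rmin_r (v1 * ca) (v1 * cb)) as M4.
  set (c' := Rmin (sg * x1) (Rmin (v1 * ca) (v1 * cb))) in *.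
  destruct (Rle_dec (Rabs y) y2) as [Hsmall|Hlarge].
  - assert (Hyp : 0 < Rabs y).
    { apply Rnot_le_lt. intro. assert (Rabs y = 0) by (pose proof (Rabs_pos y); lra). rewrite H0 in Hxy. lra. }
    assert (Hax : fst (gt (0, y)) < g0) by (apply axis_decay; lra).
    assert (Hbox : forall t, 0 <= t <= x1 -> wedge s m (t, y)).
    { intros t Ht. unfold wedge, cone; cbn [fst snd]. split; [lra|]. split; [unfold x1 in *; lra|]. nra. }
    assert (HMV : Cmod ((gt (x1, y) - RtoC g1 * (x1, y)) - (gt (0, y) - RtoC g1 * (0%R, y))) <= e * (x1 - 0)).
    { set (dg := fun w => epsilon (inhabits (RtoC 0)) (fun l => cderiv gt w l)).
      assert (Hdg : forall w, wedge s m w -> cderiv gt w (dg w)).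
      { intros w Hw. apply epsilon_spec. apply holo_log, Hw. }
      apply (mean_value_const (fun t => gt (t, y) - RtoC g1 * (t, y))%C (fun t => dg (t, y) - RtoC g1)%C); [lra| |].
      - intros t Ht. eapply rderiv_val.
        + apply (rderiv_comp (fun w => gt w - RtoC g1 * w)%C (fun t => (t, y))); [apply rderiv_horizontal|].
          apply cderiv_minus; [apply Hdg, Hbox, Ht|apply cderiv_scal, cderiv_id].
        + ring.
      - intros t Ht. apply (Hder (t, y)); cbn [fst snd]; [lra|lra|]. apply Hdg, Hbox, Ht. }
    pose proof (Rle_trans _ _ _ (Re_le_Cmod _) HMV) as L.
    replace (fst (gt (x1, y) - RtoC g1 * (x1, y) - (gt (0, y) - RtoC g1 * (0%R, y)))%C)
      with (fst (gt (x1, y)) - fst (gt (0, y)) - g1 * x1) in L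
      by (unfold Cminus, Cplus, Copp, Cmult, RtoC; cbn [fst snd]; ring).
    apply Rabs_le_between in L.
    assert (L2 : fst (gt (x1, y)) - g0 <= (g + e) * x1) by nra.
    assert (L3 : v * (fst (gt (x1, y)) - g0) <= v2 * (g + e) * x1).
    { apply Rle_trans with (v * ((g + e) * x1)); [apply Rmult_le_compat_l; lra|].
      rewrite <- Rmult_assoc. apply Rmult_le_compat_r; [lra|]. apply Rmult_le_compat_r; lra. }
    rewrite Hve in L3. unfold sg in *. nra.
  - assert (Hcase : exists cc, (cc = ca \/ cc = cb) /\ fst (gt (x1, y)) <= g0 - cc).
    { unfold Rabs in Hlarge, Hy. destruct (Rcase_abs y).
      - exists cb. split; [now right|]. apply Hb; [unfold x1 in *; lra|lra].
      - exists ca. split; [now left|]. apply Ha; [unfold x1 in *; lra|lra]. }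
    destruct Hcase as [cc [Hcc Hle]].
    assert (v1 * cc <= v * cc) by (apply Rmult_le_compat_r; [destruct Hcc; subst; lra|lra]).
    assert (v * (fst (gt (x1, y)) - g0) <= v * (- cc)) by (apply Rmult_le_compat_l; lra).
    destruct Hcc; subst cc; lra.
Qed.
End Gap.
End Kappa.

(** * Uniform asymptotics of the coefficients *)

Lemma mcoef_dilate (F : C -> C) (R0 x : R) (n : nat) : 0 < R0 -> exp x < 1 -> holo_disc F R0 ->
  (RtoC (R0 ^ n) * mcoef F n (x + ln R0) = mcoef (fun z => F (RtoC R0 * z)%C) n x)%C.
Proof.
  intros HR Hx HF.
  assert (HR0 : RtoC R0 <> 0) by (intro E; apply RtoC_inj in E; lra).
  assert (Hx' : exp (x + ln R0) < R0) by (rewrite exp_plus, exp_ln by exact HR; nra).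
  assert (X : ex_CInt (fun y => mcoef_int F n (x + ln R0, y)) (- PI) PI).
  { apply ex_CInt_rcont. intros; eapply mcoef_int_cont; eassumption. }
  unfold mcoef.
  transitivity (/ RtoC (2 * PI) * (RtoC (R0 ^ n) * CInt (fun y => mcoef_int F n (x + ln R0, y)%R) (- PI) PI))%C; [ring|].
  f_equal. rewrite <- CInt_scal by exact X. apply CInt_ext. intros y _. unfold mcoef_int.
  assert (E : Cexp (x + ln R0, y) = (RtoC R0 * Cexp (x, y))%C).
  { rewrite (Cexp_split (x + ln R0)), (Cexp_split x), exp_plus, exp_ln by exact HR. rewrite RtoC_mult. ring. }
  rewrite !Cexp_opp, !Cexp_INR_mult, E, Cpow_mult_l, <- RtoC_pow.
  assert (N1 : RtoC (R0 ^ n) <> 0).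
  { intro Z. apply RtoC_inj in Z. pose proof (pow_lt R0 n HR). lra. }
  assert (N2 : (Cexp (x, y) ^ n)%C <> 0) by (apply Cpow_nz, Cexp_neq_0).
  field. split; assumption.
Qed.

Lemma abs_ln_between (c c0 c1 : R) : 0 < c0 -> c0 <= c <= c1 -> Rabs (ln c) <= Rabs (ln c0) + Rabs (ln c1).
Proof.
  intros H0 Hc.
  assert (A : ln c0 <= ln c) by (destruct (proj1 Hc) as [L|L]; [left; now apply ln_increasing|right; now rewrite L]).
  assert (B : ln c <= ln c1) by (destruct (proj2 Hc) as [L|L]; [left; apply ln_increasing; lra|right; now rewrite L]).
  pose proof (Rle_abs (ln c1)). pose proof (Rabs_pos (ln c1)). pose proof (Rabs_pos (ln c0)).
  pose proof (Rle_abs (- ln c0)) as L. rewrite Rabs_Ropp in L. apply Rabs_le. lra.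
Qed.

Section Asymptotics.
Variables (kappa : nat -> R) (R0 eta phi ts delta g0 g1 : R) (Gth Gka f : C -> C) (beta v1 v2 : R).
Hypothesis (Hkn : forall j, 0 <= kappa j) (Hna : non_arithmetic kappa).
Hypothesis (HR : 0 < R0) (Heta : 0 < eta) (Hphi : 0 < phi < PI / 2).
Hypothesis Hext : forall z, Cmod z < R0 ->
     @is_pseries C_AbsRing C_NormedModule (fun n => RtoC (gcoef kappa n)) z (Gka z).
Hypothesis (Hth : holo (Delta0 R0 eta phi) Gth) (Hka : holo (Delta0 R0 eta phi) Gka)
  (Hf : holo (Delta0 R0 eta phi) f).
Hypothesis Hlim : filterlim (PSeries (gcoef kappa)) (at_left R0) (locally g0).
Hypothesis (Hts : 0 <= ts) (Hdelta : 0 < delta) (Hbeta : 0 <= beta).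
Hypothesis Hexp_th : bigO_at (Delta0 R0 eta phi) R0 Gth
     (fun z => Copp (Cmult (RtoC ts) (Clog (Cminus (RtoC 1) (Cdiv z (RtoC R0)))))) delta.
Hypothesis Hexp_ka : bigO_at (Delta0 R0 eta phi) R0 Gka
     (fun z => Cminus (RtoC g0) (Cmult (RtoC g1) (Cminus (RtoC 1) (Cdiv z (RtoC R0))))) (1 + delta).
Hypothesis Hexp_f : bigO_at (Delta0 R0 eta phi) R0
       (fun z => Cdiv (f z) (Cpower (Cminus (RtoC 1) (Cdiv z (RtoC R0))) (RtoC (- beta))))
       (fun _ => RtoC 1) delta.
Hypothesis (Hv1 : 0 < v1) (Hv12 : v1 <= v2) (Hvg : v2 * g1 < 1).
Hypothesis Hal1 : 0 < v1 * ts + beta.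

Let s := dom_s eta phi.
Let m := dom_m phi.
Let I := {v : R | v1 <= v <= v2}.
Let zw (w : C) : C := (RtoC R0 * Cexp w)%C.
Let A (v : I) (w : C) : C := (f (zw w) * Cexp (RtoC (proj1_sig v) * Gth (zw w)))%C.
Let B (v : I) (w : C) : C := (RtoC (proj1_sig v) * (Gka (zw w) - RtoC g0))%C.
Let al (v : I) : R := proj1_sig v * ts + beta.
Let c (v : I) : R := 1 - proj1_sig v * g1.
Let a1 := v1 * ts + beta.
Let a2 := v2 * ts + beta.
(** The exponent of the error: 1 for replacing [1 - e^w] by [-w], [delta] from the expansions, and
    [a1], the least value of [al], because the contour estimate needs [d <= al v]. *)
Let d := Rmin (Rmin 1 delta) a1.
(** [1 - v g1] is monotone in [v] in a direction that depends on the sign of [g1], so both ends are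
    compared. *)
Let c0 := Rmin (1 - v1 * g1) (1 - v2 * g1).
Let c1 := Rmax (1 - v1 * g1) (1 - v2 * g1).
(** [(p, q)] is the unit vector with [p / q = m / 2]: the rays run at half the slope of the
    boundary, the line up to which [gap] is available. *)
Let q := / sqrt (1 + (m / 2) * (m / 2)).
Let p := m / 2 * q.

Lemma d_bounds : 0 < d <= 1 /\ d <= delta /\ d <= a1.
Proof.
  unfold d. split; [split|split].
  - repeat apply Rmin_glb_lt; try lra; exact Hal1.
  - eapply Rle_trans; apply Rmin_l.
  - eapply Rle_trans; [apply Rmin_l|apply Rmin_r].
  - apply Rmin_r.
Qed.

Lemma c0_pos : 0 < c0.
Proof. unfold c0. apply Rmin_glb_lt; [|lra]. destruct (Rle_dec g1 0); nra. Qed.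

Lemma c_bounds (v : I) : c0 <= c v <= c1.
Proof.
  destruct v as [v Hv]. unfold c, c0, c1; cbn [proj1_sig].
  destruct (Rle_dec 0 g1).
  - pose proof (Rmin_r (1 - v1 * g1) (1 - v2 * g1)). pose proof (Rmax_l (1 - v1 * g1) (1 - v2 * g1)). split; nra.
  - pose proof (Rmin_l (1 - v1 * g1) (1 - v2 * g1)). pose proof (Rmax_r (1 - v1 * g1) (1 - v2 * g1)). split; nra.
Qed.

Lemma al_bounds (v : I) : a1 <= al v <= a2.
Proof. destruct v as [v Hv]. unfold al, a1, a2; cbn [proj1_sig]. split; nra. Qed.

Lemma direction : 0 < m /\ 0 < p /\ 0 < q /\ p * p + q * q = 1 /\ p < m * q /\ p / q = m / 2.
Proof.
  pose proof (dom_m_pos phi Hphi) as Hm. fold m in Hm.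
  assert (Hs : 0 < 1 + m / 2 * (m / 2)) by nra.
  pose proof (sqrt_lt_R0 _ Hs) as Hs1. pose proof (sqrt_sqrt _ (Rlt_le _ _ Hs)) as Hs2.
  assert (Hq : 0 < q) by (apply Rinv_0_lt_compat, Hs1).
  assert (Hqq : q * q * (1 + m / 2 * (m / 2)) = 1).
  { rewrite <- Hs2. unfold q. field. lra. }
  split; [exact Hm|]. split; [unfold p; nra|]. split; [exact Hq|]. split.
  - rewrite <- Hqq. unfold p. ring.
  - split; [unfold p; nra|unfold p; field; lra].
Qed.

Lemma zw_Delta0 (w : C) : wedge s m w -> Delta0 R0 eta phi (zw w).
Proof. apply Delta0_wedge; assumption. Qed.

Lemma holo_zw (G : C -> C) : holo (Delta0 R0 eta phi) G -> holo (wedge s m) (fun w => G (zw w)).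
Proof.
  intros HG w Hw. destruct (HG _ (zw_Delta0 w Hw)) as [l Hl].
  eexists. apply (cderiv_comp G zw); [apply cderiv_scal, cderiv_Cexp|exact Hl].
Qed.

Lemma contour_side_bounded (x1 y y' : R) (G : C -> C) : holo (wedge s m) G -> y <= y' ->
  (forall t, y <= t <= y' -> wedge s m (x1, t)) ->
  exists M, 0 <= M /\ forall t, y <= t <= y' -> Cmod (G (x1, t)) <= M.
Proof.
  intros HG Hy HW. apply (rcont_bounded (fun t => G (x1, t)) y y' Hy).
  intros t Ht. apply (rcont_comp G (fun t => (x1, t))); [eapply rderiv_rcont, rderiv_vertical|].
  destruct (HG _ (HW t Ht)) as [l Hl]. eapply cderiv_ccont, Hl.
Qed.

(** [f] and [g_theta] are continuous on two compact vertical segments; [v] enters only through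
    [v <= v2]. If the rays reach [x1] above the height [PI], no height qualifies. *)
Lemma prefactor_bounded (x1 : R) : 0 < x1 < s -> exists M, 0 <= M /\
  forall (v : I) y, x1 <= p / q * Rabs y -> Rabs y <= PI -> Cmod (A v (x1, y)) <= M.
Proof.
  intros Hx. destruct direction as [Hm [Hp [Hq [Hpq [Hsl Hk]]]]].
  pose proof PI_lt_4 as Hpi4. pose proof PI_RGT_0 as Hpi.
  set (y1 := x1 / (m / 2)).
  assert (Hy1 : 0 < y1) by (apply Rdiv_lt_0_compat; lra).
  assert (Ey1 : m / 2 * y1 = x1) by (unfold y1; field; lra).
  destruct (Rle_dec y1 PI) as [Hle|Hgt].
  - assert (W1 : forall t, y1 <= t <= PI -> wedge s m (x1, t)).
    { intros t Ht. unfold wedge, cone; cbn [fst snd]. rewrite Rabs_pos_eq by lra. repeat split; nra. }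
    assert (W2 : forall t, - PI <= t <= - y1 -> wedge s m (x1, t)).
    { intros t Ht. unfold wedge, cone; cbn [fst snd]. rewrite Rabs_left by lra. repeat split; nra. }
    destruct (contour_side_bounded x1 y1 PI _ (holo_zw f Hf) Hle W1) as [M1 [HM1 B1]].
    destruct (contour_side_bounded x1 (- PI) (- y1) _ (holo_zw f Hf) ltac:(lra) W2) as [M2 [HM2 B2]].
    destruct (contour_side_bounded x1 y1 PI _ (holo_zw Gth Hth) Hle W1) as [M3 [HM3 B3]].
    destruct (contour_side_bounded x1 (- PI) (- y1) _ (holo_zw Gth Hth) ltac:(lra) W2) as [M4 [HM4 B4]].
    exists ((M1 + M2) * exp (v2 * (M3 + M4))). pose proof (exp_pos (v2 * (M3 + M4))).
    split; [apply Rmult_le_pos; lra|]. intros [v Hv] y Hy Hyp. unfold A; cbn [proj1_sig].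
    assert (Hyy : y1 <= Rabs y).
    { rewrite Hk in Hy. apply Rmult_le_reg_l with (m / 2); lra. }
    assert (Hb : Cmod (f (zw (x1, y))) <= M1 + M2 /\ Cmod (Gth (zw (x1, y))) <= M3 + M4).
    { revert Hyy Hyp. unfold Rabs. destruct (Rcase_abs y); intros.
      - specialize (B2 y ltac:(lra)). specialize (B4 y ltac:(lra)). cbv beta in B2, B4. lra.
      - specialize (B1 y ltac:(lra)). specialize (B3 y ltac:(lra)). cbv beta in B1, B3. lra. }
    destruct Hb as [Hb1 Hb2]. rewrite Cmod_mult. apply Rmult_le_compat; try apply Cmod_ge_0; [exact Hb1|].
    eapply Rle_trans; [apply Cmod_Cexp_le|]. apply exp_le_compat.
    rewrite Cmod_mult, Cmod_R, Rabs_pos_eq by lra. apply Rmult_le_compat; try apply Cmod_ge_0; lra.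
  - exists 0. split; [lra|]. intros v y Hy Hyp. exfalso. rewrite Hk in Hy.
    assert (m / 2 * Rabs y <= m / 2 * PI) by (apply Rmult_le_compat_l; lra).
    assert (m / 2 * PI < m / 2 * y1) by (apply Rmult_lt_compat_l; lra). lra.
Qed.

Definition integrand (v : R) (n : nat) (z : C) : C :=
  Cmult (f z) (Cexp (Cmult (RtoC v) (Cplus (Gth z) (Cmult (RtoC (INR n)) (Gka z))))).

Lemma holo_integrand (v : R) (n : nat) : holo (Delta0 R0 eta phi) (integrand v n).
Proof.
  intros z Hz. destruct (Hf z Hz) as [l1 H1]. destruct (Hth z Hz) as [l2 H2]. destruct (Hka z Hz) as [l3 H3].
  eexists. apply cderiv_mult; [exact H1|].
  apply (cderiv_comp Cexp (fun z => RtoC v * (Gth z + RtoC (INR n) * Gka z))%C); [|apply cderiv_Cexp].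
  apply cderiv_scal, cderiv_plus; [exact H2|apply cderiv_scal, H3].
Qed.

(** The first error term comes from the deformed contour, the second from the arms of the Hankel
    contour, cut at distance [n (1 - v g1) rho0]; the latter is exponentially small and [1/n] is
    enough. *)
Lemma contour_estimate : exists Cst N0, 0 <= Cst /\ forall (v : R) (n : nat), v1 <= v <= v2 -> (N0 <= n)%nat ->
  Cmod (RtoC (exp (- (INR n * v * g0))) * (RtoC (2 * PI) * Ci * (RtoC (R0 ^ n) * zcoef (integrand v n) n))
     - RtoC (Rpower (INR n * (1 - v * g1)) (v * ts + beta - 1)) * (RtoC (2 * PI) * Ci * RtoC (/ Gamma (v * ts + beta))))
  <= Cst * (Rpower (INR n) (v * ts + beta - 1 - d) + Rpower (INR n * (1 - v * g1)) (v * ts + beta - 1) * / INR n).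
Proof.
  destruct d_bounds as [Hd [Hdd Hda]]. pose proof c0_pos as Hc0.
  destruct direction as [Hm [Hp [Hq [Hpq [Hsl Hk]]]]].
  destruct (expansion_f_theta R0 eta phi HR Heta Hphi f Gth beta ts delta d v2 Hd Hdd Hbeta Hts ltac:(lra) Hexp_f Hexp_th)
    as [Kf [ef [HKf [Hef HA]]]].
  destruct (expansion_kappa R0 eta phi HR Heta Hphi Gka g0 g1 delta d Hd Hdd Hexp_ka) as [Kk [ek [HKk [Hek HB]]]].
  assert (Hvk : 0 <= v2 * Kk) by (apply Rmult_le_pos; lra).
  assert (Hs : 0 < s) by (apply dom_s_pos; assumption).
  destruct (contour_transfer I A B al c m s d (Kf + v2 * Kk) (Rmin ef ek) a2 c0 c1 p q)
    as [rho0 [Cst [N0 [Hrho [HCst [x1 HT]]]]]]; try assumption; try lra.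
  - apply Rmin_glb_lt; lra.
  - intro v. pose proof (al_bounds v). lra.
  - exact c_bounds.
  - intros v w Hw Hsm. unfold A, al. destruct v as [v Hv]; cbn [proj1_sig].
    eapply Rle_trans; [apply (HA v w); [lra|exact Hw|]|].
    + eapply Rlt_le_trans; [exact Hsm|apply Rmin_l].
    + apply Rmult_le_compat_r; [left; apply Rpower_pos|lra].
  - intros v w Hw Hsm. unfold B, c. destruct v as [v Hv]; cbn [proj1_sig].
    replace (RtoC v * (Gka (zw w) - RtoC g0) - RtoC (1 - (1 - v * g1)) * w)%C
      with (RtoC v * (Gka (zw w) - RtoC g0 - RtoC g1 * w))%C.
    2:{ replace (1 - (1 - v * g1)) with (v * g1) by ring. rewrite (RtoC_mult v g1). ring. }
    rewrite Cmod_mult, Cmod_R, Rabs_pos_eq by lra.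
    pose proof (HB w Hw (Rlt_le_trans _ _ _ Hsm (Rmin_r _ _))) as HBw. fold (zw w) in HBw.
    pose proof (Cmod_ge_0 w) as Hw0. pose proof (Rpower_pos (Cmod w) d) as Hr0.
    assert (HX : 0 <= Cmod w * Rpower (Cmod w) d) by (apply Rmult_le_pos; lra).
    apply Rle_trans with (v2 * (Kk * (Cmod w * Rpower (Cmod w) d))).
    + apply Rmult_le_compat; [lra|apply Cmod_ge_0|lra|exact HBw].
    + rewrite Rmult_plus_distr_r. assert (0 <= Kf * (Cmod w * Rpower (Cmod w) d)) by (now apply Rmult_le_pos). lra.
  - intros r Hr.
    destruct (gap kappa R0 eta phi g0 g1 Gka Hkn Hna HR Heta Hphi Hext Hka Hlim Kk ek d v1 v2 HKk Hek Hd)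
      with (r := r) as [x1 [Hx1 [Hx1s [c' [Hc' Hg]]]]]; try assumption.
    exists x1. split; [exact Hx1|].
    destruct (prefactor_bounded x1) as [M [HM HMb]]; [split; [lra|exact Hx1s]|].
    exists c', M. split; [exact Hc'|]. split; [exact HM|]. intros v y Hy Hyp. split; [|now apply HMb].
    unfold B. destruct v as [v Hv]; cbn [proj1_sig].
    rewrite Hk in Hy. specialize (Hg v y Hv Hy Hyp).
    replace (fst (RtoC v * (Gka (zw (x1, y)) - RtoC g0))%C) with (v * (fst (Gka (zw (x1, y))) - g0)); [exact Hg|].
    unfold Cminus, Cmult, Copp, Cplus, RtoC; cbn [fst snd]. ring.
  - destruct (INR_unbounded (/ (c0 * rho0))) as [N1 HN1].
    exists (Cst + 2 / p * / (p * c0 * rho0)), (S (N0 + N1)).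
    assert (Hcr : 0 < c0 * rho0) by (now apply Rmult_lt_0_compat).
    assert (Hpc : 0 < p * c0 * rho0) by (rewrite Rmult_assoc; now apply Rmult_lt_0_compat).
    assert (HD : 0 <= 2 / p * / (p * c0 * rho0)).
    { apply Rmult_le_pos; [left; apply Rdiv_lt_0_compat; lra|left; now apply Rinv_0_lt_compat]. }
    split; [lra|].
    intros v n Hv Hn.
    set (iv := exist (fun v => v1 <= v <= v2) v Hv : I).
    pose proof (c_bounds iv) as Hcv. pose proof (al_bounds iv) as Hav.
    assert (Ec : c iv = 1 - v * g1) by reflexivity. assert (Ea : al iv = v * ts + beta) by reflexivity.
    set (cv := 1 - v * g1) in *. set (av := v * ts + beta) in *.
    assert (Hn0 : 0 < INR n) by (apply lt_0_INR; lia).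
    assert (HnN : INR N1 <= INR n) by (apply le_INR; lia).
    set (F := fun z => integrand v n (RtoC R0 * z)%C).
    assert (HF0 : holo_disc (integrand v n) R0).
    { intros z Hz. apply holo_integrand. now apply Delta0_disc. }
    assert (HF : holo_disc F 1).
    { intros z Hz. destruct (HF0 (RtoC R0 * z)%C) as [l Hl].
      { rewrite Cmod_mult, Cmod_R, Rabs_pos_eq by lra. nra. }
      eexists. apply (cderiv_comp (integrand v n) (fun z => RtoC R0 * z)%C); [apply cderiv_scal, cderiv_id|exact Hl]. }
    set (k := RtoC (exp (- (INR n * v * g0)))).
    assert (Hk0 : k <> 0).
    { unfold k. intro E. apply RtoC_inj in E. pose proof (exp_pos (- (INR n * v * g0))). lra. }
    (* The constant [k] removes [exp (n v g0)] from the integrand, so that the exponent [B] has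
       value 0 at the singularity. *)
    assert (Hfull : forall w, (A iv w * Cexp (RtoC (INR n) * (B iv w - w)) = k * mcoef_int F n w)%C).
    { intro w. unfold A, B, F, mcoef_int, integrand, k; cbn [proj1_sig iv]. fold (zw w).
      rewrite <- Cexp_R.
      transitivity (f (zw w) * (Cexp (RtoC v * Gth (zw w)) * Cexp (RtoC (INR n) * (RtoC v * (Gka (zw w) - RtoC g0) - w))))%C; [ring|].
      rewrite <- Cexp_plus.
      transitivity (f (zw w) * (Cexp (RtoC (- (INR n * v * g0))) * (Cexp (RtoC v * (Gth (zw w) + RtoC (INR n) * Gka (zw w))) * Cexp (- (RtoC (INR n) * w)))))%C; [|ring].
      rewrite <- !Cexp_plus. do 2 f_equal. rewrite RtoC_opp, !RtoC_mult. ring. }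
    destruct (wedge_primitive s m (fun w => k * mcoef_int F n w)%C Hs Hm) as [P HP].
    { intros w Hw. destruct (holo_integrand v n _ (zw_Delta0 w Hw)) as [l Hl].
      destruct (cderiv_mcoef_int F n w (l * RtoC R0)%C) as [mm Hmm].
      { unfold F. eapply cderiv_val; [apply (cderiv_comp (integrand v n) (fun z => RtoC R0 * z)%C)|].
        - apply cderiv_scal, cderiv_id.
        - exact Hl.
        - ring. }
      exists (k * mm)%C. apply cderiv_scal, Hmm. }
    destruct (cone_primitive m (fun w => Cpower (- w) (RtoC (- av)) * Cexp (- w))%C Hm) as [Q HQ].
    { intros w Hw. pose proof (cone_slit m w Hm Hw) as Hsw. eexists. apply cderiv_mult.
      - apply (cderiv_comp (fun u => Cpower u (RtoC (- av))) Copp); [apply cderiv_opp, cderiv_id|apply cderiv_Cpower, Hsw].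
      - apply (cderiv_comp Cexp Copp); [apply cderiv_opp, cderiv_id|apply cderiv_Cexp]. }
    destruct (HT iv n P Q) as [W1 [W2 HTT]]; [lia| |exact HQ|].
    { intros w Hw. eapply cderiv_val; [apply HP, Hw|]. symmetry. apply Hfull. }
    rewrite (wedge_coefficient m Hm F P k n s (-1) x1) in HTT; try assumption; try lra.
    assert (Ecoef : mcoef F n (-1) = (RtoC (R0 ^ n) * zcoef (integrand v n) n)%C).
    { unfold F. assert (He1 : exp (-1) < 1) by (rewrite <- exp_0; apply exp_increasing; lra).
      rewrite <- mcoef_dilate by assumption. f_equal. symmetry. apply (zcoef_mcoef _ _ R0); [exact HF0|].
      rewrite exp_plus, exp_ln by exact HR. nra. }
    rewrite Ecoef in HTT. rewrite Ec, Ea in HTT.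
    set (T := INR n * cv * rho0) in *.
    assert (HcT : INR n * (c0 * rho0) <= T).
    { unfold T. rewrite Rmult_assoc. apply Rmult_le_compat_l; [lra|]. apply Rmult_le_compat_r; lra. }
    assert (HT1 : 1 <= T).
    { eapply Rle_trans; [|exact HcT]. apply Rmult_le_reg_r with (/ (c0 * rho0)); [now apply Rinv_0_lt_compat|].
      rewrite Rmult_assoc, Rinv_r by lra. lra. }
    pose proof (hankel_constant m p q av Hm Hp Hq Hpq Hsl ltac:(unfold av, a1 in *; lra) Q HQ T HT1) as HH.
    set (rp := Rpower (INR n * cv) (av - 1)) in *.
    assert (Hrp : 0 < rp) by apply Rpower_pos.
    set (Del := (Q ((T * p)%R, (T * q)%R) - Q ((T * p)%R, (- (T * q))%R))%C) in *.
    match goal with |- Cmod (?X - _) <= _ => set (XX := X) in * end.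
    replace (XX - RtoC rp * (RtoC (2 * PI) * Ci * RtoC (/ Gamma av)))%C with
      ((XX - RtoC rp * Del) + RtoC rp * (Del - RtoC (2 * PI) * Ci * RtoC (/ Gamma av)))%C by ring.
    eapply Rle_trans; [apply Cmod_triangle|]. rewrite Cmod_mult, (Cmod_R rp), (Rabs_pos_eq rp) by lra.
    pose proof (Rpower_pos (INR n) (av - 1 - d)) as Hr2.
    assert (Hexp : 2 / p * exp (- (p * T)) <= 2 / p * / (p * c0 * rho0) * / INR n).
    { rewrite (Rmult_assoc (2 / p)). apply Rmult_le_compat_l; [left; apply Rdiv_lt_0_compat; lra|].
      rewrite exp_Ropp, <- Rinv_mult. apply Rinv_le_contravar; [now apply Rmult_lt_0_compat|].
      apply Rle_trans with (p * T).
      - replace (p * c0 * rho0 * INR n) with (p * (INR n * (c0 * rho0))) by ring. apply Rmult_le_compat_l; lra.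
      - pose proof (exp_ineq1_le (p * T)). lra. }
    pose proof (Rinv_0_lt_compat _ Hn0) as Hni.
    assert (Y2 : rp * Cmod (Del - RtoC (2 * PI) * Ci * RtoC (/ Gamma av)) <= 2 / p * / (p * c0 * rho0) * (rp * / INR n)).
    { replace (2 / p * / (p * c0 * rho0) * (rp * / INR n)) with (rp * (2 / p * / (p * c0 * rho0) * / INR n)) by ring.
      apply Rmult_le_compat_l; [lra|]. eapply Rle_trans; [exact HH|exact Hexp]. }
    assert (Hpi : 0 <= rp * / INR n) by (apply Rmult_le_pos; lra).
    eapply Rle_trans; [apply Rplus_le_compat; [exact HTT|exact Y2]|].
    rewrite Rmult_plus_distr_r, !Rmult_plus_distr_l.
    assert (0 <= Cst * (rp * / INR n)) by (now apply Rmult_le_pos).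
    assert (0 <= 2 / p * / (p * c0 * rho0) * Rpower (INR n) (av - 1 - d)) by (apply Rmult_le_pos; lra).
    lra.
Qed.

(** Relative to the main term both errors are at most a constant times [n^-d]. Uniformity needs
    [Gamma] bounded above, by [Gamma_le_ends], and the factor [(1 - v g1)^(v ts + beta - 1)] bounded
    away from 0. *)
Theorem uniform_asymptotics (eps : R) : 0 < eps ->
  exists N0 : nat, forall (N : nat) (v : R), (N0 <= N)%nat -> v1 <= v <= v2 ->
    Cmod (zcoef (integrand v N) N / RtoC (exp (INR N * v * g0)
                     * Rpower (INR N * (1 - v * g1)) (v * ts + beta - 1)
                     / (R0 ^ N * Gamma (v * ts + beta))) - RtoC 1) <= eps.
Proof.
  intros He. destruct d_bounds as [Hd [Hdd Hda]]. pose proof c0_pos as Hc0. pose proof PI_RGT_0 as Hpi.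
  destruct contour_estimate as [Cst [N0 [HCst HC]]].
  set (GM := Gamma a1 + Gamma a2).
  assert (Ha12 : a1 <= a2) by (unfold a1, a2; nra).
  assert (HGM : 0 < GM) by (unfold GM; pose proof (Gamma_pos a1 Hal1); pose proof (Gamma_pos a2 ltac:(unfold a1 in *; lra)); lra).
  (* Bounds [cv^(1 - av)] whatever the signs of [av - 1] and [ln cv], since [|av - 1| <= 1 + a2]. *)
  set (CC := exp ((1 + a2) * (Rabs (ln c0) + Rabs (ln c1)))).
  pose proof (exp_pos ((1 + a2) * (Rabs (ln c0) + Rabs (ln c1)))) as HCC. fold CC in HCC.
  set (D := GM / (2 * PI) * (Cst * (CC + 1))).
  assert (Hgp : 0 < GM / (2 * PI)) by (apply Rdiv_lt_0_compat; lra).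
  assert (HD : 0 <= D) by (unfold D; apply Rmult_le_pos; [lra|apply Rmult_le_pos; lra]).
  destruct (INR_unbounded (Rpower (D / eps + 1) (/ d))) as [N1 HN1].
  exists (S (N0 + N1)). intros n v Hn Hv.
  assert (Hn1 : 1 <= INR n) by (change 1 with (INR 1); apply le_INR; lia).
  assert (HnN : INR N1 <= INR n) by (apply le_INR; lia).
  specialize (HC v n Hv ltac:(lia)).
  pose proof (c_bounds (exist _ v Hv)) as Hcv. pose proof (al_bounds (exist _ v Hv)) as Hav.
  unfold c in Hcv; unfold al in Hav; cbn [proj1_sig] in Hcv, Hav.
  set (cv := 1 - v * g1) in *. set (av := v * ts + beta) in *.
  set (Z := zcoef (integrand v n) n) in *.
  assert (Ha1 : 0 < a1) by exact Hal1.
  pose proof (Gamma_pos av ltac:(lra)) as HGa. pose proof (Gamma_le_ends av a1 a2 Ha1 Hav) as HGle. fold GM in HGle.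
  set (rp := Rpower (INR n * cv) (av - 1)) in *.
  assert (Hrp : 0 < rp) by apply Rpower_pos.
  pose proof (exp_pos (INR n * v * g0)) as Hex. pose proof (pow_lt R0 n HR) as HRn.
  set (ex := exp (INR n * v * g0)) in *.
  assert (Eex : exp (- (INR n * v * g0)) = / ex) by (unfold ex; apply exp_Ropp).
  rewrite Eex in HC.
  assert (HX : (Z / RtoC (ex * rp / (R0 ^ n * Gamma av)) - RtoC 1)%C =
     (RtoC (Gamma av / (2 * PI * rp)) * / Ci * (RtoC (/ ex) * (RtoC (2 * PI) * Ci * (RtoC (R0 ^ n) * Z)) - RtoC rp * (RtoC (2 * PI) * Ci * RtoC (/ Gamma av))))%C).
  { assert (Hr1 : forall r : R, 0 < r -> RtoC r <> 0) by (intros r Hr E; apply RtoC_inj in E; lra).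
    pose proof Ci_neq_0. pose proof (Hr1 _ Hex). pose proof (Hr1 _ Hrp). pose proof (Hr1 _ HRn). pose proof (Hr1 _ HGa).
    pose proof RtoC_2PI_neq_0.
    assert (Hinv : forall r : R, 0 < r -> RtoC (/ r) = (/ RtoC r)%C) by (intros; apply RtoC_inv; lra).
    assert (P1 : 0 < R0 ^ n * Gamma av) by (now apply Rmult_lt_0_compat).
    assert (P2 : 0 < 2 * PI * rp) by (apply Rmult_lt_0_compat; lra).
    unfold Rdiv. rewrite (RtoC_mult (ex * rp)), (RtoC_mult ex rp), (RtoC_mult (Gamma av) (/ _)).
    rewrite (Hinv _ P1), (Hinv _ P2), (Hinv _ Hex), (Hinv _ HGa), (RtoC_mult (R0 ^ n)), (RtoC_mult (2 * PI) rp).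
    field. repeat split; assumption. }
  rewrite HX. rewrite !Cmod_mult, Cmod_inv, Cmod_Ci, Rinv_1, Rmult_1_r by apply Ci_neq_0.
  rewrite Cmod_R, Rabs_pos_eq by (left; apply Rdiv_lt_0_compat; [lra|apply Rmult_lt_0_compat; lra]).
  assert (Hnd : Rpower (INR n) (- d) * D <= eps).
  { rewrite Rpower_Ropp.
    assert (HP : D / eps + 1 <= Rpower (INR n) d).
    { assert (Hq1 : 0 < D / eps + 1) by (assert (0 <= D / eps) by (apply Rdiv_le_0_compat; lra); lra).
      replace (D / eps + 1) with (Rpower (Rpower (D / eps + 1) (/ d)) d) by (rewrite Rpower_mult, Rinv_l, Rpower_1; lra).
      apply Rpower_le_base; [apply Rpower_pos|lra|lra]. }
    pose proof (Rpower_pos (INR n) d). rewrite Rmult_comm. apply Rle_div_l; [exact H|].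
    assert (eps * (D / eps + 1) = D + eps) by (field; lra). nra. }
  eapply Rle_trans; [|exact Hnd].
  assert (Hncv : 0 < INR n * cv) by (apply Rmult_lt_0_compat; lra).
  assert (Hfac : Rpower (INR n) (av - 1 - d) <= rp * (CC * Rpower (INR n) (- d))).
  { replace (av - 1 - d) with ((av - 1) + - d) by ring. rewrite Rpower_plus.
    pose proof (Rpower_pos (INR n) (- d)).
    rewrite <- Rmult_assoc. apply Rmult_le_compat_r; [lra|].
    unfold rp. rewrite <- Rpower_mult_distr by lra. rewrite Rmult_assoc.
    pose proof (Rpower_pos (INR n) (av - 1)).
    rewrite <- (Rmult_1_r (Rpower (INR n) (av - 1))) at 1. apply Rmult_le_compat_l; [lra|].
    unfold Rpower, CC. rewrite <- exp_plus. rewrite <- exp_0 at 1. apply exp_le_compat.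
    pose proof (abs_ln_between cv c0 c1 Hc0 Hcv) as L.
    assert (L2 : Rabs ((av - 1) * ln cv) <= (1 + a2) * (Rabs (ln c0) + Rabs (ln c1))).
    { rewrite Rabs_mult. apply Rmult_le_compat; try apply Rabs_pos; [apply Rabs_le; lra|exact L]. }
    apply Rabs_le_between in L2. lra. }
  assert (Hin : / INR n <= Rpower (INR n) (- d)).
  { rewrite <- (Rpower_1 (INR n)) at 1 by lra. rewrite <- Rpower_Ropp. apply Rle_Rpower; lra. }
  pose proof (Rpower_pos (INR n) (- d)) as Hpd.
  apply Rle_trans with (Gamma av / (2 * PI * rp) * (Cst * (rp * ((CC + 1) * Rpower (INR n) (- d))))).
  - apply Rmult_le_compat_l; [left; apply Rdiv_lt_0_compat; [lra|apply Rmult_lt_0_compat; lra]|].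
    eapply Rle_trans; [exact HC|]. apply Rmult_le_compat_l; [exact HCst|].
    assert (rp * / INR n <= rp * Rpower (INR n) (- d)) by (apply Rmult_le_compat_l; lra). lra.
  - replace (Gamma av / (2 * PI * rp) * (Cst * (rp * ((CC + 1) * Rpower (INR n) (- d)))))
      with (Rpower (INR n) (- d) * (Gamma av / (2 * PI) * (Cst * (CC + 1)))) by (field; lra).
    apply Rmult_le_compat_l; [lra|]. unfold D. apply Rmult_le_compat_r; [apply Rmult_le_pos; lra|].
    apply Rmult_le_compat_r; [left; apply Rinv_0_lt_compat; lra|exact HGle].
Qed.
End Asymptotics.

(** * Coefficients of the exponential of a power series *)

(** Agreement up to [O(z^n)], that is, of all coefficients below [n]. *)
Definition small_o_pow (F E : C -> C) (n : nat) : Prop :=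
  exists K r, 0 < r /\ 0 <= K /\ forall z, Cmod z < r -> Cmod (F z - E z) <= K * Cmod z ^ n.

Lemma mcoef_congr (F E : C -> C) (rho rho' x : R) (n i : nat) : holo_disc F rho -> holo_disc E rho' ->
  exp x < rho -> exp x < rho' -> small_o_pow F E n -> (i < n)%nat -> mcoef F i x = mcoef E i x.
Proof.
  intros HF HE Hx Hx' [K [r [Hr [HK H]]]] Hi. pose proof (exp_pos x) as Hex.
  destruct (cseries_remainder (fun k => mcoef E k x) E (exp x) (S i) Hex) as [K2 [r2 [Hr2 [HK2 H2]]]].
  { intros z Hz. apply (taylor_series E rho'); [exact HE|split; assumption]. }
  apply (mcoef_extract F (fun k => mcoef E k x) i rho (Rmin (Rmin r r2) 1) (K + K2) x HF Hx).
  - repeat apply Rmin_glb_lt; lra.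
  - intros z Hz.
    assert (A1 : Cmod z < r) by (eapply Rlt_le_trans; [exact Hz|eapply Rle_trans; apply Rmin_l]).
    assert (A2 : Cmod z < r2) by (eapply Rlt_le_trans; [exact Hz|eapply Rle_trans; [apply Rmin_l|apply Rmin_r]]).
    assert (A3 : Cmod z < 1) by (eapply Rlt_le_trans; [exact Hz|apply Rmin_r]).
    specialize (H z A1). specialize (H2 z A2). pose proof (Cmod_ge_0 z) as Hz0.
    set (T := csum (fun k => mcoef E k x * z ^ k)%C (S i)) in *.
    replace (F z - T)%C with ((F z - E z) + (E z - T))%C by ring.
    eapply Rle_trans; [apply Cmod_triangle|]. rewrite Rmult_plus_distr_r. apply Rplus_le_compat; [|exact H2].
    eapply Rle_trans; [exact H|]. apply Rmult_le_compat_l; [exact HK|].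
    replace n with (S i + (n - S i))%nat by lia. rewrite pow_add.
    rewrite <- (Rmult_1_r (Cmod z ^ S i)) at 2. apply Rmult_le_compat_l; [apply pow_le, Hz0|].
    rewrite <- (pow1 (n - S i)). apply pow_incr. lra.
Qed.

Lemma mcoef_0 (F : C -> C) (rho x : R) : holo_disc F rho -> exp x < rho -> mcoef F 0 x = F 0.
Proof.
  intros HF Hx. pose proof (exp_pos x).
  destruct (HF 0) as [l Hl]; [rewrite Cmod_0; lra|].
  destruct (Hl 1 Rlt_0_1) as [r [Hr H1]].
  apply (mcoef_extract F (fun _ => F 0) O rho r (1 + Cmod l) x HF Hx Hr).
  intros z Hz. specialize (H1 z). replace (z - 0)%C with z in H1 by ring. specialize (H1 Hz).
  simpl csum. replace (F z - (0 + F 0 * 1))%C with ((F z - F 0 - l * z) + l * z)%C by ring.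
  eapply Rle_trans; [apply Cmod_triangle|]. rewrite Cmod_mult. simpl pow. lra.
Qed.

Lemma exp_small_o (g p : C -> C) (n : nat) (M r : R) : (1 <= n)%nat -> 0 < r ->
  (forall z, Cmod z < r -> Cmod (p z) <= M) ->
  small_o_pow g p n -> small_o_pow (fun z => Cexp (g z)) (fun z => Cexp (p z)) n.
Proof.
  intros Hn Hr HM [K [r1 [Hr1 [HK H]]]].
  exists (exp M * (K * exp K)), (Rmin r (Rmin r1 1)).
  pose proof (exp_pos M) as HeM. pose proof (exp_pos K) as HeK.
  split; [repeat apply Rmin_glb_lt; lra|]. split; [apply Rmult_le_pos; [lra|apply Rmult_le_pos; lra]|].
  intros z Hz.
  assert (A1 : Cmod z < r) by (eapply Rlt_le_trans; [exact Hz|apply Rmin_l]).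
  assert (A2 : Cmod z < r1) by (eapply Rlt_le_trans; [exact Hz|eapply Rle_trans; [apply Rmin_r|apply Rmin_l]]).
  assert (A3 : Cmod z < 1) by (eapply Rlt_le_trans; [exact Hz|eapply Rle_trans; apply Rmin_r]).
  specialize (H z A2). specialize (HM z A1).
  replace (Cexp (g z) - Cexp (p z))%C with (Cexp (p z) * (Cexp (g z - p z) - 1))%C.
  2:{ rewrite Cexp_minus. field. apply Cexp_neq_0. }
  rewrite Cmod_mult, Rmult_assoc. pose proof (Cmod_ge_0 z) as Hz0.
  assert (Hzn : 0 <= Cmod z ^ n <= 1).
  { split; [apply pow_le, Hz0|]. rewrite <- (pow1 n). apply pow_incr. lra. }
  apply Rmult_le_compat; try apply Cmod_ge_0.
  - eapply Rle_trans; [apply Cmod_Cexp_le|]. now apply exp_le_compat.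
  - eapply Rle_trans; [apply Cmod_Cexp_m1|].
    replace (K * exp K * Cmod z ^ n) with (K * Cmod z ^ n * exp K) by ring.
    apply Rmult_le_compat; [apply Cmod_ge_0|left; apply exp_pos|exact H|]. apply exp_le_compat. nra.
Qed.

Lemma csum_bound (c : nat -> C) (n : nat) : exists M, forall z, Cmod z < 1 -> Cmod (csum (fun k => c k * z ^ k)%C n) <= M.
Proof.
  induction n as [|n [M HM]].
  - exists 0. intros z _. simpl. rewrite Cmod_0. lra.
  - exists (M + Cmod (c n)). intros z Hz. simpl. eapply Rle_trans; [apply Cmod_triangle|].
    apply Rplus_le_compat; [now apply HM|]. rewrite Cmod_mult, Cmod_pow.
    rewrite <- (Rmult_1_r (Cmod (c n))) at 2. apply Rmult_le_compat_l; [apply Cmod_ge_0|].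
    rewrite <- (pow1 n). apply pow_incr. split; [apply Cmod_ge_0|lra].
Qed.

Lemma CInt_csum (f : nat -> R -> C) (n : nat) (a b : R) : (forall k t, rcont (f k) t) ->
  (forall t, rcont (fun y => csum (fun k => f k y) n) t) /\
  CInt (fun y => csum (fun k => f k y) n) a b = csum (fun k => CInt (f k) a b) n.
Proof.
  intros Hf. induction n as [|n [IH1 IH2]].
  - simpl. split; [intro; apply rcont_const|]. rewrite CInt_const. ring.
  - simpl. split; [intro t; apply rcont_plus; [apply IH1|apply Hf]|].
    rewrite CInt_plus; [now rewrite IH2| |]; apply ex_CInt_rcont; intros; auto.
Qed.

(** The identity [z E' = z p' E]: in the coordinate [w] the function [E e^(-n w)] is periodic, so
    its derivative integrates to 0 over a period. With a polynomial exponent the sum under the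
    integral is finite. *)
Lemma exp_poly_rec (c : nat -> C) (n : nat) (x : R) :
  let E := fun z => Cexp (csum (fun k => c k * z ^ k)%C (S n)) in
  (RtoC (INR n) * mcoef E n x =
   csum (fun j => RtoC (INR (S j)) * c (S j) * mcoef E (n - 1 - j) x)%C n)%C.
Proof.
  intros E. pose proof RtoC_2PI_neq_0 as N2.
  set (p := fun w => csum (fun k => c k * Cexp (RtoC (INR k) * w))%C (S n)).
  set (dp := fun w => csum (fun k => RtoC (INR k) * c k * Cexp (RtoC (INR k) * w))%C (S n)).
  assert (Hp : forall w, cderiv p w (dp w)).
  { intro w. apply (csum_deriv (fun k w => c k * Cexp (RtoC (INR k) * w))%C
      (fun k w => RtoC (INR k) * c k * Cexp (RtoC (INR k) * w))%C).
    intros k _. eapply cderiv_val.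
    - apply cderiv_scal. apply (cderiv_comp Cexp (fun w => RtoC (INR k) * w)%C); [apply cderiv_scal, cderiv_id|apply cderiv_Cexp].
    - ring. }
  assert (HEp : forall w, E (Cexp w) = Cexp (p w)).
  { intro w. unfold E, p. f_equal. apply csum_ext. intros k _. now rewrite Cexp_INR_mult. }
  assert (HE : forall rho, holo_disc E rho).
  { intros rho z _. unfold E. eexists. apply (cderiv_comp Cexp (fun z => csum (fun k => c k * z ^ k)%C (S n))); [|apply cderiv_Cexp].
    apply (csum_deriv (fun k z => c k * z ^ k)%C (fun k z => c k * (RtoC (INR k) * z ^ (k - 1)))%C).
    intros k _. apply cderiv_scal.
    clear. induction k as [|k IH].
    - apply (cderiv_ext (fun _ => RtoC 1)); [reflexivity|]. eapply cderiv_val; [apply cderiv_const|]. simpl. ring.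
    - apply (cderiv_ext (fun w => w * w ^ k)%C); [intro; reflexivity|].
      eapply cderiv_val; [apply cderiv_mult; [apply cderiv_id|exact IH]|].
      replace (S k - 1)%nat with k by lia. rewrite S_INR, RtoC_plus.
      destruct k as [|k]; [simpl; ring|]. replace (S k - 1)%nat with k by lia. simpl. ring. }
  assert (Hcont : forall k t, rcont (fun y => mcoef_int E k (x, y)) t).
  { intros k t. apply (mcoef_int_cont E k x (exp x + 1)); [apply HE|lra]. }
  set (Th := fun w => (Cexp (p w) * Cexp (- (RtoC (INR n) * w)))%C).
  set (dTh := fun w => (csum (fun k => RtoC (INR k) * c k * mcoef_int E (n - k) w) (S n) - RtoC (INR n) * mcoef_int E n w)%C).
  assert (HTh : forall w, cderiv Th w (dTh w)).
  { intro w. eapply cderiv_val.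
    - apply cderiv_mult; [apply (cderiv_comp Cexp p); [apply Hp|apply cderiv_Cexp]|apply cderiv_Cexp_lin].
    - cbv beta. unfold dTh, dp.
      replace (mcoef_int E n w) with (Cexp (p w) * Cexp (- (RtoC (INR n) * w)))%C by (unfold mcoef_int; now rewrite HEp).
      rewrite (csum_ext (fun k => RtoC (INR k) * c k * mcoef_int E (n - k) w)%C
        (fun k => (Cexp (p w) * Cexp (- (RtoC (INR n) * w))) * (RtoC (INR k) * c k * Cexp (RtoC (INR k) * w)))%C).
      + rewrite csum_scal. ring.
      + intros k Hk. unfold mcoef_int. rewrite HEp.
        replace (Cexp (- (RtoC (INR (n - k)) * w))) with (Cexp (- (RtoC (INR n) * w)) * Cexp (RtoC (INR k) * w))%C; [ring|].
        rewrite <- Cexp_plus. f_equal. rewrite minus_INR by lia. rewrite RtoC_minus. ring. }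
  set (h := fun (k : nat) (y : R) => (RtoC (INR k) * c k * mcoef_int E (n - k) (x, y))%C).
  assert (Hh : forall k t, rcont (h k) t) by (intros k t; apply rcont_mult; [apply rcont_const|apply Hcont]).
  destruct (CInt_csum h (S n) (- PI) PI Hh) as [C1 C2].
  assert (X : forall k, ex_CInt (fun y => mcoef_int E k (x, y)) (- PI) PI).
  { intros k. apply ex_CInt_rcont. intros; apply Hcont. }
  assert (EI : CInt (fun y => Ci * dTh (x, y))%C (- PI) PI = 0).
  { rewrite (CInt_deriv (fun y => Th (x, y))).
    - replace (Th (x, PI)) with (Th (x, (- PI)%R)); [ring|].
      unfold Th. rewrite <- !HEp. rewrite !Cexp_opp, !Cexp_INR_mult.
      replace (Cexp (x, PI)) with (Cexp (x, (- PI)%R)); [reflexivity|].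
      rewrite <- Cexp_periodic. do 2 f_equal. ring.
    - intros t _. eapply rderiv_val; [apply (rderiv_comp Th (fun y => (x, y))); [apply rderiv_vertical|apply HTh]|]. ring.
    - intros t _. apply rcont_mult; [apply rcont_const|].
      apply (rcont_plus (fun y => csum (fun k => h k y) (S n)) (fun y => - (RtoC (INR n) * mcoef_int E n (x, y)))%C); [apply C1|].
      apply (rcont_comp Copp); [apply rcont_mult; [apply rcont_const|apply Hcont]|].
      eapply cderiv_ccont, cderiv_opp, cderiv_id. }
  assert (Xd : ex_CInt (fun y => dTh (x, y)) (- PI) PI).
  { apply (@ex_RInt_minus C_R_NormedModule (fun y => csum (fun k => h k y) (S n)) (fun y => RtoC (INR n) * mcoef_int E n (x, y))%C).
    - apply ex_CInt_rcont. intros; apply C1.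
    - apply ex_CInt_scal, X. }
  rewrite (CInt_scal Ci (fun y => dTh (x, y)) (- PI) PI Xd) in EI.
  assert (EI2 : CInt (fun y => dTh (x, y)) (- PI) PI = 0).
  { transitivity (/ Ci * (Ci * CInt (fun y => dTh (x, y)) (- PI) PI))%C; [field; exact Ci_neq_0|]. rewrite EI. ring. }
  unfold dTh in EI2.
  rewrite (CInt_minus (fun y => csum (fun k => h k y) (S n)) (fun y => RtoC (INR n) * mcoef_int E n (x, y))%C) in EI2.
  2: { apply ex_CInt_rcont. intros; apply C1. }
  2: { apply ex_CInt_scal, X. }
  rewrite C2, (CInt_scal _ _ _ _ (X n)) in EI2.
  assert (E3 : csum (fun k => CInt (h k) (- PI) PI) (S n) =
     (RtoC (2 * PI) * csum (fun j => RtoC (INR (S j)) * c (S j) * mcoef E (n - 1 - j) x) n)%C).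
  { assert (Hshift : forall (g : nat -> C) n, csum g (S n) = (g O + csum (fun k => g (S k)) n)%C).
    { intros g k. induction k as [|k IH]; [simpl; ring|].
      change (csum g (S (S k))) with (csum g (S k) + g (S k))%C. rewrite IH. simpl. ring. }
    rewrite Hshift, <- csum_scal.
    assert (E0 : CInt (h O) (- PI) PI = 0).
    { unfold h. rewrite (CInt_scal (RtoC (INR 0) * c O)%C _ _ _ (X (n - 0)%nat)). simpl INR. ring. }
    rewrite E0, Cplus_0_l. apply csum_ext. intros k Hk. unfold h.
    rewrite (CInt_scal (RtoC (INR (S k)) * c (S k))%C _ _ _ (X (n - S k)%nat)).
    unfold mcoef. replace (n - 1 - k)%nat with (n - S k)%nat by lia. field. exact N2. }
  rewrite E3 in EI2. unfold mcoef at 1.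
  set (S1 := csum (fun j => RtoC (INR (S j)) * c (S j) * mcoef E (n - 1 - j) x)%C n) in *.
  set (J := CInt (fun y => mcoef_int E n (x, y)) (- PI) PI) in *.
  transitivity (/ RtoC (2 * PI) * (RtoC (2 * PI) * S1 - (RtoC (2 * PI) * S1 - RtoC (INR n) * J)))%C; [field; exact N2|].
  rewrite EI2. field. exact N2.
Qed.

(** Truncating the exponent after degree [n] leaves the coefficients up to [n] unchanged, so the
    polynomial case suffices and no series is integrated termwise. *)
Theorem exp_series_rec (c : nat -> C) (g : C -> C) (rho x : R) (n : nat) :
  (forall z, Cmod z < rho -> cseries_eps c z (g z)) -> holo_disc (fun z => Cexp (g z)) rho -> exp x < rho ->
  (RtoC (INR n) * mcoef (fun z => Cexp (g z)) n x =
   csum (fun j => RtoC (INR (S j)) * c (S j) * mcoef (fun z => Cexp (g z)) (n - 1 - j) x)%C n)%C.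
Proof.
  intros Hg HF Hx. pose proof (exp_pos x) as Hex.
  set (p := fun z => csum (fun k => c k * z ^ k)%C (S n)).
  set (E := fun z => Cexp (p z)).
  assert (HE : holo_disc E (exp x + 1)).
  { intros z _. unfold E, p. eexists. apply (cderiv_comp Cexp (fun z => csum (fun k => c k * z ^ k)%C (S n))); [|apply cderiv_Cexp].
    apply (csum_deriv (fun k z => c k * z ^ k)%C (fun k z => c k * (RtoC (INR k) * z ^ (k - 1)))%C).
    intros k _. apply cderiv_scal.
    clear. induction k as [|k IH].
    - apply (cderiv_ext (fun _ => RtoC 1)); [reflexivity|]. eapply cderiv_val; [apply cderiv_const|]. simpl. ring.
    - apply (cderiv_ext (fun w => w * w ^ k)%C); [intro; reflexivity|].
      eapply cderiv_val; [apply cderiv_mult; [apply cderiv_id|exact IH]|].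
      replace (S k - 1)%nat with k by lia. rewrite S_INR, RtoC_plus.
      destruct k as [|k]; [simpl; ring|]. replace (S k - 1)%nat with k by lia. simpl. ring. }
  assert (Hsm : small_o_pow (fun z => Cexp (g z)) E (S n)).
  { destruct (csum_bound c (S n)) as [M HM].
    apply (exp_small_o g p (S n) M 1); [lia|lra|exact HM|].
    destruct (cseries_remainder c g rho (S n)) as [K [r1 [Hr1 [HK H]]]]; [lra|exact Hg|].
    exists K, r1. split; [lra|]. split; [exact HK|exact H]. }
  assert (Hc : forall i, (i < S n)%nat -> mcoef (fun z => Cexp (g z)) i x = mcoef E i x).
  { intros i Hi. apply (mcoef_congr _ E rho (exp x + 1) x (S n) i HF HE Hx); [lra|exact Hsm|exact Hi]. }
  rewrite Hc by lia. unfold E, p. rewrite (exp_poly_rec c n x). apply csum_ext. intros j Hj.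
  f_equal. symmetry. apply Hc. lia.
Qed.

(** * The cycle index of the symmetric group *)

Fixpoint rsum (f : nat -> R) (n : nat) : R :=
  match n with O => 0 | S n => rsum f n + f n end.

Lemma rsum_shift (f : nat -> R) (n : nat) : rsum f (S n) = f O + rsum (fun k => f (S k)) n.
Proof.
  induction n as [|n IH]; [simpl; ring|].
  change (rsum f (S (S n))) with (rsum f (S n) + f (S n)). rewrite IH. simpl. ring.
Qed.

Lemma csum_rsum (f : nat -> R) (n : nat) : csum (fun k => RtoC (f k)) n = RtoC (rsum f n).
Proof. induction n as [|n IH]; [reflexivity|]. simpl. rewrite IH, RtoC_plus. reflexivity. Qed.


Module CycleIndex.
Import HB.structures ssreflect ssrfun ssrbool ssrnat eqtype seq choice fintype bigop finset fingroup perm.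

Lemma RplusA : associative Rplus. Proof. by move=> x y z; ring. Qed.
Lemma RplusC : commutative Rplus. Proof. by move=> x y; ring. Qed.
Lemma Rplus0 : left_id 0%R Rplus. Proof. by move=> x; ring. Qed.
Lemma RmultA : associative Rmult. Proof. by move=> x y z; ring. Qed.
Lemma RmultC : commutative Rmult. Proof. by move=> x y; ring. Qed.
Lemma Rmult1 : left_id 1%R Rmult. Proof. by move=> x; ring. Qed.
HB.instance Definition _ := Monoid.isComLaw.Build R 0%R Rplus RplusA RplusC Rplus0.
HB.instance Definition _ := Monoid.isComLaw.Build R 1%R Rmult RmultA RmultC Rmult1.

Lemma Rbig_distr (J : finType) (P : pred J) (F : J -> R) (c : R) :
  \big[Rplus/0%R]_(i | P i) (c * F i)%R = (c * \big[Rplus/0%R]_(i | P i) F i)%R.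
Proof. by elim/big_rec2: _ => [|i u v _ ->]; ring. Qed.

Lemma Rbig_const (J : finType) (A : {set J}) (c : R) :
  \big[Rplus/0%R]_(i in A) c = (INR #|A| * c)%R.
Proof.
rewrite big_const; elim: #|A| => [|n IH] /=; first by ring.
by rewrite IH -/(INR n.+1) S_INR; ring.
Qed.

Section Weights.
Variables (T : finType) (a : nat -> R).

(** Only orbits inside [A] count; points outside are fixed by a permutation on [A] and would each
    bring in a factor [a 1]. *)
Definition cycle_weight (A : {set T}) (s : {perm T}) : R :=
  \big[Rmult/1%R]_(c in porbits s | c \subset A) a #|c|.

Definition total_weight (A : {set T}) : R :=
  \big[Rplus/0%R]_(s | perm_on A s) cycle_weight A s.

(* The cycle through [x] is weighted by [b] instead of [a]; contracting it one
   point at a time replaces [b] by [b \o S]. *)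
Definition marked_weight (x : T) (b : nat -> R) (A : {set T}) : R :=
  \big[Rplus/0%R]_(s | perm_on A s) (b #|porbit s x| *
     \big[Rmult/1%R]_(c in porbits s | (c \subset A) && (x \notin c)) a #|c|)%R.

Lemma porbit_sub (s : {perm T}) (x : T) (A : {set T}) :
  x \in A -> (forall z, z \in A -> s z \in A) -> porbit s x \subset A.
Proof.
move=> xA sA; apply/subsetP=> z /porbitP[i ->]; elim: i => [|i IH]; first by rewrite expg0 perm1.
by rewrite expgSr permM; apply: sA.
Qed.

Lemma porbit_closed (s : {perm T}) (x z : T) : z \in porbit s x -> s z \in porbit s x.
Proof. by move=> /porbitP[i ->]; rewrite -permM -expgSr mem_porbit. Qed.

Lemma porbit_eq_on (s t : {perm T}) (z : T) :
  (forall u, u \in porbit s z -> s u = t u) -> porbit s z = porbit t z.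
Proof.
move=> st; have E n : (s ^+ n)%g z = (t ^+ n)%g z.
  elim: n => [|n IH]; first by rewrite !expg0.
  by rewrite !expgSr !permM -IH st // mem_porbit.
apply/setP=> u; apply/porbitP/porbitP=> -[i ->]; exists i; by rewrite E.
Qed.

Lemma porbit_of_mem (s : {perm T}) (c : {set T}) (x : T) : c \in porbits s -> x \in c -> c = porbit s x.
Proof. by move=> /imsetP[z _ ->] xz; apply/eqP; rewrite eq_sym eq_porbit_mem. Qed.

Section Contract.
Variables (s : {perm T}) (x y : T).
Hypotheses (xy : x != y) (sy : s y = y).
(** Products of permutations act from left to right: [t] sends [x] to [y] and [y] to [s x], so the
    fixed point [y] is inserted right after [x] in its cycle. *)
Let t := (tperm x y * s)%g.

Lemma contract_x : t x = y. Proof. by rewrite permM tpermL. Qed.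
Lemma contract_y : t y = s x. Proof. by rewrite permM tpermR. Qed.
Lemma contract_z z : z != x -> z != y -> t z = s z.
Proof. by move=> zx zy; rewrite permM tpermD // eq_sym. Qed.

Lemma porbit_contract : porbit t x = y |: porbit s x.
Proof.
apply/eqP; rewrite eqEsubset; apply/andP; split.
  apply: porbit_sub; first by rewrite !inE porbit_id orbT.
  move=> z; rewrite !inE; have [->|zx] := eqVneq z x; first by rewrite contract_x eqxx.
  have [->|zy] /= := eqVneq z y; first by rewrite contract_y => _; rewrite porbit_closed ?orbT ?porbit_id.
  by rewrite contract_z // => /porbit_closed ->; rewrite orbT.
have yt : y \in porbit t x by rewrite -contract_x; apply: porbit_closed; apply: porbit_id.
rewrite subUset sub1set yt /=; apply: porbit_sub; first exact: porbit_id.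
move=> z zt; have [->|zx] := eqVneq z x; first by rewrite -contract_y; apply: porbit_closed.
have [->|zy] := eqVneq z y; first by rewrite sy.
by rewrite -contract_z //; apply: porbit_closed.
Qed.

Lemma card_porbit_contract : #|porbit t x| = #|porbit s x|.+1.
Proof.
rewrite porbit_contract cardsU1.
suff -> : y \notin porbit s x by [].
rewrite porbit_sym; apply/negP => xs.
have : porbit s y \subset [set y].
  by apply: porbit_sub; rewrite ?inE // => z; rewrite inE => /eqP ->; rewrite sy inE.
by move/subsetP/(_ _ xs); rewrite inE (negbTE xy).
Qed.

Lemma porbits_contract (c : {set T}) : x \notin c -> y \notin c -> (c \in porbits t) = (c \in porbits s).
Proof.
move=> xc yc; apply/imsetP/imsetP => -[z _ E]; exists z => //; rewrite E; move: xc yc; rewrite E => xc yc.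
  apply: porbit_eq_on => u uz; apply: contract_z; apply/eqP => Eu; first by rewrite -Eu uz in xc.
  by rewrite -Eu uz in yc.
apply: porbit_eq_on => u uz; symmetry; apply: contract_z; apply/eqP => Eu; first by rewrite -Eu uz in xc.
by rewrite -Eu uz in yc.
Qed.
End Contract.

(** Makes multiplication by [tperm x y] the change of variables that removes [y] from the cycle of
    [x]. *)
Lemma perm_on_contract (A : {set T}) (s : {perm T}) (x y : T) : x \in A -> y \in A -> x != y ->
  perm_on A (tperm x y * s)%g && ((tperm x y * s)%g x == y) = perm_on (A :\ y) s.
Proof.
move=> xA yA xy.
have tA : perm_on A (tperm x y).
  by apply/subsetP=> z /(subsetP (tperm_on x y)); rewrite !inE => /orP[/eqP->|/eqP->].
rewrite permM tpermL; apply/andP/idP.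
  move=> [sA /eqP sy].
  have sA' : perm_on A s by rewrite -[s](tpermKg x y); apply: perm_onM.
  apply/subsetP=> z zs; rewrite !inE (subsetP sA' z zs) andbT.
  by apply/eqP=> zy; move: zs; rewrite inE /= zy sy eqxx.
move=> sA; split.
  apply: perm_onM => //; apply/subsetP=> z zs.
  by have := subsetP sA z zs; rewrite !inE => /andP[].
by apply/eqP/(out_perm sA); rewrite !inE eqxx.
Qed.

Lemma perm_on_fix (A : {set T}) (s : {perm T}) (x : T) :
  perm_on A s && (s x == x) = perm_on (A :\ x) s.
Proof.
apply/andP/idP.
  move=> [sA /eqP sx]; apply/subsetP=> z zs; rewrite !inE (subsetP sA z zs) andbT.
  by apply/eqP=> zx; move: zs; rewrite inE /= zx sx eqxx.
move=> sA; split; last by apply/eqP/(out_perm sA); rewrite !inE eqxx.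
by apply/subsetP=> z zs; have := subsetP sA z zs; rewrite !inE => /andP[].
Qed.

(** Permutations are sorted by the image of [x]. A fixed [x] leaves an arbitrary permutation of the
    other points; an image [y] is contracted away, which shortens the marked cycle by one and keeps
    all other cycles. *)
Lemma marked_weight_rec (x : T) (b : nat -> R) (A : {set T}) : x \in A ->
  marked_weight x b A = (b 1%N * total_weight (A :\ x) +
    \big[Rplus/0%R]_(y in A :\ x) marked_weight x (fun n => b n.+1) (A :\ y))%R.
Proof.
move=> xA; rewrite /marked_weight.
rewrite (partition_big (fun s : {perm T} => s x) (mem A)) /=; last by move=> s sA; rewrite perm_closed.
rewrite (bigD1 x) //=; congr Rplus.
  rewrite /total_weight -Rbig_distr; apply: eq_big => [s|s]; first exact: perm_on_fix.
  rewrite perm_on_fix => sA.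
  have sx : s x = x by apply: (out_perm sA); rewrite !inE eqxx.
  have -> : porbit s x = [set x].
    apply/eqP; rewrite eqEsubset sub1set porbit_id andbT; apply: porbit_sub; first by rewrite inE.
    by move=> z; rewrite inE => /eqP ->; rewrite sx inE.
  rewrite cards1; congr Rmult; rewrite /cycle_weight; apply: eq_bigl => c.
  by rewrite subsetD1.
apply: eq_big => [y|y]; first by rewrite !inE andbC.
move=> /andP[yA yx].
rewrite (reindex_inj (mulgI (tperm x y))) /=.
have xy : x != y by rewrite eq_sym.
apply: eq_big => [s|s]; first exact: perm_on_contract.
rewrite perm_on_contract // => sA.
have sy : s y = y by apply: (out_perm sA); rewrite !inE eqxx.
rewrite card_porbit_contract //; congr Rmult; apply: eq_bigl => c.
case: (boolP (x \in c)) => xc; first by rewrite !andbF.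
rewrite !andbT subsetD1; case: (boolP (y \in c)) => yc; last by rewrite andbT porbits_contract.
rewrite !andbF; apply/negP => /andP[ct _].
move: xc; rewrite (porbit_of_mem _ _ _ ct yc) porbit_sym porbit_contract //.
by rewrite !inE eqxx.
Qed.

Lemma total_weight_marked (x : T) (A : {set T}) : x \in A -> total_weight A = marked_weight x a A.
Proof.
move=> xA; rewrite /total_weight /marked_weight; apply: eq_bigr => s sA.
rewrite /cycle_weight (bigD1 (porbit s x)) /=.
  congr Rmult; apply: eq_bigl => c.
  rewrite -!andbA; case: (boolP (c \in porbits s)) => //= cs; congr andb.
  apply/idP/idP.
    by apply: contra => xc; rewrite (porbit_of_mem _ _ _ cs xc).
  by apply: contra => /eqP ->; exact: porbit_id.
rewrite imset_f //=; apply: porbit_sub => // z zA; by rewrite perm_closed.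
Qed.

Lemma total_weight0 : total_weight set0 = 1%R.
Proof.
rewrite /total_weight (big_pred1 1%g); last first.
  move=> s /=; apply/idP/eqP => [s0|->]; last exact: perm_on1.
  by apply: (perm_on_id s0); rewrite cards0.
rewrite /cycle_weight big1 // => c /andP[/imsetP[z _ ->]].
by rewrite subset0 => /eqP E; have := porbit_id 1%g z; rewrite E inE.
Qed.

Variable h : nat -> R.
Hypothesis h0 : h 0%N = 1%R.
Hypothesis hS : forall n, (INR n.+1 * h n.+1 = rsum (fun j => a j.+1 * h (n - j)%N) n.+1)%R.

(** The second formula counts a marked cycle of length [j + 1]: there are [n! / (n - j)!] of them,
    and the other points weigh [(n - j)! h (n - j)]. One induction proves both claims: the total
    weight is the marked weight with [b = a], and the marked weight on the next level has [n + 1]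
    equal contributions from the choice of [y]. *)
Lemma weights_eq (n : nat) :
  (forall A : {set T}, #|A| = n -> total_weight A = (INR (Factorial.fact n) * h n)%R) /\
  (forall (A : {set T}) x b, #|A| = n.+1 -> x \in A ->
     marked_weight x b A = (INR (Factorial.fact n) * rsum (fun j => b j.+1 * h (n - j)%N) n.+1)%R).
Proof.
elim: n => [|n [IHW IHw]].
  split=> [A /cards0_eq ->|A x b cA xA]; first by rewrite total_weight0 h0 /=; ring.
  rewrite marked_weight_rec //.
  have E : A :\ x = set0 by apply/eqP; rewrite -cards_eq0; move: (cardsD1 x A); rewrite cA xA add1n => -[<-].
  by rewrite E big_set0 total_weight0 /= h0; ring.
have HW : forall A : {set T}, #|A| = n.+1 -> total_weight A = (INR (Factorial.fact n.+1) * h n.+1)%R.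
  move=> A cA; have /card_gt0P[x xA] : (0 < #|A|)%N by rewrite cA.
  rewrite (total_weight_marked _ _ xA) (IHw A x a cA xA) -hS.
  change (Factorial.fact n.+1) with (Nat.mul n.+1 (Factorial.fact n)); rewrite mult_INR; ring.
split=> // A x b cA xA.
have cAx z : z \in A -> #|A :\ z| = n.+1 by move=> zA; move: (cardsD1 z A); rewrite cA zA add1n => -[<-].
rewrite marked_weight_rec // HW; last exact: cAx.
rewrite (eq_bigr (fun=> (INR (Factorial.fact n) * rsum (fun j => b j.+2 * h (n - j)%N) n.+1)%R)); last first.
  move=> y; rewrite !inE => /andP[yx yA]; apply: IHw; first exact: cAx.
  by rewrite !inE xA andbT eq_sym.
rewrite Rbig_const cAx // [in RHS]rsum_shift subn0.
change (Factorial.fact n.+1) with (Nat.mul n.+1 (Factorial.fact n)); rewrite mult_INR.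
change (rsum (fun k => b k.+2 * h (n.+1 - k.+1)%N)%R n.+1) with (rsum (fun j => b j.+2 * h (n - j)%N)%R n.+1).
ring.
Qed.
End Weights.

Lemma porbits_weight (N : nat) (s : {perm 'I_N}) (a : nat -> R) :
  cycle_weight _ a [set: 'I_N] s = \big[Rmult/1%R]_(1 <= j < N.+1) pow (a j) (HNdef.ncycles s j).
Proof.
have -> : cycle_weight _ a [set: 'I_N] s = \big[Rmult/1%R]_(c in porbits s) a #|c|.
  by apply: eq_bigl => c; rewrite subsetT andbT.
rewrite (partition_big (fun c : {set 'I_N} => inord #|c| : 'I_N.+1) predT) //=.
have E (j : 'I_N.+1) : \big[Rmult/1%R]_(c in porbits s | inord #|c| == j) a #|c| = pow (a j) (HNdef.ncycles s j).
  have bnd (c : {set 'I_N}) : (#|c| < N.+1)%N by have := max_card (mem c); rewrite card_ord ltnS.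
  transitivity (\big[Rmult/1%R]_(c in [set c in porbits s | #|c| == j :> nat]) a j).
    apply: eq_big => [c|c]; first by rewrite !inE -val_eqE /= inordK.
    by move=> /andP[_ /eqP <-]; rewrite inordK.
  by rewrite big_const /HNdef.ncycles; elim: #|_| => [|k IH] //=; rewrite IH.
rewrite (eq_bigr _ (fun j _ => E j)) -(big_mkord predT (fun j => pow (a j) (HNdef.ncycles s j))).
rewrite [LHS]big_ltn_cond //=.
(* The grouping by size starts at 0, the product in [HN] at 1; no orbit is empty. *)
have -> : HNdef.ncycles s 0 = 0%N.
  apply/eqP; rewrite cards_eq0; apply/eqP/setP => c; rewrite !inE; apply/negP => /andP[/imsetP[z _ ->]].
  by rewrite (negbTE (card_porbit_neq0 s z)).
by rewrite /=; ring.
Qed.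

Lemma HN_eq (theta kappa : nat -> R) (N : nat) (h : nat -> R) : h 0%N = 1%R ->
  (forall n, (INR n.+1 * h n.+1 = rsum (fun j => (theta j.+1 + INR N * kappa j.+1) * h (n - j)%N) n.+1)%R) ->
  HN theta kappa N = h N.
Proof.
move=> h0 hS.
have [HW _] := weights_eq 'I_N (fun j => theta j + INR N * kappa j)%R h h0 hS N.
rewrite /HN /HNdef.HN.
rewrite (eq_bigr (cycle_weight _ (fun j => theta j + INR N * kappa j)%R [set: 'I_N])); last first.
  by move=> s _; rewrite porbits_weight.
rewrite (eq_bigl (fun s => perm_on [set: 'I_N] s)); last by move=> s; apply/esym/subsetP.
have := HW [set: 'I_N]; rewrite cardsT card_ord => /(_ erefl); rewrite /total_weight => ->.
rewrite -Rmult_assoc Rinv_l ?Rmult_1_l //.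
exact: INR_fact_neq_0.
Qed.
End CycleIndex.

Lemma csum_plus (f g : nat -> C) (n : nat) : csum (fun k => f k + g k)%C n = (csum f n + csum g n)%C.
Proof. induction n as [|n IH]; [simpl; ring|]. simpl. rewrite IH. ring. Qed.

Lemma cseries_eps_comb (a b : nat -> C) (c z l m : C) : cseries_eps a z l -> cseries_eps b z m ->
  cseries_eps (fun k => a k + c * b k)%C z (l + c * m)%C.
Proof.
  intros Ha Hb eps He. pose proof (Cmod_ge_0 c) as Hc.
  destruct (Ha (eps / 2)) as [n1 H1]; [lra|].
  destruct (Hb (eps / 2 / (Cmod c + 1))) as [n2 H2]; [apply Rdiv_lt_0_compat; lra|].
  exists (Nat.max n1 n2). intros n Hn. specialize (H1 n ltac:(lia)). specialize (H2 n ltac:(lia)).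
  rewrite (csum_ext _ (fun k => a k * z ^ k + c * (b k * z ^ k))%C), csum_plus, csum_scal by (intros; ring).
  set (X := csum (fun k => a k * z ^ k)%C n) in *. set (Y := csum (fun k => b k * z ^ k)%C n) in *.
  replace (X + c * Y - (l + c * m))%C with ((X - l) + c * (Y - m))%C by ring.
  eapply Rle_lt_trans; [apply Cmod_triangle|]. rewrite Cmod_mult.
  assert (Cmod c * Cmod (Y - m) <= (Cmod c + 1) * (eps / 2 / (Cmod c + 1))).
  { apply Rmult_le_compat; try apply Cmod_ge_0; lra. }
  replace ((Cmod c + 1) * (eps / 2 / (Cmod c + 1))) with (eps / 2) in H by (field; lra). lra.
Qed.

Lemma cseries_at_0 (c : nat -> C) (l : C) : cseries_eps c 0 l -> l = c O.
Proof.
  intros H. replace l with ((l - c O) + c O)%C by ring. rewrite (Cmod_eq_0 (l - c O)%C); [ring|]. apply Rle_antisym; [|apply Cmod_ge_0].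
  apply Rnot_lt_le. intros Hl. destruct (H _ Hl) as [n0 Hn]. specialize (Hn (S n0) ltac:(lia)).
  assert (E : forall n, csum (fun k => c k * 0 ^ k)%C (S n) = c O).
  { induction n as [|n IH]; [simpl; ring|].
    change (csum (fun k => c k * 0 ^ k)%C (S (S n))) with (csum (fun k => c k * 0 ^ k)%C (S n) + c (S n) * (0 * 0 ^ n))%C.
    rewrite IH. ring. }
  rewrite E in Hn. rewrite <- Cmod_opp in Hn. replace (- (c O - l))%C with (l - c O)%C in Hn by ring. lra.
Qed.

(** The weights [theta j + N kappa j] involve [N] only as a parameter: the recursion runs over all
    orders [n] with [N] fixed, and [n = N] is taken at the end. The factor [j] from the derivative
    cancels the division by [j] in [gcoef]. *)
Lemma HN_zcoef (theta kappa : nat -> R) (R0 : R) (Gth Gka : C -> C) (N : nat) : 0 < R0 ->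
  (forall z, Cmod z < R0 -> cseries_eps (fun n => RtoC (gcoef theta n)) z (Gth z)) ->
  (forall z, Cmod z < R0 -> cseries_eps (fun n => RtoC (gcoef kappa n)) z (Gka z)) ->
  holo_disc (fun z => Cexp (Gth z + RtoC (INR N) * Gka z))%C R0 ->
  zcoef (fun z => Cexp (Gth z + RtoC (INR N) * Gka z))%C N = RtoC (HN theta kappa N).
Proof.
  intros HR Hth Hka Hhol.
  set (g := fun z => (Gth z + RtoC (INR N) * Gka z)%C).
  set (x := ln (R0 / 2)).
  assert (Hx : exp x < R0) by (unfold x; rewrite exp_ln; lra).
  pose (c := fun k => RtoC (gcoef theta k + INR N * gcoef kappa k)).
  assert (Hg : forall z, Cmod z < R0 -> cseries_eps c z (g z)).
  { intros z Hz eps He.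
    destruct (cseries_eps_comb _ _ (RtoC (INR N)) z _ _ (Hth z Hz) (Hka z Hz) eps He) as [n0 Hn].
    exists n0. intros n Hn0. erewrite csum_ext; [apply (Hn n Hn0)|].
    intros k _. unfold c. now rewrite RtoC_plus, RtoC_mult. }
  rewrite (zcoef_mcoef _ N R0 x Hhol Hx).
  set (h := fun n => fst (mcoef (fun z => Cexp (g z)) n x)).
  assert (H0 : mcoef (fun z => Cexp (g z)) 0 x = RtoC 1).
  { rewrite (mcoef_0 _ R0) by assumption.
    rewrite (cseries_at_0 c (g 0)) by (apply Hg; rewrite Cmod_0; exact HR).
    unfold c. simpl. rewrite Rmult_0_r, Rplus_0_r. apply Cexp_0. }
  assert (Hrec : forall n, (forall k, (k <= n)%nat -> mcoef (fun z => Cexp (g z)) k x = RtoC (h k)) ->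
     (RtoC (INR (S n)) * mcoef (fun z => Cexp (g z)) (S n) x)%C =
     RtoC (rsum (fun j => (theta (S j) + INR N * kappa (S j)) * h (n - j)%nat) (S n))).
  { intros n IH. rewrite (exp_series_rec c g R0) by assumption. rewrite <- csum_rsum.
    apply csum_ext. intros j Hj. replace (S n - 1 - j)%nat with (n - j)%nat by lia.
    rewrite IH by lia. unfold c. rewrite <- !RtoC_mult. f_equal.
    unfold gcoef. pose proof (lt_0_INR (S j) ltac:(lia)). field. lra. }
  (* The recursion has real data and starts at 1, so the coefficients are real and [h] loses nothing
     by taking real parts. *)
  assert (Hreal : forall n k, (k <= n)%nat -> mcoef (fun z => Cexp (g z)) k x = RtoC (h k)).
  { induction n as [|n IH]; intros k Hk.
    - replace k with O by lia. unfold h. rewrite H0. reflexivity.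
    - destruct (Nat.eq_dec k (S n)) as [->|Hne]; [|apply IH; lia].
      specialize (Hrec n IH). pose proof (lt_0_INR (S n) ltac:(lia)) as Hp.
      assert (Hnz : RtoC (INR (S n)) <> 0) by (intro E; apply RtoC_inj in E; lra).
      assert (E : mcoef (fun z => Cexp (g z)) (S n) x =
         RtoC (/ INR (S n) * rsum (fun j => (theta (S j) + INR N * kappa (S j)) * h (n - j)%nat) (S n))).
      { rewrite RtoC_mult, <- Hrec, RtoC_inv by lra. field. exact Hnz. }
      unfold h at 1. rewrite E. reflexivity. }
  etransitivity; [exact (Hreal N N (Nat.le_refl N))|]. f_equal. symmetry. apply CycleIndex.HN_eq.
  - unfold h. rewrite H0. reflexivity.
  - intros n. apply RtoC_inj. rewrite RtoC_mult, <- (Hreal (S n) (S n)) by lia.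
    apply Hrec. intros k Hk. now apply (Hreal n).
Qed.

Lemma holomorphic_on_holo (D : C -> Prop) (F : C -> C) : holomorphic_on D F -> holo D F.
Proof. intros H z Hz. destruct (H z Hz) as [l Hl]. exists l. now apply is_derive_cderiv. Qed.

Theorem theorem3p5
  (theta kappa : nat -> R) (R0 eta phi thetastar delta gkR gk1R : R)
  (Gth Gka : C -> C)
  (* standing assumptions *)
  (Htheta_nn : forall j, (0 <= theta j)%R)
  (Hkappa_nn : forall j, (0 <= kappa j)%R)
  (Hkappa_na : non_arithmetic kappa)
  (Hkappa_pos : exists j, (2 <= j)%nat /\ (0 < kappa j)%R)
  (* radii of convergence *)
  (HR : (0 < R0)%R)
  (Hrad_th : CV_radius (gcoef theta) = Finite R0)
  (Hrad_ka : CV_radius (gcoef kappa) = Finite R0)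
  (* the domain Delta_0 *)
  (Heta : (0 < eta)%R) (Hphi : (0 < phi < PI / 2)%R)
  (* Gth, Gka : holomorphic extensions of g_theta, g_kappa to Delta_0 *)
  (Hext_th : forall z, (Cmod z < R0)%R ->
     @is_pseries C_AbsRing C_NormedModule (fun n => RtoC (gcoef theta n)) z (Gth z))
  (Hext_ka : forall z, (Cmod z < R0)%R ->
     @is_pseries C_AbsRing C_NormedModule (fun n => RtoC (gcoef kappa n)) z (Gka z))
  (Hhol_th : holomorphic_on (Delta0 R0 eta phi) Gth)
  (Hhol_ka : holomorphic_on (Delta0 R0 eta phi) Gka)
  (* g_kappa(R) and g_kappa^{1}(R) as limits r -> R- *)
  (HgkR : filterlim (PSeries (gcoef kappa)) (at_left R0) (locally gkR))
  (Hgk1R : filterlim (fun r => r * Derive (PSeries (gcoef kappa)) r)%R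
             (at_left R0) (locally gk1R))
  (Hgk1R_lt : (gk1R < 1)%R)
  (* singular expansions *)
  (Hthetastar : (0 <= thetastar)%R) (Hdelta : (0 < delta)%R)
  (Hexp_th : bigO_at (Delta0 R0 eta phi) R0 Gth
     (fun z => Copp (Cmult (RtoC thetastar) (Clog (Cminus (RtoC 1) (Cdiv z (RtoC R0))))))
     delta)
  (Hexp_ka : bigO_at (Delta0 R0 eta phi) R0 Gka
     (fun z => Cminus (RtoC gkR)
                 (Cmult (RtoC gk1R) (Cminus (RtoC 1) (Cdiv z (RtoC R0)))))
     (1 + delta)) :
  (forall (f : C -> C) (beta v1 v2 : R),
     holomorphic_on (Delta0 R0 eta phi) f ->
     (0 <= beta)%R ->
     bigO_at (Delta0 R0 eta phi) R0
       (fun z => Cdiv (f z) (Cpower (Cminus (RtoC 1) (Cdiv z (RtoC R0))) (RtoC (- beta))))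
       (fun _ => RtoC 1) delta ->
     (0 < v1 < 1)%R -> (1 < v2 < / gk1R)%R ->
     (forall v, (v1 <= v <= v2)%R -> (0 < v * thetastar + beta)%R) ->
     forall eps : R, (0 < eps)%R ->
       exists N0 : nat, forall (N : nat) (v : R), (N0 <= N)%nat -> (v1 <= v <= v2)%R ->
         (Cmod (Cminus
            (Cdiv
              (zcoef (fun z => Cmult (f z)
                        (Cexp (Cmult (RtoC v)
                           (Cplus (Gth z) (Cmult (RtoC (INR N)) (Gka z)))))) N)
              (RtoC (exp (INR N * v * gkR)
                     * Rpower (INR N * (1 - v * gk1R)) (v * thetastar + beta - 1)
                     / (R0 ^ N * Gamma (v * thetastar + beta)))))
            (RtoC 1)) <= eps)%R)
  /\
  ((0 < thetastar)%R ->
     forall eps : R, (0 < eps)%R ->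
       exists N0 : nat, forall N : nat, (N0 <= N)%nat ->
         (Rabs (HN theta kappa N
                / (exp (INR N * gkR) * Rpower (INR N * (1 - gk1R)) (thetastar - 1)
                   / (R0 ^ N * Gamma thetastar)) - 1) <= eps)%R).

Proof.
  apply holomorphic_on_holo in Hhol_th, Hhol_ka.
  split.
  - intros f beta v1 v2 Hf Hbeta Hexp_f Hv1 Hv2 Hal eps Heps.
    (* Since [/ 0 = 0], the bound [1 < v2 < / gk1R] can only hold for positive [gk1R]. *)
    assert (Hg : 0 < gk1R).
    { apply Rnot_le_lt. intros Hle. assert (/ gk1R <= 0).
      { destruct Hle as [Hl| ->]; [left; now apply Rinv_lt_0_compat|rewrite Rinv_0; lra]. }
      lra. }
    apply (uniform_asymptotics kappa R0 eta phi thetastar delta gkR gk1R Gth Gka f beta v1 v2);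
      try assumption; try lra.
    + now apply holomorphic_on_holo.
    + apply Rmult_lt_reg_r with (/ gk1R); [now apply Rinv_0_lt_compat|].
      rewrite Rmult_assoc, Rinv_r by lra. lra.
    + apply Hal. lra.
  (* The case [f = 1], [beta = 0] on the degenerate interval [v1 = v2 = 1], where [v2 * g1 < 1] is
     the assumption [gk1R < 1]. *)
  - intros Hts eps Heps.
    assert (H1 : bigO_at (Delta0 R0 eta phi) R0
       (fun z => Cdiv (RtoC 1) (Cpower (Cminus (RtoC 1) (Cdiv z (RtoC R0))) (RtoC (- 0))))
       (fun _ => RtoC 1) delta).
    { exists 0, 1. split; [lra|]. intros z _ _.
      unfold Cpower. rewrite Ropp_0, Cmult_0_l, Cexp_0.
      replace (1 / 1 - 1)%C with (RtoC 0) by (field; intro E; apply RtoC_inj in E; lra).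
      rewrite Cmod_0. lra. }
    destruct (uniform_asymptotics kappa R0 eta phi thetastar delta gkR gk1R Gth Gka (fun _ => RtoC 1) 0 1 1)
      with (eps := eps) as [N0 HN0]; try assumption; try lra.
    { intros z _. exists (RtoC 0). apply cderiv_const. }
    exists N0. intros N HN. specialize (HN0 N 1 HN ltac:(lra)).
    replace (1 * thetastar + 0) with thetastar in HN0 by ring.
    rewrite !Rmult_1_l, Rmult_1_r in HN0.
    assert (E : integrand Gth Gka (fun _ => RtoC 1) 1 N = (fun z => Cexp (Gth z + RtoC (INR N) * Gka z))%C).
    { apply functional_extensionality. intro z. unfold integrand. now rewrite !Cmult_1_l. }
    rewrite E, (HN_zcoef theta kappa R0) in HN0; try assumption.
    2:{ intros z Hz. now apply is_pseries_cseries, Hext_th. }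
    2:{ intros z Hz. now apply is_pseries_cseries, Hext_ka. }
    2:{ rewrite <- E. intros z Hz. apply (holo_integrand R0 eta phi); try assumption.
        - intros w _. exists (RtoC 0). apply cderiv_const.
        - now apply Delta0_disc. }
    rewrite <- Cmod_R, RtoC_minus, RtoC_div; [exact HN0|].
    pose proof (Gamma_pos thetastar Hts). pose proof (pow_lt R0 N HR).
    assert (0 < exp (INR N * gkR) * Rpower (INR N * (1 - gk1R)) (thetastar - 1) / (R0 ^ N * Gamma thetastar)).
    { apply Rdiv_lt_0_compat; apply Rmult_lt_0_compat; try assumption; apply exp_pos. }
    lra.
Qed.
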